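(* Let $f\in C^3([0,1])$ satisfy $0<m\le|f''(x)|$ for all $x\in[0,1]$, for some constant $m$. Then $Z_f(s)$ admits a meromorphic continuation to a neighborhood of $s=\tfrac23$; more precisely, for each $\eta<1/21$ it extends meromorphically to the disk $|s-\tfrac23|<\eta$, with a simple pole at $s=\tfrac23$. Moreover, $$\operatorname{Res}_{s=2/3}Z_f(s)=\frac{\sqrt3\,\Gamma(1/3)^3}{2^{2/3}\pi^3}\int_0^1|f''(v)|^{2/3}dv.$$
   Context: A Farey interval is an interval $I=[c/d,a/b]\subset[0,1]$ with $b,d\in\mathbb{N}$, $a,c\in\mathbb{Z}$, $0\le c\le d$, $0\le a\le b$, $\gcd(a,b)=\gcd(c,d)=1$ and $ad-bc=1$. For $f\in C^2([0,1])$ set $c_I(f)=f\!\left(\frac{a+c}{b+d}\right)-\frac{b}{b+d}f\!\left(\frac ab\right)-\frac{d}{b+d}f\!\left(\frac cd\right)$ and $T_I(f)=(b+d)c_I(f)$. The Farey zeta function is $Z_f(s)=\sum_I|T_I(f)|^s$, summed over all Farey intervals, defined for $\Re(s)$ large. *)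

(* Defs.v *)
From Stdlib Require Import Reals ZArith List.
From Coquelicot Require Import Coquelicot.
Import ListNotations.
Open Scope R_scope.

Definition unit_interval (x : R) : Prop := 0 <= x <= 1.

(** [f1], [f2], [f3] are the successive derivatives of [f] on [0,1], one-sided
    at the endpoints, and [f3] is continuous there: [f] is in C^3([0,1]).
    Values outside [0,1] play no role. *)
Definition C3_unit_interval (f f1 f2 f3 : R -> R) : Prop :=
  forall x, unit_interval x ->
    D_in f f1 unit_interval x /\
    D_in f1 f2 unit_interval x /\
    D_in f2 f3 unit_interval x /\
    continue_in f3 unit_interval x.

(** The interval [c/d, a/b], encoded by its endpoints in lowest terms. *)
Record quad : Type := Quad { qa : Z; qb : Z; qc : Z; qd : Z }.

Definition farey (I : quad) : Prop :=
  let (a, b, c, d) := I in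
  (1 <= b /\ 1 <= d /\ 0 <= c <= d /\ 0 <= a <= b /\
   Z.gcd a b = 1 /\ Z.gcd c d = 1 /\ a * d - b * c = 1)%Z.

Definition farey_c (f : R -> R) (I : quad) : R :=
  let (a, b, c, d) := I in
  f (IZR (a + c) / IZR (b + d))
  - IZR b / IZR (b + d) * f (IZR a / IZR b)
  - IZR d / IZR (b + d) * f (IZR c / IZR d).

Definition farey_T (f : R -> R) (I : quad) : R :=
  IZR (qb I + qd I) * farey_c f I.

(** [t ^ s] for real [t >= 0] and complex [s], with [0 ^ s = 0]. *)
Definition cpow (t : R) (s : C) : C :=
  if Req_EM_T t 0 then RtoC 0
  else (exp (Re s * ln t) * cos (Im s * ln t),
        exp (Re s * ln t) * sin (Im s * ln t)).

(** Unordered summation over the set [A]: the finite partial sums converge to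
    [l] along the directed set of finite subsets of [A].  For complex terms
    this is the same as absolute convergence. *)
Definition has_sum {T : Type} (A : T -> Prop) (u : T -> C) (l : C) : Prop :=
  forall eps : R, 0 < eps ->
    exists L0 : list T, List.Forall A L0 /\
      forall L : list T, NoDup L -> List.Forall A L -> incl L0 L ->
        Cmod (Cminus (fold_right Cplus (RtoC 0) (map u L)) l) < eps.

(** [farey_zeta f s z]: the series Z_f(s) converges, with sum [z]. *)
Definition farey_zeta (f : R -> R) (s z : C) : Prop :=
  has_sum farey (fun I => cpow (Rabs (farey_T f I)) s) z.

Definition holomorphic_at (F : C -> C) (z0 : C) : Prop :=
  locally z0 (fun z => @ex_derive C_AbsRing C_NormedModule F z).

Definition has_pole (F : C -> C) (z0 : C) (n : nat) : Prop :=
  (1 <= n)%nat /\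
  exists G : C -> C, holomorphic_at G z0 /\ G z0 <> RtoC 0 /\
    locally' z0 (fun z => F z = Cdiv (G z) (Cpow (Cminus z z0) n)).

(** The value of [F] at a pole is irrelevant; at every other point [F] is
    holomorphic, removable singularities being filled in. *)
Definition meromorphic_on (U : C -> Prop) (F : C -> C) : Prop :=
  forall z0, U z0 -> holomorphic_at F z0 \/ exists n, has_pole F z0 n.

(** [r] is the coefficient of [(z - z0)^-1] in the Laurent expansion of [F] at
    [z0], the principal part being finite. *)
Definition has_residue (F : C -> C) (z0 r : C) : Prop :=
  exists (n : nat) (a : nat -> C) (H : C -> C),
    holomorphic_at H z0 /\ a 0%nat = r /\
    locally' z0 (fun z =>
      F z = Cplus (H z)
              (sum_n (fun k => Cdiv (a k) (Cpow (Cminus z z0) (S k))) n)).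

Definition connected_set (U : C -> Prop) : Prop :=
  ~ exists A B : C -> Prop,
      open A /\ open B /\ (forall z, U z -> A z \/ B z) /\
      (exists z, U z /\ A z) /\ (exists z, U z /\ B z) /\
      (forall z, U z -> ~ (A z /\ B z)).

(** [g] is a partial function, given by its graph.  [F] is a meromorphic
    continuation of [g] to [W]: it is meromorphic on a connected open set
    containing both [W] and the domain of [g], and agrees with [g] there. *)
Definition meromorphic_continuation
    (g : C -> C -> Prop) (W : C -> Prop) (F : C -> C) : Prop :=
  exists U : C -> Prop,
    open U /\ connected_set U /\
    (forall s, W s -> U s) /\
    (forall s z, g s z -> U s /\ F s = z) /\
    meromorphic_on U F.

Definition disk (z0 : C) (r : R) (s : C) : Prop := Cmod (Cminus s z0) < r.

(** Euler's integral; only meaningful for [x > 0]. *)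
Definition Gamma (x : R) : R :=
  RInt_gen (fun t => Rpower t (x - 1) * exp (- t))
           (at_right 0) (Rbar_locally p_infty).

(* Main.v *)
(* The error of linear interpolation gives |T_I| = |f''(xi)| / (2 b d (b + d)) for some xi in I.
   The intervals with d <= b are indexed by d, k >= 1 and r invertible modulo d: b = k d + r, and
   c = - 1 / r modulo d; the others are their mirror images.  For fixed d and k the sum over r
   has the form sum_r F(r / d) G(c / d), and bounds for Kloosterman sums show that r and c are
   equidistributed independently: up to O(d ^ (6/7)) the sum is phi(d) (int F) (int G).  The
   errors add up to a function holomorphic on Re s > 13/21 = 2/3 - 1/21, where 3 s - 6/7 > 1,
   and the main terms of each half add up to
     zeta(3 s - 1) / zeta(3 s) * int_0^1 (|f''| / 2) ^ s * int_1^oo (t (t + 1)) ^ (- s) dt,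
   whose pole at s = 2/3 comes from zeta(3 s - 1).

   The Kloosterman bound, with exponent 5/6, is the elementary one obtained from a fourth moment.
   The value Gamma(1/3) ^ 3 sqrt 3 / (4 pi) of the last integral at s = 2/3 comes from products of
   the integrals of exp(- u ^ 3) and u exp(- u ^ 3) over [0, x]. *)
Require Import Defs.
From Stdlib Require Import Reals Lra Lia List ZArith Permutation Classical ClassicalEpsilon.
From Coquelicot Require Import Coquelicot.
From mathcomp Require all_boot all_order all_algebra all_solvable complex Rstruct zify ring lra.
Open Scope R_scope.

(** * Kloosterman sums *)

(** Powers of [|T_I|] are handled through logarithms. For [d <= b] the interval has length at most
    [1 / d], so [ln |T_I|] is, up to [O(1 / d)], a function of [c / d] plus a function of [r / d]
    minus [3 ln d]; this is what makes each term a product [F(r / d) G(c / d)], uniformly for [s] in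
    bounded sets.

    An error [O(d ^ theta)] at each [d] yields a continuation to [Re s > (1 + theta) / 3], so any
    saving over the trivial [theta = 1] passes 2/3. The value 6/7 is the exponent 5/6 rounded up to
    absorb divisor functions and logarithms.

    A continuation must agree with the series at every point of convergence, and that set is not
    prescribed. It therefore has to be shown that the series diverges for [Re s <= 2/3]; this is
    read off from the pole.

    Holomorphy is used through the quantitative class [C11], whose error bound passes to sums of
    series and to integrals. A bounded function of this class has a [C11] constant that depends only
    on its bound, by Cauchy's formula; this gives the theorem of Weierstrass on which all
    continuations rest. *)

Module FiniteSums.
Import all_boot all_order all_algebra all_solvable.
Import zify ring lra.
Set Implicit Arguments. Unset Strict Implicit. Unset Printing Implicit Defensive.
Import Order.TTheory GRing.Theory Num.Theory.
Local Open Scope ring_scope.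

Definition tau (n : nat) : nat := size (divisors n).

(** The range [N] is independent of [n], so that sums over [n <= N] and over the divisors of [n] can
    be exchanged. *)
Lemma tau_card N n : (0 < n)%N -> (n <= N)%N -> tau n = #|[pred e : 'I_N.+1 | (e %| n)%N]|.
Proof.
move=> n0 nN; rewrite /tau cardE -(size_map (@nat_of_ord N.+1)).
apply/perm_size/uniq_perm.
- exact: divisors_uniq.
- by rewrite map_inj_uniq ?enum_uniq //; apply: val_inj.
move=> e; rewrite -dvdn_divisors //; apply/idP/mapP.
  move=> he; have le : (e < N.+1)%N by rewrite ltnS (leq_trans _ nN) // dvdn_leq.
  by exists (Ordinal le); rewrite // mem_enum inE.
by case=> x; rewrite mem_enum inE => hx ->.
Qed.

Lemma tauE n : (0 < n)%N -> tau n = #|[pred e : 'I_n.+1 | (e %| n)%N]|.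
Proof. by move=> n0; rewrite (tau_card n0 (leqnn n)). Qed.

(** Compare the product formulas prime by prime: the exponents in [e] are at most those in [n], and
    the further primes of [n] contribute factors at least 1. *)
Lemma totient_le_dvd e n : (0 < n)%N -> (e %| n)%N -> (totient e <= totient n)%N.
Proof.
move=> n0 en; have e0 := dvdn_gt0 n0 en.
have pe : perm_eq (primes e) [seq q <- primes n | (q %| e)%N].
  apply: uniq_perm; rewrite ?filter_uniq ?primes_uniq // => q.
  rewrite mem_filter !mem_primes e0 n0 /=.
  apply/andP/andP => [[-> qe]|[qe /andP[-> _]]] //.
  by split => //=; apply: dvdn_trans en.
rewrite !totientE // (perm_big _ pe) big_filter big_mkcond /= big_seq [leqRHS]big_seq.
apply: leq_prod => q; rewrite mem_primes => /andP[qp _].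
have q1 : (0 < q.-1)%N by case: q qp => [|[]].
case: ifP => _; last by rewrite muln_gt0 q1 expn_gt0 prime_gt0.
by rewrite leq_mul2l leq_pexp2l ?prime_gt0 ?orbT // -!subn1 leq_sub2r // dvdn_leq_log.
Qed.

(** [n] is the sum of [totient e] over its divisors [e], and each summand is at most [totient n].
    This serves as lower bound for the totient. *)
Lemma le_totient_tau n : (0 < n)%N -> (n <= totient n * tau n)%N.
Proof.
move=> n0; rewrite -{1}(sum_totient_dvd n) tauE // mulnC -sum_nat_const.
by apply: leq_sum => e he; apply: totient_le_dvd.
Qed.

Section KloostermanSum.
Variables (p : nat) (C : numClosedFieldType) (z : C).
Local Notation d := p.+2.
Hypothesis z_prim : d.-primitive_root z.
Local Notation Zd := 'I_d.

(** The modulus is [p.+2] because ['I_d] is a ring only when it has two elements or more; modulus 1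
    is treated apart in [kloosterman_equidistribution]. The root of unity stays abstract until
    [root_of_unity]. *)
Definition addchar (x : Zd) : C := z ^+ x.
Local Notation e := addchar.

Lemma addcharD x y : e (x + y) = e x * e y.
Proof. by rewrite /e -exprD /= (prim_expr_mod z_prim). Qed.

Lemma addchar0 : e 0 = 1.
Proof. by rewrite /e expr0. Qed.

Lemma addcharM a x : e (a * x) = e x ^+ a.
Proof. by rewrite /e -exprM /= (prim_expr_mod z_prim) mulnC. Qed.

Lemma addchar_norm x : `|e x| = 1.
Proof.
have h : `|z| ^+ d = 1 by rewrite -normrX (prim_expr_order z_prim) normr1.
rewrite /e normrX; move/eqP: h; rewrite pexpr_eq1 // => /eqP ->.
by rewrite expr1n.
Qed.

Lemma addcharN x : e (- x) = (e x)^*.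
Proof.
have h : e (- x) * e x = 1 by rewrite -addcharD addNr addchar0.
have := normCK (e x); rewrite addchar_norm expr1n => h2.
have nz : e x != 0 by rewrite -normr_eq0 addchar_norm oner_neq0.
by apply: (mulIf nz); rewrite h mulrC -h2.
Qed.

Lemma addchar_orth x : \sum_a e (a * x) = if x == 0 then d%:R else 0.
Proof.
case: eqP => [->|/eqP nz].
  under eq_bigr do rewrite mulr0 addchar0.
  by rewrite sumr_const card_ord.
have w1 : e x != 1.
  rewrite /e -(prim_order_dvd z_prim); apply: contra nz => /dvdnP [k hk].
  apply/eqP/val_inj => /=; have := ltn_ord x; rewrite hk.
  case: k {hk} => [|k]; first by rewrite mul0n.
  by rewrite mulSn ltnNge leq_addr.
have : (e x - 1) * \sum_(a : Zd) e (a * x) = 0.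
  under eq_bigr do rewrite addcharM.
  by rewrite -subrX1 /e exprAC (prim_expr_order z_prim) expr1n subrr.
by move/eqP; rewrite mulf_eq0 subr_eq0 (negbTE w1) => /eqP.
Qed.

(** After expanding the square, the sums over [a] and [b] detect the equalities [f i = f j] and
    [g i = g j] by orthogonality. *)
Lemma parseval (I : finType) (P : pred I) (f g : I -> Zd) :
  \sum_a \sum_b `|\sum_(i | P i) e (a * f i + b * g i)| ^+ 2 =
  d%:R ^+ 2 *
  #|[set ij : I * I | [&& P ij.1, P ij.2, f ij.1 == f ij.2 & g ij.1 == g ij.2]]|%:R.
Proof.
have expand a b : `|\sum_(i | P i) e (a * f i + b * g i)| ^+ 2 =
   \sum_(ij | P ij.1 && P ij.2) e (a * (f ij.1 - f ij.2)) * e (b * (g ij.1 - g ij.2)).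
  rewrite normCK rmorph_sum big_distrlr /= pair_big /=.
  apply: eq_bigr => -[i j] _ /=.
  rewrite -addcharN -!addcharD; congr e.
  by rewrite !mulrBr opprD -!addrA; congr (_ + _); rewrite addrCA.
under eq_bigr do under eq_bigr do rewrite expand.
under eq_bigr do rewrite exchange_big.
rewrite exchange_big /=.
under eq_bigr => ij _.
  under eq_bigr do rewrite -mulr_sumr.
  rewrite -mulr_suml !addchar_orth !subr_eq0.
  over.
rewrite -sum1_card natr_sum mulr_sumr big_mkcond [RHS]big_mkcond /=.
apply: eq_bigr => -[i j] _; rewrite inE /=.
case: (P i) (P j) (f i == f j) (g i == g j) => [] [] [] [] //=;
  by rewrite ?mul0r ?mulr0 // mulr1 expr2.
Qed.

Definition Kloosterman (a b : Zd) : C :=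
  \sum_(u : Zd | u \is a GRing.unit) e (a * u + b * u^-1).

Lemma Kloosterman_sym a b : Kloosterman a b = Kloosterman b a.
Proof.
rewrite /Kloosterman (reindex_inj (@invr_inj _)) /=.
apply: eq_big => u; first by rewrite unitrV.
by move=> _; rewrite invrK addrC.
Qed.

Lemma Kloosterman_scale u a b : u \is a GRing.unit ->
  Kloosterman (a * u) (b * u^-1) = Kloosterman a b.
Proof.
move=> hu; rewrite /Kloosterman [RHS](reindex_inj (mulrI hu)) /=.
apply: eq_big => v; first by rewrite unitrMr.
by move=> hv; rewrite invrM // [v^-1 * u^-1]mulrC !mulrA.
Qed.

Definition quadruples : nat :=
  #|[set ij : (Zd * Zd) * (Zd * Zd) |
    [&& (ij.1.1 \is a GRing.unit) && (ij.1.2 \is a GRing.unit),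
        (ij.2.1 \is a GRing.unit) && (ij.2.2 \is a GRing.unit),
        ij.1.1 + ij.1.2 == ij.2.1 + ij.2.2 &
        ij.1.1^-1 + ij.1.2^-1 == ij.2.1^-1 + ij.2.2^-1]]|.

(** The square of a Kloosterman sum is an exponential sum over pairs of units, so its fourth moment
    is an instance of [parseval] for pairs. *)
Lemma Kloosterman_moment :
  \sum_a \sum_b `|Kloosterman a b| ^+ 4 = d%:R ^+ 2 * quadruples%:R.
Proof.
rewrite /quadruples -(parseval (I := (Zd * Zd)%type)
  (fun x => (x.1 \is a GRing.unit) && (x.2 \is a GRing.unit))
  (fun x => x.1 + x.2) (fun x => x.1^-1 + x.2^-1)).
apply: eq_bigr => a _; apply: eq_bigr => b _.
rewrite (exprM _ 2 2) -normrX; congr (_ ^+ 2); congr (Num.norm _).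
rewrite expr2 /Kloosterman big_distrlr /= pair_big /=; apply: eq_bigr => -[x y] _ /=.
by rewrite -addcharD !mulrDr addrACA.
Qed.

(* Up to the common factor [x3], a quadruple is determined by [x1 = x3 (1 + B)]
   and [x2 = x3 (1 + C)], and it then satisfies [B * C * (B + C + 2) = 0]. *)
Definition triples : nat :=
  #|[set xy : Zd * Zd | xy.1 * xy.2 * (xy.1 + xy.2 + 2%:R) == 0]|.

Lemma quadruples_le : (quadruples <= d * triples)%N.
Proof.
rewrite /quadruples /triples -[X in (X * _)%N]card_ord -cardsT -cardsX.
pose F (ij : (Zd * Zd) * (Zd * Zd)) : Zd * (Zd * Zd) :=
  (ij.2.1, (ij.1.1 / ij.2.1 - 1, ij.1.2 / ij.2.1 - 1)).
rewrite -(card_in_imset (f := F)); last first.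
  move=> [[x1 x2] [x3 x4]] [[y1 y2] [y3 y4]]; rewrite !inE /=.
  move=> /and4P[/andP[ux1 ux2] /andP[ux3 ux4] /eqP hx _].
  move=> /and4P[/andP[uy1 uy2] /andP[uy3 uy4] /eqP hy _].
  move=> hF; have h3 : x3 = y3 := congr1 fst hF.
  have h1 : x1 / x3 - 1 = y1 / y3 - 1 := congr1 (fun t => t.2.1) hF.
  have h2 : x2 / x3 - 1 = y2 / y3 - 1 := congr1 (fun t => t.2.2) hF.
  rewrite -h3 in uy3 hy h1 h2 *.
  have ui : x3^-1 \is a GRing.unit by rewrite unitrV.
  have e1 : x1 = y1 by move: h1 => /addIr /(mulIr ui).
  have e2 : x2 = y2 by move: h2 => /addIr /(mulIr ui).
  by move: hy; rewrite -e1 -e2 hx => /addrI ->.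
apply/subset_leq_card/subsetP => _ /imsetP[[[x1 x2] [x3 x4]] + ->].
rewrite !inE /= => /and4P[/andP[u1 u2] /andP[u3 u4] /eqP hs /eqP hi].
(* Clearing denominators gives [(x1 + x2) x3 x4 = (x1 + x2) x1 x2]. The factor [x1 + x2] need not be
   a unit and cannot be cancelled, hence a cubic equation. *)
have key : (x1 + x2) * (x1 - x3) * (x2 - x3) = 0.
  have e4 : x4 = x1 + x2 - x3 by rewrite hs [x3 + x4]addrC addrK.
  have k1 : (x1 + x2) * (x3 * x4) = (x1 + x2) * (x1 * x2).
    have clear_den (a b c f : Zd) : a \is a GRing.unit -> b \is a GRing.unit ->
        a * b * (c * f) * (a^-1 + b^-1) = (a + b) * (c * f).
      move=> ua ub; have := divrr ua; have := divrr ub.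
      set i := a^-1; set j := b^-1 => hj hi'.
      transitivity (a * i * (b * (c * f)) + b * j * (a * (c * f))); first by ring.
      by rewrite hi' hj; ring.
    by rewrite -clear_den // hi [x1 * x2 * _]mulrC clear_den // -hs.
  have -> : (x1 + x2) * (x1 - x3) * (x2 - x3) = (x1 + x2) * (x1 * x2) - (x1 + x2) * (x3 * x4).
    by rewrite e4; ring.
  by rewrite k1 subrr.
have -> : x1 / x3 - 1 + (x2 / x3 - 1) + 2%:R = (x1 + x2) / x3.
  by set i := x3^-1; ring.
have -> : x1 / x3 - 1 = (x1 - x3) / x3 by rewrite mulrBl divrr.
have -> : x2 / x3 - 1 = (x2 - x3) / x3 by rewrite mulrBl divrr.
apply/eqP; transitivity ((x1 + x2) * (x1 - x3) * (x2 - x3) * x3^-1 ^+ 3); last first.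
  by rewrite key mul0r.
by set i := x3^-1; ring.
Qed.

Lemma card_dvdn_ord e : (e %| d)%N -> (#|[set x : Zd | (e %| x)%N]| = d %/ e)%N.
Proof.
move=> he; rewrite divn_count_dvd -sum1_card big_mkcond /=.
have h : (\sum_(0 <= i < d) (e %| i) = \sum_(1 <= i < d.+1) (e %| i))%N.
  apply/eqP; rewrite -(eqn_add2r (e %| d)%N) -big_nat_recr //= he.
  by rewrite big_nat_recl // dvdn0 big_add1 addnC.
rewrite -h big_mkord; apply: eq_bigr => x _; rewrite inE.
by case: (_ %| _)%N.
Qed.

Lemma card_dvdn_shift e (c : Zd) : (e %| d)%N ->
  (#|[set x : Zd | (e %| nat_of_ord (c + x)%R)%N]| = d %/ e)%N.
Proof.
move=> he; rewrite -card_dvdn_ord // -(card_imset _ (addrI c)) /=.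
apply: eq_card => y; rewrite inE; apply/imsetP/idP.
  by case=> x; rewrite inE => hx ->.
have E : c + (y - c) = y by rewrite addrC subrK.
by move=> hy; exists (y - c); [rewrite inE; move: hy; rewrite -{1}E | rewrite E].
Qed.

Definition divisor_triples (e1 e2 e3 : nat) : nat :=
  #|[set xy : Zd * Zd | [&& e1 %| xy.1, e2 %| xy.2 &
                            e3 %| nat_of_ord (xy.1 + xy.2 + 2%:R)%R]%N]|.

(** Any two of the three linear forms determine the pair, so any two conditions leave at most
    [(d / ei) (d / ej)] choices. The product of the three bounds is the square of
    [(d / e1) (d / e2) (d / e3)], which is at most [d ^ 2]. *)
Lemma divisor_triples_le e1 e2 e3 : (e1 %| d)%N -> (e2 %| d)%N -> (e3 %| d)%N ->
  (d <= e1 * e2 * e3)%N -> (divisor_triples e1 e2 e3 ^ 3 <= d ^ 4)%N.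
Proof.
move=> h1 h2 h3 hd; set n := divisor_triples _ _ _.
have n12 : (n <= (d %/ e1) * (d %/ e2))%N.
  rewrite -!card_dvdn_ord // -cardsX; apply/subset_leq_card/subsetP => -[x y].
  by rewrite !inE /= => /and3P[-> ->].
have n13 : (n <= (d %/ e1) * (d %/ e3))%N.
  rewrite -!card_dvdn_ord // -cardsX.
  pose F (xy : Zd * Zd) := (xy.1, xy.1 + xy.2 + 2%:R).
  rewrite /n /divisor_triples -(card_imset _ (f := F)).
    apply/subset_leq_card/subsetP => _ /imsetP[[x y] + ->].
    by rewrite !inE /= => /and3P[-> _].
  move=> [x y] [x' y'] hF; have hx : x = x' := congr1 fst hF.
  have : x + y + 2%:R = x' + y' + 2%:R := congr1 snd hF.
  by rewrite hx => /addIr /addrI ->.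
have n23 : (n <= (d %/ e2) * (d %/ e3))%N.
  rewrite -!card_dvdn_ord // -cardsX.
  pose F (xy : Zd * Zd) := (xy.2, xy.1 + xy.2 + 2%:R).
  rewrite /n /divisor_triples -(card_imset _ (f := F)).
    apply/subset_leq_card/subsetP => _ /imsetP[[x y] + ->].
    by rewrite !inE /= => /and3P[_ -> ->].
  move=> [x y] [x' y'] hF; have hx : y = y' := congr1 fst hF.
  have : x + y + 2%:R = x' + y' + 2%:R := congr1 snd hF.
  by rewrite hx => /addIr /addIr ->.
have [[p1 p2] p3] := (divnK h1, divnK h2, divnK h3).
move: (d %/ e1)%N (d %/ e2)%N (d %/ e3)%N n12 n13 n23 p1 p2 p3 => a b c n12 n13 n23 p1 p2 p3.
have abc : (a * b * c <= d ^ 2)%N.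
  rewrite -(leq_pmul2r (isT : (0 < d)%N)) -expnSr.
  apply: (@leq_trans (a * b * c * (e1 * e2 * e3))); first by rewrite leq_mul2l hd orbT.
  have -> : (a * b * c * (e1 * e2 * e3) = (a * e1) * (b * e2) * (c * e3))%N by ring.
  by rewrite p1 p2 p3 !expnS expn0 muln1 mulnA.
apply: (@leq_trans ((a * b * c) ^ 2)); last first.
  by rewrite (expnM d 2 2) leq_exp2r.
have -> : ((a * b * c) ^ 2 = (a * b) * ((a * c) * (b * c)))%N by ring.
by rewrite !expnS expn0 muln1; rewrite !leq_mul.
Qed.

(* If [e1], [e2], [e3] are the gcds of [d] with the three factors, then [d <= e1 * e2 * e3],
   while at most [d ^ 2 / (ei * ej)] pairs have these gcds. *)
Lemma triples_le : (triples ^ 3 <= tau d ^ 9 * d ^ 4)%N.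
Proof.
pose T := ('I_d.+1 * 'I_d.+1 * 'I_d.+1)%type.
pose valid (t : T) := [&& t.1.1 %| d, t.1.2 %| d, t.2 %| d & d <= t.1.1 * t.1.2 * t.2]%N.
pose n (t : T) := divisor_triples t.1.1 t.1.2 t.2.
pose K := (\max_(t | valid t) n t)%N.
have K3 : (K ^ 3 <= d ^ 4)%N.
  rewrite /K; apply: (big_ind (fun k => (k ^ 3 <= d ^ 4)%N)) => //.
    by move=> x y hx hy; rewrite /maxn; case: ifP.
  by move=> t /and4P[h1 h2 h3 h4]; apply: divisor_triples_le.
pose g (xy : Zd * Zd) : T :=
  (inord (gcdn xy.1 d), inord (gcdn xy.2 d), inord (gcdn (xy.1 + xy.2 + 2%:R : Zd)%R d)).
have gE (x : Zd) : (inord (gcdn x d) : 'I_d.+1) = gcdn x d :> nat.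
  by apply: inordK; rewrite ltnS; apply: dvdn_leq; rewrite // dvdn_gcdr.
have gv (x y w : Zd) : x * y * w = 0 ->
    valid (inord (gcdn x d), inord (gcdn y d), inord (gcdn w d)).
  move=> /(congr1 (@nat_of_ord _)) /= h.
  have {h} : (d %| nat_of_ord x * nat_of_ord y * nat_of_ord w)%N.
    by apply/eqP; rewrite -modnMml h.
  rewrite /valid /= !gE !dvdn_gcdr /=.
  move: (nat_of_ord x) (nat_of_ord y) (nat_of_ord w) => a b c h3.
  apply: dvdn_leq; first by rewrite !muln_gt0 !gcdn_gt0 /= !orbT.
  have step u v : (d %| u * v -> d %| gcdn u d * v)%N.
    by move=> huv; rewrite muln_gcdl dvdn_gcd huv dvdn_mulr.
  rewrite -mulnA; apply: (step a); rewrite mulnCA; apply: (step b).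
  by rewrite mulnCA mulnA mulnC; apply: (step c); rewrite mulnC.
have tri : (triples <= tau d ^ 3 * K)%N.
  rewrite /triples -sum1_card (partition_big g valid); last first.
    by move=> [x y]; rewrite inE => /eqP h; exact: (gv x y (x + y + 2%:R) h).
  apply: (@leq_trans (\sum_(t | valid t) K)).
    apply: leq_sum => t vt; apply: (@leq_trans (n t)); last exact: leq_bigmax_cond.
    rewrite sum1_card /n /divisor_triples; apply/subset_leq_card/subsetP => -[x y].
    rewrite !inE => /andP[_ /eqP <-] /=.
    by have := gE (x + y + 2%:R) => /= ->; rewrite !gE !dvdn_gcdl.
  rewrite sum_nat_const leq_mul2r; apply/orP; right.
  have -> : tau d = #|[set e : 'I_d.+1 | (e %| d)%N]| by rewrite tauE // cardsE.
  rewrite !expnS expn0 muln1 mulnA -!cardsX.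
  apply/subset_leq_card/subsetP => -[[x y] w].
  by rewrite !inE /valid /= => /and4P[-> -> -> _].
apply: (@leq_trans ((tau d ^ 3 * K) ^ 3)); first by rewrite leq_exp2r.
by rewrite expnMn -expnM leq_mul2l K3 orbT.
Qed.

(** Two solutions differ by a multiple of [d / gcd(a, d)], so all of them lie in one translate of
    these multiples. *)
Lemma card_linear_congruence (a a' : Zd) :
  (#|[set u : Zd | (a * u == a')%R]| <= gcdn a d)%N.
Proof.
have [-> | [u0]] := set_0Vmem [set u : Zd | (a * u == a')%R]; first by rewrite cards0.
rewrite inE => /eqP hu0.
have g0 : (0 < gcdn a d)%N by rewrite gcdn_gt0 orbT.
have gd := dvdn_gcdr a d.
have hd : (d %/ gcdn a d * gcdn a d = d)%N by rewrite divnK.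
have -> : gcdn a d = (d %/ (d %/ gcdn a d))%N.
  by rewrite -[X in (X %/ _)%N]hd mulKn // divn_gt0 // dvdn_leq.
rewrite -(@card_dvdn_shift _ (- u0)); last first.
  by apply/dvdnP; exists (gcdn a d); rewrite mulnC.
apply/subset_leq_card/subsetP => u; rewrite !inE => /eqP hu.
have : a * (- u0 + u) = 0 by rewrite mulrDr mulrN hu0 hu addNr.
move: (- u0 + u) => v /(congr1 (@nat_of_ord _)) /= hv.
have {hv} : (d %| a * v)%N by apply/eqP.
move: (nat_of_ord a) (nat_of_ord v) g0 hd => {gd} a1 v1 g0 hd h.
have h1 : (d %/ gcdn a1 d * gcdn a1 d %| a1 %/ gcdn a1 d * v1 * gcdn a1 d)%N.
  by rewrite hd mulnAC divnK ?dvdn_gcdl.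
move: h1; rewrite dvdn_pmul2r // Gauss_dvdr // /coprime.
by rewrite -(eqn_pmul2r g0) muln_gcdl !divnK ?dvdn_gcdl ?dvdn_gcdr // gcdnC mul1n.
Qed.

Lemma card_unit_ord : #|[set u : Zd | u \is a GRing.unit]| = totient d.
Proof.
rewrite totient_count_coprime big_mkord -sum1_card big_mkcond /=.
apply: eq_bigr => x _; rewrite inE.
have := @unitZpE d x isT; rewrite natr_Zp => ->.
by case: (coprime _ _).
Qed.

(** The map [u -> (a u, b / u)] takes each value at most [gcd(a, d)] times, since already its first
    component does. *)
Lemma Kloosterman_orbit a b :
  (totient d)%:R * `|Kloosterman a b| ^+ 4 <=
  (gcdn a d)%:R * (d%:R ^+ 2 * quadruples%:R).
Proof.
rewrite -Kloosterman_moment -card_unit_ord.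
have -> : #|[set u : Zd | u \is a GRing.unit]|%:R * `|Kloosterman a b| ^+ 4 =
    \sum_(u : Zd | u \is a GRing.unit) `|Kloosterman (a * u) (b * u^-1)| ^+ 4.
  rewrite -sum1_card natr_sum mulr_suml; apply: eq_big => u; first by rewrite inE.
  by rewrite inE => hu; rewrite mul1r Kloosterman_scale.
rewrite pair_big (partition_big (fun u => (a * u, b * u^-1)) predT) //= mulr_sumr.
apply: ler_sum => -[x y] _ /=.
under eq_bigr => u /andP[_ /eqP [-> ->]] do over.
rewrite /= sumr_const -[X in X <= _]mulr_natl ler_wpM2r ?exprn_ge0 // ler_nat.
apply: leq_trans (card_linear_congruence a x).
apply/subset_leq_card/subsetP => u; rewrite !inE unfold_in /=.
by move=> /andP[_ /eqP/(congr1 fst) /= ->].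
Qed.

(* The sum takes the same value on the whole orbit of [(a, b)] under [(u a, b / u)],
   which is therefore small compared to the fourth moment. *)
Theorem Kloosterman_bound a b :
  `|Kloosterman a b| ^+ 12 <= (tau d * gcdn a d)%:R ^+ 12 * d%:R ^+ 10.
Proof.
have orb := Kloosterman_orbit a b.
set S := `|Kloosterman a b| in orb *; have S0 : 0 <= S by rewrite normr_ge0.
have d0 : 0 < d%:R ^+ 3 :> C by rewrite exprn_gt0 // ltr0n.
rewrite -(ler_pM2l d0).
(* The cube matches the bound for [triples ^ 3]. Altogether
   [d ^ 3 S ^ 12 <= tau ^ 12 gcd ^ 3 d ^ 13], that is, [S] is at most [tau gcd d ^ (5/6)]. *)
have st1 : d%:R ^+ 3 * S ^+ 12 <= (tau d)%:R ^+ 3 * ((totient d)%:R * S ^+ 4) ^+ 3.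
  have -> : (tau d)%:R ^+ 3 * ((totient d)%:R * S ^+ 4) ^+ 3 =
      (totient d * tau d)%:R ^+ 3 * S ^+ 12 by rewrite natrM; ring.
  by rewrite ler_wpM2r ?exprn_ge0 // lerXn2r ?nnegrE ?ler0n // ler_nat le_totient_tau.
apply: (le_trans st1).
have st2 : ((totient d)%:R * S ^+ 4) ^+ 3 <= ((gcdn a d * d ^ 2 * (d * triples))%N%:R) ^+ 3.
  rewrite lerXn2r ?nnegrE ?mulr_ge0 ?ler0n ?exprn_ge0 //.
  apply: (le_trans orb); rewrite mulrA -natrX -!natrM ler_nat.
  by rewrite leq_mul2l quadruples_le orbT.
apply: (le_trans (ler_wpM2l _ st2)); first by rewrite exprn_ge0 ?ler0n.
rewrite -!natrX -!natrM ler_nat.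
have g0 : (0 < gcdn a d)%N by rewrite gcdn_gt0 orbT.
rewrite !expnMn.
apply: (@leq_trans (tau d ^ 3 * (gcdn a d ^ 3 * (d ^ 3 * d ^ 3) * (d ^ 3 * (tau d ^ 9 * d ^ 4))))).
  by rewrite !leq_mul2l triples_le !orbT.
have -> : (tau d ^ 3 * (gcdn a d ^ 3 * (d ^ 3 * d ^ 3) * (d ^ 3 * (tau d ^ 9 * d ^ 4))) =
  d ^ 3 * (tau d ^ 12 * gcdn a d ^ 3 * d ^ 10))%N.
  by move: (tau d) (gcdn a d) => t g; ring.
by rewrite leq_mul2l leq_mul2r leq_mul2l leq_pexp2l // !orbT.
Qed.

End KloostermanSum.

(** * Fourier coefficients modulo [d] *)

Definition harmonic_sum (F : numFieldType) (n : nat) : F := \sum_(m < n.+1 | (0 < m)%N) m%:R^-1.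

Lemma gcdn_sub m n : (m <= n)%N -> gcdn (n - m) n = gcdn m n.
Proof. by move=> /subnK; move: (n - m)%N => k <-; rewrite gcdnDl gcdnDr gcdnC. Qed.

Section GcdSum.
Variables (F : numFieldType) (n : nat).

Lemma sum_multiples_le e (f : nat -> F) : (0 < e)%N -> (forall k, 0 <= f k) ->
  \sum_(m < n.+1 | (0 < m)%N && (e %| m)%N) f (m %/ e)%N <= \sum_(k < n.+1 | (0 < k)%N) f k.
Proof.
move=> e0 f0; pose h (m : 'I_n.+1) : 'I_n.+1 := inord (m %/ e).
have hE (m : 'I_n.+1) : h m = (m %/ e)%N :> nat.
  by apply: inordK; rewrite ltnS; apply: leq_trans (leq_div _ _) _; rewrite -ltnS.
pose D := [set m : 'I_n.+1 | (0 < m)%N && (e %| m)%N].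
have inj : {in D &, injective h}.
  move=> x y; rewrite !inE => /andP[_ hx] /andP[_ hy] /(congr1 (@nat_of_ord _)).
  by rewrite !hE => hxy; apply: val_inj; rewrite /= -(divnK hx) -(divnK hy) hxy.
have -> : \sum_(m < n.+1 | (0 < m)%N && (e %| m)%N) f (m %/ e)%N = \sum_(k in h @: D) f k.
  rewrite big_imset //=; apply: eq_big => m; first by rewrite inE.
  by rewrite hE.
rewrite big_mkcond [leRHS]big_mkcond /=; apply: ler_sum => k _.
case: ifP => [/imsetP[m] | _]; last by case: ifP.
rewrite inE => /andP[m0 em] ->; rewrite hE divn_gt0 //.
by rewrite (dvdn_leq m0 em).
Qed.

(** Replace [gcd(m, n)] by the sum of all common divisors [e]; for fixed [e] the multiples [m = e k]
    contribute at most the sum of the [1 / k]. *)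
Lemma sum_gcd_le : (0 < n)%N ->
  \sum_(m < n.+1 | (0 < m)%N) (gcdn m n)%:R / m%:R <= (tau n)%:R * harmonic_sum F n.
Proof.
move=> n0.
apply: (@le_trans _ _ (\sum_(m < n.+1 | (0 < m)%N)
   \sum_(e < n.+1 | (e %| n)%N) if (e %| m)%N then e%:R / m%:R else 0)).
  apply: ler_sum => m m0.
  have hg : (gcdn m n < n.+1)%N by rewrite ltnS dvdn_leq ?dvdn_gcdr.
  rewrite (bigD1 (Ordinal hg)) ?dvdn_gcdr //= dvdn_gcdl lerDl.
  by apply: sumr_ge0 => e _; case: ifP => // _; rewrite divr_ge0 ?ler0n.
rewrite exchange_big /= tauE // mulrC -[_%:R]/(1 *+ _) -sumr_const mulr_sumr.
apply: ler_sum => e en; rewrite mulr1.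
have e0 : (0 < e)%N := dvdn_gt0 n0 en.
have inv0 (k : nat) : 0 <= k%:R^-1 :> F by rewrite invr_ge0 ler0n.
rewrite -big_mkcondr; apply: le_trans (sum_multiples_le e0 inv0).
rewrite le_eqVlt; apply/orP; left; apply/eqP/eq_bigr => m /andP[m0 em].
rewrite -[X in _ / X%:R](divnK em) natrM invfM.
by rewrite mulrCA divff ?mulr1 // pnatr_eq0 -lt0n.
Qed.

End GcdSum.

Section Fourier.
Variables (p : nat) (C : numClosedFieldType) (z : C).
Local Notation d := p.+2.
Hypothesis z_prim : d.-primitive_root z.
Local Notation Zd := 'I_d.
Local Notation e := (addchar z).

(** Normalized so that [fourier F 0] is the mean of [F]. *)
Definition fourier (F : Zd -> C) (m : Zd) : C :=
  d%:R^-1 * \sum_j F j * e (- (m * j)).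

Lemma fourier_inversion F j : F j = \sum_m fourier F m * e (m * j).
Proof.
have d0 : d%:R != 0 :> C by rewrite pnatr_eq0.
apply: (mulfI d0); rewrite mulr_sumr.
under eq_bigr => m _ do rewrite /fourier -mulrA mulVKf // mulr_suml.
rewrite exchange_big /=.
under eq_bigr => k _.
  under eq_bigr => m _ do rewrite -mulrA -(addcharD z_prim) addrC -mulrBr.
  rewrite -mulr_sumr (addchar_orth z_prim) subr_eq0.
  over.
rewrite (bigD1 j) //= eqxx mulrC big1 ?addr0 // => k; rewrite eq_sym => /negbTE ->.
by rewrite mulr0.
Qed.

(** Summation by parts: shifting [F] by 1 multiplies its coefficient at [m] by [e m], so [1 - e m]
    times the coefficient is controlled by the cyclic variation of [F]. *)
Lemma fourier_decay F m :
  d%:R * `|1 - e m| * `|fourier F m| <= \sum_j `|F (j + 1) - F j|.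
Proof.
have d0 : d%:R != 0 :> C by rewrite pnatr_eq0.
have -> : d%:R * `|1 - e m| * `|fourier F m| = `|\sum_j (F (j + 1) - F j) * e (- (m * j))|.
  have dn : d%:R = `|d%:R| :> C by rewrite normr_nat.
  rewrite dn -!normrM; rewrite -normrN; congr (Num.norm _).
  rewrite /fourier.
  have -> : \sum_j (F (j + 1) - F j) * e (- (m * j)) =
      e m * (\sum_j F j * e (- (m * j))) - \sum_j F j * e (- (m * j)).
    under eq_bigr do rewrite mulrBl.
    rewrite sumrB; congr (_ - _); rewrite mulr_sumr [RHS](reindex_inj (addIr 1)) /=.
    apply: eq_bigr => j _; rewrite mulrCA -(addcharD z_prim); congr (_ * e _).
    by rewrite mulrDr mulr1 opprD addrCA subrr addr0.
  set T := \sum_j _; rewrite [d%:R * _]mulrC -mulrA mulVKf //.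
  by rewrite mulrBl mul1r opprB.
apply: (le_trans (ler_norm_sum _ _ _)); apply: ler_sum => j _.
by rewrite normrM (addchar_norm z_prim) mulr1.
Qed.

Lemma fourier_zero F A : (forall j, `|F j| <= A) -> `|fourier F 0| <= A.
Proof.
move=> hF; rewrite /fourier normrM normfV normr_nat ler_pdivrMl ?ltr0n //.
apply: (le_trans (ler_norm_sum _ _ _)).
rewrite -[X in X%:R * _](card_ord d) mulr_natl -sumr_const; apply: ler_sum => j _.
by rewrite normrM (addchar_norm z_prim) mulr1.
Qed.

(** The two inputs that are not algebraic are kept as hypotheses: that a chord of the circle is long
    enough, and a value [K] standing for [d ^ (5/6)]. *)
Hypothesis dist : forall m : Zd, m != 0 ->
  (minn m (d - m))%:R <= d%:R * `|1 - e m|.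
Variable K : C.
Hypothesis K_ge0 : 0 <= K.
Hypothesis K_pow : K ^+ 12 = d%:R ^+ 10.

Definition weight (m : Zd) : C := if m == 0 then 1 else (minn m (d - m))%:R^-1.

Lemma minn_gt0 (m : Zd) : m != 0 -> (0 < minn m (d - m))%N.
Proof.
move=> m0; rewrite leq_min subn_gt0 ltn_ord andbT lt0n.
by apply: contra m0 => /eqP h; apply/eqP/val_inj.
Qed.

Lemma fourier_le F A m : (forall j, `|F j| <= A) ->
  \sum_j `|F (j + 1) - F j| <= A -> `|fourier F m| <= A * weight m.
Proof.
move=> hF hV; rewrite /weight; case: eqP => [->|/eqP m0].
  by rewrite mulr1; apply: fourier_zero.
have w0 := minn_gt0 m0.
rewrite ler_pdivlMr ?ltr0n // mulrC.
apply: le_trans hV; apply: le_trans (fourier_decay F m).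
by rewrite ler_wpM2r ?normr_ge0 // dist.
Qed.

Lemma Kloosterman_le (a b : Zd) :
  `|Kloosterman z a b| <= (tau d * gcdn a d)%:R * K.
Proof.
rewrite -(@ler_pXn2r _ 12) ?nnegrE ?normr_ge0 ?mulr_ge0 ?ler0n //.
by rewrite exprMn K_pow Kloosterman_bound.
Qed.

Local Notation W := (\sum_(m : Zd | m != 0) (gcdn m d)%:R * weight m).

(** [1 / min(m, d - m) <= 1 / m + 1 / (d - m)], and [m] and [d - m] have the same gcd with [d]; each
    half is a sum bounded by [sum_gcd_le]. *)
Lemma weight_sum_le : W <= 2%:R * (tau d)%:R * harmonic_sum C d.
Proof.
have half (h : Zd -> nat) : injective h -> (forall m, m != 0 -> (0 < h m < d)%N) ->
    \sum_(m : Zd | m != 0) (gcdn (h m) d)%:R / (h m)%:R <= (tau d)%:R * harmonic_sum C d.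
  move=> hi hb; apply: le_trans (@sum_gcd_le C d isT).
  pose g (m : Zd) : 'I_d.+1 := inord (h m).
  have gE m : m != 0 -> g m = h m :> nat.
    by move=> /hb /andP[_ hm]; apply: inordK; rewrite ltnS ltnW.
  pose D := [set m : Zd | m != 0].
  have inj : {in D &, injective g}.
    move=> x y; rewrite !inE => hx hy /(congr1 (@nat_of_ord _)).
    by rewrite !gE // => /hi.
  have -> : \sum_(m : Zd | m != 0) (gcdn (h m) d)%:R / (h m)%:R =
     \sum_(k in g @: D) (gcdn k d)%:R / k%:R :> C.
    rewrite big_imset //=; apply: eq_big => m; first by rewrite inE.
    by move=> m0; rewrite gE.
  rewrite big_mkcond [leRHS]big_mkcond /=; apply: ler_sum => k _.
  case: ifP => [/imsetP[m] | _]; last by case: ifP => // _; rewrite divr_ge0 ?ler0n.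
  by rewrite inE => m0 ->; rewrite gE //; case/andP: (hb m m0) => -> _.
have pos (m : Zd) : m != 0 -> (0 < m)%N.
  by move=> /minn_gt0; rewrite leq_min => /andP[].
rewrite -mulrA mulr_natl mulr2n.
have h1 := half (@nat_of_ord d) (@ord_inj d).
have h2 := half (fun m : Zd => (d - m)%N).
apply: (le_trans _ (lerD (h1 _) (h2 _ _))); last 3 first.
- by move=> m m0; rewrite pos //= ltn_ord.
- move=> x y /= /eqP; rewrite eqn_sub2lE ?(ltnW (ltn_ord _)) //.
  by move=> /eqP /val_inj.
- by move=> m m0; rewrite subn_gt0 ltn_ord /= ltn_subrL pos.
rewrite -big_split /=; apply: ler_sum => m m0.
rewrite gcdn_sub ?(ltnW (ltn_ord m)) //
   -mulrDr ler_wpM2l ?ler0n // /weight (negbTE m0) /minn.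
by case: ifP => _; rewrite ?lerDl ?lerDr invr_ge0 ler0n.
Qed.

(** Fourier expansion of [F] and [G] turns the sum into one of Kloosterman sums at the frequencies
    [(m, - n)]. Frequency [(0, 0)] gives the main term; all others are bounded by
    [Kloosterman_le]. *)
Lemma equidistribution (F G : Zd -> C) A B :
  (forall j, `|F j| <= A) -> \sum_j `|F (j + 1) - F j| <= A ->
  (forall j, `|G j| <= B) -> \sum_j `|G (j + 1) - G j| <= B ->
  `|\sum_(u : Zd | u \is a GRing.unit) F u * G (- u^-1) -
     (totient d)%:R * ((d%:R^-1 * \sum_j F j) * (d%:R^-1 * \sum_j G j))| <=
  8%:R * A * B * K * (tau d)%:R ^+ 3 * harmonic_sum C d ^+ 2.
Proof.
move=> hF vF hG vG.
have A0 : 0 <= A := le_trans (normr_ge0 _) (hF 0).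
have B0 : 0 <= B := le_trans (normr_ge0 _) (hG 0).
pose T m n := fourier F m * fourier G n * Kloosterman z m (- n).
have mean H : d%:R^-1 * \sum_j H j = fourier H 0.
  rewrite /fourier; congr (_ * _); apply: eq_bigr => j _.
  by rewrite mul0r oppr0 addchar0 mulr1.
have -> : \sum_(u : Zd | u \is a GRing.unit) F u * G (- u^-1) = \sum_m \sum_n T m n.
  transitivity (\sum_(u : Zd | u \is a GRing.unit) \sum_m \sum_n
     fourier F m * fourier G n * e (m * u + - n * u^-1)).
    apply: eq_bigr => u _; rewrite {1}(fourier_inversion F u) {1}(fourier_inversion G (- u^-1)).
    rewrite big_distrlr /=; apply: eq_bigr => m _; apply: eq_bigr => n _.
    by rewrite mulrACA -(addcharD z_prim) mulrN mulNr.
  rewrite exchange_big /=; apply: eq_bigr => m _.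
  by rewrite exchange_big /=; apply: eq_bigr => n _; rewrite /T /Kloosterman mulr_sumr.
have T00 : T 0 0 = (totient d)%:R * ((d%:R^-1 * \sum_j F j) * (d%:R^-1 * \sum_j G j)).
  rewrite !mean /T mulrC; congr (_ * _).
  rewrite /Kloosterman -card_unit_ord -sum1_card natr_sum.
  apply: eq_big => u; first by rewrite inE.
  by rewrite oppr0 !mul0r addr0 addchar0.
rewrite -T00 (bigD1 0) //= (bigD1 0 (P := xpredT)) //= -[T 0 0 + _ + _]addrA [X in Num.norm X]addrC addKr.
have tK0 : 0 <= (tau d)%:R * K by rewrite mulr_ge0 ?ler0n.
have w0 m : 0 <= weight m by rewrite /weight; case: ifP => // _; rewrite invr_ge0 ler0n.
have W0 : 0 <= W by apply: sumr_ge0 => m _; rewrite mulr_ge0 ?ler0n.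
have Tl m n : m != 0 -> `|T m n| <= (A * B * ((tau d)%:R * K)) * ((gcdn m d)%:R * weight m) * weight n.
  move=> m0; rewrite /T 2!normrM.
  have := Kloosterman_le m (- n); rewrite natrM => hk.
  have -> : (A * B * ((tau d)%:R * K)) * ((gcdn m d)%:R * weight m) * weight n =
     (A * weight m) * (B * weight n) * ((tau d)%:R * (gcdn m d)%:R * K) by ring.
  apply: ler_pM; rewrite ?mulr_ge0 ?normr_ge0 //.
  by apply: ler_pM; rewrite ?normr_ge0 //; apply: fourier_le.
(* For [m = 0] the gcd of the first frequency would be [d] and the bound useless; the symmetry of
   the Kloosterman sum brings in [gcd(n, d)] instead. *)
have Tr n : n != 0 -> `|T 0 n| <= (A * B * ((tau d)%:R * K)) * ((gcdn n d)%:R * weight n).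
  move=> n0; rewrite /T 2!normrM.
  have := Kloosterman_le (- n) 0; rewrite natrM Kloosterman_sym => hk.
  have gn : gcdn (- n : Zd) d = gcdn n d.
    by rewrite /= gcdnC gcdn_modr gcdnC gcdn_sub // ltnW.
  rewrite gn in hk.
  have -> : (A * B * ((tau d)%:R * K)) * ((gcdn n d)%:R * weight n) =
     (A * weight 0) * (B * weight n) * ((tau d)%:R * (gcdn n d)%:R * K).
    by rewrite {2}/weight eqxx; ring.
  apply: ler_pM; rewrite ?mulr_ge0 ?normr_ge0 //.
  by apply: ler_pM; rewrite ?normr_ge0 //; apply: fourier_le.
have Hw : \sum_n weight n <= 1 + W.
  rewrite (bigD1 0) //= {1}/weight eqxx lerD2l; apply: ler_sum => m m0.
  by rewrite ler_peMl // ler1n gcdn_gt0 orbT.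
have bound : `|\sum_(i | i != 0) T 0 i + \sum_(i | i != 0) \sum_n T i n| <=
   (A * B * ((tau d)%:R * K)) * (W + W * (1 + W)).
  apply: (le_trans (ler_normD _ _)); rewrite mulrDr; apply: lerD.
    rewrite mulr_sumr; apply: (le_trans (ler_norm_sum _ _ _)).
    by apply: ler_sum => n n0; apply: Tr.
  rewrite mulrA; apply: (@le_trans _ _ (A * B * ((tau d)%:R * K) * W * \sum_n weight n)); last first.
    by rewrite ler_wpM2l ?mulr_ge0.
  rewrite [_ * W]mulr_sumr mulr_suml; apply: (le_trans (ler_norm_sum _ _ _)).
  apply: ler_sum => m m0; rewrite mulr_sumr; apply: (le_trans (ler_norm_sum _ _ _)).
  by apply: ler_sum => n _; apply: Tl.
apply: (le_trans bound).
have hW := weight_sum_le.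
set Hd := harmonic_sum C d in hW *.
have H1 : 1 <= Hd.
  have l1 : (1 < d.+1)%N by [].
  rewrite /Hd /harmonic_sum (bigD1 (Ordinal l1)) //= invr1 lerDl.
  by apply: sumr_ge0 => m _; rewrite invr_ge0 ler0n.
have t1 : 1 <= (tau d)%:R :> C.
  by rewrite ler1n; have := le_totient_tau (isT : (0 < d)%N); case: (tau d) => //; rewrite muln0.
have tH1 : 1 <= (tau d)%:R * Hd by rewrite mulr_ege1.
(* With [W <= 2 x] and [1 <= x], one has [2 W + W ^ 2 <= 4 x + 4 x ^ 2 <= 8 x ^ 2]. *)
set x := (tau d)%:R * Hd in tH1.
have -> : 8%:R * A * B * K * (tau d)%:R ^+ 3 * Hd ^+ 2 = (A * B * ((tau d)%:R * K)) * (8%:R * x ^+ 2).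
  by rewrite /x; ring.
apply: ler_wpM2l; first by rewrite !mulr_ge0.
have x0 : 0 <= x by apply: le_trans tH1.
rewrite -mulrA -/x in hW.
have hWW : W * W <= (2%:R * x) * (2%:R * x) by rewrite ler_pM.
have xx : x <= x * x by rewrite ler_peMr.
have -> : W + W * (1 + W) = 2%:R * W + W * W by ring.
apply: (le_trans (lerD (ler_wpM2l _ hW) hWW)); first by rewrite ler0n.
have -> : 2%:R * (2%:R * x) + 2%:R * x * (2%:R * x) = 4%:R * x + 4%:R * (x * x) by ring.
have -> : 8%:R * x ^+ 2 = 4%:R * (x * x) + 4%:R * (x * x) by ring.
by rewrite lerD2r ler_wpM2l ?ler0n.
Qed.

End Fourier.

(** * Growth of the divisor function *)

Lemma tauM m n : (0 < m)%N -> (0 < n)%N -> (tau (m * n) <= tau m * tau n)%N.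
Proof.
move=> m0 n0; rewrite /tau -(size_allpairs muln); apply: uniq_leq_size (divisors_uniq _) _.
move=> c; rewrite -dvdn_divisors ?muln_gt0 ?m0 // => hc.
have g0 : (0 < gcdn c m)%N by rewrite gcdn_gt0 m0 orbT.
(* A divisor [c] of [m n] splits into [gcd(c, m)], which divides [m], and its cofactor, which is
   prime to [m / gcd(c, m)] and hence divides [n]. *)
apply/allpairsP; exists (gcdn c m, c %/ gcdn c m)%N; split => /=.
- by rewrite -dvdn_divisors // dvdn_gcdr.
- rewrite -dvdn_divisors //.
  have h : (c %/ gcdn c m * gcdn c m %| m %/ gcdn c m * n * gcdn c m)%N.
    by rewrite mulnAC !divnK ?dvdn_gcdl ?dvdn_gcdr.
  move: h; rewrite dvdn_pmul2r // Gauss_dvdr // /coprime.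
  by rewrite -(eqn_pmul2r g0) muln_gcdl !divnK ?dvdn_gcdl ?dvdn_gcdr // mul1n.
- by rewrite mulnC divnK ?dvdn_gcdl.
Qed.

Section DivisorBound.
Variable F : realFieldType.

(** The weight [1 / n ^ 2] bounds the moment of order 0, and the recursion on [j] keeps the bounds
    independent of [N]. *)
Definition tau_moment (j N : nat) : F :=
  \sum_(n < N.+1 | (0 < n)%N) (tau n)%:R ^+ j / n%:R ^+ 2.

(* [tau n = \sum_(e %| n) 1], and [tau] is submultiplicative. *)
Lemma tau_momentS j N : tau_moment j.+1 N <= tau_moment j N ^+ 2.
Proof.
pose g (n : nat) : F := (tau n)%:R ^+ j / n%:R ^+ 2.
have g0 n : 0 <= g n by rewrite divr_ge0 ?exprn_ge0 ?ler0n.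
have -> : tau_moment j.+1 N = \sum_(n < N.+1 | (0 < n)%N) \sum_(e < N.+1 | (e %| n)%N) g n.
  apply: eq_bigr => n n0; rewrite sumr_const exprS -mulrA -[RHS]mulr_natl; congr (_%:R * _).
  by rewrite (@tau_card N n n0 (ltn_ord n)).
rewrite (exchange_big_dep (fun e : 'I_N.+1 => (0 < e)%N)) /=; last first.
  by move=> n e n0; apply: dvdn_gt0.
rewrite expr2 {1}/tau_moment mulr_suml; apply: ler_sum => e e0.
apply: le_trans (ler_wpM2l (g0 e) (sum_multiples_le N e0 g0)).
rewrite mulr_sumr; apply: ler_sum => n /andP[n0 en].
have k0 : (0 < n %/ e)%N by rewrite divn_gt0 // dvdn_leq.
rewrite /g mulf_div -!exprMn -!natrM [(e * _)%N]mulnC divnK //.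
rewrite ler_wpM2r ?invr_ge0 ?exprn_ge0 ?ler0n // lerXn2r ?nnegrE ?ler0n // ler_nat.
by rewrite -{1}(divnK en) mulnC tauM.
Qed.

Lemma tau_moment0 N : tau_moment 0 N <= 2%:R.
Proof.
(* The sharper bound [2 - 1 / N] is the one that passes through the induction, by telescoping. *)
suff h : (0 < N)%N -> tau_moment 0 N <= 2%:R - N%:R^-1.
  case: N h => [|N] h; first by rewrite /tau_moment big_mkcond big_ord1 /= ler0n.
  by apply: le_trans (h _) _ => //; rewrite lerBlDr lerDl invr_ge0 ler0n.
elim: N => // -[|N] IH _.
  by rewrite /tau_moment big_mkcond !big_ord_recl big_ord0 /= expr0 !expr1n; lra.
rewrite /tau_moment big_mkcond big_ord_recr /= -big_mkcond.
apply: (le_trans (lerD (IH isT) (lexx _))).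
have -> : (N.+2%:R : F) = N.+1%:R + 1 by rewrite -natr1.
have : 0 < N.+1%:R :> F by rewrite ltr0n.
move: (N.+1%:R : F) => x x0.
have key : ((x + 1) ^+ 2)^-1 <= x^-1 - (x + 1)^-1.
  have -> : x^-1 - (x + 1)^-1 = (x * (x + 1))^-1.
    by field; apply/andP; split; lra.
  by rewrite lef_pV2 ?posrE; nra.
by rewrite expr0 mul1r; lra.
Qed.

(** A single term is at most the whole moment, which is at most [2 ^ (2 ^ j)]. As [j] is arbitrary,
    this is the bound of [tau n] by any small power of [n]. *)
Theorem divisor_bound (j : nat) : exists2 c : F, 0 < c &
  forall n : nat, (0 < n)%N -> (tau n)%:R ^+ j <= c * n%:R ^+ 2.
Proof.
exists (2%:R ^+ (2 ^ j)); first by rewrite exprn_gt0 ?ltr0n.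
move=> n n0; rewrite -ler_pdivrMr ?exprn_gt0 ?ltr0n //.
have mom : forall i, tau_moment i n <= 2%:R ^+ (2 ^ i).
  have pos i : 0 <= tau_moment i n.
    by apply: sumr_ge0 => k _; rewrite divr_ge0 ?exprn_ge0 ?ler0n.
  elim=> [|i IH]; first exact: tau_moment0.
  by apply: le_trans (tau_momentS _ _) _; rewrite expnSr exprM lerXn2r ?nnegrE ?exprn_ge0 ?ler0n.
apply: le_trans (mom j); rewrite /tau_moment (bigD1 (@ord_max n)) //= lerDl.
by apply: sumr_ge0 => k _; rewrite divr_ge0 ?exprn_ge0 ?ler0n.
Qed.

End DivisorBound.

End FiniteSums.

(** * Equidistribution of modular inverses *)

Definition rsum {T : Type} (f : T -> R) (l : list T) : R := fold_right Rplus 0 (map f l).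

Definition bounded_lipschitz (F : R -> R) (A : R) : Prop :=
  (forall x, 0 <= x <= 1 -> Rabs (F x) <= A) /\
  (forall x y, 0 <= x <= 1 -> 0 <= y <= 1 -> Rabs (F x - F y) <= A * Rabs (x - y)).

(** The retraction onto [0,1]: composing with it extends a function known on [0,1] only to a
    function continuous on the whole line. *)
Definition clamp (x : R) : R := Rmax 0 (Rmin 1 x).

Lemma clamp_in x : 0 <= clamp x <= 1.
Proof. unfold clamp, Rmax, Rmin; repeat destruct Rle_dec; lra. Qed.

Lemma clamp_id x : 0 <= x <= 1 -> clamp x = x.
Proof. unfold clamp, Rmax, Rmin; repeat destruct Rle_dec; lra. Qed.

Lemma clamp_dist x y : Rabs (clamp x - clamp y) <= Rabs (x - y).
Proof.
unfold clamp, Rmax, Rmin, Rabs; repeat destruct Rle_dec; repeat destruct Rcase_abs; lra.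
Qed.

Lemma continuous_clamp x : continuous clamp x.
Proof.
apply continuity_pt_filterlim; intros e he; exists e; split; [exact he|].
intros y [_ hy]; unfold dist in *; simpl in *; unfold Rdist in *.
eapply Rle_lt_trans; [apply clamp_dist | exact hy].
Qed.

Lemma lipschitz_continuous F A x : 0 <= A ->
  (forall u v, Rabs (F u - F v) <= A * Rabs (u - v)) -> continuous F x.
Proof.
intros hA hF; apply continuity_pt_filterlim; intros e he.
exists (e / (A + 1)); split; [apply Rdiv_lt_0_compat; lra|].
intros y [_ hy]; unfold dist in *; simpl in *; unfold Rdist in *.
eapply Rle_lt_trans; [apply hF|].
apply Rle_lt_trans with ((A + 1) * Rabs (y - x)); [pose proof (Rabs_pos (y - x)); nra|].
apply Rlt_le_trans with ((A + 1) * (e / (A + 1))); [apply Rmult_lt_compat_l; lra|].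
right; field; lra.
Qed.

Lemma bounded_lipschitz_pos F A : bounded_lipschitz F A -> 0 <= A.
Proof.
intros [h _]; apply Rle_trans with (Rabs (F 0)); [apply Rabs_pos | apply h; lra].
Qed.

Lemma continuous_clamped F A x : bounded_lipschitz F A -> continuous (fun t => F (clamp t)) x.
Proof.
intros h; pose proof (bounded_lipschitz_pos _ _ h) as hA; destruct h as [_ h].
apply lipschitz_continuous with A; [exact hA|]; intros u v.
eapply Rle_trans; [apply h; apply clamp_in|].
apply Rmult_le_compat_l; [exact hA | apply clamp_dist].
Qed.

Lemma ex_RInt_lipschitz F A a b : bounded_lipschitz F A -> 0 <= a -> a <= b -> b <= 1 ->
  ex_RInt F a b.
Proof.
intros h ha hab hb; apply ex_RInt_ext with (fun t => F (clamp t)).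
- intros x; rewrite Rmin_left, Rmax_right by lra; intros hx.
  rewrite clamp_id; lra.
- apply (ex_RInt_continuous (V := R_CompleteNormedModule)); intros z _.
  apply continuous_clamped with A; exact h.
Qed.

Lemma rsum_app {T} (f : T -> R) l1 l2 : rsum f (l1 ++ l2) = rsum f l1 + rsum f l2.
Proof.
unfold rsum; induction l1 as [|x l1 IH]; simpl; [ring | rewrite IH; ring].
Qed.

Lemma riemann_sum_le F A d : bounded_lipschitz F A -> (0 < d)%nat ->
  Rabs (/ INR d * rsum (fun j => F (INR j / INR d)) (seq 0 d) - RInt F 0 1) <= A / INR d.
Proof.
intros h hd; pose proof (bounded_lipschitz_pos _ _ h) as hA.
assert (hd' : 0 < INR d) by (apply lt_0_INR; exact hd).
assert (step : forall n, (n <= d)%nat ->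
  Rabs (/ INR d * rsum (fun j => F (INR j / INR d)) (seq 0 n) - RInt F 0 (INR n / INR d))
    <= INR n * (A / INR d / INR d)).
{ induction n as [|n IH]; intros hn.
  - simpl; unfold Rdiv; rewrite Rmult_0_l, RInt_point; unfold rsum, zero; simpl.
    rewrite Rmult_0_r, Rmult_0_l, Rminus_0_r, Rabs_R0; lra.
  - specialize (IH ltac:(lia)).
    assert (hn1 : INR n / INR d <= 1).
    { apply Rmult_le_reg_r with (INR d); [lra|].
      unfold Rdiv; rewrite Rmult_assoc, Rinv_l, Rmult_1_r, Rmult_1_l by lra.
      apply le_INR; lia. }
    assert (hs1 : INR (S n) / INR d <= 1).
    { apply Rmult_le_reg_r with (INR d); [lra|].
      unfold Rdiv; rewrite Rmult_assoc, Rinv_l, Rmult_1_r, Rmult_1_l by lra.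
      apply le_INR; lia. }
    assert (h0 : 0 <= INR n / INR d) by (apply Rdiv_le_0_compat; [apply pos_INR|lra]).
    assert (gap : INR (S n) / INR d - INR n / INR d = / INR d) by (rewrite S_INR; field; lra).
    assert (gp : 0 < / INR d) by (apply Rinv_0_lt_compat; lra).
    rewrite seq_S, rsum_app; simpl (0 + n)%nat.
    rewrite <- (RInt_Chasles F 0 (INR n / INR d) (INR (S n) / INR d))
      by (apply ex_RInt_lipschitz with A; auto; lra).
    unfold plus; simpl (AbelianMonoid.plus _ _ _); unfold rsum at 2; simpl (fold_right _ _ _).
    assert (piece : Rabs (/ INR d * F (INR n / INR d) - RInt F (INR n / INR d) (INR (S n) / INR d))
        <= A / INR d / INR d).
    { replace (/ INR d * F (INR n / INR d)) with
        (RInt (fun _ => F (INR n / INR d)) (INR n / INR d) (INR (S n) / INR d))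
        by (rewrite RInt_const, gap; unfold scal; simpl; unfold mult; simpl; ring).
      rewrite <- (RInt_minus (V := R_CompleteNormedModule) (fun _ => F (INR n / INR d)) F);
        [ | apply ex_RInt_const | apply ex_RInt_lipschitz with A; auto; lra].
      eapply Rle_trans.
      - apply (norm_RInt_le_const (V := R_NormedModule) (fun x => F (INR n / INR d) - F x)
          (INR n / INR d) (INR (S n) / INR d) _ (A / INR d)); [lra | | ].
        + intros x hx; simpl; unfold norm; simpl; unfold abs; simpl.
          destruct h as [_ h]; eapply Rle_trans; [apply h; lra|].
          apply Rmult_le_compat_l; [exact hA|]; rewrite Rabs_left1; lra.
        + apply (RInt_correct (V := R_CompleteNormedModule)), (ex_RInt_minus (V := R_NormedModule));
            [apply ex_RInt_const | apply ex_RInt_lipschitz with A; auto; lra].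
      - right; rewrite gap; field; lra. }
    rewrite S_INR.
    match goal with |- Rabs ?e <= _ => replace e with
      ((/ INR d * rsum (fun j => F (INR j / INR d)) (seq 0 n) - RInt F 0 (INR n / INR d))
       + (/ INR d * F (INR n / INR d) - RInt F (INR n / INR d) (INR (S n) / INR d))) end.
    + eapply Rle_trans; [apply Rabs_triang|]; lra.
    + rewrite S_INR; simpl; ring. }
specialize (step d (le_n d)).
replace (INR d / INR d) with 1 in step by (field; lra).
replace (INR d * (A / INR d / INR d)) with (A / INR d) in step by (field; lra).
exact step.
Qed.

(** Jordan's inequality with a weaker constant, read off from the Taylor polynomial of degree 7,
    since [y ^ 2 <= 4] on this range. *)
Lemma sin_ge_quarter y : 0 <= y <= PI / 2 -> y / 4 <= sin y.
Proof.
intros [h0 h1]; pose proof PI_4 as h4.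
destruct (SIN y h0 ltac:(lra)) as [h _].
eapply Rle_trans; [|exact h].
unfold sin_lb, sin_approx, sin_term; simpl.
assert (y * y <= 4) by nra.
assert (0 <= y * y) by nra.
set (q := y * y) in *.
match goal with |- _ <= ?e => replace e with (y * (1 - q / 6 + q * q / 120 - q * q * q / 5040))
  by (unfold q; field) end.
assert (1 / 4 <= 1 - q / 6 + q * q / 120 - q * q * q / 5040) by nra; nra.
Qed.

(** The chord has length [2 sin (PI m / d)]. By the symmetry [m -> d - m] it is enough to treat
    angles up to [PI / 2]. *)
Lemma chord_ge m d : (0 < m < d)%nat ->
  let t := 2 * PI * INR m / INR d in
  INR (Nat.min m (d - m)) ^ 2 <= INR d ^ 2 * ((1 - cos t) ^ 2 + sin t ^ 2).
Proof.
intros hm t; pose proof PI_RGT_0 as hpi; pose proof PI2_3_2 as hpi2.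
assert (hd : 0 < INR d) by (apply lt_0_INR; lia).
assert (m0 : 0 < INR m) by (apply lt_0_INR; lia).
assert (md : INR m < INR d) by (apply lt_INR; lia).
assert (e : (1 - cos t) ^ 2 + sin t ^ 2 = (2 * sin (PI * INR m / INR d)) ^ 2).
{ replace t with (2 * (PI * INR m / INR d)) by (unfold t; field; lra).
  rewrite cos_2a_sin, sin_2a.
  pose proof (sin2_cos2 (PI * INR m / INR d)) as h; unfold Rsqr in h.
  set (u := sin _) in *; set (v := cos _) in *.
  replace ((2 * u * v) ^ 2) with (4 * u * u * (v * v)) by ring.
  replace (v * v) with (1 - u * u) by lra; ring. }
rewrite e, <- Rpow_mult_distr; apply pow_incr; split; [apply pos_INR|].
assert (small : forall k, (0 < k)%nat -> (2 * k <= d)%nat ->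
  INR k <= INR d * (2 * sin (PI * INR k / INR d))).
{ intros k k0 kd.
  assert (k0' : 0 < INR k) by (apply lt_0_INR; lia).
  assert (2 * INR k <= INR d).
  { replace 2 with (INR 2) by reflexivity; rewrite <- mult_INR; apply le_INR; lia. }
  assert (b : 0 <= PI * INR k / INR d <= PI / 2).
  { split; [apply Rdiv_le_0_compat; nra|].
    apply Rmult_le_reg_r with (INR d); [lra|].
    replace (PI * INR k / INR d * INR d) with (PI * INR k) by (field; lra); nra. }
  pose proof (sin_ge_quarter _ b) as hs.
  apply Rle_trans with (INR d * (2 * (PI * INR k / INR d / 4))).
  - replace (INR d * (2 * (PI * INR k / INR d / 4))) with (PI / 2 * INR k) by (field; lra); nra.
  - apply Rmult_le_compat_l; lra. }
destruct (Nat.le_gt_cases (2 * m) d) as [hle|hgt].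
- rewrite Nat.min_l by lia; apply small; lia.
- rewrite Nat.min_r by lia.
  replace (PI * INR m / INR d) with (PI - PI * INR (d - m) / INR d)
    by (rewrite minus_INR by lia; field; lra).
  rewrite sin_PI_x; apply small; lia.
Qed.

Lemma one_plus_ln_le n x : 0 < x -> 0 < n -> 1 <= n -> 1 + ln x <= n * Rpower x (/ n).
Proof.
intros hx hn h1; unfold Rpower.
pose proof (exp_ineq1_le (/ n * ln x)) as h.
apply Rle_trans with (n * (1 + / n * ln x)).
- replace (n * (1 + / n * ln x)) with (n + ln x) by (field; lra); lra.
- apply Rmult_le_compat_l; lra.
Qed.

Lemma ln_ge_inv x : 0 < x -> / (x + 1) <= ln ((x + 1) / x).
Proof.
intros hx.
pose proof (exp_ineq1_le (ln (x / (x + 1)))) as h.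
assert (p : 0 < x / (x + 1)) by (apply Rdiv_lt_0_compat; lra).
rewrite exp_ln in h by exact p.
replace ((x + 1) / x) with (/ (x / (x + 1))) by (field; lra).
rewrite ln_Rinv by exact p.
replace (/ (x + 1)) with (1 - x / (x + 1)) by (field; lra); lra.
Qed.

Lemma Rpower_five_sixths_pow x : 0 < x -> Rpower x (5 / 6) ^ 12 = x ^ 10.
Proof.
intros hx; rewrite <- !Rpower_pow by (auto; apply exp_pos).
rewrite Rpower_mult; f_equal; simpl; lra.
Qed.

(** The shift is cyclic: in the step from [d - 1] back to 0 only the bound on [F] itself helps,
    which costs [2 A]. *)
Lemma lipschitz_variation F A d j : bounded_lipschitz F A -> (0 < d)%nat -> (j < d)%nat ->
  Rabs (F (INR (Nat.modulo (j + 1) d) / INR d) - F (INR j / INR d))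
    <= A / INR d + (if Nat.eq_dec (j + 1) d then 2 * A else 0).
Proof.
intros h hd hj; pose proof (bounded_lipschitz_pos _ _ h) as hA.
assert (hd' : 0 < INR d) by (apply lt_0_INR; exact hd).
assert (in01 : forall i, (i < d)%nat -> 0 <= INR i / INR d <= 1).
{ intros i hi; split; [apply Rdiv_le_0_compat; [apply pos_INR | lra]|].
  apply Rmult_le_reg_r with (INR d); [lra|].
  unfold Rdiv; rewrite Rmult_assoc, Rinv_l, Rmult_1_r, Rmult_1_l by lra.
  apply le_INR; lia. }
assert (a0 : 0 <= A / INR d) by (apply Rdiv_le_0_compat; lra).
destruct h as [h1 h2]; destruct (Nat.eq_dec (j + 1) d) as [e|ne].
- pose proof (h1 _ (in01 _ hj)) as b1.
  assert (hm : (Nat.modulo (j + 1) d < d)%nat) by (apply Nat.mod_upper_bound; lia).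
  pose proof (h1 _ (in01 _ hm)) as b2.
  eapply Rle_trans; [apply Rabs_triang|]; rewrite Rabs_Ropp; lra.
- rewrite Nat.mod_small by lia; rewrite Rplus_0_r.
  eapply Rle_trans; [apply h2; apply in01; lia|].
  right; rewrite plus_INR; simpl.
  replace ((INR j + 1) / INR d - INR j / INR d) with (/ INR d) by (field; lra).
  rewrite Rabs_pos_eq; [reflexivity | left; apply Rinv_0_lt_compat; lra].
Qed.

Module Equidistribution.
Import all_boot all_order all_algebra all_solvable complex Rstruct.
Import zify ring.
Import FiniteSums.
Set Implicit Arguments. Unset Strict Implicit. Unset Printing Implicit Defensive.
Import Order.TTheory GRing.Theory Num.Theory.
Local Open Scope ring_scope.
Local Open Scope complex_scope.
Local Delimit Scope R_scope with coqR.

Definition units (d : nat) : seq nat := [seq r <- iota 0 d | coprime r d].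

Lemma big_rsum (T : Type) (s : seq T) (P : pred T) (f : T -> R) :
  \sum_(i <- s | P i) f i = rsum f (filter P s).
Proof.
elim: s => [|x s IH]; first by rewrite big_nil.
by rewrite big_cons /=; case: (P x) => //; rewrite IH.
Qed.

Definition cis (t : R) : R[i] := cos t +i* sin t.
Arguments cis t%_ring_scope.

Lemma cisD a b : cis (a + b) = cis a * cis b.
Proof.
rewrite /cis; apply/eqP; rewrite eq_complex /=; apply/andP; split; apply/eqP.
  exact: cos_plus.
by rewrite [RHS]addrC; apply: sin_plus.
Qed.

Lemma cisX t n : cis t ^+ n = cis (n%:R * t).
Proof.
elim: n => [|n IH]; first by rewrite expr0 mul0r /cis cos_0 sin_0.
by rewrite exprSr IH -cisD -natr1 mulrDl mul1r.
Qed.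

Lemma complexX (x : R) n : (x ^+ n)%:C = x%:C ^+ n.
Proof. exact: rmorphXn. Qed.

Lemma complexM (x y : R) : (x * y)%:C = x%:C * y%:C.
Proof. exact: rmorphM. Qed.

Lemma complex_nat n : (n%:R : R)%:C = n%:R.
Proof. exact: rmorph_nat. Qed.

Lemma complexV (x : R) : (x^-1)%:C = x%:C^-1.
Proof. exact: fmorphV. Qed.

Section RootOfUnity.
Variable p : nat.
Local Notation d := p.+2.

Definition root_of_unity : R[i] := cis (2%:R * PI / d%:R).

Lemma root_of_unityX m : root_of_unity ^+ m = cis (2 * PI * INR m / INR d)%coqR.
Proof.
rewrite /root_of_unity cisX; congr cis.
rewrite !INRE RdivE !RmultE -[2%coqR]/(INR 2) INRE.
by rewrite mulrA [m%:R * _]mulrC.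
Qed.

Lemma root_of_unity_chord m : (0 < m < d)%N ->
  (minn m (d - m))%:R <= d%:R * `|1 - root_of_unity ^+ m|.
Proof.
move=> hm; rewrite -(@ler_pXn2r _ 2) ?nnegrE ?mulr_ge0 ?ler0n ?normr_ge0 //.
rewrite exprMn root_of_unityX.
have := @chord_ge m d ltac:(lia); cbv zeta.
move: (2 * PI * INR m / INR d)%coqR => t /RleP.
rewrite RmultE RplusE !RpowE !INRE RminusE => h.
have -> : minn m (d - m) = Nat.min m (d - m) by lia.
have -> : `|1 - cis t| ^+ 2 = ((1 - cos t) ^+ 2 + sin t ^+ 2)%:C.
  by rewrite -add_Re2_Im2 /cis /= sub0r sqrrN.
by move: h; rewrite -lecR complexX [X in _ <= X]complexM [X in _ <= X * _]complexX !complex_nat.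
Qed.

Lemma root_of_unity_prim : d.-primitive_root root_of_unity.
Proof.
rewrite /primitive_root_of_unity /=; apply/forallP => i; apply/eqP.
have [->|ne] := eqVneq i.+1 d.
  rewrite unity_rootE root_of_unityX.
  have -> : (2 * PI * INR d / INR d)%coqR = (2 * PI)%coqR.
    by rewrite RdivE (RmultE _ (INR d)) INRE mulfK ?pnatr_eq0.
  by rewrite /cis cos_2PI sin_2PI eqxx.
apply/negbTE; rewrite unity_rootE; apply/eqP => h.
have hi : (0 < i.+1 < d)%N by rewrite /= ltn_neqAle ne ltn_ord.
have := root_of_unity_chord hi; rewrite h subrr normr0 mulr0 lern0 => /eqP.
lia.
Qed.

End RootOfUnity.

Lemma Nat_moduloE m n : Nat.modulo m n.+1 = (m %% n.+1)%N.
Proof.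
symmetry; apply: (Nat.mod_unique _ _ (m %/ n.+1)); first by apply/ssrnat.ltP; rewrite ltn_mod.
by rewrite {1}(divn_eq m n.+1) mulnC.
Qed.

Lemma norm_complex (x : R) : `|x%:C| = `|x|%:C.
Proof. by rewrite normc_def /= expr0n addr0 sqrtr_sqr. Qed.

Lemma complex_sum (I : finType) (P : pred I) (f : I -> R) :
  (\sum_(i | P i) f i)%:C = \sum_(i | P i) (f i)%:C.
Proof. exact: rmorph_sum. Qed.

(** The abstract statement at the root [exp (2 i PI / d)]. The samples of [F] have variation at most
    [d (A / d) + 2 A = 3 A] around the cycle, whence the factors [3 A] and [3 B]. *)
Lemma equidistribution_nat (d : nat) (inv : nat -> nat) (F G : R -> R) (A B : R) :
  (1 < d)%N ->
  (forall r, (r < d)%N -> coprime r d -> (inv r < d)%N /\ (d %| r * inv r + 1)%N) ->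
  bounded_lipschitz F A -> bounded_lipschitz G B ->
  `| rsum (fun r => F (INR r / INR d)%coqR * G (INR (inv r) / INR d)%coqR) (units d) -
     (totient d)%:R *
       ((d%:R^-1 * rsum (fun j => F (INR j / INR d)%coqR) (iota 0 d)) *
        (d%:R^-1 * rsum (fun j => G (INR j / INR d)%coqR) (iota 0 d))) | <=
  8%:R * (3%:R * A) * (3%:R * B) * Rpower (INR d) (5 / 6)%coqR * (tau d)%:R ^+ 3
    * harmonic_sum R d ^+ 2.
Proof.
case: d => [|[|p]] // _; set d := p.+2 => hinv hF hG.
pose s (H : R -> R) (j : 'I_d) : R := H (INR j / INR d)%coqR.
have A0 : 0 <= A by apply/RleP/(bounded_lipschitz_pos _ _ hF).
have B0 : 0 <= B by apply/RleP/(bounded_lipschitz_pos _ _ hG).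
have in01 (j : 'I_d) : (0 <= INR j / INR d <= 1)%coqR.
  split; apply/RleP; rewrite RdivE !INRE ?divr_ge0 ?ler0n //.
  by rewrite ler_pdivrMr ?ltr0n // mul1r ler_nat ltnW.
have sup H a : 0 <= a -> bounded_lipschitz H a -> forall j, `|(s H j)%:C| <= (3%:R * a)%:C.
  move=> a0 [h _] j; rewrite norm_complex lecR.
  apply: le_trans (_ : a <= _); last by rewrite ler_peMl // ler1n.
  by have /RleP := h _ (in01 j); rewrite RabsE.
have var H a : 0 <= a -> bounded_lipschitz H a ->
    \sum_(j : 'I_d) `|(s H (j + 1))%:C - (s H j)%:C| <= (3%:R * a)%:C.
  move=> a0 h.
  have -> : \sum_(j : 'I_d) `|(s H (j + 1))%:C - (s H j)%:C| =
     (\sum_(j : 'I_d) `|s H (j + 1) - s H j|)%:C.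
    rewrite complex_sum; apply: eq_bigr => j _; rewrite -norm_complex.
    by congr (Num.norm _); rewrite rmorphB.
  rewrite lecR.
  apply: (@le_trans _ _ (\sum_(j : 'I_d) (a / d%:R + if j == ord_max then 2%:R * a else 0))).
    apply: ler_sum => j _.
    have := @lipschitz_variation H a d j h ltac:(lia) ltac:(have := ltn_ord j; lia).
    move=> hh; rewrite /s.
    have -> : ((j + 1)%R : 'I_d) = Nat.modulo (j + 1) d :> nat.
      by rewrite [LHS]/= modnDmr Nat_moduloE.
    apply: le_trans; first by apply/RleP; exact: hh.
    rewrite RplusE RdivE INRE lerD2l.
    have -> : (j == ord_max) = ((j + 1)%coq_nat == d) by rewrite -val_eqE /=; lia.
    by case: Nat.eq_dec => [/eqP ->|/eqP/negbTE ->].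
  rewrite big_split /= sumr_const card_ord -big_mkcond big_pred1_eq.
  rewrite -[X in X + _]mulr_natr divfK ?pnatr_eq0 //.
  by rewrite -{1}[a]mul1r -mulrDl.
have dist (m : 'I_d) : m != 0 -> (minn m (d - m))%:R <= d%:R * `|1 - addchar (root_of_unity p) m|.
  move=> m0; apply: root_of_unity_chord; rewrite ltn_ord andbT lt0n.
  by apply: contra m0 => /eqP h; apply/eqP/val_inj.
have K0 : 0 <= (Rpower (INR d) (5 / 6)%coqR)%:C.
  by rewrite (lecR 0); apply/RleP; left; apply: exp_pos.
have KX : (Rpower (INR d) (5 / 6)%coqR)%:C ^+ 12 = d%:R ^+ 10 :> R[i].
  have d0 : Rlt 0%coqR (INR d) by apply: lt_0_INR; lia.
  by rewrite -complexX -RpowE (Rpower_five_sixths_pow _ d0) RpowE INRE complexX complex_nat.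
have := equidistribution (root_of_unity_prim p) dist K0 KX
   (sup _ _ A0 hF) (var _ _ A0 hF) (sup _ _ B0 hG) (var _ _ B0 hG).
have meanE H : d%:R^-1 * \sum_j (s H j)%:C =
    (d%:R^-1 * rsum (fun j => H (INR j / INR d)%coqR) (iota 0 d))%:C :> R[i].
  rewrite complexM; congr (_ * _); first by rewrite complexV complex_nat.
  rewrite -complex_sum; congr (_%:C); rewrite -(big_mkord predT (fun j => H (INR j / INR d)%coqR)).
  by rewrite big_rsum filter_predT /index_iota subn0.
have sumE : \sum_(u : 'I_d | u \is a GRing.unit) (s F u)%:C * (s G (- u^-1))%:C =
    (rsum (fun r => F (INR r / INR d)%coqR * G (INR (inv r) / INR d)%coqR) (units d))%:C :> R[i].
  rewrite /units -big_rsum -[iota 0 d]/(index_iota 0 d) big_mkord complex_sum.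
  have unitE (u : 'I_d) : (u \is a GRing.unit) = coprime u d.
    by have := @unitZpE d u isT; rewrite natr_Zp coprime_sym.
  apply: eq_big => [u|u uu]; first exact: unitE.
  rewrite complexM; congr (_ * (G (INR _ / INR d)%coqR)%:C).
  have [lt dv] := hinv u (ltn_ord u) (etrans (esym (unitE u)) uu).
  pose v : 'I_d := Ordinal lt.
  suff -> : - u^-1 = v by [].
  have : u * v + 1 = 0.
    by apply/val_inj; rewrite /= modnDm; apply/eqP.
  move=> /eqP; rewrite addr_eq0 => /eqP h.
  apply: (mulrI uu); rewrite h mulrN divrr //.
rewrite !meanE sumE.
have hE : harmonic_sum R[i] d = (harmonic_sum R d)%:C.
  rewrite /harmonic_sum complex_sum; apply: eq_bigr => i _.
  by rewrite complexV complex_nat.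
rewrite hE -!complex_nat -complexX -[(harmonic_sum R d)%:C ^+ 2]complexX -!complexM.
by rewrite -rmorphB norm_complex lecR.
Qed.

Lemma harmonic_sum_le_ln n : (0 < n)%N -> harmonic_sum R n <= 1 + ln n%:R.
Proof.
elim: n => // -[|n] IH _.
  rewrite /harmonic_sum big_mkcond !big_ord_recl big_ord0 /= invr1 !addr0 add0r.
  by rewrite -[1%:R]/(1%coqR) ln_1 addr0.
rewrite /harmonic_sum big_mkcond big_ord_recr /= -big_mkcond.
apply: (le_trans (lerD (IH isT) (lexx _))); rewrite -addrA lerD2l.
have n0 : Rlt 0%coqR (n.+1%:R) by apply/RltP; rewrite ltr0n.
have := ln_ge_inv _ n0; rewrite ln_div //; last by apply/RltP; rewrite RplusE natr1 ltr0n.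
move=> /RleP; rewrite RplusE RinvE natr1 RminusE => h.
by rewrite -lerBrDl.
Qed.

Lemma equidistribution_mean (d : nat) (inv : nat -> nat) (F G : R -> R) (A B : R) :
  lt 1 d ->
  (forall r, lt r d -> coprime r d -> lt (inv r) d /\ Nat.divide d (r * inv r + 1)) ->
  bounded_lipschitz F A -> bounded_lipschitz G B ->
  (Rabs (rsum (fun r => F (INR r / INR d) * G (INR (inv r) / INR d)) (units d) -
     INR (totient d) *
       ((/ INR d * rsum (fun j => F (INR j / INR d)) (List.seq 0 d)) *
        (/ INR d * rsum (fun j => G (INR j / INR d)) (List.seq 0 d)))) <=
  72 * A * B * (Rpower (INR d) (5 / 6) * INR (tau d) ^ 3 * (1 + ln (INR d)) ^ 2))%coqR.
Proof.
move=> d1 hinv hF hG.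
have d1' : (1 < d)%N by apply/ssrnat.ltP.
have hinv' r : (r < d)%N -> coprime r d -> (inv r < d)%N /\ (d %| r * inv r + 1)%N.
  move=> /ssrnat.ltP rd cr; have [/ssrnat.ltP h1 [q hq]] := hinv r rd cr; split => //.
  by apply/dvdnP; exists q.
have A0 : 0 <= A by apply/RleP/(bounded_lipschitz_pos _ _ hF).
have B0 : 0 <= B by apply/RleP/(bounded_lipschitz_pos _ _ hG).
apply/RleP; have h := equidistribution_nat d1' hinv' hF hG.
rewrite RabsE !INRE; rewrite !INRE in h.
apply: (le_trans h).
have Hle := harmonic_sum_le_ln (ltnW d1').
have H0 : 0 <= harmonic_sum R d by apply: sumr_ge0 => i _; rewrite invr_ge0 ler0n.
have K0 : 0 <= Rpower d%:R (5 / 6)%coqR by apply/RleP; left; apply: exp_pos.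
rewrite !RmultE !RpowE RplusE.
have -> : 8%:R * (3%:R * A) * (3%:R * B) * Rpower d%:R (5 / 6)%coqR * (tau d)%:R ^+ 3 * harmonic_sum R d ^+ 2
   = (72%:R * A * B * (Rpower d%:R (5 / 6)%coqR * (tau d)%:R ^+ 3)) * harmonic_sum R d ^+ 2 by ring.
have -> : (72%coqR : R) = 72%:R by rewrite -INRE INR_IZR_INZ.
rewrite [leRHS]mulrA; apply: ler_wpM2l.
  by rewrite !mulr_ge0 ?exprn_ge0 ?ler0n.
by rewrite lerXn2r ?nnegrE // (le_trans H0).
Qed.

Lemma tau_pow_le (j : nat) : exists2 c : R, Rlt 0%coqR c &
  forall n : nat, lt 0 n -> (INR (tau n) ^ j <= c * INR n ^ 2)%coqR.
Proof.
have [c c0 h] := divisor_bound R j; exists c; first exact/RltP.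
move=> n n0; apply/RleP; rewrite !RpowE RmultE !INRE; apply: h.
exact/ssrnat.ltP.
Qed.

Lemma totient_le n : le (totient n) n.
Proof.
case: n => // n; apply/ssrnat.leP; rewrite totient_count_coprime.
rewrite -{3}[n.+1]subn0 -[(_ - 0)%N]muln1 -sum_nat_const_nat.
by apply: leq_sum => i _; case: coprime.
Qed.

Lemma tau_gt0 n : lt 0 n -> lt 0 (tau n).
Proof.
move=> /ssrnat.ltP n0; apply/ssrnat.ltP; have := le_totient_tau n0.
by case: (tau n) => //; rewrite muln0 leqNgt n0.
Qed.

Lemma units1 : units 1 = (0%N :: nil)%list.
Proof. by []. Qed.

Lemma coprime_gcd r d : coprime r d = true <-> Nat.gcd r d = 1%N.
Proof.
have -> : Nat.gcd r d = gcdn r d.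
  apply: Nat.gcd_unique.
  - by have /dvdnP [k hk] := dvdn_gcdl r d; exists k.
  - by have /dvdnP [k hk] := dvdn_gcdr r d; exists k.
  - move=> q [k hk] [l hl]; have /dvdnP [i hi] : (q %| gcdn r d)%N.
      by rewrite dvdn_gcd; apply/andP; split; apply/dvdnP; [exists k | exists l].
    by exists i.
by split => [/eqP | h]; last exact/eqP.
Qed.

Lemma in_units r d : List.In r (units d) <-> lt r d /\ Nat.gcd r d = 1%N.
Proof.
rewrite /units -coprime_gcd.
have e : forall s : seq nat, List.In r [seq x <- s | coprime x d] <-> List.In r s /\ coprime r d.
  elim=> [|x s IH] /=; first by split => // -[].
  case: ifP => cx /=; rewrite IH; split.
  - by case=> [<-|[? ?]]; [split; [left|] | split; [right|]].
  - by case=> -[->|h] cr; [left | right].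
  - by case=> h cr; split; [right|].
  - by case=> -[xr|h] cr //; rewrite -xr cx in cr.
rewrite e; have -> : iota 0 d = List.seq 0 d by [].
rewrite List.in_seq; split=> [[[_ h] c] | [h c]]; split => //; first split => //; lia.
Qed.

Lemma nodup_units d : List.NoDup (units d).
Proof.
rewrite /units; have h : List.NoDup (iota 0 d) by have := List.seq_NoDup d 0.
exact: List.NoDup_filter h.
Qed.

Lemma length_units d : lt 0 d -> List.length (units d) = totient d.
Proof.
move=> d0; rewrite -[LHS]/(size (units d)) size_filter totient_count_coprime.
rewrite -sum1_count big_mkcond /= /index_iota subn0; apply: eq_bigr => i _.
by rewrite coprime_sym; case: coprime.
Qed.

Definition divisor_list (n : nat) : seq nat := [seq k <- iota 1 n | (k %| n)%N].

Lemma in_divisor_list k n : lt 0 n -> List.In k (divisor_list n) <-> Nat.divide k n.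
Proof.
move=> n0; have e : forall s : seq nat, List.In k [seq x <- s | (x %| n)%N] <-> List.In k s /\ (k %| n)%N.
  elim=> [|x s IH] /=; first by split => // -[].
  case: ifP => cx /=; rewrite IH; split.
  - by case=> [<-|[? ?]]; [split; [left|] | split; [right|]].
  - by case=> -[->|h] cr; [left | right].
  - by case=> h cr; split; [right|].
  - by case=> -[xr|h] cr //; rewrite -xr cx in cr.
rewrite e; have -> : iota 1 n = List.seq 1 n by [].
rewrite List.in_seq; split=> [[_ /dvdnP [q hq]]|[q hq]]; first by exists q.
have hk : (k %| n)%N by apply/dvdnP; exists q.
have := dvdn_leq _ hk; have := dvdn_gt0 _ hk; split => //.
by have /ssrnat.ltP n0' := n0; have := dvdn_leq n0' hk; have := dvdn_gt0 n0' hk; lia.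
Qed.

Lemma nodup_divisor_list n : List.NoDup (divisor_list n).
Proof.
rewrite /divisor_list; have h : List.NoDup (iota 1 n) by have := List.seq_NoDup n 1.
exact: List.NoDup_filter h.
Qed.

Lemma sum_totient_divisor_list n : lt 0 n ->
  rsum (fun k => INR (List.length (units k))) (divisor_list n) = INR n.
Proof.
move=> n0; have n0' : (0 < n)%N by apply/ssrnat.ltP.
rewrite /divisor_list -big_rsum -[n in RHS](sum_totient_dvd n) INRE natr_sum.
rewrite -(big_mkord (fun d => d %| n)%N (fun d => (totient d)%:R)) big_ltn_cond //.
have -> : (0 %| n)%N = false by case: n n0 n0'.
rewrite /index_iota subSS subn0; apply: eq_bigr => k hk.
by rewrite length_units ?INRE //; apply/ssrnat.ltP; apply: dvdn_gt0 hk.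
Qed.

End Equidistribution.

Import FiniteSums Equidistribution.

Lemma Rpower_le_compat x y a : 0 < x -> x <= y -> 0 <= a -> Rpower x a <= Rpower y a.
Proof. intros; apply Rle_Rpower_l; [lra|split; lra]. Qed.

Lemma error_growth : exists c, 0 < c /\ forall d, (1 <= d)%nat ->
  Rpower (INR d) (5 / 6) * INR (tau d) ^ 3 * (1 + ln (INR d)) ^ 2 <= c * Rpower (INR d) (6 / 7).
Proof.
(* The room between the exponents is [6/7 - 5/6 = 4/168], shared equally between [tau ^ 3] and the
   squared logarithm. Since [504 = 3 * 168], the bound of [tau ^ 504] by [d ^ 2] gives [tau ^ 3] at
   most a constant times [d ^ (2/168)]. *)
destruct (tau_pow_le 504) as [c0 hc0 h].
exists (Rpower c0 (/ 168) * 168 ^ 2); split.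
{ apply Rmult_lt_0_compat; [apply exp_pos | lra]. }
intros d hd; assert (d1 : 1 <= INR d) by (change 1 with (INR 1); apply le_INR; lia).
assert (t1 : 0 < INR (tau d)) by (apply lt_0_INR, tau_gt0; lia).
specialize (h d ltac:(lia)).
assert (ht : INR (tau d) ^ 3 <= Rpower c0 (/ 168) * Rpower (INR d) (2 / 168)).
{ replace (INR (tau d) ^ 3) with (Rpower (INR (tau d) ^ 504) (/ 168)).
  - replace (Rpower c0 (/ 168) * Rpower (INR d) (2 / 168)) with (Rpower (c0 * INR d ^ 2) (/ 168)).
    + apply Rpower_le_compat; [apply pow_lt; lra | exact h | lra].
    + rewrite <- Rpower_mult_distr by (auto; apply pow_lt; lra).
      f_equal; rewrite <- Rpower_pow, Rpower_mult by lra; f_equal; simpl; field.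
  - rewrite <- !Rpower_pow, Rpower_mult by lra; f_equal.
    rewrite !INR_IZR_INZ; simpl; lra. }
assert (hl : (1 + ln (INR d)) ^ 2 <= (168 * Rpower (INR d) (/ 168)) ^ 2).
{ apply pow_incr; split; [|apply one_plus_ln_le; lra].
  assert (0 <= ln (INR d)) by (rewrite <- ln_1; apply ln_le; lra); lra. }
assert (p3 : 0 <= INR (tau d) ^ 3) by (apply pow_le; lra).
assert (pk : 0 < Rpower (INR d) (5 / 6)) by apply exp_pos.
replace (Rpower (INR d) (6 / 7)) with
  (Rpower (INR d) (5 / 6) * Rpower (INR d) (2 / 168) * Rpower (INR d) (/ 168) ^ 2).
2:{ rewrite <- (Rpower_pow 2) by apply exp_pos; rewrite Rpower_mult, <- !Rpower_plus; f_equal; simpl; field. }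
apply Rle_trans with (Rpower (INR d) (5 / 6) * (Rpower c0 (/ 168) * Rpower (INR d) (2 / 168))
   * (168 * Rpower (INR d) (/ 168)) ^ 2).
- apply Rmult_le_compat; [ | apply pow2_ge_0 | | exact hl].
  + apply Rmult_le_pos; lra.
  + apply Rmult_le_compat_l; lra.
- right; ring.
Qed.

Lemma RInt_bounded_lipschitz F A : bounded_lipschitz F A -> Rabs (RInt F 0 1) <= A.
Proof.
intros h; replace A with ((1 - 0) * A) by ring.
apply (norm_RInt_le_const (V := R_NormedModule) F 0 1); [lra | |].
- intros x hx; apply h; exact hx.
- apply (RInt_correct (V := R_CompleteNormedModule)), ex_RInt_lipschitz with A; auto; lra.
Qed.

Theorem kloosterman_equidistribution : exists c, 0 < c /\
  forall (d : nat) (inv : nat -> nat) (F G : R -> R) (A B : R), (1 <= d)%nat ->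
  (forall r, (r < d)%nat -> Nat.gcd r d = 1%nat -> (inv r < d)%nat /\ Nat.divide d (r * inv r + 1)) ->
  bounded_lipschitz F A -> bounded_lipschitz G B ->
  Rabs (rsum (fun r => F (INR r / INR d) * G (INR (inv r) / INR d)) (units d)
        - INR (length (units d)) * (RInt F 0 1 * RInt G 0 1)) <= c * A * B * Rpower (INR d) (6 / 7).
Proof.
destruct error_growth as [c [c0 hc]]; exists (72 * c + 3); split; [lra|].
intros d inv F G A B hd hinv hF hG.
pose proof (bounded_lipschitz_pos _ _ hF) as A0; pose proof (bounded_lipschitz_pos _ _ hG) as B0.
pose proof (RInt_bounded_lipschitz _ _ hF) as iF; pose proof (RInt_bounded_lipschitz _ _ hG) as iG.
assert (AB : 0 <= A * B) by (apply Rmult_le_pos; auto).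
assert (prod : Rabs (RInt F 0 1 * RInt G 0 1) <= A * B).
{ rewrite Rabs_mult; apply Rmult_le_compat; auto using Rabs_pos. }
rewrite length_units by lia.
(* Modulus 1 has no ring ['I_d]: its only unit is 0, and both the sum and the main term are at most
   [A B]. *)
destruct (Nat.eq_dec d 1) as [->|d1].
- rewrite units1; unfold rsum; simpl.
  replace (Rpower 1 (6 / 7)) with 1 by (unfold Rpower; rewrite ln_1, Rmult_0_r, exp_0; reflexivity).
  assert (i0 : inv 0%nat = 0%nat) by (destruct (hinv 0%nat) as [h _]; [lia | reflexivity | lia]).
  rewrite i0; simpl; unfold Rdiv; rewrite Rmult_0_l, !Rmult_1_l, Rplus_0_r.
  eapply Rle_trans; [apply Rabs_triang|]; rewrite Rabs_Ropp, (Rabs_mult (F 0)).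
  assert (Rabs (F 0) * Rabs (G 0) <= A * B).
  { apply Rmult_le_compat; try apply Rabs_pos; [apply hF | apply hG]; lra. }
  nra.
- assert (hd' : 0 < INR d) by (apply lt_0_INR; lia).
  pose proof (@equidistribution_mean d inv F G A B ltac:(lia)
    (fun r hr hc => hinv r hr (proj1 (coprime_gcd r d) hc)) hF hG) as main.
  pose proof (riemann_sum_le F A d hF ltac:(lia)) as rF.
  pose proof (riemann_sum_le G B d hG ltac:(lia)) as rG.
  specialize (hc d hd).
  set (MF := / INR d * rsum (fun j => F (INR j / INR d)) (seq 0 d)) in *.
  set (MG := / INR d * rsum (fun j => G (INR j / INR d)) (seq 0 d)) in *.
  (* Passing from Riemann sums to integrals costs [3 A B / d], multiplied by [totient d <= d]. *)
  assert (bMF : Rabs (MF * MG - RInt F 0 1 * RInt G 0 1) <= 3 * (A * B) / INR d).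
  { replace (MF * MG - RInt F 0 1 * RInt G 0 1) with
      ((MF - RInt F 0 1) * (MG - RInt G 0 1) + (MF - RInt F 0 1) * RInt G 0 1
        + RInt F 0 1 * (MG - RInt G 0 1)) by ring.
    eapply Rle_trans; [apply Rabs_triang|].
    eapply Rle_trans; [apply Rplus_le_compat_r, Rabs_triang|].
    rewrite !Rabs_mult.
    assert (q1 : Rabs (MF - RInt F 0 1) * Rabs (MG - RInt G 0 1) <= A / INR d * B).
    { apply Rmult_le_compat; auto using Rabs_pos.
      eapply Rle_trans; [exact rG|].
      apply Rmult_le_reg_r with (INR d); [lra|].
      replace (B / INR d * INR d) with B by (field; lra).
      assert (1 <= INR d) by (change 1 with (INR 1); apply le_INR; lia); nra. }
    assert (q2 : Rabs (MF - RInt F 0 1) * Rabs (RInt G 0 1) <= A / INR d * B)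
      by (apply Rmult_le_compat; auto using Rabs_pos).
    assert (q3 : Rabs (RInt F 0 1) * Rabs (MG - RInt G 0 1) <= A * (B / INR d))
      by (apply Rmult_le_compat; auto using Rabs_pos).
    replace (3 * (A * B) / INR d) with (A / INR d * B + A / INR d * B + A * (B / INR d)) by (field; lra).
    lra. }
  assert (tot : INR (prime.totient d) <= INR d) by (apply le_INR, totient_le).
  assert (one : 1 <= Rpower (INR d) (6 / 7)).
  { rewrite <- (Rpower_O (INR d)) by lra; apply Rle_Rpower; [|lra].
    change 1 with (INR 1); apply le_INR; lia. }
  match goal with |- Rabs (?x - ?t * ?i) <= _ =>
    replace (x - t * i) with ((x - t * (MF * MG)) + t * (MF * MG - i)) by ring end.
  eapply Rle_trans; [apply Rabs_triang|]; rewrite (Rabs_mult (INR (prime.totient d))).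
  rewrite (Rabs_pos_eq (INR (prime.totient d))) by apply pos_INR.
  assert (INR (prime.totient d) * Rabs (MF * MG - RInt F 0 1 * RInt G 0 1) <= INR d * (3 * (A * B) / INR d))
    by (apply Rmult_le_compat; auto using pos_INR, Rabs_pos).
  replace (INR d * (3 * (A * B) / INR d)) with (3 * (A * B)) in * by (field; lra).
  set (P := Rpower (INR d) (6 / 7)) in *.
  assert (72 * A * B * (Rpower (INR d) (5 / 6) * INR (tau d) ^ 3 * (1 + ln (INR d)) ^ 2)
     <= 72 * A * B * (c * P)) by (apply Rmult_le_compat_l; [nra | exact hc]).
  assert (A * B <= A * B * P) by nra.
  nra.
Qed.

(** * Unordered sums *)

Lemma im_le_Cmod z : Rabs (Im z) <= Cmod z.
Proof.
unfold Cmod, Im; rewrite <- (sqrt_Rsqr_abs (snd z)); apply sqrt_le_1_alt; unfold Rsqr.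
pose proof (pow2_ge_0 (fst z)); lra.
Qed.

Lemma Cmod_le_abs z : Cmod z <= Rabs (Re z) + Rabs (Im z).
Proof.
pose proof (Rabs_pos (Re z)); pose proof (Rabs_pos (Im z)).
unfold Cmod, Re, Im in *; rewrite <- (sqrt_pow2 (Rabs (fst z) + Rabs (snd z))) by lra.
apply sqrt_le_1_alt; rewrite <- (pow2_abs (fst z)), <- (pow2_abs (snd z)); nra.
Qed.

Lemma rsum_cons {T} (f : T -> R) x l : rsum f (x :: l) = f x + rsum f l.
Proof. reflexivity. Qed.

Lemma rsum_perm {T} (f : T -> R) l l' : Permutation l l' -> rsum f l = rsum f l'.
Proof. induction 1; rewrite ?rsum_cons in *; lra. Qed.

Lemma rsum_le {T} (f g : T -> R) l : (forall x, In x l -> f x <= g x) -> rsum f l <= rsum g l.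
Proof.
induction l as [|x l IH]; intros h; [apply Rle_refl|]; rewrite !rsum_cons.
apply Rplus_le_compat; [apply h; left; reflexivity | apply IH; intros; apply h; right; auto].
Qed.

Lemma rsum_ext {T} (f g : T -> R) l : (forall x, In x l -> f x = g x) -> rsum f l = rsum g l.
Proof. intros h; apply Rle_antisym; apply rsum_le; intros x hx; rewrite (h x hx); lra. Qed.

Lemma rsum_nonneg {T} (f : T -> R) l : (forall x, In x l -> 0 <= f x) -> 0 <= rsum f l.
Proof.
induction l as [|x l IH]; intros h; [apply Rle_refl|]; rewrite rsum_cons.
apply Rplus_le_le_0_compat; [apply h; left; reflexivity | apply IH; intros; apply h; right; auto].
Qed.

Lemma rsum_scal {T} (f : T -> R) c l : rsum (fun x => c * f x) l = c * rsum f l.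
Proof. induction l as [|x l IH]; [unfold rsum; simpl; ring|]; rewrite !rsum_cons, IH; ring. Qed.

Lemma rsum_plus {T} (f g : T -> R) l : rsum (fun x => f x + g x) l = rsum f l + rsum g l.
Proof. induction l as [|x l IH]; [unfold rsum; simpl; ring|]; rewrite !rsum_cons, IH; ring. Qed.

Lemma rsum_const {T} c (l : list T) : rsum (fun _ => c) l = INR (length l) * c.
Proof.
induction l as [|x l IH]; [unfold rsum; simpl; ring|].
rewrite rsum_cons, IH; cbn [length]; rewrite S_INR; ring.
Qed.

Lemma rsum_map {S T} (g : S -> T) (f : T -> R) l : rsum f (map g l) = rsum (fun x => f (g x)) l.
Proof. unfold rsum; rewrite map_map; reflexivity. Qed.

Definition csum {T} (u : T -> C) (l : list T) : C := fold_right Cplus (RtoC 0) (map u l).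

Lemma csum_cons {T} (u : T -> C) x l : csum u (x :: l) = Cplus (u x) (csum u l).
Proof. reflexivity. Qed.

Lemma csum_pair {T} (u : T -> C) l : csum u l = (rsum (fun x => Re (u x)) l, rsum (fun x => Im (u x)) l).
Proof.
induction l as [|x l IH]; [reflexivity|]; rewrite csum_cons, !rsum_cons, IH.
destruct (u x); reflexivity.
Qed.

Lemma csum_app {T} (u : T -> C) l1 l2 : csum u (l1 ++ l2) = Cplus (csum u l1) (csum u l2).
Proof. rewrite !csum_pair, !rsum_app; reflexivity. Qed.

Lemma csum_perm {T} (u : T -> C) l l' : Permutation l l' -> csum u l = csum u l'.
Proof. intros h; rewrite !csum_pair; f_equal; apply rsum_perm; auto. Qed.

Lemma csum_ext {T} (u v : T -> C) l : (forall x, In x l -> u x = v x) -> csum u l = csum v l.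
Proof. intros h; rewrite !csum_pair; f_equal; apply rsum_ext; intros x hx; rewrite h; auto. Qed.

Lemma csum_plus {T} (u v : T -> C) l : csum (fun x => Cplus (u x) (v x)) l = Cplus (csum u l) (csum v l).
Proof.
induction l as [|x l IH]; [unfold csum; simpl; ring|]; rewrite !csum_cons, IH; ring.
Qed.

Lemma csum_scal {T} (u : T -> C) c l : csum (fun x => Cmult c (u x)) l = Cmult c (csum u l).
Proof. induction l as [|x l IH]; [unfold csum; simpl; ring|]; rewrite !csum_cons, IH; ring. Qed.

Lemma csum_map {S T} (g : S -> T) (u : T -> C) l : csum u (map g l) = csum (fun x => u (g x)) l.
Proof. unfold csum; rewrite map_map; reflexivity. Qed.

Lemma csum_flat_map {I T} (u : T -> C) (fib : I -> list T) l :
  csum u (flat_map fib l) = csum (fun i => csum u (fib i)) l.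
Proof. induction l as [|i l IH]; [reflexivity|]; simpl flat_map; rewrite csum_app, csum_cons, IH; reflexivity. Qed.

Lemma Cmod_csum_le {T} (u : T -> C) l : Cmod (csum u l) <= rsum (fun x => Cmod (u x)) l.
Proof.
induction l as [|x l IH]; [unfold csum, rsum; simpl; rewrite Cmod_0; lra|].
rewrite csum_cons, rsum_cons; eapply Rle_trans; [apply Cmod_triangle|lra].
Qed.

Lemma dedup {T} (l : list T) : exists l', NoDup l' /\ forall x, In x l' <-> In x l.
Proof.
induction l as [|x l [l' [h1 h2]]]; [exists nil; split; [constructor | tauto]|].
destruct (classic (In x l)) as [hx|hx].
- exists l'; split; [auto|]; intros y; rewrite h2; simpl; split; [tauto|].
  intros [<-|]; auto.
- exists (x :: l'); split; [constructor; rewrite ?h2; auto|].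
  intros y; simpl; rewrite h2; tauto.
Qed.

Lemma incl_perm {T} (l0 l : list T) : NoDup l0 -> NoDup l -> incl l0 l ->
  exists l1, Permutation l (l0 ++ l1).
Proof.
intros h0; revert l; induction h0 as [|x l0 hx h0 IH]; intros l hl hi.
- exists l; apply Permutation_refl.
- destruct (in_split x l (hi x (or_introl eq_refl))) as [a [b ->]].
  pose proof (NoDup_remove _ _ _ hl) as [hab hn].
  destruct (IH (a ++ b) hab) as [l1 p].
  { intros y hy; specialize (hi y (or_intror hy)).
    apply in_app_or in hi; apply in_or_app; destruct hi as [|[->|]]; auto; contradiction. }
  exists l1; simpl; apply Permutation_sym, Permutation_cons_app, Permutation_sym; exact p.
Qed.

Lemma split_list {T} (P : T -> Prop) (l : list T) :
  exists l1 l2, Permutation l (l1 ++ l2) /\ List.Forall P l1 /\ List.Forall (fun x => ~ P x) l2.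
Proof.
induction l as [|x l [l1 [l2 [p [f1 f2]]]]]; [exists nil, nil; repeat constructor|].
destruct (classic (P x)) as [hx|hx].
- exists (x :: l1), l2; split; [simpl; constructor; exact p|]; split; [constructor; auto | auto].
- exists l1, (x :: l2); split; [apply Permutation_cons_app; exact p|]; split; [auto | constructor; auto].
Qed.

Lemma rsum_incl_le {T} (f : T -> R) l0 l : (forall x, In x l -> 0 <= f x) ->
  NoDup l0 -> NoDup l -> incl l0 l -> rsum f l0 <= rsum f l.
Proof.
intros hf h0 hl hi; destruct (incl_perm l0 l h0 hl hi) as [l1 p].
rewrite (rsum_perm f _ _ p), rsum_app.
assert (0 <= rsum f l1); [|lra].
apply rsum_nonneg; intros x hx; apply hf, (Permutation_in x (Permutation_sym p)).
apply in_or_app; auto.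
Qed.

(** For nonnegative terms this is summability with sum at most [B], stated without naming the sum;
    it is the form in which majorants are passed around. *)
Definition rbound {T} (A : T -> Prop) (a : T -> R) (B : R) : Prop :=
  forall l, NoDup l -> List.Forall A l -> rsum a l <= B.

Section HasSum.
Context {T : Type}.
Implicit Types (A : T -> Prop) (u v : T -> C) (a : T -> R).

Lemma rbound_pos A a B : rbound A a B -> 0 <= B.
Proof. intros h; apply (h nil); constructor. Qed.

Lemma rbound_le A a b B : (forall x, A x -> a x <= b x) -> rbound A b B -> rbound A a B.
Proof.
intros h hb l nl fl; apply Rle_trans with (rsum b l); [|apply hb; auto].
apply rsum_le; intros x hx; apply h; rewrite List.Forall_forall in fl; auto.
Qed.

Lemma rbound_scal A a B c : 0 <= c -> rbound A a B -> rbound A (fun x => c * a x) (c * B).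
Proof. intros hc h l nl fl; rewrite rsum_scal; apply Rmult_le_compat_l; auto. Qed.

Lemma rbound_plus A a b B B' : rbound A a B -> rbound A b B' ->
  rbound A (fun x => a x + b x) (B + B').
Proof. intros h h' l nl fl; rewrite rsum_plus; apply Rplus_le_compat; auto. Qed.

Lemma has_sum_near A u l eps : has_sum A u l -> 0 < eps ->
  exists L0, NoDup L0 /\ List.Forall A L0 /\
    forall L, NoDup L -> List.Forall A L -> incl L0 L -> Cmod (Cminus (csum u L) l) < eps.
Proof.
intros h he; destruct (h eps he) as [L0 [f0 h0]].
destruct (dedup L0) as [L1 [n1 e1]]; exists L1; split; [auto|split].
- rewrite List.Forall_forall in *; intros x hx; apply f0, e1, hx.
- intros L nl fl hi; apply h0; auto; intros x hx; apply hi, e1, hx.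
Qed.

Lemma list_union (A : T -> Prop) l1 l2 : List.Forall A l1 -> List.Forall A l2 ->
  exists l, NoDup l /\ List.Forall A l /\ incl l1 l /\ incl l2 l.
Proof.
intros f1 f2; destruct (dedup (l1 ++ l2)) as [l [nl el]]; exists l; split; [auto|].
rewrite List.Forall_forall in *; repeat split; intros x hx.
- apply el, in_app_or in hx; destruct hx; auto.
- apply el, in_or_app; auto.
- apply el, in_or_app; auto.
Qed.

Lemma has_sum_unique A u l l' : has_sum A u l -> has_sum A u l' -> l = l'.
Proof.
intros h h'; apply NNPP; intros ne.
assert (hp : 0 < Cmod (Cminus l l')).
{ apply Cmod_gt_0; intros e; apply ne; replace l with (Cplus (Cminus l l') l') by ring.
  rewrite e; ring. }
destruct (has_sum_near _ _ _ (Cmod (Cminus l l') / 2) h ltac:(lra)) as [L0 [n0 [f0 h0]]].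
destruct (has_sum_near _ _ _ (Cmod (Cminus l l') / 2) h' ltac:(lra)) as [L1 [n1 [f1 h1]]].
destruct (list_union A L0 L1 f0 f1) as [L [nl [fl [i0 i1]]]].
specialize (h0 L nl fl i0); specialize (h1 L nl fl i1).
assert (Cmod (Cminus l l') <= Cmod (Cminus (csum u L) l) + Cmod (Cminus (csum u L) l')); [|lra].
replace (Cminus l l') with (Cplus (Copp (Cminus (csum u L) l)) (Cminus (csum u L) l')) by ring.
eapply Rle_trans; [apply Cmod_triangle|]; rewrite Cmod_opp; lra.
Qed.

Lemma has_sum_ext A u v l : (forall x, A x -> u x = v x) -> has_sum A u l -> has_sum A v l.
Proof.
intros e h eps he; destruct (h eps he) as [L0 [f0 h0]]; exists L0; split; auto.
intros L nl fl hi; specialize (h0 L nl fl hi).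
change (fold_right Cplus (RtoC 0) (map v L)) with (csum v L).
rewrite <- (csum_ext u v); [exact h0|].
intros x hx; apply e; rewrite List.Forall_forall in fl; auto.
Qed.

Lemma has_sum_pred_ext A A' u l : (forall x, A x <-> A' x) -> has_sum A u l -> has_sum A' u l.
Proof.
intros e h eps he; destruct (h eps he) as [L0 [f0 h0]]; exists L0.
assert (q : forall L, List.Forall A L <-> List.Forall A' L).
{ intros L; rewrite !List.Forall_forall; split; intros hL x hx; apply e, hL, hx. }
split; [apply q; auto|]; intros L nl fl hi; apply h0; auto; apply q; auto.
Qed.

Lemma has_sum_plus A u v l l' : has_sum A u l -> has_sum A v l' ->
  has_sum A (fun x => Cplus (u x) (v x)) (Cplus l l').
Proof.
intros h h' eps he.
destruct (has_sum_near _ _ _ (eps / 2) h ltac:(lra)) as [L0 [n0 [f0 h0]]].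
destruct (has_sum_near _ _ _ (eps / 2) h' ltac:(lra)) as [L1 [n1 [f1 h1]]].
destruct (list_union A L0 L1 f0 f1) as [L [nl [fl [i0 i1]]]].
exists L; split; [auto|]; intros M nm fm hi.
specialize (h0 M nm fm (incl_tran i0 hi)); specialize (h1 M nm fm (incl_tran i1 hi)).
fold (csum (fun x => Cplus (u x) (v x)) M); rewrite csum_plus.
replace (Cminus (Cplus (csum u M) (csum v M)) (Cplus l l')) with
  (Cplus (Cminus (csum u M) l) (Cminus (csum v M) l')) by ring.
eapply Rle_lt_trans; [apply Cmod_triangle|]; lra.
Qed.

Lemma has_sum_scal A u l c : has_sum A u l -> has_sum A (fun x => Cmult c (u x)) (Cmult c l).
Proof.
intros h eps he; pose proof (Cmod_ge_0 c) as hc.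
destruct (h (eps / (Cmod c + 1))) as [L0 [f0 h0]]; [apply Rdiv_lt_0_compat; lra|].
exists L0; split; [auto|]; intros L nl fl hi; specialize (h0 L nl fl hi).
fold (csum (fun x => Cmult c (u x)) L); fold (csum u L) in h0; rewrite csum_scal.
replace (Cminus (Cmult c (csum u L)) (Cmult c l)) with (Cmult c (Cminus (csum u L) l)) by ring.
rewrite Cmod_mult.
apply Rle_lt_trans with ((Cmod c + 1) * Cmod (Cminus (csum u L) l)).
- apply Rmult_le_compat_r; [apply Cmod_ge_0 | lra].
- apply Rlt_le_trans with ((Cmod c + 1) * (eps / (Cmod c + 1))).
  + apply Rmult_lt_compat_l; lra.
  + right; field; lra.
Qed.

Lemma has_sum_bound A u a l B : (forall x, A x -> Cmod (u x) <= a x) -> rbound A a B ->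
  has_sum A u l -> Cmod l <= B.
Proof.
intros h hb hs; apply Rnot_lt_le; intros hlt.
destruct (has_sum_near _ _ _ (Cmod l - B) hs ltac:(lra)) as [L [nl [fl hL]]].
specialize (hL L nl fl (incl_refl L)).
assert (Cmod l <= Cmod (Cminus (csum u L) l) + Cmod (csum u L)).
{ replace l with (Cplus (Copp (Cminus (csum u L) l)) (csum u L)) at 1 by ring.
  eapply Rle_trans; [apply Cmod_triangle|]; rewrite Cmod_opp; lra. }
assert (Cmod (csum u L) <= B); [|lra].
eapply Rle_trans; [apply Cmod_csum_le|]; eapply Rle_trans; [|apply (hb L nl fl)].
apply rsum_le; intros x hx; apply h; rewrite List.Forall_forall in fl; auto.
Qed.

Lemma has_sum_real A a B : (forall x, A x -> 0 <= a x) -> rbound A a B ->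
  exists l, has_sum A (fun x => RtoC (a x)) l.
Proof.
intros ha hb.
destruct (completeness (fun y => exists L, NoDup L /\ List.Forall A L /\ y = rsum a L)) as [S [hS1 hS2]].
- exists B; intros y [L [nl [fl ->]]]; auto.
- exists 0, nil; repeat constructor.
- exists (RtoC S); intros eps he.
  destruct (classic (exists L, NoDup L /\ List.Forall A L /\ S - eps < rsum a L)) as [[L0 [n0 [f0 h0]]]|no].
  + exists L0; split; [auto|]; intros L nl fl hi.
    assert (h1 : rsum a L0 <= rsum a L).
    { apply rsum_incl_le; auto; intros x hx; apply ha; rewrite List.Forall_forall in fl; auto. }
    assert (h2 : rsum a L <= S) by (apply hS1; exists L; auto).
    fold (csum (fun x => RtoC (a x)) L).
    replace (csum (fun x => RtoC (a x)) L) with (RtoC (rsum a L)).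
    * rewrite <- RtoC_minus, Cmod_R; rewrite Rabs_left1; lra.
    * rewrite csum_pair; apply injective_projections; [reflexivity|].
      change (0 = rsum (fun _ : T => 0) L); rewrite rsum_const; ring.
  + exfalso; assert (S <= S - eps); [|lra]; apply hS2; intros y [L [nl [fl ->]]].
    apply Rnot_lt_le; intros hlt; apply no; exists L; auto.
Qed.

Lemma has_sum_exists A u a B : (forall x, A x -> Cmod (u x) <= a x) -> rbound A a B ->
  exists l, has_sum A u l.
Proof.
intros h hb.
(* A real family [g] with [|g| <= a] is the difference of the nonnegative summable families [a + g]
   and [a]. *)
assert (pos : forall g : T -> R, (forall x, A x -> Rabs (g x) <= a x) ->
  exists l, has_sum A (fun x => RtoC (g x)) l).
{ intros g hg.
  destruct (has_sum_real A (fun x => a x + g x) (2 * B)) as [l1 h1].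
  - intros x hx; specialize (hg x hx); apply Rabs_le_between in hg; lra.
  - intros L nl fl; rewrite rsum_plus.
    assert (rsum g L <= rsum a L).
    { apply rsum_le; intros x hx; rewrite List.Forall_forall in fl.
      specialize (hg x (fl x hx)); apply Rabs_le_between in hg; lra. }
    specialize (hb L nl fl); lra.
  - destruct (has_sum_real A a B) as [l2 h2]; auto.
    { intros x hx; specialize (hg x hx); eapply Rle_trans; [apply Rabs_pos | exact hg]. }
    exists (Cplus l1 (Cmult (RtoC (-1)) l2)).
    apply has_sum_ext with (fun x => Cplus (RtoC (a x + g x)) (Cmult (RtoC (-1)) (RtoC (a x)))).
    + intros x _; apply injective_projections; simpl; ring.
    + apply has_sum_plus; [|apply has_sum_scal]; auto. }
destruct (pos (fun x => Re (u x))) as [l1 h1].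
{ intros x hx; eapply Rle_trans; [apply re_le_Cmod | auto]. }
destruct (pos (fun x => Im (u x))) as [l2 h2].
{ intros x hx; eapply Rle_trans; [apply im_le_Cmod | auto]. }
exists (Cplus l1 (Cmult Ci l2)).
apply has_sum_ext with (fun x => Cplus (RtoC (Re (u x))) (Cmult Ci (RtoC (Im (u x))))).
- intros x _; destruct (u x) as [p q]; unfold Cplus, Cmult, Ci, RtoC; simpl; f_equal; ring.
- apply has_sum_plus; [|apply has_sum_scal]; auto.
Qed.

Lemma has_sum_union A A' u l l' : (forall x, A x -> A' x -> False) ->
  has_sum A u l -> has_sum A' u l' -> has_sum (fun x => A x \/ A' x) u (Cplus l l').
Proof.
intros dis h h' eps he.
destruct (has_sum_near _ _ _ (eps / 2) h ltac:(lra)) as [L0 [n0 [f0 h0]]].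
destruct (has_sum_near _ _ _ (eps / 2) h' ltac:(lra)) as [L1 [n1 [f1 h1]]].
exists (L0 ++ L1); split.
{ rewrite List.Forall_forall in *; intros x hx; apply in_app_or in hx; destruct hx; auto. }
intros L nl fl hi; destruct (split_list A L) as [M0 [M1 [p [g0 g1]]]].
assert (nm : NoDup (M0 ++ M1)) by (eapply Permutation_NoDup; eauto).
assert (n01 := NoDup_app_remove_r _ _ nm); assert (n11 := NoDup_app_remove_l _ _ nm).
assert (g1' : List.Forall A' M1).
{ rewrite List.Forall_forall in *; intros x hx; destruct (fl x); auto.
  - apply (Permutation_in x (Permutation_sym p)), in_or_app; auto.
  - exfalso; apply (g1 x); auto. }
assert (mem : forall x, In x L -> In x M0 \/ In x M1).
{ intros x hx; apply in_app_or, (Permutation_in x p), hx. }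
assert (i0 : incl L0 M0).
{ intros x hx; destruct (mem x) as [|hm]; auto; [apply hi, in_or_app; auto|].
  exfalso; rewrite List.Forall_forall in *; apply (g1 x); auto. }
assert (i1 : incl L1 M1).
{ intros x hx; destruct (mem x) as [hm|]; auto; [apply hi, in_or_app; auto|].
  exfalso; rewrite List.Forall_forall in *; apply (dis x); auto. }
specialize (h0 M0 n01 g0 i0); specialize (h1 M1 n11 g1' i1).
fold (csum u L); rewrite (csum_perm u _ _ p), csum_app.
replace (Cminus (Cplus (csum u M0) (csum u M1)) (Cplus l l')) with
  (Cplus (Cminus (csum u M0) l) (Cminus (csum u M1) l')) by ring.
eapply Rle_lt_trans; [apply Cmod_triangle|]; lra.
Qed.

(** Unordered convergence is absolute. Adding to a list the missing part of [L0] brings its sum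
    within 1 of [l], so all partial sums are bounded; applied to the terms of one sign, this bounds
    the sums of absolute values of the real and imaginary parts. *)
Lemma has_sum_rbound A u l : has_sum A u l -> exists B, rbound A (fun x => Cmod (u x)) B.
Proof.
intros h; destruct (has_sum_near _ _ _ 1 h ltac:(lra)) as [L0 [n0 [f0 h0]]].
set (B := Cmod l + 1 + rsum (fun x => Cmod (u x)) L0).
assert (hB : forall L, NoDup L -> List.Forall A L -> Cmod (csum u L) <= B).
{ intros L nl fl; destruct (split_list (fun x => In x L) L0) as [M0 [M1 [p [g0 g1]]]].
  assert (nm : NoDup (M0 ++ M1)) by (eapply Permutation_NoDup; eauto).
  assert (n11 := NoDup_app_remove_l _ _ nm).
  rewrite List.Forall_forall in *.
  assert (nLM : NoDup (L ++ M1)) by (apply NoDup_app; auto; intros x hx hm; apply (g1 x); auto).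
  assert (fLM : forall x, In x (L ++ M1) -> A x).
  { intros x hx; apply in_app_or in hx; destruct hx; auto.
    apply f0, (Permutation_in x (Permutation_sym p)), in_or_app; auto. }
  assert (iLM : incl L0 (L ++ M1)).
  { intros x hx; apply (Permutation_in x p) in hx; apply in_app_or in hx; apply in_or_app.
    destruct hx; auto. }
  specialize (h0 (L ++ M1) nLM (proj2 (List.Forall_forall _ _) fLM) iLM).
  rewrite csum_app in h0.
  assert (hM : Cmod (csum u M1) <= rsum (fun x => Cmod (u x)) L0).
  { eapply Rle_trans; [apply Cmod_csum_le|]; rewrite (rsum_perm _ _ _ p), rsum_app.
    assert (0 <= rsum (fun x => Cmod (u x)) M0) by (apply rsum_nonneg; intros; apply Cmod_ge_0); lra. }
  replace (csum u L) with (Cplus (Cminus (Cplus (csum u L) (csum u M1)) l) (Cplus l (Copp (csum u M1)))) by ring.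
  eapply Rle_trans; [apply Cmod_triangle|].
  pose proof (Cmod_triangle l (Copp (csum u M1))) as t; rewrite Cmod_opp in t; unfold B; lra. }
assert (abs : forall g : T -> R, (forall L, NoDup L -> List.Forall A L -> Rabs (rsum g L) <= B) ->
  rbound A (fun x => Rabs (g x)) (2 * B)).
{ intros g hg L nl fl; destruct (split_list (fun x => 0 <= g x) L) as [M0 [M1 [p [g0 g1]]]].
  assert (nm : NoDup (M0 ++ M1)) by (eapply Permutation_NoDup; eauto).
  assert (n01 := NoDup_app_remove_r _ _ nm); assert (n11 := NoDup_app_remove_l _ _ nm).
  assert (fm : List.Forall A (M0 ++ M1)).
  { rewrite List.Forall_forall in *; intros x hx; apply fl, (Permutation_in x (Permutation_sym p)), hx. }
  apply List.Forall_app in fm; destruct fm as [fm0 fm1].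
  rewrite (rsum_perm _ _ _ p), rsum_app; rewrite List.Forall_forall in g0, g1.
  rewrite (rsum_ext _ g M0) by (intros x hx; apply Rabs_pos_eq; auto).
  rewrite (rsum_ext _ (fun x => -1 * g x) M1), rsum_scal.
  2:{ intros x hx; specialize (g1 x hx); rewrite Rabs_left; lra. }
  pose proof (hg M0 n01 fm0) as b0; pose proof (hg M1 n11 fm1) as b1.
  apply Rabs_le_between in b0; apply Rabs_le_between in b1; lra. }
exists (2 * B + 2 * B).
apply rbound_le with (fun x => Rabs (Re (u x)) + Rabs (Im (u x))).
- intros x _; apply Cmod_le_abs.
- apply rbound_plus; apply abs; intros L nl fl; specialize (hB L nl fl); rewrite csum_pair in hB.
  + eapply Rle_trans; [|exact hB]; exact (re_le_Cmod (_, _)).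
  + eapply Rle_trans; [|exact hB]; exact (im_le_Cmod (_, _)).
Qed.

End HasSum.

Lemma has_sum_bij {S T} (A : S -> Prop) (A' : T -> Prop) (f : S -> T) (g : T -> S) (u : T -> C) l :
  (forall x, A x -> A' (f x) /\ g (f x) = x) -> (forall y, A' y -> A (g y) /\ f (g y) = y) ->
  has_sum A (fun x => u (f x)) l -> has_sum A' u l.
Proof.
intros hf hg h eps he; destruct (h eps he) as [L0 [f0 h0]].
exists (map f L0); split.
{ rewrite List.Forall_forall in *; intros y hy; apply in_map_iff in hy; destruct hy as [x [<- hx]].
  apply hf, f0, hx. }
intros L nl fl hi; rewrite List.Forall_forall in *.
assert (e : map f (map g L) = L).
{ rewrite map_map; rewrite <- (map_id L) at 2; apply map_ext_in; intros y hy; apply hg; auto. }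
rewrite <- e, map_map; apply h0.
- apply (NoDup_map_inv f); rewrite e; exact nl.
- rewrite List.Forall_forall; intros x hx; apply in_map_iff in hx; destruct hx as [y [<- hy]].
  apply hg; auto.
- intros x hx; destruct (hf x (f0 x hx)) as [_ <-]; apply in_map, hi, in_map, hx.
Qed.

Lemma NoDup_flat_map {I T} (fib : I -> list T) (pr : T -> I) l : NoDup l ->
  (forall i, In i l -> NoDup (fib i) /\ forall t, In t (fib i) -> pr t = i) -> NoDup (flat_map fib l).
Proof.
induction 1 as [|i l hi hl IH]; intros h; [constructor|]; simpl.
apply NoDup_app.
- apply h; left; reflexivity.
- apply IH; intros j hj; apply h; right; exact hj.
- intros t h1 h2; apply in_flat_map in h2; destruct h2 as [j [hj h2]].
  apply h in h1; [|left; reflexivity]; apply h in h2; [|right; exact hj].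
  apply hi; rewrite <- h1, h2; exact hj.
Qed.

(** The fibers are finite lists, so a finite set of indices lifts to a finite set of terms and no
    convergence inside a fiber has to be discussed. *)
Lemma has_sum_fiber {I T} (A : T -> Prop) (A' : I -> Prop) (pr : T -> I) (fib : I -> list T) u l :
  (forall t, A t -> A' (pr t)) ->
  (forall i, A' i -> NoDup (fib i) /\ forall t, In t (fib i) <-> A t /\ pr t = i) ->
  has_sum A u l -> has_sum A' (fun i => csum u (fib i)) l.
Proof.
intros hpr hfib h eps he; destruct (h eps he) as [L0 [f0 h0]].
exists (map pr L0); rewrite List.Forall_forall in f0; split.
{ rewrite List.Forall_forall; intros y hy; apply in_map_iff in hy; destruct hy as [x [<- hx]]; auto. }
intros L nl fl hi; rewrite List.Forall_forall in fl.
fold (csum (fun i => csum u (fib i)) L); rewrite <- csum_flat_map; apply h0.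
- apply NoDup_flat_map with pr; auto; intros i hil; destruct (hfib i (fl i hil)) as [n e].
  split; [exact n|]; intros t ht; apply e in ht; tauto.
- rewrite List.Forall_forall; intros t ht; apply in_flat_map in ht; destruct ht as [i [hil ht]].
  apply (hfib i (fl i hil)) in ht; tauto.
- intros t ht; apply in_flat_map; exists (pr t); split; [apply hi, in_map, ht|].
  apply hfib; auto.
Qed.

Section Products.
Context {S T : Type}.

Lemma rsum_list_prod (a : S -> R) (b : T -> R) l l' :
  rsum (fun p => a (fst p) * b (snd p)) (list_prod l l') = rsum a l * rsum b l'.
Proof.
induction l as [|x l IH]; [unfold rsum; simpl; ring|]; simpl list_prod.
rewrite rsum_app, rsum_map, IH, rsum_cons; simpl; rewrite rsum_scal; ring.
Qed.

Lemma csum_list_prod (u : S -> C) (v : T -> C) l l' :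
  csum (fun p => Cmult (u (fst p)) (v (snd p))) (list_prod l l') = Cmult (csum u l) (csum v l').
Proof.
induction l as [|x l IH]; [unfold csum; simpl; ring|]; simpl list_prod.
rewrite csum_app, csum_map, IH, csum_cons; simpl; rewrite csum_scal; ring.
Qed.

Lemma NoDup_list_prod (l : list S) (l' : list T) : NoDup l -> NoDup l' -> NoDup (list_prod l l').
Proof.
intros h h'; induction h as [|x l hx h IH]; [constructor|]; simpl; apply NoDup_app; auto.
- apply FinFun.Injective_map_NoDup; auto; intros y y' e; injection e; auto.
- intros [y z] h1 h2; apply in_map_iff in h1; destruct h1 as [w [e _]]; injection e; intros; subst.
  apply in_prod_iff in h2; tauto.
Qed.

Definition both (A : S -> Prop) (A' : T -> Prop) (p : S * T) : Prop := A (fst p) /\ A' (snd p).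

Lemma enclosing_rectangle A A' (L : list (S * T)) : List.Forall (both A A') L ->
  exists l l', NoDup l /\ NoDup l' /\ List.Forall A l /\ List.Forall A' l' /\ incl L (list_prod l l').
Proof.
intros fL; destruct (dedup (map fst L)) as [l [n e]]; destruct (dedup (map snd L)) as [l' [n' e']].
exists l, l'; rewrite !List.Forall_forall in *; repeat split; auto.
- intros x hx; apply e, in_map_iff in hx; destruct hx as [p [<- hp]]; apply fL, hp.
- intros x hx; apply e', in_map_iff in hx; destruct hx as [p [<- hp]]; apply fL, hp.
- intros [x y] hp; apply in_prod; [apply e | apply e']; apply in_map_iff; exists (x, y); auto.
Qed.

Lemma rbound_prod A A' (a : S -> R) (b : T -> R) B B' :
  (forall x, A x -> 0 <= a x) -> (forall x, A' x -> 0 <= b x) ->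
  rbound A a B -> rbound A' b B' -> rbound (both A A') (fun p => a (fst p) * b (snd p)) (B * B').
Proof.
intros ha hb h h' L nL fL; destruct (enclosing_rectangle A A' L fL) as [l [l' [n [n' [f [f' i]]]]]].
apply Rle_trans with (rsum (fun p => a (fst p) * b (snd p)) (list_prod l l')).
- apply rsum_incl_le; auto using NoDup_list_prod.
  intros [x y] hp; apply in_prod_iff in hp; rewrite List.Forall_forall in *; simpl.
  apply Rmult_le_pos; [apply ha, f | apply hb, f']; tauto.
- rewrite rsum_list_prod; apply Rmult_le_compat; auto.
  + apply rsum_nonneg; rewrite List.Forall_forall in f; auto.
  + apply rsum_nonneg; rewrite List.Forall_forall in f'; auto.
Qed.

(** Absolute convergence of both factors gives a sum [m] over the pairs; over large rectangles the
    partial sums factor, which identifies [m] with the product. *)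
Lemma has_sum_prod A A' (u : S -> C) (v : T -> C) l l' :
  has_sum A u l -> has_sum A' v l' ->
  has_sum (both A A') (fun p => Cmult (u (fst p)) (v (snd p))) (Cmult l l').
Proof.
intros h h'; destruct (has_sum_rbound _ _ _ h) as [B hB]; destruct (has_sum_rbound _ _ _ h') as [B' hB'].
destruct (has_sum_exists (both A A') (fun p => Cmult (u (fst p)) (v (snd p)))
  (fun p => Cmod (u (fst p)) * Cmod (v (snd p))) (B * B')) as [m hm].
{ intros p _; rewrite Cmod_mult; lra. }
{ apply (rbound_prod A A' (fun x => Cmod (u x)) (fun y => Cmod (v y))); auto; intros; apply Cmod_ge_0. }
replace (Cmult l l') with m; [exact hm|].
apply NNPP; intros ne.
assert (hp : 0 < Cmod (Cminus m (Cmult l l'))).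
{ apply Cmod_gt_0; intros e; apply ne.
  replace m with (Cplus (Cminus m (Cmult l l')) (Cmult l l')) by ring; rewrite e; ring. }
set (D := Cmod (Cminus m (Cmult l l'))) in *.
pose proof (Cmod_ge_0 l) as pl; pose proof (Cmod_ge_0 l') as pl'.
set (e := Rmin 1 (D / (2 * (Cmod l + Cmod l' + 2)))).
assert (he : 0 < e).
{ apply Rmin_glb_lt; [lra | apply Rdiv_lt_0_compat; lra]. }
assert (e1 : e <= 1) by apply Rmin_l.
assert (e2 : e * (Cmod l + Cmod l' + 2) <= D / 2).
{ apply Rle_trans with (D / (2 * (Cmod l + Cmod l' + 2)) * (Cmod l + Cmod l' + 2)).
  - apply Rmult_le_compat_r; [lra | apply Rmin_r].
  - right; field; lra. }
destruct (has_sum_near _ _ _ e h he) as [L0 [n0 [f0 h0]]].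
destruct (has_sum_near _ _ _ e h' he) as [L1 [n1 [f1 h1]]].
destruct (has_sum_near _ _ _ (D / 2) hm ltac:(lra)) as [L2 [n2 [f2 h2]]].
destruct (enclosing_rectangle A A' L2 f2) as [l3 [l4 [n3 [n4 [f3 [f4 i]]]]]].
destruct (list_union A L0 l3 f0 f3) as [M [nM [fM [i0 i3]]]].
destruct (list_union A' L1 l4 f1 f4) as [M' [nM' [fM' [i1 i4]]]].
specialize (h0 M nM fM i0); specialize (h1 M' nM' fM' i1).
specialize (h2 (list_prod M M') (NoDup_list_prod _ _ nM nM')).
assert (fP : List.Forall (both A A') (list_prod M M')).
{ rewrite List.Forall_forall in *; intros [x y] hp'; apply in_prod_iff in hp'; split; simpl;
    [apply fM | apply fM']; tauto. }
assert (iP : incl L2 (list_prod M M')).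
{ intros [x y] hxy; apply i, in_prod_iff in hxy; apply in_prod; [apply i3 | apply i4]; tauto. }
specialize (h2 fP iP); rewrite csum_list_prod in h2.
set (X := csum u M) in *; set (Y := csum v M') in *.
assert (hXY : Cmod (Cminus (Cmult X Y) (Cmult l l')) <= e * (Cmod l + Cmod l' + 1)).
{ replace (Cminus (Cmult X Y) (Cmult l l')) with
    (Cplus (Cmult (Cminus X l) (Cminus Y l')) (Cplus (Cmult (Cminus X l) l') (Cmult l (Cminus Y l')))) by ring.
  eapply Rle_trans; [apply Cmod_triangle|].
  eapply Rle_trans; [apply Rplus_le_compat_l, Cmod_triangle|]; rewrite !Cmod_mult.
  pose proof (Cmod_ge_0 (Cminus X l)); pose proof (Cmod_ge_0 (Cminus Y l')); nra. }
assert (D <= Cmod (Cminus (Cmult X Y) m) + Cmod (Cminus (Cmult X Y) (Cmult l l'))).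
{ unfold D; replace (Cminus m (Cmult l l')) with
   (Cplus (Copp (Cminus (Cmult X Y) m)) (Cminus (Cmult X Y) (Cmult l l'))) by ring.
  eapply Rle_trans; [apply Cmod_triangle|]; rewrite Cmod_opp; lra. }
nra.
Qed.

End Products.

(** * Holomorphic functions *)

Definition cexp (z : C) : C := (exp (Re z) * cos (Im z), exp (Re z) * sin (Im z)).

Lemma exp_incr x y : x <= y -> exp x <= exp y.
Proof. intros [h| ->]; [left; apply exp_increasing, h | right; reflexivity]. Qed.

Lemma cexp_0 : cexp 0 = 1%C.
Proof. unfold cexp; simpl; rewrite exp_0, cos_0, sin_0, !Rmult_1_l; reflexivity. Qed.

Lemma cexp_plus z w : cexp (z + w) = (cexp z * cexp w)%C.
Proof.
unfold cexp; destruct z as [a b], w as [c d]; unfold Cplus, Cmult, Re, Im; simpl.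
rewrite exp_plus, cos_plus, sin_plus; apply injective_projections; simpl; ring.
Qed.

Lemma Cmod_cexp z : Cmod (cexp z) = exp (Re z).
Proof.
transitivity (sqrt (exp (Re z) ^ 2)); [|apply sqrt_pow2; left; apply exp_pos].
unfold Cmod, cexp; f_equal; cbn [fst snd].
pose proof (sin2_cos2 (Im z)) as h; unfold Rsqr in h.
replace (exp (Re z) ^ 2) with (exp (Re z) ^ 2 * 1) by ring; rewrite <- h; ring.
Qed.

Lemma cexp_RtoC x : cexp (RtoC x) = RtoC (exp x).
Proof. unfold cexp, RtoC; simpl; rewrite cos_0, sin_0, Rmult_1_r, Rmult_0_r; reflexivity. Qed.

Lemma Rabs_sin_le x : Rabs (sin x) <= Rabs x.
Proof.
destruct (MVT_gen sin 0 x cos) as [c [_ h]].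
- intros; apply is_derive_sin.
- intros; apply continuity_sin.
- rewrite sin_0, !Rminus_0_r in h; rewrite h, Rabs_mult.
  pose proof (COS_bound c); assert (Rabs (cos c) <= 1) by (apply Rabs_le; lra).
  pose proof (Rabs_pos x); nra.
Qed.

Lemma one_minus_cos_le x : 0 <= 1 - cos x <= x ^ 2 / 2 /\ 1 - cos x <= Rabs x.
Proof.
replace x with (2 * (x / 2)) at 1 2 4 by field; rewrite cos_2a_sin.
pose proof (Rabs_sin_le (x / 2)) as h; pose proof (SIN_bound (x / 2)) as b.
unfold Rdiv in h at 2; rewrite Rabs_mult, (Rabs_pos_eq (/ 2)) in h by lra.
assert (e : sin (x / 2) * sin (x / 2) = Rabs (sin (x / 2)) ^ 2) by (rewrite pow2_abs; ring).
assert (e' : x ^ 2 = Rabs x ^ 2) by (rewrite pow2_abs; ring).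
assert (Rabs (sin (x / 2)) <= 1) by (apply Rabs_le; lra).
pose proof (Rabs_pos (sin (x / 2))); pose proof (Rabs_pos x).
rewrite e'; replace (1 - (1 - 2 * sin (x / 2) * sin (x / 2))) with (2 * (sin (x / 2) * sin (x / 2))) by ring.
rewrite e; split; nra.
Qed.

Lemma sin_sub_le x : Rabs (sin x - x) <= x ^ 2.
Proof.
destruct (MVT_gen (fun t => sin t - t) 0 x (fun t => cos t - 1)) as [c [hc h]].
- intros; auto_derive; [trivial | ring].
- intros t _; apply continuity_pt_minus; [apply continuity_sin | apply continuity_pt_id].
- rewrite sin_0, !Rminus_0_r in h; rewrite h, Rabs_mult.
  destruct (one_minus_cos_le c) as [[h0 _] h2].
  assert (Rabs (cos c - 1) <= Rabs x).
  { rewrite Rabs_left1 by lra; apply Rle_trans with (Rabs c); [lra|].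
    revert hc; unfold Rmin, Rmax, Rabs; repeat destruct Rle_dec; repeat destruct Rcase_abs; lra. }
  rewrite <- (pow2_abs x); pose proof (Rabs_pos x); nra.
Qed.

Lemma exp_sub_le x : Rabs (exp x - 1) <= Rabs x * exp (Rabs x).
Proof.
destruct (MVT_gen exp 0 x exp) as [c [hc h]].
- intros; apply is_derive_exp.
- intros; apply derivable_continuous_pt, derivable_pt_exp.
- rewrite exp_0, Rminus_0_r in h; rewrite h, Rabs_mult, (Rabs_pos_eq (exp c)) by (left; apply exp_pos).
  rewrite Rmult_comm; apply Rmult_le_compat_l; [apply Rabs_pos|].
  apply exp_incr; revert hc; unfold Rmin, Rmax, Rabs; repeat destruct Rle_dec; repeat destruct Rcase_abs; lra.
Qed.

Lemma exp_sub2_le x : Rabs (exp x - 1 - x) <= x ^ 2 * exp (Rabs x).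
Proof.
destruct (MVT_gen (fun t => exp t - 1 - t) 0 x (fun t => exp t - 1)) as [c [hc h]].
- intros; auto_derive; [trivial | ring].
- intros t _; apply continuity_pt_minus; [|apply continuity_pt_id].
  apply continuity_pt_minus; [apply derivable_continuous_pt, derivable_pt_exp|].
  apply continuity_pt_const; intros ? ?; reflexivity.
- rewrite exp_0 in h; replace (exp x - 1 - x) with ((exp c - 1) * x) by lra; rewrite Rabs_mult.
  assert (hcx : Rabs c <= Rabs x).
  { revert hc; unfold Rmin, Rmax, Rabs; repeat destruct Rle_dec; repeat destruct Rcase_abs; lra. }
  pose proof (exp_sub_le c) as e.
  assert (Rabs c * exp (Rabs c) <= Rabs x * exp (Rabs x)).
  { apply Rmult_le_compat; [apply Rabs_pos | left; apply exp_pos | exact hcx | apply exp_incr; lra]. }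
  rewrite <- (pow2_abs x); pose proof (Rabs_pos x); nra.
Qed.

Lemma cexp_quadratic w : Cmod (cexp w - 1 - w) <= 3 * Cmod w ^ 2 * exp (Cmod w).
Proof.
destruct w as [x y].
assert (hx := re_le_Cmod (x, y)); assert (hy := im_le_Cmod (x, y)); simpl in hx, hy.
unfold Re in hx; unfold Im in hy; simpl in hx, hy.
set (W := Cmod (x, y)) in *.
assert (W0 : 0 <= W) by apply Cmod_ge_0.
assert (E1 : 1 <= exp W) by (rewrite <- exp_0; apply exp_incr; lra).
assert (Ex : exp (Rabs x) <= exp W) by (apply exp_incr; lra).
assert (ex : exp x <= exp W).
{ apply exp_incr; pose proof (Rle_abs x); lra. }
pose proof (exp_pos x) as px.
assert (XY : x ^ 2 + y ^ 2 = W ^ 2).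
{ unfold W, Cmod; rewrite pow2_sqrt; cbn [fst snd]; [reflexivity | nra]. }
(* Split the error into its part in the phase, multiplied by [exp x], and its part in the
   modulus. *)
replace (cexp (x, y) - 1 - (x, y))%C with
  (RtoC (exp x) * ((cos y - 1)%R, (sin y - y)%R) + ((exp x - 1 - x)%R, (y * (exp x - 1))%R))%C
  by (unfold cexp; apply injective_projections; simpl; ring).
eapply Rle_trans; [apply Cmod_triangle|].
rewrite Cmod_mult, Cmod_R, Rabs_pos_eq by lra.
eapply Rle_trans; [apply Rplus_le_compat; [apply Rmult_le_compat_l; [lra | apply Cmod_le_abs] | apply Cmod_le_abs]|].
unfold Re, Im; simpl.
destruct (one_minus_cos_le y) as [[c0 c1] _].
pose proof (sin_sub_le y) as s1; pose proof (exp_sub_le x) as e1; pose proof (exp_sub2_le x) as e2.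
rewrite (Rabs_left1 (cos y - 1)), Rabs_mult by lra.
pose proof (Rabs_pos x); pose proof (Rabs_pos y).
assert (t1 : exp x * (- (cos y - 1) + Rabs (sin y - y)) <= exp W * (2 * y ^ 2)).
{ apply Rmult_le_compat; try lra; pose proof (Rabs_pos (sin y - y)); nra. }
assert (t2 : Rabs (exp x - 1 - x) <= x ^ 2 * exp W).
{ eapply Rle_trans; [exact e2|]; apply Rmult_le_compat_l; [apply pow2_ge_0 | lra]. }
assert (t3 : Rabs y * Rabs (exp x - 1) <= Rabs y * (Rabs x * exp W)).
{ apply Rmult_le_compat_l; [lra|]; eapply Rle_trans; [exact e1|]; apply Rmult_le_compat_l; lra. }
assert (t4 : Rabs y * Rabs x <= W ^ 2 / 2).
{ rewrite <- XY, <- (pow2_abs x), <- (pow2_abs y); pose proof (pow2_ge_0 (Rabs x - Rabs y)); nra. }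
assert (y ^ 2 <= W ^ 2) by (pose proof (pow2_ge_0 x); lra).
assert (Rabs y * (Rabs x * exp W) <= W ^ 2 / 2 * exp W).
{ rewrite <- Rmult_assoc; apply Rmult_le_compat_r; lra. }
nra.
Qed.

(** Lets the mesh of a subdivision tend to 0 inside an inequality. *)
Lemma le_archi x y c : 0 <= c -> (forall n, (1 <= n)%nat -> x <= y + c / INR n) -> x <= y.
Proof.
intros hc h; apply Rnot_lt_le; intros hlt.
destruct (nfloor_ex (c / (x - y))) as [n [_ hn]]; [apply Rdiv_le_0_compat; lra|].
specialize (h (S n) ltac:(lia)); rewrite S_INR in h.
pose proof (pos_INR n).
assert (c / (INR n + 1) < x - y); [|lra].
apply Rmult_lt_reg_r with (INR n + 1); [lra|].
replace (c / (INR n + 1) * (INR n + 1)) with (c / (x - y) * (x - y)) by (field; lra).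
rewrite (Rmult_comm (x - y)); apply Rmult_lt_compat_r; lra.
Qed.

Lemma Cmod_chain (f : nat -> C) n e : (forall i, (i < n)%nat -> Cmod (f (S i) - f i) <= e) ->
  Cmod (f n - f O) <= INR n * e.
Proof.
induction n as [|n IH]; intros h.
- replace (f O - f O)%C with (RtoC 0) by ring; rewrite Cmod_0; simpl; lra.
- replace (f (S n) - f O)%C with ((f (S n) - f n) + (f n - f O))%C by ring.
  eapply Rle_trans; [apply Cmod_triangle|]; rewrite S_INR.
  specialize (IH (fun i hi => h i ltac:(lia))); specialize (h n ltac:(lia)); lra.
Qed.

(* [v] is the derivative of [u], with a quantified error: in this form
   differentiability passes to the sum of a series term by term. *)
Definition C11 (s0 : C) (R K : R) (u v : C -> C) : Prop :=
  forall s t, Cmod (s - s0) < R -> Cmod (t - s0) < R ->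
    Cmod (u t - u s - v s * (t - s)) <= K * Cmod (t - s) ^ 2.

Definition segment (s t : C) (l : R) : C := (s + RtoC l * (t - s))%C.

Lemma segment_in_disc s0 R s t l : 0 <= l <= 1 -> Cmod (s - s0) < R -> Cmod (t - s0) < R ->
  Cmod (segment s t l - s0) < R.
Proof.
intros hl hs ht; unfold segment.
replace (s + RtoC l * (t - s) - s0)%C with (RtoC (1 - l) * (s - s0) + RtoC l * (t - s0))%C
  by (rewrite RtoC_minus; ring).
eapply Rle_lt_trans; [apply Cmod_triangle|].
rewrite !Cmod_mult, !Cmod_R, !Rabs_pos_eq by lra.
destruct (Req_dec l 0) as [->|hl0]; [lra|].
assert (l * Cmod (t - s0) < l * R) by (apply Rmult_lt_compat_l; lra).
assert ((1 - l) * Cmod (s - s0) <= (1 - l) * R) by (apply Rmult_le_compat_l; lra); lra.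
Qed.

(** Cut the segment into [n] equal steps: the linear errors add up to [L |t - s|], the quadratic
    ones to [K |t - s| ^ 2 / n], which vanishes in the limit. *)
Lemma C11_mean_value s0 R K u v s t w L : 0 <= K -> C11 s0 R K u v ->
  Cmod (s - s0) < R -> Cmod (t - s0) < R ->
  (forall l, 0 <= l <= 1 -> Cmod (v (segment s t l) - w) <= L) ->
  Cmod (u t - u s - w * (t - s)) <= L * Cmod (t - s).
Proof.
intros hK hu hs ht hL; apply le_archi with (K * Cmod (t - s) ^ 2).
{ apply Rmult_le_pos; [lra | apply pow2_ge_0]. }
intros n hn; assert (n0 : 0 < INR n) by (apply lt_0_INR; lia).
set (z := fun i => segment s t (INR i / INR n)).
assert (in01 : forall i, (i <= n)%nat -> 0 <= INR i / INR n <= 1).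
{ intros i hi; split; [apply Rdiv_le_0_compat; [apply pos_INR | lra]|].
  apply Rmult_le_reg_r with (INR n); [lra|].
  unfold Rdiv; rewrite Rmult_assoc, Rinv_l, Rmult_1_r, Rmult_1_l by lra; apply le_INR; lia. }
pose proof (Cmod_chain (fun i => (u (z i) - w * z i)%C) n
  (L * (Cmod (t - s) / INR n) + K * (Cmod (t - s) / INR n) ^ 2)) as h.
cbv beta in h.
replace (z n) with t in h by (unfold z, segment; replace (INR n / INR n) with 1 by (field; lra); ring).
replace (z O) with s in h by (unfold z, segment; simpl; unfold Rdiv; rewrite Rmult_0_l; ring).
replace (u t - u s - w * (t - s))%C with (u t - w * t - (u s - w * s))%C by ring.
eapply Rle_trans; [apply h|]; clear h.
- intros i hi.
  assert (st : (z (S i) - z i)%C = (RtoC (/ INR n) * (t - s))%C).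
  { unfold z, segment; replace (INR (S i) / INR n) with (INR i / INR n + / INR n) by (rewrite S_INR; field; lra).
    rewrite RtoC_plus; ring. }
  assert (mst : Cmod (z (S i) - z i) = Cmod (t - s) / INR n).
  { rewrite st, Cmod_mult, Cmod_R, Rabs_pos_eq by (left; apply Rinv_0_lt_compat; lra).
    unfold Rdiv; ring. }
  replace (u (z (S i)) - w * z (S i) - (u (z i) - w * z i))%C with
    ((u (z (S i)) - u (z i) - v (z i) * (z (S i) - z i)) + (v (z i) - w) * (z (S i) - z i))%C by ring.
  eapply Rle_trans; [apply Cmod_triangle|]; rewrite Cmod_mult.
  assert (a : Cmod (u (z (S i)) - u (z i) - v (z i) * (z (S i) - z i)) <= K * Cmod (z (S i) - z i) ^ 2).
  { apply hu; apply segment_in_disc; auto; apply in01; lia. }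
  assert (b : Cmod (v (z i) - w) <= L) by (apply hL, in01; lia).
  rewrite mst in *.
  assert (0 <= Cmod (t - s) / INR n) by (apply Rdiv_le_0_compat; [apply Cmod_ge_0 | lra]); nra.
- right; field; lra.
Qed.

(** Add the error estimates from [s] to [t] and from [t] to [s]: the values of [u] cancel. *)
Lemma C11_derivative_lipschitz s0 R K u v s t : C11 s0 R K u v ->
  Cmod (s - s0) < R -> Cmod (t - s0) < R -> Cmod (v t - v s) <= 2 * K * Cmod (t - s).
Proof.
intros hu hs ht; pose proof (hu s t hs ht) as h1; pose proof (hu t s ht hs) as h2.
destruct (Req_dec (Cmod (t - s)) 0) as [e|ne].
- apply Cmod_eq_0 in e; assert (t = s) as -> by (replace t with ((t - s) + s)%C by ring; rewrite e; ring).
  replace (v s - v s)%C with (RtoC 0) by ring; replace (s - s)%C with (RtoC 0) by ring.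
  rewrite Cmod_0; lra.
- apply Rmult_le_reg_r with (Cmod (t - s)); [pose proof (Cmod_ge_0 (t - s)); lra|].
  rewrite <- Cmod_mult.
  replace ((v t - v s) * (t - s))%C with
    ((u t - u s - v s * (t - s)) + (u s - u t - v t * (s - t)))%C by ring.
  eapply Rle_trans; [apply Cmod_triangle|].
  replace (Cmod (s - t)) with (Cmod (t - s)) in h2 by (rewrite <- Cmod_opp; f_equal; ring); nra.
Qed.

(** * Integrals over the unit interval and over circles *)

Definition Ccontinuous (f : R -> C) : Prop :=
  forall x eps, 0 < eps -> exists del, 0 < del /\ forall y, Rabs (y - x) < del -> Cmod (f y - f x) < eps.

Definition Cint (f : R -> C) : C := (RInt (fun x => Re (f x)) 0 1, RInt (fun x => Im (f x)) 0 1).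

Lemma Ccontinuous_Re f x : Ccontinuous f -> continuous (fun y => Re (f y)) x.
Proof.
intros h; apply continuity_pt_filterlim; intros e he; destruct (h x e he) as [d [d0 hd]].
exists d; split; [exact d0|]; intros y [_ hy]; simpl in *; unfold Rdist in *.
eapply Rle_lt_trans; [|apply (hd y hy)]; apply (re_le_Cmod (f y - f x)%C).
Qed.

Lemma Ccontinuous_Im f x : Ccontinuous f -> continuous (fun y => Im (f y)) x.
Proof.
intros h; apply continuity_pt_filterlim; intros e he; destruct (h x e he) as [d [d0 hd]].
exists d; split; [exact d0|]; intros y [_ hy]; simpl in *; unfold Rdist in *.
eapply Rle_lt_trans; [|apply (hd y hy)]; apply (im_le_Cmod (f y - f x)%C).
Qed.

Lemma ex_RInt_Re f a b : Ccontinuous f -> ex_RInt (fun x => Re (f x)) a b.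
Proof. intros h; apply (ex_RInt_continuous (V := R_CompleteNormedModule)); intros; apply Ccontinuous_Re, h. Qed.

Lemma ex_RInt_Im f a b : Ccontinuous f -> ex_RInt (fun x => Im (f x)) a b.
Proof. intros h; apply (ex_RInt_continuous (V := R_CompleteNormedModule)); intros; apply Ccontinuous_Im, h. Qed.

Lemma Cint_ext f g : (forall x, 0 <= x <= 1 -> f x = g x) -> Cint f = Cint g.
Proof.
intros h; unfold Cint; f_equal; apply RInt_ext; intros x; rewrite Rmin_left, Rmax_right by lra;
  intros hx; rewrite h by lra; reflexivity.
Qed.

Lemma Cint_plus f g : Ccontinuous f -> Ccontinuous g ->
  Cint (fun x => (f x + g x)%C) = (Cint f + Cint g)%C.
Proof.
intros hf hg; unfold Cint, Cplus; simpl; f_equal;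
  apply (RInt_plus (V := R_CompleteNormedModule)); auto using ex_RInt_Re, ex_RInt_Im.
Qed.

Lemma Cint_scal c f : Ccontinuous f -> Cint (fun x => (c * f x)%C) = (c * Cint f)%C.
Proof.
intros hf; pose proof (ex_RInt_Re f 0 1 hf) as hr; pose proof (ex_RInt_Im f 0 1 hf) as hi.
apply injective_projections.
- transitivity (RInt (fun x => minus (scal (fst c) (Re (f x))) (scal (snd c) (Im (f x)))) 0 1);
    [reflexivity|].
  rewrite (RInt_minus (V := R_CompleteNormedModule)), !(RInt_scal (V := R_CompleteNormedModule));
    auto using (ex_RInt_scal (V := R_NormedModule)).
- transitivity (RInt (fun x => plus (scal (fst c) (Im (f x))) (scal (snd c) (Re (f x)))) 0 1);
    [reflexivity|].
  rewrite (RInt_plus (V := R_CompleteNormedModule)), !(RInt_scal (V := R_CompleteNormedModule));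
    auto using (ex_RInt_scal (V := R_NormedModule)).
Qed.

Lemma Cint_const c : Cint (fun _ => c) = c.
Proof.
unfold Cint; rewrite !RInt_const; destruct c as [a b]; unfold scal; simpl; unfold mult; simpl.
f_equal; ring.
Qed.

(** The factor 2 comes from estimating the real and the imaginary part separately. *)
Lemma Cint_bound f M : Ccontinuous f -> (forall x, 0 <= x <= 1 -> Cmod (f x) <= M) -> Cmod (Cint f) <= 2 * M.
Proof.
intros hf h; eapply Rle_trans; [apply Cmod_le_abs|]; unfold Cint, Re at 1, Im at 1; simpl.
assert (Rabs (RInt (fun x => Re (f x)) 0 1) <= M).
{ replace M with ((1 - 0) * M) by ring.
  apply (norm_RInt_le_const (V := R_NormedModule) (fun x => Re (f x)) 0 1); [lra | |].
  - intros x hx; eapply Rle_trans; [apply re_le_Cmod | apply h; lra].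
  - apply (RInt_correct (V := R_CompleteNormedModule)), ex_RInt_Re, hf. }
assert (Rabs (RInt (fun x => Im (f x)) 0 1) <= M).
{ replace M with ((1 - 0) * M) by ring.
  apply (norm_RInt_le_const (V := R_NormedModule) (fun x => Im (f x)) 0 1); [lra | |].
  - intros x hx; eapply Rle_trans; [apply im_le_Cmod | apply h; lra].
  - apply (RInt_correct (V := R_CompleteNormedModule)), ex_RInt_Im, hf. }
lra.
Qed.

Lemma Ccontinuous_const c : Ccontinuous (fun _ => c).
Proof.
intros x e he; exists 1; split; [lra|]; intros y _; replace (c - c)%C with (RtoC 0) by ring.
rewrite Cmod_0; exact he.
Qed.

Lemma Ccontinuous_plus f g : Ccontinuous f -> Ccontinuous g -> Ccontinuous (fun x => (f x + g x)%C).
Proof.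
intros hf hg x e he.
destruct (hf x (e / 2) ltac:(lra)) as [d1 [p1 h1]]; destruct (hg x (e / 2) ltac:(lra)) as [d2 [p2 h2]].
exists (Rmin d1 d2); split; [apply Rmin_glb_lt; auto|]; intros y hy.
specialize (h1 y (Rlt_le_trans _ _ _ hy (Rmin_l _ _))); specialize (h2 y (Rlt_le_trans _ _ _ hy (Rmin_r _ _))).
replace (f y + g y - (f x + g x))%C with ((f y - f x) + (g y - g x))%C by ring.
eapply Rle_lt_trans; [apply Cmod_triangle | lra].
Qed.

Lemma Ccontinuous_mult f g : Ccontinuous f -> Ccontinuous g -> Ccontinuous (fun x => (f x * g x)%C).
Proof.
intros hf hg x e he; pose proof (Cmod_ge_0 (f x)) as pf; pose proof (Cmod_ge_0 (g x)) as pg.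
set (D := Cmod (f x) + Cmod (g x) + 1).
set (e' := Rmin 1 (e / (2 * D))).
assert (he' : 0 < e') by (apply Rmin_glb_lt; [lra | apply Rdiv_lt_0_compat; unfold D; lra]).
assert (e1 : e' <= 1) by apply Rmin_l.
assert (e2 : e' * D <= e / 2).
{ apply Rle_trans with (e / (2 * D) * D); [apply Rmult_le_compat_r; [unfold D; lra | apply Rmin_r]|].
  right; field; unfold D; lra. }
destruct (hf x e' he') as [d1 [p1 h1]]; destruct (hg x e' he') as [d2 [p2 h2]].
exists (Rmin d1 d2); split; [apply Rmin_glb_lt; auto|]; intros y hy.
specialize (h1 y (Rlt_le_trans _ _ _ hy (Rmin_l _ _))); specialize (h2 y (Rlt_le_trans _ _ _ hy (Rmin_r _ _))).
replace (f y * g y - f x * g x)%C with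
  ((f y - f x) * (g y - g x) + ((f y - f x) * g x + f x * (g y - g x)))%C by ring.
eapply Rle_lt_trans; [apply Cmod_triangle|].
eapply Rle_lt_trans; [apply Rplus_le_compat_l, Cmod_triangle|]; rewrite !Cmod_mult.
pose proof (Cmod_ge_0 (f y - f x)%C); pose proof (Cmod_ge_0 (g y - g x)%C).
assert (e' * D < e) by lra; unfold D in *; nra.
Qed.

Definition circle (x : R) : C := cexp (0, 2 * PI * x).

Lemma Cmod_circle x : Cmod (circle x) = 1.
Proof. unfold circle; rewrite Cmod_cexp; simpl; apply exp_0. Qed.

Lemma circle_inv x : (circle x * circle (- x))%C = 1%C.
Proof.
unfold circle; rewrite <- cexp_plus; replace (_ + _)%C with (RtoC 0); [apply cexp_0|].
unfold Cplus, RtoC; simpl; f_equal; ring.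
Qed.

Lemma circle_quadratic : exists K, 0 <= K /\ forall x y, Rabs (y - x) <= 1 ->
  Cmod (circle y - circle x - RtoC (y - x) * ((0, 2 * PI)%R * circle x)) <= K * Rabs (y - x) ^ 2.
Proof.
pose proof PI_RGT_0 as hpi.
exists (3 * (2 * PI) ^ 2 * exp (2 * PI)); split.
{ pose proof (exp_pos (2 * PI)); pose proof (pow2_ge_0 (2 * PI)); nra. }
intros x y hxy; set (w := (0, 2 * PI * (y - x))%R : C).
assert (e : circle y = (circle x * cexp w)%C).
{ unfold circle, w; rewrite <- cexp_plus; f_equal; unfold Cplus; simpl; f_equal; ring. }
replace (circle y - circle x - RtoC (y - x) * ((0, 2 * PI)%R * circle x))%C with
  (circle x * (cexp w - 1 - w))%C.
2:{ rewrite e; replace w with (RtoC (y - x) * ((0, 2 * PI)%R : C))%C at 2; [ring|].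
    unfold w; apply injective_projections; simpl; ring. }
rewrite Cmod_mult, Cmod_circle, Rmult_1_l.
assert (hw : Cmod w = 2 * PI * Rabs (y - x)).
{ unfold w; replace ((0, 2 * PI * (y - x))%R : C) with (RtoC (2 * PI * (y - x)) * Ci)%C
    by (unfold Ci; apply injective_projections; simpl; ring).
  rewrite Cmod_mult, Cmod_R, Cmod_Ci, Rmult_1_r, Rabs_mult, (Rabs_pos_eq (2 * PI)) by lra; reflexivity. }
eapply Rle_trans; [apply cexp_quadratic|]; rewrite hw.
assert (exp (2 * PI * Rabs (y - x)) <= exp (2 * PI)).
{ apply exp_incr; nra. }
rewrite Rpow_mult_distr.
pose proof (pow2_ge_0 (Rabs (y - x))); pose proof (pow2_ge_0 (2 * PI)).
replace (3 * (2 * PI) ^ 2 * exp (2 * PI) * Rabs (y - x) ^ 2) with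
  (3 * ((2 * PI) ^ 2 * Rabs (y - x) ^ 2) * exp (2 * PI)) by ring.
apply Rmult_le_compat_l; [nra | assumption].
Qed.

Lemma Ccontinuous_quadratic f g K : 0 <= K -> (forall x y, Rabs (y - x) <= 1 ->
  Cmod (f y - f x - RtoC (y - x) * g x) <= K * Rabs (y - x) ^ 2) -> Ccontinuous f.
Proof.
intros hK h x e he; pose proof (Cmod_ge_0 (g x)) as pg.
exists (Rmin 1 (e / (K + Cmod (g x) + 1))); split.
{ apply Rmin_glb_lt; [lra | apply Rdiv_lt_0_compat; lra]. }
intros y hy; assert (hy1 := Rlt_le_trans _ _ _ hy (Rmin_l _ _)); assert (hy2 := Rlt_le_trans _ _ _ hy (Rmin_r _ _)).
specialize (h x y ltac:(lra)).
replace (f y - f x)%C with ((f y - f x - RtoC (y - x) * g x) + RtoC (y - x) * g x)%C by ring.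
eapply Rle_lt_trans; [apply Cmod_triangle|]; rewrite Cmod_mult, Cmod_R.
pose proof (Rabs_pos (y - x)) as pa.
assert (sq : Rabs (y - x) ^ 2 <= Rabs (y - x)) by nra.
assert (K * Rabs (y - x) ^ 2 <= K * Rabs (y - x)) by (apply Rmult_le_compat_l; lra).
apply Rle_lt_trans with ((K + Cmod (g x) + 1) * Rabs (y - x)); [lra|].
apply Rlt_le_trans with ((K + Cmod (g x) + 1) * (e / (K + Cmod (g x) + 1))).
- apply Rmult_lt_compat_l; lra.
- right; field; lra.
Qed.

Lemma Ccontinuous_circle : Ccontinuous circle.
Proof. destruct circle_quadratic as [K [h0 h]]; apply Ccontinuous_quadratic with (1 := h0) (2 := h). Qed.

Lemma is_derive_quadratic (f : R -> R) x l K : 0 <= K ->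
  (forall y, Rabs (y - x) <= 1 -> Rabs (f y - f x - (y - x) * l) <= K * Rabs (y - x) ^ 2) ->
  is_derive f x l.
Proof.
intros hK h; apply is_derive_Reals; intros e he.
assert (dp : 0 < Rmin 1 (e / (K + 1))) by (apply Rmin_glb_lt; [lra | apply Rdiv_lt_0_compat; lra]).
exists (mkposreal _ dp); intros d hd hdlt; simpl in hdlt.
assert (h1 := Rlt_le_trans _ _ _ hdlt (Rmin_l _ _)); assert (h2 := Rlt_le_trans _ _ _ hdlt (Rmin_r _ _)).
specialize (h (x + d)); replace (x + d - x) with d in h by ring; specialize (h ltac:(lra)).
replace ((f (x + d) - f x) / d - l) with ((f (x + d) - f x - d * l) / d) by (field; exact hd).
unfold Rdiv; rewrite Rabs_mult, Rabs_inv.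
assert (pd : 0 < Rabs d) by (apply Rabs_pos_lt; exact hd).
apply Rmult_lt_reg_r with (Rabs d); [exact pd|].
rewrite Rmult_assoc, Rinv_l, Rmult_1_r by lra.
apply Rle_lt_trans with ((K + 1) * Rabs d * Rabs d); [pose proof (pow2_ge_0 (Rabs d)); simpl in *; lra|].
apply Rmult_lt_compat_r; [exact pd|].
apply Rlt_le_trans with ((K + 1) * (e / (K + 1))); [apply Rmult_lt_compat_l; lra|].
right; field; lra.
Qed.

(** The fundamental theorem of calculus for each component: the increment of [f] over the period is
    0. *)
Lemma Cint_derivative_periodic f g K : 0 <= K -> Ccontinuous g -> f 0 = f 1 ->
  (forall x y, Rabs (y - x) <= 1 -> Cmod (f y - f x - RtoC (y - x) * g x) <= K * Rabs (y - x) ^ 2) ->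
  Cint g = 0%C.
Proof.
intros hK hg hp h; unfold Cint, RtoC; f_equal.
- rewrite (is_RInt_unique _ _ _ (minus (Re (f 1)) (Re (f 0)))).
  + rewrite hp; unfold minus, plus, opp; simpl; ring.
  + apply (is_RInt_derive (V := R_CompleteNormedModule) (fun x => Re (f x)) (fun x => Re (g x))).
    * intros x _; apply is_derive_quadratic with K; [exact hK|]; intros y hy.
      eapply Rle_trans; [|apply (h x y hy)].
      eapply Rle_trans; [|apply re_le_Cmod]; right; f_equal; unfold Re, Im; simpl; ring.
    * intros; apply Ccontinuous_Re, hg.
- rewrite (is_RInt_unique _ _ _ (minus (Im (f 1)) (Im (f 0)))).
  + rewrite hp; unfold minus, plus, opp; simpl; ring.
  + apply (is_RInt_derive (V := R_CompleteNormedModule) (fun x => Im (f x)) (fun x => Im (g x))).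
    * intros x _; apply is_derive_quadratic with K; [exact hK|]; intros y hy.
      eapply Rle_trans; [|apply (h x y hy)].
      eapply Rle_trans; [|apply im_le_Cmod]; right; f_equal; unfold Re, Im; simpl; ring.
    * intros; apply Ccontinuous_Im, hg.
Qed.

(** Differentiability along the real line in the same quantified form as [C11], stable under
    products. *)
Definition quadratic (f g : R -> C) (K : R) : Prop := forall x y, Rabs (y - x) <= 1 ->
  Cmod (f y - f x - RtoC (y - x) * g x) <= K * Rabs (y - x) ^ 2.

Lemma quadratic_increment f g K B x y : 0 <= K -> quadratic f g K -> Cmod (g x) <= B -> Rabs (y - x) <= 1 ->
  Cmod (f y - f x) <= (B + K) * Rabs (y - x).
Proof.
intros hK h hB hxy; specialize (h x y hxy).
replace (f y - f x)%C with ((f y - f x - RtoC (y - x) * g x) + RtoC (y - x) * g x)%C by ring.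
eapply Rle_trans; [apply Cmod_triangle|]; rewrite Cmod_mult, Cmod_R.
pose proof (Rabs_pos (y - x)).
assert (K * Rabs (y - x) ^ 2 <= K * Rabs (y - x)) by (apply Rmult_le_compat_l; nra).
assert (Rabs (y - x) * Cmod (g x) <= Rabs (y - x) * B) by (apply Rmult_le_compat_l; lra).
lra.
Qed.

Lemma quadratic_mult f1 g1 f2 g2 K B : 0 <= K -> quadratic f1 g1 K -> quadratic f2 g2 K ->
  (forall x, Cmod (f1 x) <= B /\ Cmod (g1 x) <= B /\ Cmod (f2 x) <= B /\ Cmod (g2 x) <= B) ->
  quadratic (fun x => f1 x * f2 x)%C (fun x => g1 x * f2 x + f1 x * g2 x)%C (2 * K * B + (B + K) ^ 2).
Proof.
intros hK h1 h2 hB x y hxy; destruct (hB x) as [b1 [c1 [b2 c2]]].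
pose proof (quadratic_increment f1 g1 K B x y hK h1 c1 hxy) as i1.
pose proof (quadratic_increment f2 g2 K B x y hK h2 c2 hxy) as i2.
specialize (h1 x y hxy); specialize (h2 x y hxy).
replace (f1 y * f2 y - f1 x * f2 x - RtoC (y - x) * (g1 x * f2 x + f1 x * g2 x))%C with
  ((f1 y - f1 x - RtoC (y - x) * g1 x) * f2 x + f1 x * (f2 y - f2 x - RtoC (y - x) * g2 x)
   + (f1 y - f1 x) * (f2 y - f2 x))%C by ring.
eapply Rle_trans; [apply Cmod_triangle|].
eapply Rle_trans; [apply Rplus_le_compat_r, Cmod_triangle|]; rewrite !Cmod_mult.
set (d := Rabs (y - x)) in *; assert (d0 : 0 <= d) by apply Rabs_pos.
assert (t1 : Cmod (f1 y - f1 x - RtoC (y - x) * g1 x) * Cmod (f2 x) <= K * d ^ 2 * B).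
{ apply Rmult_le_compat; auto using Cmod_ge_0. }
assert (t2 : Cmod (f1 x) * Cmod (f2 y - f2 x - RtoC (y - x) * g2 x) <= B * (K * d ^ 2)).
{ apply Rmult_le_compat; auto using Cmod_ge_0. }
assert (t3 : Cmod (f1 y - f1 x) * Cmod (f2 y - f2 x) <= ((B + K) * d) * ((B + K) * d)).
{ apply Rmult_le_compat; auto using Cmod_ge_0. }
lra.
Qed.

(** * Cauchy's integral formula *)

Section Cauchy.
Variables (s0 : C) (Rd K : R) (u v : C -> C).
Hypotheses (hK : 0 <= K) (hu : C11 s0 Rd K u v).

Lemma C11_v_bound z : Cmod (z - s0) < Rd -> Cmod (v z) <= Cmod (v s0) + 2 * K * Rd.
Proof.
intros hz; assert (h0 : Cmod (s0 - s0) < Rd).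
{ replace (s0 - s0)%C with (RtoC 0) by ring; rewrite Cmod_0; pose proof (Cmod_ge_0 (z - s0)); lra. }
pose proof (C11_derivative_lipschitz s0 Rd K u v s0 z hu h0 hz) as h.
replace (v z) with (v s0 + (v z - v s0))%C by ring.
eapply Rle_trans; [apply Cmod_triangle|].
assert (2 * K * Cmod (z - s0) <= 2 * K * Rd) by (apply Rmult_le_compat_l; lra); lra.
Qed.

Lemma C11_increment s t : Cmod (s - s0) < Rd -> Cmod (t - s0) < Rd ->
  Cmod (u t - u s) <= (Cmod (v s0) + 2 * K * Rd) * Cmod (t - s) + K * Cmod (t - s) ^ 2.
Proof.
intros hs ht; pose proof (hu s t hs ht) as h; pose proof (C11_v_bound s hs) as b.
replace (u t - u s)%C with ((u t - u s - v s * (t - s)) + v s * (t - s))%C by ring.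
eapply Rle_trans; [apply Cmod_triangle|]; rewrite Cmod_mult.
assert (Cmod (v s) * Cmod (t - s) <= (Cmod (v s0) + 2 * K * Rd) * Cmod (t - s)).
{ apply Rmult_le_compat_r; [apply Cmod_ge_0 | exact b]. }
lra.
Qed.

Lemma Ccontinuous_comp_u f : Ccontinuous f -> (forall x, Cmod (f x - s0) < Rd) -> Ccontinuous (fun x => u (f x)).
Proof.
intros hf hd x e he.
set (B := Cmod (v s0) + 2 * K * Rd + K + 1).
assert (hR : 0 <= Rd) by (pose proof (hd x); pose proof (Cmod_ge_0 (f x - s0)); lra).
assert (hB : 0 < B) by (unfold B; pose proof (Cmod_ge_0 (v s0)); nra).
destruct (hf x (Rmin 1 (e / B))) as [d [d0 h]]; [apply Rmin_glb_lt; [lra | apply Rdiv_lt_0_compat; lra]|].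
exists d; split; [exact d0|]; intros y hy; specialize (h y hy).
assert (h1 := Rlt_le_trans _ _ _ h (Rmin_l _ _)); assert (h2 := Rlt_le_trans _ _ _ h (Rmin_r _ _)).
eapply Rle_lt_trans; [apply C11_increment; apply hd|].
set (D := Cmod (f y - f x)) in *; assert (D0 : 0 <= D) by apply Cmod_ge_0.
assert (K * D ^ 2 <= K * D) by (apply Rmult_le_compat_l; nra).
apply Rle_lt_trans with (B * D); [unfold B; lra|].
apply Rlt_le_trans with (B * (e / B)); [apply Rmult_lt_compat_l; lra|].
right; field; lra.
Qed.

Lemma Ccontinuous_comp_v f : Ccontinuous f -> (forall x, Cmod (f x - s0) < Rd) -> Ccontinuous (fun x => v (f x)).
Proof.
intros hf hd x e he.
destruct (hf x (e / (2 * K + 1))) as [d [d0 h]]; [apply Rdiv_lt_0_compat; lra|].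
exists d; split; [exact d0|]; intros y hy; specialize (h y hy).
eapply Rle_lt_trans; [apply (C11_derivative_lipschitz s0 Rd K u v _ _ hu (hd x) (hd y))|].
set (D := Cmod (f y - f x)) in *; assert (D0 : 0 <= D) by apply Cmod_ge_0.
apply Rle_lt_trans with ((2 * K + 1) * D); [lra|].
apply Rlt_le_trans with ((2 * K + 1) * (e / (2 * K + 1))); [apply Rmult_lt_compat_l; lra|].
right; field; lra.
Qed.

Variables (s : C) (r : R).
Hypotheses (hr : 0 < r) (hsr : Cmod (s - s0) + r < Rd).

Definition polar (l x : R) : C := (s + RtoC (l * r) * circle x)%C.

Lemma polar_in l x : 0 <= l <= 1 -> Cmod (polar l x - s0) < Rd.
Proof.
intros hl; unfold polar; replace (s + RtoC (l * r) * circle x - s0)%C with ((s - s0) + RtoC (l * r) * circle x)%C by ring.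
eapply Rle_lt_trans; [apply Cmod_triangle|].
rewrite Cmod_mult, Cmod_circle, Cmod_R, Rabs_pos_eq, Rmult_1_r by nra; nra.
Qed.

Lemma Ccontinuous_polar l : Ccontinuous (polar l).
Proof.
apply Ccontinuous_plus; [apply Ccontinuous_const | apply Ccontinuous_mult; [apply Ccontinuous_const | apply Ccontinuous_circle]].
Qed.

Lemma Ccontinuous_circle_opp : Ccontinuous (fun x => circle (- x)).
Proof.
intros x e he; destruct (Ccontinuous_circle (- x) e he) as [d [d0 h]]; exists d; split; [exact d0|].
intros y hy; apply h; replace (- y - - x) with (- (y - x)) by ring; rewrite Rabs_Ropp; exact hy.
Qed.

(** Means over the circle of radius [l r] around [s]. Divided by [l r], [mean_u l] is Cauchy's
    integral of [u / (z - s) ^ 2]; the plan is to show that it equals [mean_v l], that this does not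
    depend on [l], and that for [l = 0] it is [v s]. *)
Definition mean_v (l : R) : C := Cint (fun x => v (polar l x)).
Definition mean_u (l : R) : C := Cint (fun x => u (polar l x) * circle (- x))%C.

Lemma Ccontinuous_mean_v l : 0 <= l <= 1 -> Ccontinuous (fun x => v (polar l x)).
Proof. intros hl; apply Ccontinuous_comp_v; [apply Ccontinuous_polar | intros; apply polar_in, hl]. Qed.

Lemma Ccontinuous_mean_u l : 0 <= l <= 1 -> Ccontinuous (fun x => u (polar l x) * circle (- x))%C.
Proof.
intros hl; apply Ccontinuous_mult; [|apply Ccontinuous_circle_opp].
apply Ccontinuous_comp_u; [apply Ccontinuous_polar | intros; apply polar_in, hl].
Qed.

(* The derivative of [u (polar l x) * circle (- x)] in [x] has mean value 0. *)
Lemma mean_relation l : 0 <= l <= 1 -> (RtoC (l * r) * mean_v l)%C = mean_u l.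
Proof.
intros hl; destruct circle_quadratic as [Kc [Kc0 hc]].
set (I2 := (0, 2 * PI)%R : C).
set (Bv := Cmod (v s0) + 2 * K * Rd).
assert (hR : 0 < Rd) by (pose proof (Cmod_ge_0 (s - s0)); lra).
assert (Bv0 : 0 <= Bv) by (unfold Bv; pose proof (Cmod_ge_0 (v s0)); nra).
assert (hI : 0 <= Cmod I2) by apply Cmod_ge_0.
assert (lr : 0 <= l * r) by nra.
assert (q1 : quadratic (fun x => u (polar l x)) (fun x => v (polar l x) * (RtoC (l * r) * (I2 * circle x)))%C
   (K * (l * r * (Cmod I2 + Kc)) ^ 2 + Bv * (l * r * Kc))).
{ intros x y hxy.
  assert (e : (polar l y - polar l x)%C = (RtoC (l * r) * (circle y - circle x))%C) by (unfold polar; ring).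
  replace (u (polar l y) - u (polar l x) - RtoC (y - x) * (v (polar l x) * (RtoC (l * r) * (I2 * circle x))))%C
   with ((u (polar l y) - u (polar l x) - v (polar l x) * (polar l y - polar l x))
     + v (polar l x) * (RtoC (l * r) * (circle y - circle x - RtoC (y - x) * (I2 * circle x))))%C by (rewrite e; ring).
  eapply Rle_trans; [apply Cmod_triangle|]; rewrite !Cmod_mult, Cmod_R, (Rabs_pos_eq (l * r)) by exact lr.
  pose proof (hu _ _ (polar_in l x hl) (polar_in l y hl)) as h1.
  rewrite e, Cmod_mult, Cmod_R, (Rabs_pos_eq (l * r)) in h1 by exact lr.
  specialize (hc x y hxy) as h2; fold I2 in h2.
  assert (ci : Cmod (circle y - circle x) <= (Cmod I2 + Kc) * Rabs (y - x)).
  { apply (quadratic_increment circle (fun z => I2 * circle z)%C Kc); auto.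
    rewrite Cmod_mult, Cmod_circle; lra. }
  pose proof (C11_v_bound _ (polar_in l x hl)) as vb; fold Bv in vb.
  pose proof (Cmod_ge_0 (circle y - circle x)) as p0.
  set (d := Rabs (y - x)) in *; assert (d0 : 0 <= d) by apply Rabs_pos.
  assert (h3 : K * (l * r * Cmod (circle y - circle x)) ^ 2 <= K * (l * r * ((Cmod I2 + Kc) * d)) ^ 2).
  { apply Rmult_le_compat_l; [exact hK|]; apply pow_incr; split; [apply Rmult_le_pos; assumption|].
    apply Rmult_le_compat_l; assumption. }
  assert (h4 : Cmod (v (polar l x)) * (l * r * Cmod (circle y - circle x - RtoC (y - x) * (I2 * circle x)))
     <= Bv * (l * r * (Kc * d ^ 2))).
  { apply Rmult_le_compat; auto using Cmod_ge_0; [|apply Rmult_le_compat_l; auto].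
    apply Rmult_le_pos; auto using Cmod_ge_0. }
  rewrite e; eapply Rle_trans; [apply Rplus_le_compat; [eapply Rle_trans; [exact h1 | exact h3] | exact h4]|].
  right; ring. }
set (K1 := K * (l * r * (Cmod I2 + Kc)) ^ 2 + Bv * (l * r * Kc)) in *.
assert (K10 : 0 <= K1).
{ unfold K1; apply Rplus_le_le_0_compat; [apply Rmult_le_pos; [exact hK | apply pow2_ge_0]|].
  apply Rmult_le_pos; [exact Bv0|]; apply Rmult_le_pos; assumption. }
assert (q2 : quadratic (fun x => circle (- x)) (fun x => Copp I2 * circle (- x))%C Kc).
{ intros x y hxy; specialize (hc (- x) (- y)); replace (- y - - x) with (- (y - x)) in hc by ring.
  rewrite Rabs_Ropp in hc; specialize (hc hxy); fold I2 in hc.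
  replace (circle (- y) - circle (- x) - RtoC (y - x) * (Copp I2 * circle (- x)))%C with
    (circle (- y) - circle (- x) - RtoC (- (y - x)) * (I2 * circle (- x)))%C by (rewrite RtoC_opp; ring).
  exact hc. }
set (Bu := Cmod (u s0) + (Bv * Rd + K * Rd ^ 2)).
assert (hub : forall x, Cmod (u (polar l x)) <= Bu).
{ intros x; pose proof (polar_in l x hl) as hp.
  assert (h0 : Cmod (s0 - s0) < Rd) by (replace (s0 - s0)%C with (RtoC 0) by ring; rewrite Cmod_0; lra).
  pose proof (C11_increment s0 (polar l x) h0 hp) as h; fold Bv in h.
  replace (u (polar l x)) with (u s0 + (u (polar l x) - u s0))%C by ring.
  eapply Rle_trans; [apply Cmod_triangle|]; unfold Bu; apply Rplus_le_compat_l.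
  pose proof (Cmod_ge_0 (polar l x - s0)).
  eapply Rle_trans; [exact h|]; apply Rplus_le_compat; apply Rmult_le_compat_l; try lra.
  apply pow_incr; lra. }
set (B := Bu + Bv * (l * r * Cmod I2) + 1 + Cmod I2).
set (Km := K1 + Kc).
assert (fin : Cint (fun x => (I2 * (RtoC (l * r) * v (polar l x) + Copp 1 * (u (polar l x) * circle (- x)))))%C = 0%C).
{ apply Cint_derivative_periodic with (f := fun x => (u (polar l x) * circle (- x))%C)
    (K := 2 * Km * B + (B + Km) ^ 2).
  - assert (0 <= Bu) by (pose proof (hub 0); pose proof (Cmod_ge_0 (u (polar l 0))); lra).
    assert (0 <= B) by (unfold B; pose proof (Rmult_le_pos _ _ Bv0 (Rmult_le_pos _ _ lr hI)); lra).
    unfold Km; pose proof (pow2_ge_0 (B + (K1 + Kc))); nra.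
  - apply Ccontinuous_mult; [apply Ccontinuous_const|]; apply Ccontinuous_plus.
    + apply Ccontinuous_mult; [apply Ccontinuous_const | apply Ccontinuous_mean_v, hl].
    + apply Ccontinuous_mult; [apply Ccontinuous_const | apply Ccontinuous_mean_u, hl].
  - assert (circle 1 = circle 0) as c10.
    { unfold circle, cexp; simpl; rewrite !Rmult_1_r, !Rmult_0_r, cos_2PI, sin_2PI, cos_0, sin_0; reflexivity. }
    assert (circle (-1) = circle 0) as cm10.
    { unfold circle, cexp; simpl.
      replace (2 * PI * -1) with (- (2 * PI)) by ring.
      rewrite !Rmult_0_r, cos_neg, sin_neg, cos_2PI, sin_2PI, cos_0, sin_0, Ropp_0; reflexivity. }
    unfold polar; rewrite c10, Ropp_0; replace (- (1)) with (-1) by ring; rewrite cm10; reflexivity.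
  - intros x y hxy.
    assert (wd : forall f g K2, K2 <= Km -> quadratic f g K2 -> quadratic f g Km).
    { intros f g K2 hle q a b h; eapply Rle_trans; [apply (q a b h)|].
      apply Rmult_le_compat_r; [apply pow2_ge_0 | exact hle]. }
    assert (Km0 : 0 <= Km) by (unfold Km; lra).
    assert (q1' := wd _ _ K1 ltac:(unfold Km; lra) q1).
    assert (q2' := wd _ _ Kc ltac:(unfold Km; lra) q2).
    assert (m := quadratic_mult _ _ _ _ Km B Km0 q1' q2').
    lapply m; clear m.
    + intros m; specialize (m x y hxy); cbv beta in m.
      match goal with |- Cmod (?a - RtoC ?d * ?b) <= _ => match type of m with Cmod (_ - RtoC _ * ?c) <= _ =>
        replace b with c end end; [exact m|].
      pose proof (circle_inv x) as ci.
      replace (v (polar l x) * (RtoC (l * r) * (I2 * circle x)) * circle (- x))%C with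
        (I2 * (RtoC (l * r) * v (polar l x)) * (circle x * circle (- x)))%C by ring.
      rewrite ci; ring.
    + intros z; pose proof (hub z) as bz; pose proof (C11_v_bound _ (polar_in l z hl)) as vb; fold Bv in vb.
      assert (Bu0 : 0 <= Bu) by (pose proof (Cmod_ge_0 (u (polar l z))); lra).
      pose proof (Rmult_le_pos _ _ Bv0 (Rmult_le_pos _ _ lr hI)).
      rewrite !Cmod_mult, !Cmod_circle, Cmod_R, Cmod_opp, (Rabs_pos_eq (l * r)), !Rmult_1_r by exact lr.
      assert (Cmod (v (polar l z)) * (l * r * Cmod I2) <= Bv * (l * r * Cmod I2)).
      { apply Rmult_le_compat_r; [apply Rmult_le_pos; assumption | exact vb]. }
      unfold B; repeat split; lra. }
rewrite Cint_scal in fin.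
2:{ apply Ccontinuous_plus; apply Ccontinuous_mult; try apply Ccontinuous_const;
    [apply Ccontinuous_mean_v, hl | apply Ccontinuous_mean_u, hl]. }
rewrite Cint_plus, Cint_scal, Cint_scal in fin by
  (try (apply Ccontinuous_mult; [apply Ccontinuous_const|]);
   first [apply Ccontinuous_mean_v; exact hl | apply Ccontinuous_mean_u; exact hl]).
fold (mean_v l) in fin; fold (mean_u l) in fin.
assert (I2 <> 0%C).
{ unfold I2, RtoC; intros h; injection h; pose proof PI_RGT_0; lra. }
replace (RtoC (l * r) * mean_v l)%C with
  (mean_u l + /I2 * (I2 * (RtoC (l * r) * mean_v l + Copp 1 * mean_u l)))%C by (field; assumption).
rewrite fin; ring.
Qed.

(** By [mean_relation], [l' r] times the difference is the mean of the [C11] error of [u] between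
    the two radii, which is quadratic in [l' - l]. *)
Lemma mean_v_step l l' : 0 <= l <= 1 -> 0 < l' <= 1 ->
  Cmod (mean_v l' - mean_v l) <= 2 * K * r * (l' - l) ^ 2 / l'.
Proof.
intros hl hl'.
assert (e : (RtoC (l' * r) * (mean_v l' - mean_v l))%C =
   Cint (fun x => (u (polar l' x) - u (polar l x) - v (polar l x) * (polar l' x - polar l x)) * circle (- x))%C).
{ transitivity (mean_u l' + (Copp 1 * mean_u l + Copp (RtoC ((l' - l) * r)) * mean_v l))%C.
  - rewrite <- !mean_relation by lra; rewrite !RtoC_mult, RtoC_minus; ring.
  - unfold mean_u, mean_v; rewrite <- !Cint_scal, <- !Cint_plus;
      try (apply Ccontinuous_plus); try (apply Ccontinuous_mult; [apply Ccontinuous_const|]);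
      try (apply Ccontinuous_mean_u; lra); try (apply Ccontinuous_mean_v; lra).
    apply Cint_ext; intros x _.
    replace (polar l' x - polar l x)%C with (RtoC ((l' - l) * r) * circle x)%C
      by (unfold polar; rewrite !RtoC_mult, RtoC_minus; ring).
    transitivity (u (polar l' x) * circle (- x) - u (polar l x) * circle (- x)
      - RtoC ((l' - l) * r) * v (polar l x) * (circle x * circle (- x)))%C; [rewrite circle_inv; ring | ring]. }
assert (b : Cmod (RtoC (l' * r) * (mean_v l' - mean_v l)) <= 2 * (K * ((l' - l) * r) ^ 2)).
{ rewrite e; apply Cint_bound.
  - apply Ccontinuous_mult; [|apply Ccontinuous_circle_opp].
    apply Ccontinuous_plus; [apply Ccontinuous_plus|].
    + apply Ccontinuous_comp_u; [apply Ccontinuous_polar | intros; apply polar_in; lra].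
    + intros x eps he; destruct (Ccontinuous_comp_u (polar l) (Ccontinuous_polar l)
        (fun y => polar_in l y hl) x eps he) as [d [d0 h]].
      exists d; split; [exact d0|]; intros y hy; specialize (h y hy).
      replace (- u (polar l y) - - u (polar l x))%C with (- (u (polar l y) - u (polar l x)))%C by ring.
      rewrite Cmod_opp; exact h.
    + assert (h : Ccontinuous (fun x => Copp 1 * (v (polar l x) * (polar l' x + Copp 1 * polar l x)))%C).
      { apply Ccontinuous_mult; [apply Ccontinuous_const|]; apply Ccontinuous_mult; [apply Ccontinuous_mean_v, hl|].
        apply Ccontinuous_plus; [apply Ccontinuous_polar|].
        apply Ccontinuous_mult; [apply Ccontinuous_const | apply Ccontinuous_polar]. }
      intros x eps he; destruct (h x eps he) as [d [d0 h']]; exists d; split; [exact d0|].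
      intros y hy; specialize (h' y hy); eapply Rle_lt_trans; [|exact h']; right; f_equal; ring.
  - intros x _; rewrite Cmod_mult, Cmod_circle, Rmult_1_r.
    eapply Rle_trans; [apply hu; apply polar_in; lra|]; apply Rmult_le_compat_l; [exact hK|].
    replace (polar l' x - polar l x)%C with (RtoC ((l' - l) * r) * circle x)%C
      by (unfold polar; rewrite !RtoC_mult, RtoC_minus; ring).
    rewrite Cmod_mult, Cmod_circle, Cmod_R, Rmult_1_r, pow2_abs; lra. }
assert (p : 0 < l' * r) by (apply Rmult_lt_0_compat; lra).
rewrite Cmod_mult, Cmod_R, Rabs_pos_eq in b by lra.
apply Rmult_le_reg_l with (l' * r); [exact p|].
eapply Rle_trans; [exact b|]; right; field; lra.
Qed.

(** Between radii [e] and 1 the quadratic steps of a subdivision add up to something arbitrarily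
    small. The bound degenerates as the radius tends to 0, so the part from 0 to [e] is a single
    step, of size [O(e)]. *)
Lemma mean_v_constant : mean_v 1 = mean_v 0.
Proof.
assert (Kr : 0 <= 2 * K * r) by nra.
assert (d : Cmod (mean_v 1 - mean_v 0) <= 0).
{ apply le_archi with (2 * K * r); [exact Kr|].
  intros m hm; assert (m1 : 1 <= INR m) by (change 1 with (INR 1); apply le_INR; lia).
  set (e := / INR m).
  assert (e0 : 0 < e) by (apply Rinv_0_lt_compat; lra).
  assert (e1 : e <= 1) by (unfold e; rewrite <- Rinv_1; apply Rinv_le_contravar; lra).
  assert (a : Cmod (mean_v e - mean_v 0) <= 2 * K * r / INR m).
  { eapply Rle_trans; [apply mean_v_step; lra|]; right; unfold e; field; lra. }
  assert (b : Cmod (mean_v 1 - mean_v e) <= 0).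
  { apply le_archi with (2 * K * r / e); [apply Rdiv_le_0_compat; lra|].
    intros n hn; assert (n1 : 1 <= INR n) by (change 1 with (INR 1); apply le_INR; lia).
    pose proof (Cmod_chain (fun i => mean_v (e + INR i * ((1 - e) / INR n))) n
      (2 * K * r / e * (/ INR n) ^ 2)) as h; cbv beta in h.
    replace (e + INR n * ((1 - e) / INR n)) with 1 in h by (field; lra).
    replace (e + INR 0 * ((1 - e) / INR n)) with e in h by (simpl; ring).
    eapply Rle_trans; [apply h|].
    - intros i hi.
      assert (hi1 : INR (S i) <= INR n) by (apply le_INR; lia).
      pose proof (pos_INR i) as pi0.
      assert (q0 : 0 <= (1 - e) / INR n) by (apply Rdiv_le_0_compat; lra).
      assert (q1 : INR (S i) * ((1 - e) / INR n) <= 1 - e).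
      { apply Rle_trans with (INR n * ((1 - e) / INR n)); [apply Rmult_le_compat_r; lra|].
        right; field; lra. }
      rewrite S_INR in q1.
      eapply Rle_trans; [apply mean_v_step; rewrite ?S_INR; nra|].
      rewrite S_INR.
      replace (e + (INR i + 1) * ((1 - e) / INR n) - (e + INR i * ((1 - e) / INR n))) with ((1 - e) / INR n) by ring.
      assert (w : ((1 - e) / INR n) ^ 2 <= (/ INR n) ^ 2).
      { apply pow_incr; split; [exact q0|]; unfold Rdiv; rewrite <- (Rmult_1_l (/ INR n)) at 2.
        apply Rmult_le_compat_r; [left; apply Rinv_0_lt_compat; lra | lra]. }
      assert (z : / (e + (INR i + 1) * ((1 - e) / INR n)) <= / e) by (apply Rinv_le_contravar; nra).
      unfold Rdiv at 1; replace (2 * K * r / e * (/ INR n) ^ 2) with (2 * K * r * (/ INR n) ^ 2 * / e)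
        by (unfold Rdiv; ring).
      apply Rmult_le_compat.
      + apply Rmult_le_pos; [exact Kr | apply pow2_ge_0].
      + left; apply Rinv_0_lt_compat; nra.
      + apply Rmult_le_compat_l; assumption.
      + exact z.
    - right; field; lra. }
  replace (mean_v 1 - mean_v 0)%C with ((mean_v 1 - mean_v e) + (mean_v e - mean_v 0))%C by ring.
  eapply Rle_trans; [apply Cmod_triangle|]; lra. }
pose proof (Cmod_ge_0 (mean_v 1 - mean_v 0)) as g.
assert (z : (mean_v 1 - mean_v 0)%C = 0%C) by (apply Cmod_eq_0; lra).
replace (mean_v 1) with ((mean_v 1 - mean_v 0) + mean_v 0)%C by ring; rewrite z; ring.
Qed.

Theorem cauchy_formula : v s = (RtoC (/ r) * Cint (fun x => u (s + RtoC r * circle x) * circle (- x)))%C.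
Proof.
assert (h0 : mean_v 0 = v s).
{ unfold mean_v; rewrite <- (Cint_const (v s)); apply Cint_ext; intros x _.
  unfold polar; f_equal; rewrite Rmult_0_l; ring. }
assert (h1 : mean_u 1 = Cint (fun x => u (s + RtoC r * circle x) * circle (- x))%C).
{ unfold mean_u; apply Cint_ext; intros x _; unfold polar; rewrite Rmult_1_l; reflexivity. }
rewrite <- h1, <- mean_relation, mean_v_constant, h0, Rmult_1_l by lra.
rewrite Cmult_assoc, <- RtoC_mult, Rinv_l by lra; ring.
Qed.

End Cauchy.

Lemma Cmod_self s : Cmod (s - s) = 0.
Proof. replace (s - s)%C with (RtoC 0) by ring; apply Cmod_0. Qed.

Lemma Cmod_sub_triangle a b c : Cmod (a - c) <= Cmod (a - b) + Cmod (b - c).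
Proof. replace (a - c)%C with ((a - b) + (b - c))%C by ring; apply Cmod_triangle. Qed.

Lemma Cmod_sub_sym a b : Cmod (a - b) = Cmod (b - a).
Proof. rewrite <- Cmod_opp; f_equal; ring. Qed.

Lemma C11_weaken s0 R K s1 R' K' u v : 0 <= K -> K <= K' -> Cmod (s1 - s0) + R' <= R ->
  C11 s0 R K u v -> C11 s1 R' K' u v.
Proof.
intros h0 hK hR h s t hs ht; eapply Rle_trans; [apply h|].
- pose proof (Cmod_sub_triangle s s1 s0); lra.
- pose proof (Cmod_sub_triangle t s1 s0); lra.
- apply Rmult_le_compat_r; [apply pow2_ge_0 | exact hK].
Qed.

Section CauchyEstimates.
Variables (s0 : C) (Rd K : R) (u v : C -> C).
Hypotheses (hK : 0 <= K) (hR : 0 < Rd) (hu : C11 s0 Rd K u v).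

Lemma cauchy_bound M s r : 0 < r -> Cmod (s - s0) + r < Rd ->
  (forall z, Cmod (z - s0) < Rd -> Cmod (u z) <= M) -> Cmod (v s) <= 2 * M / r.
Proof.
intros hr hs hM; rewrite (cauchy_formula s0 Rd K u v hK hu s r hr hs).
rewrite Cmod_mult, Cmod_R, Rabs_pos_eq by (left; apply Rinv_0_lt_compat; exact hr).
unfold Rdiv; rewrite Rmult_comm; apply Rmult_le_compat_r; [left; apply Rinv_0_lt_compat; exact hr|].
pose proof (Ccontinuous_mean_u s0 Rd K u v hK hu s r hr hs 1 ltac:(lra)) as hc.
assert (e : forall x, polar s r 1 x = (s + RtoC r * circle x)%C) by (intros; unfold polar; rewrite Rmult_1_l; reflexivity).
rewrite (Cint_ext _ (fun x => u (polar s r 1 x) * circle (- x))%C) by (intros; rewrite e; reflexivity).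
apply Cint_bound; [exact hc|].
intros x _; rewrite Cmod_mult, Cmod_circle, Rmult_1_r; apply hM.
apply (polar_in s0 Rd s r hr hs 1 x); lra.
Qed.

Lemma cauchy_difference s t r L : 0 < r -> Cmod (s - s0) + r < Rd -> Cmod (t - s0) + r < Rd ->
  forall w, (forall x, Cmod (u (t + RtoC r * circle x) - u (s + RtoC r * circle x) - w x) <= L) ->
  Ccontinuous w ->
  Cmod (v t - v s - RtoC (/ r) * Cint (fun x => w x * circle (- x))%C) <= 2 * L / r.
Proof.
intros hr hs ht w hL hw.
rewrite (cauchy_formula s0 Rd K u v hK hu s r hr hs), (cauchy_formula s0 Rd K u v hK hu t r hr ht).
assert (cs : Ccontinuous (fun x => u (s + RtoC r * circle x) * circle (- x))%C).
{ pose proof (Ccontinuous_mean_u s0 Rd K u v hK hu s r hr hs 1 ltac:(lra)) as h; unfold polar in h.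
  rewrite Rmult_1_l in h; exact h. }
assert (ct : Ccontinuous (fun x => u (t + RtoC r * circle x) * circle (- x))%C).
{ pose proof (Ccontinuous_mean_u s0 Rd K u v hK hu t r hr ht 1 ltac:(lra)) as h; unfold polar in h.
  rewrite Rmult_1_l in h; exact h. }
assert (cw : Ccontinuous (fun x => w x * circle (- x))%C)
  by (apply Ccontinuous_mult; [exact hw | apply Ccontinuous_circle_opp]).
match goal with |- Cmod ?e <= _ => replace e with (RtoC (/ r) *
  Cint (fun x => u (t + RtoC r * circle x) * circle (- x) +
     (Copp 1 * (u (s + RtoC r * circle x) * circle (- x)) + Copp 1 * (w x * circle (- x)))))%C end.
2:{ rewrite Cint_plus, Cint_plus, Cint_scal, Cint_scal by
      (auto; repeat apply Ccontinuous_plus; apply Ccontinuous_mult; auto using Ccontinuous_const).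
    ring. }
rewrite Cmod_mult, Cmod_R, Rabs_pos_eq by (left; apply Rinv_0_lt_compat; exact hr).
unfold Rdiv; rewrite Rmult_comm; apply Rmult_le_compat_r; [left; apply Rinv_0_lt_compat; exact hr|].
apply Cint_bound.
- repeat apply Ccontinuous_plus; auto; apply Ccontinuous_mult; auto using Ccontinuous_const.
- intros x _; eapply Rle_trans; [|apply (hL x)]; right.
  transitivity (Cmod ((u (t + RtoC r * circle x) - u (s + RtoC r * circle x) - w x) * circle (- x))).
  + f_equal; ring.
  + rewrite Cmod_mult, Cmod_circle; ring.
Qed.

(** The new constants depend on the bound [M] only and no longer on [K]. Circles of radius [Rd / 2]
    bound [v], so [u] is Lipschitz; circles of radius [Rd / 4] then make [v] Lipschitz, and the mean
    value inequality concludes. *)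
Theorem cauchy_C11 M : (forall z, Cmod (z - s0) < Rd -> Cmod (u z) <= M) ->
  C11 s0 (Rd / 4) (32 * M / Rd ^ 2) u v /\ (forall z, Cmod (z - s0) < Rd / 4 -> Cmod (v z) <= 4 * M / Rd).
Proof.
intros hM.
assert (M0 : 0 <= M).
{ eapply Rle_trans; [apply Cmod_ge_0 | apply (hM s0)]; rewrite Cmod_self; exact hR. }
assert (bv : forall z, Cmod (z - s0) < Rd / 2 -> Cmod (v z) <= 4 * M / Rd).
{ intros z hz; replace (4 * M / Rd) with (2 * M / (Rd / 2)) by (field; lra).
  apply cauchy_bound; auto; lra. }
assert (lu : forall a b, Cmod (a - s0) < Rd / 2 -> Cmod (b - s0) < Rd / 2 ->
   Cmod (u b - u a) <= 4 * M / Rd * Cmod (b - a)).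
{ intros a b ha hb; replace (u b - u a)%C with (u b - u a - 0 * (b - a))%C by ring.
  apply (C11_mean_value s0 Rd K u v a b); auto; try lra.
  intros l hl; replace (v (segment a b l) - 0)%C with (v (segment a b l)) by ring.
  apply bv, segment_in_disc; auto. }
assert (lv : forall a b, Cmod (a - s0) < Rd / 4 -> Cmod (b - s0) < Rd / 4 ->
   Cmod (v b - v a) <= 32 * M / Rd ^ 2 * Cmod (b - a)).
{ intros a b ha hb.
  pose proof (cauchy_difference a b (Rd / 4) (4 * M / Rd * Cmod (b - a)) ltac:(lra) ltac:(lra) ltac:(lra)
    (fun _ => RtoC 0)) as h.
  lapply h; clear h.
  - intros h; specialize (h (Ccontinuous_const _)).
    rewrite (Cint_ext _ (fun _ => RtoC 0)), Cint_const in h by (intros; ring).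
    replace (v b - v a - RtoC (/ (Rd / 4)) * 0)%C with (v b - v a)%C in h by ring.
    eapply Rle_trans; [exact h|]; right; field; lra.
  - intros x.
    replace (u (b + RtoC (Rd / 4) * circle x) - u (a + RtoC (Rd / 4) * circle x) - 0)%C with
      (u (b + RtoC (Rd / 4) * circle x) - u (a + RtoC (Rd / 4) * circle x))%C by ring.
    assert (in2 : forall z, Cmod (z - s0) < Rd / 4 -> Cmod (z + RtoC (Rd / 4) * circle x - s0) < Rd / 2).
    { intros z hz; replace (z + RtoC (Rd / 4) * circle x - s0)%C with ((z - s0) + RtoC (Rd / 4) * circle x)%C by ring.
      eapply Rle_lt_trans; [apply Cmod_triangle|].
      rewrite Cmod_mult, Cmod_circle, Cmod_R, Rabs_pos_eq by lra; lra. }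
    eapply Rle_trans; [apply lu; auto|]; right; f_equal; f_equal; ring. }
assert (KM : 0 <= 32 * M / Rd ^ 2) by (apply Rdiv_le_0_compat; [lra | apply pow_lt; exact hR]).
split; [|intros z hz; apply bv; lra].
intros a b ha hb.
replace (32 * M / Rd ^ 2 * Cmod (b - a) ^ 2) with (32 * M / Rd ^ 2 * Cmod (b - a) * Cmod (b - a)) by ring.
apply (C11_mean_value s0 Rd K u v a b); auto; try lra.
intros l hl; eapply Rle_trans; [apply lv; auto; apply segment_in_disc; auto; lra|].
apply Rmult_le_compat_l; [exact KM|]; unfold segment.
replace (a + RtoC l * (b - a) - a)%C with (RtoC l * (b - a))%C by ring.
rewrite Cmod_mult, Cmod_R, Rabs_pos_eq by lra; pose proof (Cmod_ge_0 (b - a)); nra.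
Qed.

(** Cauchy's formula writes [v t - v s] as a mean of the differences of [u] on two translated
    circles, and on these the error of [u] is already quadratic in [t - s]. *)
Theorem derivative_C11 : exists w, C11 s0 (Rd / 2) (4 * K / Rd) v w.
Proof.
exists (fun s => RtoC (/ (Rd / 2)) * Cint (fun x => v (s + RtoC (Rd / 2) * circle x) * circle (- x)))%C.
intros s t hs ht.
pose proof (cauchy_difference s t (Rd / 2) (K * Cmod (t - s) ^ 2) ltac:(lra) ltac:(lra) ltac:(lra)
  (fun x => v (s + RtoC (Rd / 2) * circle x) * (t - s))%C) as h.
assert (inR : forall x z, Cmod (z - s0) < Rd / 2 -> Cmod (z + RtoC (Rd / 2) * circle x - s0) < Rd).
{ intros x z hz; replace (z + RtoC (Rd / 2) * circle x - s0)%C with ((z - s0) + RtoC (Rd / 2) * circle x)%C by ring.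
  eapply Rle_lt_trans; [apply Cmod_triangle|].
  rewrite Cmod_mult, Cmod_circle, Cmod_R, Rabs_pos_eq by lra; lra. }
assert (cp : Ccontinuous (fun x => s + RtoC (Rd / 2) * circle x)%C).
{ apply Ccontinuous_plus; [apply Ccontinuous_const|]; apply Ccontinuous_mult; [apply Ccontinuous_const | apply Ccontinuous_circle]. }
assert (cv : Ccontinuous (fun x => v (s + RtoC (Rd / 2) * circle x))).
{ apply (Ccontinuous_comp_v s0 Rd K u v hK hu); auto. }
lapply h; clear h.
- intros h; lapply h; clear h; [intros h | apply Ccontinuous_mult; [exact cv | apply Ccontinuous_const]].
  rewrite (Cint_ext _ (fun x => (t - s) * (v (s + RtoC (Rd / 2) * circle x) * circle (- x)))%C) in h by (intros; ring).
  rewrite Cint_scal in h by (apply Ccontinuous_mult; [exact cv | apply Ccontinuous_circle_opp]).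
  match type of h with Cmod ?e <= ?b => match goal with |- Cmod ?e' <= ?b' =>
    replace e' with e by ring; replace b' with b by (field; lra); exact h end end.
- intros x; pose proof (hu (s + RtoC (Rd / 2) * circle x)%C (t + RtoC (Rd / 2) * circle x)%C
    (inR x s hs) (inR x t ht)) as q.
  replace (t + RtoC (Rd / 2) * circle x - (s + RtoC (Rd / 2) * circle x))%C with (t - s)%C in q by ring.
  exact q.
Qed.

End CauchyEstimates.

(** * The class of holomorphic functions *)

Definition holC (u : C -> C) (s0 : C) : Prop :=
  exists R K v, 0 < R /\ 0 <= K /\ C11 s0 R K u v.

Definition entire (u v : C -> C) : Prop := forall R, exists K, 0 <= K /\ C11 0 R K u v.

Lemma entire_C11 u v s0 R : entire u v -> exists K, 0 <= K /\ C11 s0 R K u v.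
Proof.
intros h; destruct (h (Cmod s0 + R)) as [K [hK hC]]; exists K; split; [exact hK|].
apply (C11_weaken 0 (Cmod s0 + R) K s0 R K u v); auto; [lra|].
replace (s0 - 0)%C with s0 by ring; lra.
Qed.

Lemma entire_holC u v s0 : entire u v -> holC u s0.
Proof. intros h; destruct (entire_C11 u v s0 1 h) as [K [hK hC]]; exists 1, K, v; repeat split; auto; lra. Qed.

Section Weierstrass.
Context {T : Type}.
Variables (A : T -> Prop) (u v : T -> C -> C) (M : T -> R) (B : R) (S : C -> C) (s0 : C) (Rd : R).
Hypotheses (hR : 0 < Rd)
  (hu : forall i, A i -> exists K, 0 <= K /\ C11 s0 Rd K (u i) (v i))
  (hM : forall i, A i -> forall s, Cmod (s - s0) < Rd -> Cmod (u i s) <= M i)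
  (hB : rbound A M B)
  (hS : forall s, Cmod (s - s0) < Rd -> has_sum A (fun i => u i s) (S s)).

(** By [cauchy_C11] the errors of the terms are bounded by a multiple of [M i], so they can be
    summed. The constants [K] of the single terms may be unbounded in [i]. *)
Theorem weierstrass : holC S s0.
Proof.
assert (hv : forall s, Cmod (s - s0) < Rd / 4 -> exists l, has_sum A (fun i => v i s) l).
{ intros s hs; apply has_sum_exists with (a := fun i => 4 / Rd * M i) (B := 4 / Rd * B).
  - intros i hi; destruct (hu i hi) as [K [hK hC]].
    destruct (cauchy_C11 s0 Rd K (u i) (v i) hK hR hC (M i) (hM i hi)) as [_ h].
    eapply Rle_trans; [apply h; exact hs|]; right; field; lra.
  - apply rbound_scal; auto; left; apply Rdiv_lt_0_compat; lra. }
(* The derivative of the sum is the sum of the derivatives, whose convergence is [hv]. *)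
set (V := fun s => epsilon (inhabits (RtoC 0)) (fun l => has_sum A (fun i => v i s) l)).
assert (hV : forall s, Cmod (s - s0) < Rd / 4 -> has_sum A (fun i => v i s) (V s)).
{ intros s hs; unfold V; apply epsilon_spec, hv, hs. }
assert (B0 : 0 <= B) by (apply (rbound_pos A M), hB).
exists (Rd / 4), (32 / Rd ^ 2 * B), V; repeat split.
- lra.
- apply Rmult_le_pos; auto; apply Rdiv_le_0_compat; [lra | apply pow_lt; exact hR].
- intros s t hs ht.
  replace (32 / Rd ^ 2 * B * Cmod (t - s) ^ 2) with (32 / Rd ^ 2 * Cmod (t - s) ^ 2 * B) by ring.
  apply has_sum_bound with (A := A) (u := fun i => (u i t - u i s - v i s * (t - s))%C)
    (a := fun i => 32 / Rd ^ 2 * Cmod (t - s) ^ 2 * M i).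
  + intros i hi; destruct (hu i hi) as [K [hK hC]].
    destruct (cauchy_C11 s0 Rd K (u i) (v i) hK hR hC (M i) (hM i hi)) as [h _].
    eapply Rle_trans; [apply h; auto|]; right; field; lra.
  + apply rbound_scal; auto; apply Rmult_le_pos; [|apply pow2_ge_0].
    apply Rdiv_le_0_compat; [lra | apply pow_lt; exact hR].
  + replace (S t - S s - V s * (t - s))%C with (S t + (Copp 1 * S s + Copp (t - s) * V s))%C by ring.
    apply has_sum_ext with (fun i => u i t + (Copp 1 * u i s + Copp (t - s) * v i s))%C; [intros; ring|].
    apply has_sum_plus; [apply hS; lra|]; apply has_sum_plus; apply has_sum_scal; [apply hS; lra | apply hV, hs].
Qed.

End Weierstrass.

Lemma C11_plus s0 R K K' u v u' v' : C11 s0 R K u v -> C11 s0 R K' u' v' ->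
  C11 s0 R (K + K') (fun s => u s + u' s)%C (fun s => v s + v' s)%C.
Proof.
intros h h' s t hs ht; specialize (h s t hs ht); specialize (h' s t hs ht).
replace (u t + u' t - (u s + u' s) - (v s + v' s) * (t - s))%C with
  ((u t - u s - v s * (t - s)) + (u' t - u' s - v' s * (t - s)))%C by ring.
eapply Rle_trans; [apply Cmod_triangle|]; lra.
Qed.

Lemma C11_const s0 R c : C11 s0 R 0 (fun _ => c) (fun _ => 0%C).
Proof.
intros s t _ _; replace (c - c - 0 * (t - s))%C with (RtoC 0) by ring; rewrite Cmod_0; lra.
Qed.

Lemma C11_id s0 R : C11 s0 R 0 (fun s => s) (fun _ => 1%C).
Proof.
intros s t _ _; replace (t - s - 1 * (t - s))%C with (RtoC 0) by ring; rewrite Cmod_0; lra.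
Qed.

Lemma C11_lipschitz s0 R K u v : 0 <= K -> 0 < R -> C11 s0 R K u v ->
  exists L, 0 <= L /\ (forall s t, Cmod (s - s0) < R -> Cmod (t - s0) < R ->
    Cmod (u t - u s) <= L * Cmod (t - s)) /\
  (forall s, Cmod (s - s0) < R -> Cmod (u s) <= L /\ Cmod (v s) <= L).
Proof.
intros hK hR h.
set (L := Cmod (v s0) + 2 * K * R + 2 * K * R).
pose proof (Cmod_ge_0 (v s0)) as p0; pose proof (Cmod_ge_0 (u s0)) as p1.
assert (KR : 0 <= K * R) by (apply Rmult_le_pos; lra).
assert (hL : forall s t, Cmod (s - s0) < R -> Cmod (t - s0) < R -> Cmod (u t - u s) <= L * Cmod (t - s)).
{ intros s t hs ht; eapply Rle_trans; [apply (C11_increment s0 R K u v hK h); auto|].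
  assert (d : Cmod (t - s) <= 2 * R).
  { pose proof (Cmod_sub_triangle t s0 s); rewrite (Cmod_sub_sym s0 s) in *; lra. }
  pose proof (Cmod_ge_0 (t - s)) as q.
  assert (K * Cmod (t - s) ^ 2 <= K * (2 * R * Cmod (t - s))).
  { apply Rmult_le_compat_l; [exact hK|]; simpl; rewrite Rmult_1_r; apply Rmult_le_compat_r; lra. }
  unfold L; nra. }
exists (L + (Cmod (u s0) + L * R)).
assert (L0 : 0 <= L) by (unfold L; lra).
assert (LR : 0 <= L * R) by (apply Rmult_le_pos; lra).
split; [lra|split].
- intros s t hs ht; eapply Rle_trans; [apply hL; auto|]; apply Rmult_le_compat_r; [apply Cmod_ge_0 | lra].
- intros s hs; split.
  + assert (h0 : Cmod (s0 - s0) < R) by (rewrite Cmod_self; exact hR).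
    specialize (hL s0 s h0 hs); replace (u s) with (u s0 + (u s - u s0))%C by ring.
    eapply Rle_trans; [apply Cmod_triangle|].
    assert (L * Cmod (s - s0) <= L * R) by (apply Rmult_le_compat_l; lra); lra.
  + eapply Rle_trans; [apply (C11_v_bound s0 R K u v hK h s hs)|].
    assert (Cmod (v s0) + 2 * K * R <= L) by (unfold L; lra); lra.
Qed.

Lemma C11_mult s0 R K K' u v u' v' : 0 <= K -> 0 <= K' -> 0 < R -> C11 s0 R K u v -> C11 s0 R K' u' v' ->
  exists K2, 0 <= K2 /\ C11 s0 R K2 (fun s => u s * u' s)%C (fun s => v s * u' s + u s * v' s)%C.
Proof.
intros hK hK' hR h h'.
destruct (C11_lipschitz _ _ _ _ _ hK hR h) as [L [L0 [lip bd]]].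
destruct (C11_lipschitz _ _ _ _ _ hK' hR h') as [L' [L0' [lip' bd']]].
exists (K * L' + L * K' + L * L'); split; [nra|].
intros s t hs ht; specialize (h s t hs ht); specialize (h' s t hs ht); specialize (lip s t hs ht);
  specialize (lip' s t hs ht); destruct (bd s hs) as [bu _]; destruct (bd' s hs) as [bu' _].
replace (u t * u' t - u s * u' s - (v s * u' s + u s * v' s) * (t - s))%C with
  ((u t - u s - v s * (t - s)) * u' s + u s * (u' t - u' s - v' s * (t - s)) + (u t - u s) * (u' t - u' s))%C by ring.
eapply Rle_trans; [apply Cmod_triangle|].
eapply Rle_trans; [apply Rplus_le_compat_r, Cmod_triangle|]; rewrite !Cmod_mult.
set (d := Cmod (t - s)) in *; assert (d0 : 0 <= d) by apply Cmod_ge_0.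
assert (t1 := Rmult_le_compat _ _ _ _ (Cmod_ge_0 _) (Cmod_ge_0 _) h bu').
assert (t2 := Rmult_le_compat _ _ _ _ (Cmod_ge_0 _) (Cmod_ge_0 _) bu h').
assert (t3 := Rmult_le_compat _ _ _ _ (Cmod_ge_0 _) (Cmod_ge_0 _) lip lip').
replace ((K * L' + L * K' + L * L') * d ^ 2) with (K * d ^ 2 * L' + L * (K' * d ^ 2) + L * d * (L' * d)) by ring.
lra.
Qed.

Lemma holC_shrink u s0 : holC u s0 -> forall rho, 0 < rho ->
  exists R K v, 0 < R <= rho /\ 0 <= K /\ C11 s0 R K u v.
Proof.
intros [R [K [v [hR [hK h]]]]] rho hr; exists (Rmin R rho), K, v.
split; [split; [apply Rmin_glb_lt; auto | apply Rmin_r]|]; split; [exact hK|].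
apply (C11_weaken s0 R K s0 _ K u v); auto; [lra|]; rewrite Cmod_self; pose proof (Rmin_l R rho); lra.
Qed.

Lemma holC_ext u u' s0 rho : 0 < rho -> (forall s, Cmod (s - s0) < rho -> u s = u' s) ->
  holC u s0 -> holC u' s0.
Proof.
intros hr e h; destruct (holC_shrink u s0 h rho hr) as [R [K [v [hR [hK hC]]]]].
exists R, K, v; repeat split; auto; [lra|]; intros s t hs ht; rewrite <- !e by lra; apply hC; auto.
Qed.

Lemma holC_const c s0 : holC (fun _ => c) s0.
Proof. exists 1, 0, (fun _ => 0%C); repeat split; try lra; apply C11_const. Qed.

Lemma holC_id s0 : holC (fun s => s) s0.
Proof. exists 1, 0, (fun _ => 1%C); repeat split; try lra; apply C11_id. Qed.

Lemma holC_plus u u' s0 : holC u s0 -> holC u' s0 -> holC (fun s => u s + u' s)%C s0.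
Proof.
intros [R [K [v [hR [hK h]]]]] h'.
destruct (holC_shrink u' s0 h' R hR) as [R' [K' [v' [hR' [hK' hC']]]]].
exists R', (K + K'), (fun s => v s + v' s)%C; repeat split; try lra.
apply C11_plus; auto; apply (C11_weaken s0 R K s0 R' K u v); auto; [lra|]; rewrite Cmod_self; lra.
Qed.

Lemma holC_mult u u' s0 : holC u s0 -> holC u' s0 -> holC (fun s => u s * u' s)%C s0.
Proof.
intros [R [K [v [hR [hK h]]]]] h'.
destruct (holC_shrink u' s0 h' R hR) as [R' [K' [v' [hR' [hK' hC']]]]].
assert (h2 : C11 s0 R' K u v).
{ apply (C11_weaken s0 R K s0 R' K u v); auto; [lra|]; rewrite Cmod_self; lra. }
destruct (C11_mult s0 R' K K' u v u' v' hK hK' ltac:(lra) h2 hC') as [K2 [hK2 h3]].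
exists R', K2, (fun s => v s * u' s + u s * v' s)%C; repeat split; auto; lra.
Qed.

Lemma holC_opp u s0 : holC u s0 -> holC (fun s => - u s)%C s0.
Proof.
intros h; apply holC_ext with (u := fun s => (Copp 1 * u s)%C) (rho := 1); [lra | intros; ring|].
apply holC_mult; [apply holC_const | exact h].
Qed.

Lemma holC_minus u u' s0 : holC u s0 -> holC u' s0 -> holC (fun s => u s - u' s)%C s0.
Proof. intros h h'; apply holC_plus; [exact h | apply holC_opp, h']. Qed.

Lemma holC_inv u s0 : holC u s0 -> u s0 <> 0%C -> holC (fun s => / u s)%C s0.
Proof.
intros h nz; set (c := Cmod (u s0) / 2).
assert (c0 : 0 < c) by (apply Cmod_gt_0 in nz; unfold c; lra).
destruct h as [R [K [v [hR [hK h]]]]].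
destruct (C11_lipschitz _ _ _ _ _ hK hR h) as [L [L0 [lip bd]]].
set (r := Rmin R (c / (L + 1))).
assert (r0 : 0 < r) by (apply Rmin_glb_lt; [lra | apply Rdiv_lt_0_compat; lra]).
assert (rR : r <= R) by apply Rmin_l.
assert (low : forall s, Cmod (s - s0) < r -> c <= Cmod (u s)).
{ intros s hs; assert (h0 : Cmod (s0 - s0) < R) by (rewrite Cmod_self; lra).
  specialize (lip s0 s h0 ltac:(lra)).
  assert (L * Cmod (s - s0) <= c).
  { assert (hs' := Rlt_le_trans _ _ _ hs (Rmin_r _ _)); pose proof (Cmod_ge_0 (s - s0)).
    apply Rle_trans with ((L + 1) * (c / (L + 1))); [nra | right; field; lra]. }
  pose proof (Cmod_triangle (u s) (u s0 - u s)) as q.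
  replace (u s + (u s0 - u s))%C with (u s0) in q by ring.
  rewrite (Cmod_sub_sym (u s0)) in q; unfold c in *; lra. }
exists r, ((K * L + L * L) / c ^ 3), (fun s => - v s / (u s * u s))%C.
assert (c3 : 0 < c ^ 3) by (apply pow_lt; lra).
split; [lra|split; [apply Rdiv_le_0_compat; nra|]].
intros s t hs ht; pose proof (low s hs) as ls; pose proof (low t ht) as lt'.
specialize (h s t ltac:(lra) ltac:(lra)); specialize (lip s t ltac:(lra) ltac:(lra)).
destruct (bd s ltac:(lra)) as [bu bv].
assert (us : u s <> 0%C) by (intros e; rewrite e, Cmod_0 in ls; lra).
assert (ut : u t <> 0%C) by (intros e; rewrite e, Cmod_0 in lt'; lra).
replace (/ u t - / u s - - v s / (u s * u s) * (t - s))%C with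
  ((- (u t - u s - v s * (t - s)) * u s + v s * (t - s) * (u t - u s)) / (u t * (u s * u s)))%C
  by (field; split; assumption).
unfold Cdiv; rewrite Cmod_mult, Cmod_inv, !Cmod_mult by (repeat apply Cmult_neq_0; assumption).
assert (den : c ^ 3 <= Cmod (u t) * (Cmod (u s) * Cmod (u s))).
{ replace (c ^ 3) with (c * (c * c)) by ring; apply Rmult_le_compat; try nra. }
assert (num : Cmod (- (u t - u s - v s * (t - s)) * u s + v s * (t - s) * (u t - u s)) <=
   (K * L + L * L) * Cmod (t - s) ^ 2).
{ eapply Rle_trans; [apply Cmod_triangle|]; rewrite !Cmod_mult, Cmod_opp.
  set (d := Cmod (t - s)) in *; assert (d0 : 0 <= d) by apply Cmod_ge_0.
  assert (t1 := Rmult_le_compat _ _ _ _ (Cmod_ge_0 _) (Cmod_ge_0 _) h bu).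
  assert (t2 : Cmod (v s) * d * Cmod (u t - u s) <= L * d * (L * d)).
  { apply Rmult_le_compat; auto using Cmod_ge_0; [apply Rmult_le_pos; auto using Cmod_ge_0|].
    apply Rmult_le_compat_r; auto. }
  replace ((K * L + L * L) * d ^ 2) with (K * d ^ 2 * L + L * d * (L * d)) by ring; lra. }
replace ((K * L + L * L) / c ^ 3 * Cmod (t - s) ^ 2) with ((K * L + L * L) * Cmod (t - s) ^ 2 * / c ^ 3)
  by (field; lra).
apply Rmult_le_compat; auto using Cmod_ge_0.
- left; apply Rinv_0_lt_compat; lra.
- apply Rinv_le_contravar; assumption.
Qed.

Lemma holC_affine u a b s0 : holC u (a * s0 + b)%C -> holC (fun s => u (a * s + b)%C) s0.
Proof.
intros [R [K [v [hR [hK h]]]]]; pose proof (Cmod_ge_0 a) as ha.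
exists (R / (Cmod a + 1)), (K * Cmod a ^ 2), (fun s => a * v (a * s + b))%C.
split; [apply Rdiv_lt_0_compat; lra|split].
{ apply Rmult_le_pos; [exact hK | apply pow2_ge_0]. }
assert (ind : forall s, Cmod (s - s0) < R / (Cmod a + 1) -> Cmod (a * s + b - (a * s0 + b)) < R).
{ intros s hs; replace (a * s + b - (a * s0 + b))%C with (a * (s - s0))%C by ring; rewrite Cmod_mult.
  pose proof (Cmod_ge_0 (s - s0)).
  apply Rle_lt_trans with ((Cmod a + 1) * Cmod (s - s0)); [nra|].
  apply Rlt_le_trans with ((Cmod a + 1) * (R / (Cmod a + 1))); [apply Rmult_lt_compat_l; lra | right; field; lra]. }
intros s t hs ht; specialize (h _ _ (ind s hs) (ind t ht)).
replace (a * t + b - (a * s + b))%C with (a * (t - s))%C in h by ring.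
rewrite (Cmod_mult a), Rpow_mult_distr, <- Rmult_assoc in h.
replace (a * v (a * s + b) * (t - s))%C with (v (a * s + b) * (a * (t - s)))%C by ring; exact h.
Qed.

Lemma locally_Cmod z0 (P : C -> Prop) :
  (exists e, 0 < e /\ forall y, Cmod (y - z0) < e -> P y) <-> @locally C_UniformSpace z0 P.
Proof.
rewrite locally_C; split.
- intros [e [he h]]; exists (mkposreal e he); intros y hy; apply h, hy.
- intros [e h]; exists e; split; [apply cond_pos | intros y hy; apply h, hy].
Qed.

Lemma Cderive_of_error u s l : (forall eps, 0 < eps -> exists del, 0 < del /\
    forall t, Cmod (t - s) < del -> Cmod (u t - u s - l * (t - s)) <= eps * Cmod (t - s)) ->
  @is_derive C_AbsRing C_NormedModule u s l.
Proof.
intros h; split; [apply is_linear_scal_l|].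
intros x hx; apply (is_filter_lim_locally_unique (V := AbsRing_NormedModule C_AbsRing)) in hx; subst x.
intros eps; destruct (h eps (cond_pos eps)) as [d [d0 hd]].
exists (mkposreal d d0); intros t ht.
assert (e : Cmod (u t - u s - l * (t - s)) <= eps * Cmod (t - s)) by (apply hd, ht).
replace (u t - u s - l * (t - s))%C with (u t - u s - (t - s) * l)%C in e by ring; exact e.
Qed.

Lemma holC_holomorphic u s0 : holC u s0 -> holomorphic_at u s0.
Proof.
intros [R [K [v [hR [hK h]]]]]; apply locally_Cmod; exists R; split; [exact hR|].
intros s hs; exists (v s); apply Cderive_of_error; intros eps he.
exists (Rmin (R - Cmod (s - s0)) (eps / (K + 1))); split.
{ apply Rmin_glb_lt; [lra | apply Rdiv_lt_0_compat; lra]. }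
intros t ht; assert (t1 := Rlt_le_trans _ _ _ ht (Rmin_l _ _)); assert (t2 := Rlt_le_trans _ _ _ ht (Rmin_r _ _)).
eapply Rle_trans; [apply h; auto; pose proof (Cmod_sub_triangle t s s0); lra|].
pose proof (Cmod_ge_0 (t - s)) as p.
replace (K * Cmod (t - s) ^ 2) with ((K * Cmod (t - s)) * Cmod (t - s)) by ring.
apply Rmult_le_compat_r; [exact p|].
apply Rle_trans with ((K + 1) * (eps / (K + 1))); [nra | right; field; lra].
Qed.

(** Removable singularity. Differentiability of the quotient at [s0] needs the expansion of [u] to
    second order, hence the derivative [w] of [v]. It separates the residue from the regular part at
    a simple pole. *)
Theorem holC_quotient u s0 : holC u s0 ->
  exists q, holomorphic_at q s0 /\ forall s, s <> s0 -> q s = ((u s - u s0) / (s - s0))%C.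
Proof.
intros [R [K [v [hR [hK h]]]]].
destruct (derivative_C11 s0 R K u v hK hR h) as [w hw].
set (K' := 4 * K / R) in *.
assert (K'0 : 0 <= K') by (apply Rdiv_le_0_compat; lra).
set (q := fun s => if excluded_middle_informative (s = s0) then v s0 else ((u s - u s0) / (s - s0))%C).
exists q; split.
2:{ intros s hs; unfold q; destruct excluded_middle_informative; [contradiction | reflexivity]. }
assert (c0 : Cmod (s0 - s0) < R / 2) by (rewrite Cmod_self; lra).
assert (taylor : forall s, Cmod (s - s0) < R / 2 ->
  Cmod (u s - u s0 - v s0 * (s - s0) - RtoC (/ 2) * w s0 * (s - s0) * (s - s0)) <= K' * Cmod (s - s0) ^ 3).
{ intros s hs.
  (* Up to a constant, [U] is [u] minus its Taylor polynomial of degree 2. Its derivative [U'] is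
     the first-order error of [v], bounded by [K'] times a square. *)
  set (U := fun z => (u z + (Copp (v s0) * z + Copp (RtoC (/ 2) * w s0) * ((z - s0) * (z - s0))))%C).
  set (U' := fun z => (v z + (Copp (v s0) + Copp (RtoC (/ 2) * w s0) * (2 * (z - s0))))%C).
  assert (hU : C11 s0 (R / 2) (K + Cmod (RtoC (/ 2) * w s0)) U U').
  { intros a b ha hb; specialize (h a b ltac:(lra) ltac:(lra)).
    replace (U b - U a - U' a * (b - a))%C with
      ((u b - u a - v a * (b - a)) + Copp (RtoC (/ 2) * w s0) * ((b - a) * (b - a)))%C by (unfold U, U'; ring).
    eapply Rle_trans; [apply Cmod_triangle|]; rewrite Cmod_mult, Cmod_opp, (Cmod_mult (b - a)).
    lra. }
  pose proof (C11_mean_value s0 (R / 2) (K + Cmod (RtoC (/ 2) * w s0)) U U' s0 s 0 (K' * Cmod (s - s0) ^ 2)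
    ltac:(pose proof (Cmod_ge_0 (RtoC (/ 2) * w s0)); lra) hU c0 hs) as m.
  lapply m; clear m.
  - intros m; replace (U s - U s0 - 0 * (s - s0))%C with
      (u s - u s0 - v s0 * (s - s0) - RtoC (/ 2) * w s0 * (s - s0) * (s - s0))%C in m by (unfold U; ring).
    eapply Rle_trans; [exact m|]; right; ring.
  - intros l hl; pose proof (segment_in_disc s0 (R / 2) s0 s l hl c0 hs) as hz.
    specialize (hw s0 (segment s0 s l) c0 hz).
    replace (U' (segment s0 s l) - 0)%C with (v (segment s0 s l) - v s0 - w s0 * (segment s0 s l - s0))%C.
    2:{ unfold U'. replace (RtoC (/2)) with (/ 2)%C by (rewrite <- RtoC_inv; [reflexivity | lra]). field. }
    eapply Rle_trans; [exact hw|]; apply Rmult_le_compat_l; [exact K'0|].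
    apply pow_incr; split; [apply Cmod_ge_0|]; unfold segment.
    replace (s0 + RtoC l * (s - s0) - s0)%C with (RtoC l * (s - s0))%C by ring.
    rewrite Cmod_mult, Cmod_R, Rabs_pos_eq by lra; pose proof (Cmod_ge_0 (s - s0)); nra. }
apply locally_Cmod; exists (R / 2); split; [lra|]; intros s hs.
destruct (classic (s = s0)) as [->|ne].
- exists (RtoC (/ 2) * w s0)%C; apply Cderive_of_error; intros eps he.
  exists (Rmin (R / 2) (eps / (K' + 1))); split; [apply Rmin_glb_lt; [lra | apply Rdiv_lt_0_compat; lra]|].
  intros t ht; assert (t1 := Rlt_le_trans _ _ _ ht (Rmin_l _ _)); assert (t2 := Rlt_le_trans _ _ _ ht (Rmin_r _ _)).
  unfold q; destruct (excluded_middle_informative (s0 = s0)) as [_|no]; [|contradiction].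
  destruct (excluded_middle_informative (t = s0)) as [->|tne].
  + replace (v s0 - v s0 - RtoC (/ 2) * w s0 * (s0 - s0))%C with (RtoC 0) by ring.
    rewrite Cmod_0, Cmod_self; lra.
  + assert (nz : (t - s0)%C <> 0%C).
    { intros e; apply tne; replace t with ((t - s0) + s0)%C by ring; rewrite e; ring. }
    assert (p : 0 < Cmod (t - s0)) by (apply Cmod_gt_0; exact nz).
    apply Rmult_le_reg_r with (Cmod (t - s0)); [exact p|]; rewrite <- Cmod_mult.
    replace (((u t - u s0) / (t - s0) - v s0 - RtoC (/ 2) * w s0 * (t - s0)) * (t - s0))%C with
      (u t - u s0 - v s0 * (t - s0) - RtoC (/ 2) * w s0 * (t - s0) * (t - s0))%C by (field; exact nz).
    eapply Rle_trans; [apply taylor; exact t1|].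
    replace (K' * Cmod (t - s0) ^ 3) with (K' * Cmod (t - s0) * Cmod (t - s0) * Cmod (t - s0)) by ring.
    apply Rmult_le_compat_r; [lra|]; apply Rmult_le_compat_r; [lra|].
    apply Rle_trans with ((K' + 1) * (eps / (K' + 1))); [nra | right; field; lra].
- assert (nz : (s - s0)%C <> 0%C).
  { intros e; apply ne; replace s with ((s - s0) + s0)%C by ring; rewrite e; ring. }
  assert (p : 0 < Cmod (s - s0)) by (apply Cmod_gt_0; exact nz).
  assert (hq : holC q s).
  { apply holC_ext with (u := fun z => ((u z - u s0) * / (z - s0))%C) (rho := Cmod (s - s0)); [exact p| |].
    - intros z hz; unfold q; destruct excluded_middle_informative as [->|]; [|reflexivity].
      rewrite Cmod_sub_sym in hz; lra.
    - apply holC_mult.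
      + apply holC_minus; [|apply holC_const].
        exists (R / 2), K, v; split; [lra|split; [exact hK|]].
        apply (C11_weaken s0 R K s (R / 2) K u v); auto; lra.
      + apply holC_inv; [apply holC_minus; [apply holC_id | apply holC_const] | exact nz]. }
  apply holC_holomorphic, locally_Cmod in hq; destruct hq as [e [he hq]].
  apply hq; rewrite Cmod_self; exact he.
Qed.

Lemma entire_const c : entire (fun _ => c) (fun _ => 0%C).
Proof. intros R; exists 0; split; [lra | apply C11_const]. Qed.

Lemma entire_plus u v u' v' : entire u v -> entire u' v' -> entire (fun s => u s + u' s)%C (fun s => v s + v' s)%C.
Proof.
intros h h' R; destruct (h R) as [K [hK hC]]; destruct (h' R) as [K' [hK' hC']].
exists (K + K'); split; [lra | apply C11_plus; auto].
Qed.

Lemma entire_mult u v u' v' : entire u v -> entire u' v' ->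
  entire (fun s => u s * u' s)%C (fun s => v s * u' s + u s * v' s)%C.
Proof.
intros h h' R; destruct (h (Rmax 1 R)) as [K [hK hC]]; destruct (h' (Rmax 1 R)) as [K' [hK' hC']].
assert (r1 : 0 < Rmax 1 R) by (pose proof (Rmax_l 1 R); lra).
destruct (C11_mult 0 _ K K' u v u' v' hK hK' r1 hC hC') as [K2 [hK2 h2]].
exists K2; split; [exact hK2|].
apply (C11_weaken 0 (Rmax 1 R) K2 0 R K2); auto; [lra|]; rewrite Cmod_self; pose proof (Rmax_r 1 R); lra.
Qed.

Lemma entire_csum {T} (l : list T) (u v : T -> C -> C) : (forall i, In i l -> entire (u i) (v i)) ->
  entire (fun s => csum (fun i => u i s) l) (fun s => csum (fun i => v i s) l).
Proof.
induction l as [|x l IH]; intros h.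
- exact (entire_const 0).
- apply (entire_plus (u x) (v x)); [apply h; left; reflexivity | apply IH; intros; apply h; right; auto].
Qed.

(** The constant is uniform in [lam], so that the estimate can be integrated over a bounded family
    of exponents. *)
Lemma cexp_C11 Lam R : 0 <= Lam -> exists K, 0 <= K /\ forall lam, Cmod lam <= Lam ->
  C11 0 R K (fun s => cexp (s * lam)) (fun s => lam * cexp (s * lam))%C.
Proof.
intros hL; set (R' := Rmax R 0); assert (R'0 : 0 <= R') by apply Rmax_r.
set (E := exp (R' * Lam)); set (E2 := exp (2 * R' * Lam)).
assert (0 < E) by apply exp_pos; assert (0 < E2) by apply exp_pos.
exists (E * (3 * Lam ^ 2 * E2)); split.
{ pose proof (pow2_ge_0 Lam); repeat apply Rmult_le_pos; lra. }
intros lam hl s t hs ht.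
assert (cs : Cmod s < R) by (replace s with (s - 0)%C by ring; exact hs).
assert (ct : Cmod t < R) by (replace t with (t - 0)%C by ring; exact ht).
assert (rr : R <= R') by apply Rmax_l.
pose proof (Cmod_ge_0 lam); pose proof (Cmod_ge_0 s).
assert (d : Cmod (t - s) <= 2 * R').
{ pose proof (Cmod_sub_triangle t 0 s) as q; replace (t - 0)%C with t in q by ring.
  replace (0 - s)%C with (- s)%C in q by ring; rewrite Cmod_opp in q; lra. }
replace (cexp (t * lam) - cexp (s * lam) - lam * cexp (s * lam) * (t - s))%C with
  (cexp (s * lam) * (cexp ((t - s) * lam) - 1 - (t - s) * lam))%C.
2:{ replace (t * lam)%C with (s * lam + (t - s) * lam)%C by ring; rewrite cexp_plus; ring. }
rewrite Cmod_mult, Cmod_cexp.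
assert (e1 : exp (Re (s * lam)) <= E).
{ apply exp_incr; eapply Rle_trans; [apply Rle_abs|]; eapply Rle_trans; [apply re_le_Cmod|].
  rewrite Cmod_mult; apply Rmult_le_compat; lra. }
assert (e2 : Cmod (cexp ((t - s) * lam) - 1 - (t - s) * lam) <= 3 * Lam ^ 2 * E2 * Cmod (t - s) ^ 2).
{ eapply Rle_trans; [apply cexp_quadratic|]; rewrite Cmod_mult.
  pose proof (Cmod_ge_0 (t - s)) as p.
  assert (exp (Cmod (t - s) * Cmod lam) <= E2).
  { apply exp_incr; apply Rmult_le_compat; lra. }
  assert (Cmod lam ^ 2 <= Lam ^ 2) by (apply pow_incr; lra).
  rewrite Rpow_mult_distr; pose proof (pow2_ge_0 (Cmod (t - s))); pose proof (pow2_ge_0 (Cmod lam)).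
  assert (3 * (Cmod (t - s) ^ 2 * Cmod lam ^ 2) <= 3 * (Cmod (t - s) ^ 2 * Lam ^ 2)).
  { apply Rmult_le_compat_l; [lra|]; apply Rmult_le_compat_l; lra. }
  assert (0 <= 3 * (Cmod (t - s) ^ 2 * Cmod lam ^ 2)) by (apply Rmult_le_pos; [lra | apply Rmult_le_pos; lra]).
  pose proof (exp_pos (Cmod (t - s) * Cmod lam)).
  replace (3 * Lam ^ 2 * E2 * Cmod (t - s) ^ 2) with (3 * (Cmod (t - s) ^ 2 * Lam ^ 2) * E2) by ring.
  apply Rmult_le_compat; lra. }
rewrite Rmult_assoc; apply Rmult_le_compat; auto using Cmod_ge_0.
left; apply exp_pos.
Qed.

Lemma entire_cexp lam : entire (fun s => cexp (s * lam)) (fun s => lam * cexp (s * lam))%C.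
Proof.
intros R; destruct (cexp_C11 (Cmod lam) R (Cmod_ge_0 lam)) as [K [hK h]].
exists K; split; [exact hK | apply h; lra].
Qed.

Lemma Ccontinuous_cexp s lam : Ccontinuous lam -> Ccontinuous (fun x => cexp (s * lam x)%C).
Proof.
intros h x eps he.
destruct (h x 1 ltac:(lra)) as [d1 [d1p h1]].
set (R := Cmod (lam x) + 1).
destruct (cexp_C11 (Cmod s) R (Cmod_ge_0 s)) as [K [hK hC]].
specialize (hC s (Rle_refl _)).
assert (R0 : 0 < R) by (unfold R; pose proof (Cmod_ge_0 (lam x)); lra).
destruct (C11_lipschitz 0 R K _ _ hK R0 hC) as [L [L0 [lip _]]].
destruct (h x (eps / (L + 1))) as [d2 [d2p h2]]; [apply Rdiv_lt_0_compat; lra|].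
exists (Rmin d1 d2); split; [apply Rmin_glb_lt; auto|]; intros y hy.
specialize (h1 y (Rlt_le_trans _ _ _ hy (Rmin_l _ _))); specialize (h2 y (Rlt_le_trans _ _ _ hy (Rmin_r _ _))).
specialize (lip (lam x) (lam y)); rewrite !(Cmult_comm (lam _) s) in lip.
eapply Rle_lt_trans; [apply lip|].
- replace (lam x - 0)%C with (lam x) by ring; unfold R; lra.
- replace (lam y - 0)%C with (lam x + (lam y - lam x))%C by ring.
  eapply Rle_lt_trans; [apply Cmod_triangle|]; unfold R; lra.
- pose proof (Cmod_ge_0 (lam y - lam x)).
  apply Rle_lt_trans with ((L + 1) * Cmod (lam y - lam x)); [nra|].
  apply Rlt_le_trans with ((L + 1) * (eps / (L + 1))); [apply Rmult_lt_compat_l; lra | right; field; lra].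
Qed.

Lemma entire_Cint_cexp (lam : R -> C) Lam : Ccontinuous lam -> (forall x, Cmod (lam x) <= Lam) ->
  entire (fun s => Cint (fun x => cexp (s * lam x))) (fun s => Cint (fun x => lam x * cexp (s * lam x)))%C.
Proof.
intros hc hL R.
assert (L0 : 0 <= Lam) by (eapply Rle_trans; [apply Cmod_ge_0 | apply (hL 0)]).
destruct (cexp_C11 Lam R L0) as [K [hK h]].
exists (2 * K); split; [lra|]; intros s t hs ht.
assert (cc : forall z, Ccontinuous (fun x => cexp (z * lam x))) by (intros; apply Ccontinuous_cexp, hc).
replace (Cint (fun x => cexp (t * lam x)) - Cint (fun x => cexp (s * lam x))
   - Cint (fun x => lam x * cexp (s * lam x))%C * (t - s))%C with
  (Cint (fun x => cexp (t * lam x) + (Copp 1 * cexp (s * lam x) + Copp (t - s) * (lam x * cexp (s * lam x))))%C).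
- rewrite Rmult_assoc; apply Cint_bound.
  + apply Ccontinuous_plus; [apply cc|]; apply Ccontinuous_plus; apply Ccontinuous_mult;
      auto using Ccontinuous_const, Ccontinuous_mult.
  + intros x _; eapply Rle_trans; [|apply (h (lam x) (hL x) s t hs ht)]; right; f_equal; ring.
- assert (c1 : Ccontinuous (fun x => lam x * cexp (s * lam x))%C) by (apply Ccontinuous_mult; auto).
  rewrite Cint_plus, Cint_plus, Cint_scal, Cint_scal; auto; try ring.
  + apply Ccontinuous_mult; auto using Ccontinuous_const.
  + apply Ccontinuous_mult; auto using Ccontinuous_const.
  + apply Ccontinuous_plus; apply Ccontinuous_mult; auto using Ccontinuous_const.
Qed.

(** * Special values *)

Lemma has_sum_seq n0 (u : nat -> C) l : has_sum (fun n => (n0 <= n)%nat) u l ->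
  forall eps, 0 < eps -> exists N0, forall N, (N0 <= N)%nat -> Cmod (csum u (seq n0 N) - l) < eps.
Proof.
intros h eps he; destruct (h eps he) as [L0 [f0 h0]].
exists (S (list_max L0)); intros N hN; apply h0.
- apply seq_NoDup.
- rewrite List.Forall_forall; intros n hn; apply in_seq in hn; lia.
- intros n hn; apply in_seq; rewrite List.Forall_forall in f0; specialize (f0 n hn).
  pose proof (proj1 (list_max_le L0 (list_max L0)) (le_n _)) as hm; rewrite List.Forall_forall in hm.
  specialize (hm n hn); lia.
Qed.

Lemma csum_RtoC {T} (f : T -> R) l : csum (fun x => RtoC (f x)) l = RtoC (rsum f l).
Proof.
induction l as [|x l IH]; [reflexivity|]; rewrite csum_cons, rsum_cons, IH, RtoC_plus; reflexivity.
Qed.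

(** * The sum of the inverse squares *)

Lemma x_cos_le_sin x : 0 <= x <= PI / 2 -> x * cos x <= sin x.
Proof.
intros [h0 h1]; destruct (Req_dec x 0) as [->|hx]; [rewrite sin_0; lra|].
destruct (MVT_gen (fun t => sin t - t * cos t) 0 x (fun t => t * sin t)) as [c [hc h]].
- intros t _; auto_derive; [trivial | ring].
- intros t _; apply continuity_pt_minus; [apply continuity_sin|].
  apply continuity_pt_mult; [apply continuity_pt_id | apply continuity_cos].
- rewrite sin_0, Rmin_left, Rmax_right in * by lra.
  pose proof PI_RGT_0; assert (0 <= sin c) by (apply sin_ge_0; lra).
  assert (0 <= c * sin c * (x - 0)) by (repeat apply Rmult_le_pos; lra); lra.
Qed.

(** Both bounds come from [x cos x <= sin x <= x]; the upper one uses [cos ^ 2 = 1 - sin ^ 2]. *)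
Lemma inv_sin2_bounds x : 0 < x <= PI / 2 -> / x ^ 2 <= / sin x ^ 2 <= / x ^ 2 + 1.
Proof.
intros [h0 h1]; pose proof PI_RGT_0.
assert (s0 : 0 < sin x) by (apply sin_gt_0; lra).
assert (s1 : sin x < x) by (apply sin_lt_x; lra).
assert (c0 : 0 <= cos x) by (apply cos_ge_0; lra).
pose proof (x_cos_le_sin x ltac:(lra)) as hc.
split.
- apply Rinv_le_contravar; [apply pow_lt; lra | apply pow_incr; lra].
- pose proof (sin2_cos2 x) as e; unfold Rsqr in e.
  assert (x ^ 2 * cos x ^ 2 <= sin x ^ 2).
  { rewrite <- Rpow_mult_distr; apply pow_incr; split; [apply Rmult_le_pos; lra | lra]. }
  apply Rmult_le_reg_r with (sin x ^ 2 * x ^ 2); [apply Rmult_lt_0_compat; apply pow_lt; lra|].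
  replace (/ sin x ^ 2 * (sin x ^ 2 * x ^ 2)) with (x ^ 2) by (field; lra).
  replace ((/ x ^ 2 + 1) * (sin x ^ 2 * x ^ 2)) with (sin x ^ 2 + sin x ^ 2 * x ^ 2) by (field; lra).
  nra.
Qed.

Definition odd_angle (N k : nat) : R := (2 * INR k + 1) * PI / (4 * INR N).

Lemma odd_angle_bounds N k : (k < N)%nat -> 0 < odd_angle N k <= PI / 2.
Proof.
intros h; pose proof PI_RGT_0; pose proof (pos_INR k).
assert (k1 : INR k + 1 <= INR N) by (rewrite <- S_INR; apply le_INR; lia).
unfold odd_angle; split; [apply Rdiv_lt_0_compat; nra|].
apply Rmult_le_reg_r with (4 * INR N); [lra|].
replace ((2 * INR k + 1) * PI / (4 * INR N) * (4 * INR N)) with ((2 * INR k + 1) * PI) by (field; lra).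
nra.
Qed.

(* Doubling [N]: each angle [y] is replaced by [y / 2] and [(PI - y) / 2]. *)
Lemma sum_inv_sin2 m :
  rsum (fun k => / sin (odd_angle (2 ^ m) k) ^ 2) (seq 0 (2 ^ m)) = 2 * 4 ^ m.
Proof.
induction m as [|m IH].
- unfold rsum, odd_angle; simpl.
  replace ((2 * 0 + 1) * PI / (4 * 1)) with (PI / 4) by field.
  rewrite sin_PI4, Rmult_1_r; pose proof sqrt2_neq_0.
  assert (e : sqrt 2 * sqrt 2 = 2) by (apply sqrt_sqrt; lra).
  replace (1 / sqrt 2 * (1 / sqrt 2)) with (/ (sqrt 2 * sqrt 2)) by (field; assumption); rewrite e; lra.
- set (N := (2 ^ m)%nat) in *.
  assert (N0 : (0 < N)%nat) by (unfold N; clear; induction m; simpl; lia).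
  assert (N1 : 1 <= INR N) by (change 1 with (INR 1); apply le_INR; lia).
  replace (2 ^ S m)%nat with (N + N)%nat by (unfold N; simpl; lia).
  rewrite seq_app, rsum_app; simpl (0 + N)%nat.
  assert (p : Permutation (seq N N) (map (fun k => (N + N - 1 - k)%nat) (seq 0 N))).
  { apply NoDup_Permutation; [apply seq_NoDup | |].
    - apply NoDup_map_NoDup_ForallPairs; [|apply seq_NoDup].
      intros a b ha hb e; apply in_seq in ha, hb; lia.
    - intros k; rewrite in_seq, in_map_iff; split.
      + intros hk; exists (N + N - 1 - k)%nat; rewrite in_seq; lia.
      + intros [j [<- hj]]; apply in_seq in hj; lia. }
  rewrite (rsum_perm _ _ _ p), rsum_map, <- rsum_plus.
  rewrite (rsum_ext _ (fun k => 4 * / sin (odd_angle N k) ^ 2)).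
  + rewrite rsum_scal, IH; simpl; ring.
  + intros k hk; apply in_seq in hk.
    destruct (odd_angle_bounds N k) as [y0 y1]; [lia|].
    set (y := odd_angle N k) in *; pose proof PI_RGT_0.
    assert (INR k + 1 <= INR N) by (rewrite <- S_INR; apply le_INR; lia).
    replace (odd_angle (N + N) k) with (y / 2).
    2:{ unfold y, odd_angle; rewrite plus_INR; field; lra. }
    replace (odd_angle (N + N) (N + N - 1 - k)) with (PI / 2 - y / 2).
    2:{ unfold y, odd_angle; rewrite !minus_INR, plus_INR by lia; simpl; field; lra. }
    rewrite sin_shift; replace y with (2 * (y / 2)) at 3 by field; rewrite sin_2a.
    assert (s0 : 0 < sin (y / 2)) by (apply sin_gt_0; lra).
    assert (c0 : 0 < cos (y / 2)) by (apply cos_gt_0; lra).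
    pose proof (sin2_cos2 (y / 2)) as e; unfold Rsqr in e.
    set (s := sin (y / 2)) in *; set (c := cos (y / 2)) in *.
    replace (4 * / (2 * s * c) ^ 2) with ((s * s + c * c) / (s ^ 2 * c ^ 2)) by (rewrite e; field; lra).
    field; lra.
Qed.

(** Summing [inv_sin2_bounds] over the [2 ^ m] angles places [16 * 4 ^ m / PI ^ 2] times [S] between
    [2 * 4 ^ m - 2 ^ m] and [2 * 4 ^ m]. *)
Lemma odd_squares_bounds m : let S := rsum (fun k => / (2 * INR k + 1) ^ 2) (seq 0 (2 ^ m)) in
  PI ^ 2 / 8 * (1 - / (2 * 2 ^ m)) <= S <= PI ^ 2 / 8.
Proof.
intros S; pose proof (sum_inv_sin2 m) as h; set (N := (2 ^ m)%nat) in *.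
assert (NI : INR N = 2 ^ m) by (unfold N; rewrite pow_INR; reflexivity).
assert (P : 0 < 2 ^ m) by (apply pow_lt; lra).
assert (P4 : 4 ^ m = 2 ^ m * 2 ^ m) by (rewrite <- Rpow_mult_distr; f_equal; lra).
pose proof PI_RGT_0 as hpi.
assert (e : rsum (fun k => / odd_angle N k ^ 2) (seq 0 N) = 16 * 4 ^ m / PI ^ 2 * S).
{ unfold S; rewrite <- rsum_scal; apply rsum_ext; intros k _; unfold odd_angle; rewrite NI, P4.
  pose proof (pos_INR k); field; repeat split; nra. }
assert (b : rsum (fun k => / odd_angle N k ^ 2) (seq 0 N) <= 2 * 4 ^ m <=
   rsum (fun k => / odd_angle N k ^ 2 + 1) (seq 0 N)).
{ rewrite <- h; split; apply rsum_le; intros k hk; apply in_seq in hk;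
    apply inv_sin2_bounds, odd_angle_bounds; lia. }
rewrite rsum_plus, rsum_const, length_seq, Rmult_1_r, e, NI in b.
assert (q : 0 < 16 * 4 ^ m / PI ^ 2) by (apply Rdiv_lt_0_compat; [rewrite P4; nra | apply pow_lt; lra]).
split; apply Rmult_le_reg_l with (16 * 4 ^ m / PI ^ 2); auto.
- replace (16 * 4 ^ m / PI ^ 2 * (PI ^ 2 / 8 * (1 - / (2 * 2 ^ m)))) with (2 * 4 ^ m - 2 ^ m)
    by (rewrite P4; field; split; nra); lra.
- replace (16 * 4 ^ m / PI ^ 2 * (PI ^ 2 / 8)) with (2 * 4 ^ m) by (field; lra); lra.
Qed.

Lemma inv_squares_rbound : rbound (fun n => (1 <= n)%nat) (fun n => / INR n ^ 2) 2.
Proof.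
intros L nl fl.
assert (N : forall N, rsum (fun n => / INR n ^ 2) (seq 1 (S N)) <= 2 - / INR (S N)).
{ induction N as [|N IH]; [unfold rsum; simpl; lra|].
  rewrite seq_S, rsum_app; unfold rsum at 2; cbn [map fold_right Nat.add].
  assert (p : 0 < INR (S N)) by (apply lt_0_INR; lia).
  replace (1 + S N)%nat with (S (S N)) by lia; rewrite (S_INR (S N)).
  assert (/ (INR (S N) + 1) ^ 2 <= / INR (S N) - / (INR (S N) + 1)); [|lra].
  replace (/ INR (S N) - / (INR (S N) + 1)) with (/ (INR (S N) * (INR (S N) + 1))) by (field; lra).
  apply Rinv_le_contravar; nra. }
apply Rle_trans with (rsum (fun n => / INR n ^ 2) (seq 1 (S (list_max L)))).
- apply rsum_incl_le; auto using seq_NoDup.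
  + intros n hn; apply in_seq in hn; left; apply Rinv_0_lt_compat, pow_lt, lt_0_INR; lia.
  + intros n hn; apply in_seq; rewrite List.Forall_forall in fl; specialize (fl n hn).
    pose proof (proj1 (list_max_le L (list_max L)) (le_n _)) as hm; rewrite List.Forall_forall in hm.
    specialize (hm n hn); lia.
- specialize (N (list_max L)).
  assert (0 < / INR (S (list_max L))) by (apply Rinv_0_lt_compat, lt_0_INR; lia); lra.
Qed.

(** The odd terms have sum [PI ^ 2 / 8] and the even ones a quarter of the total, so three quarters
    of the total are [PI ^ 2 / 8]. *)
Theorem basel : has_sum (fun n => (1 <= n)%nat) (fun n => RtoC (/ INR n ^ 2)) (RtoC (PI ^ 2 / 6)).
Proof.
destruct (has_sum_real (fun n => (1 <= n)%nat) (fun n => / INR n ^ 2) 2) as [l hl].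
{ intros n hn; left; apply Rinv_0_lt_compat, pow_lt, lt_0_INR; lia. }
{ exact inv_squares_rbound. }
destruct (has_sum_real (fun _ : nat => True) (fun k => / (2 * INR k + 1) ^ 2) (PI ^ 2 / 8)) as [lo hlo].
{ intros k _; left; apply Rinv_0_lt_compat, pow_lt; pose proof (pos_INR k); lra. }
{ intros L nl _.
  apply Rle_trans with (rsum (fun k => / (2 * INR k + 1) ^ 2) (seq 0 (2 ^ S (list_max L)))).
  - apply rsum_incl_le; auto using seq_NoDup.
    + intros k _; left; apply Rinv_0_lt_compat, pow_lt; pose proof (pos_INR k); lra.
    + intros n hn; apply in_seq.
      pose proof (proj1 (list_max_le L (list_max L)) (le_n _)) as hm; rewrite List.Forall_forall in hm.
      specialize (hm n hn); pose proof (Nat.pow_gt_lin_r 2 (S (list_max L)) ltac:(lia)); lia.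
  - apply (odd_squares_bounds (S (list_max L))). }
assert (elo : lo = RtoC (PI ^ 2 / 8)).
{ assert (z : Cmod (lo - RtoC (PI ^ 2 / 8)) <= 0).
  { apply Rnot_lt_le; intros hlt; set (e := Cmod (lo - RtoC (PI ^ 2 / 8))) in *.
    assert (hlo' : has_sum (fun n => (0 <= n)%nat) (fun k => RtoC (/ (2 * INR k + 1) ^ 2)) lo).
    { revert hlo; apply has_sum_pred_ext; intros; split; [lia | trivial]. }
    destruct (has_sum_seq 0 _ lo hlo' (e / 2) ltac:(lra)) as [N0 hN].
    destruct (nfloor_ex (PI ^ 2 / (4 * e))) as [n1 [_ hn1]].
    { apply Rdiv_le_0_compat; [apply pow2_ge_0 | lra]. }
    set (m := (N0 + S n1)%nat).
    assert (mN : (m <= 2 ^ m)%nat) by (pose proof (Nat.pow_gt_lin_r 2 m ltac:(lia)); lia).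
    (* The bounds are known for [2 ^ m] terms only; this suffices because the sum is already known
       to exist. *)
    specialize (hN (2 ^ m)%nat ltac:(unfold m in *; lia)).
    rewrite csum_RtoC in hN; destruct (odd_squares_bounds m) as [b1 b2].
    set (S := rsum _ _) in *.
    assert (d : Cmod (RtoC S - RtoC (PI ^ 2 / 8)) < e / 2).
    { rewrite <- RtoC_minus, Cmod_R, Rabs_left1 by lra.
      assert (P : INR m <= 2 ^ m) by (replace (2 ^ m) with (INR (2 ^ m)) by (rewrite pow_INR; reflexivity); apply le_INR, mN).
      assert (M : PI ^ 2 / (4 * e) < INR m).
      { unfold m; rewrite plus_INR, S_INR; pose proof (pos_INR N0); lra. }
      assert (P0 : 0 < 2 ^ m) by (apply pow_lt; lra).
      assert (PI ^ 2 / 8 * / (2 * 2 ^ m) < e / 2); [|lra].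
      apply Rmult_lt_reg_r with (2 * 2 ^ m); [lra|].
      rewrite Rmult_assoc, Rinv_l, Rmult_1_r by lra.
      assert (PI ^ 2 / (4 * e) * (4 * e) = PI ^ 2) by (field; lra).
      pose proof (pow2_ge_0 PI); nra. }
    assert (e <= Cmod (RtoC S - lo) + Cmod (RtoC S - RtoC (PI ^ 2 / 8))); [|lra].
    unfold e; replace (lo - RtoC (PI ^ 2 / 8))%C with
      (Copp (RtoC S - lo) + (RtoC S - RtoC (PI ^ 2 / 8)))%C by ring.
    eapply Rle_trans; [apply Cmod_triangle|]; rewrite Cmod_opp; lra. }
  assert (z' : (lo - RtoC (PI ^ 2 / 8))%C = 0%C) by (apply Cmod_eq_0; pose proof (Cmod_ge_0 (lo - RtoC (PI ^ 2 / 8))); lra).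
  replace lo with ((lo - RtoC (PI ^ 2 / 8)) + RtoC (PI ^ 2 / 8))%C by ring; rewrite z'; ring. }
assert (hev : has_sum (fun n => (1 <= n)%nat /\ Nat.Even n) (fun n => RtoC (/ INR n ^ 2)) (RtoC (/ 4) * l)%C).
{ apply has_sum_bij with (A := fun n => (1 <= n)%nat) (f := fun n => (2 * n)%nat) (g := Nat.div2).
  - intros n hn; split; [split; [lia | exists n; reflexivity]|]; apply Nat.div2_double.
  - intros n [hn [k ->]]; rewrite Nat.div2_double; split; lia.
  - apply has_sum_ext with (fun n => RtoC (/ 4) * RtoC (/ INR n ^ 2))%C; [|apply has_sum_scal, hl].
    intros n hn; rewrite <- RtoC_mult, mult_INR; f_equal; simpl; field; apply not_0_INR; lia. }
assert (hod : has_sum (fun n => (1 <= n)%nat /\ Nat.Odd n) (fun n => RtoC (/ INR n ^ 2)) lo).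
{ apply has_sum_bij with (A := fun _ : nat => True) (f := fun k => (2 * k + 1)%nat) (g := Nat.div2).
  - intros n _; split; [split; [lia | exists n; reflexivity]|].
    replace (2 * n + 1)%nat with (S (2 * n)) by lia; apply Nat.div2_succ_double.
  - intros n [hn [k ->]]; replace (2 * k + 1)%nat with (S (2 * k)) by lia; rewrite Nat.div2_succ_double; split; [trivial | lia].
  - revert hlo; apply has_sum_ext; intros k _; rewrite plus_INR, mult_INR; simpl; f_equal; f_equal; ring. }
assert (hall : has_sum (fun n => (1 <= n)%nat) (fun n => RtoC (/ INR n ^ 2)) (RtoC (/ 4) * l + lo)%C).
{ eapply has_sum_pred_ext; [|apply has_sum_union; [|exact hev | exact hod]].
  - intros n; split; [tauto|]; intros hn; destruct (Nat.Even_or_Odd n); tauto.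
  - intros n [_ h1] [_ h2]; exact (Nat.Even_Odd_False n h1 h2). }
pose proof (has_sum_unique _ _ _ _ hl hall) as e; rewrite elo in e.
replace (RtoC (PI ^ 2 / 6)) with l; [exact hl|].
assert (e2 : (RtoC (3 / 4) * l)%C = RtoC (PI ^ 2 / 8)).
{ replace (3 / 4) with (1 - / 4) by lra; rewrite RtoC_minus.
  replace ((RtoC 1 - RtoC (/ 4)) * l)%C with (l - RtoC (/ 4) * l)%C by ring; rewrite e at 1; ring. }
replace (PI ^ 2 / 6) with (4 / 3 * (PI ^ 2 / 8)) by field; rewrite RtoC_mult, <- e2, Cmult_assoc, <- RtoC_mult.
replace (4 / 3 * (3 / 4)) with 1 by field; ring.
Qed.

(** * The integral of [(t (t + 1)) ^ (- 2/3)] in terms of [Gamma (1/3)] *)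

Lemma ex_RInt_cont (f : R -> R) a b : (forall x, continuous f x) -> ex_RInt f a b.
Proof. intros h; apply (ex_RInt_continuous (V := R_CompleteNormedModule)); auto. Qed.

Lemma RInt_le_cont (f g : R -> R) a b : a <= b -> (forall x, continuous f x) -> (forall x, continuous g x) ->
  (forall x, a < x < b -> f x <= g x) -> RInt f a b <= RInt g a b.
Proof. intros; apply RInt_le; auto using ex_RInt_cont. Qed.

Lemma is_derive_primitive (f : R -> R) x : (forall y, continuous f y) -> is_derive (fun y => RInt f 0 y) x (f x).
Proof.
intros h; apply (is_derive_RInt (V := R_NormedModule) f _ 0); [|apply h].
apply filter_forall; intros y; apply (RInt_correct (V := R_CompleteNormedModule)), ex_RInt_cont, h.
Qed.

(** The majorant [exp (2 - u)] fits both integrands below, because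
    [u ^ 3 - 3 u + 2 = (u - 1) ^ 2 (u + 2)] is nonnegative. *)
Lemma improper_limit (g : R -> R) : (forall x, continuous g x) ->
  (forall u, 0 <= u -> 0 <= g u <= exp (2 - u)) ->
  exists L, (forall x, 0 <= x -> RInt g 0 x <= L) /\
    forall eps, 0 < eps -> exists X, 0 < X /\ forall x, X <= x -> L - eps < RInt g 0 x.
Proof.
intros hc hg.
assert (mono : forall x y, 0 <= x <= y -> RInt g 0 x <= RInt g 0 y).
{ intros x y hxy; rewrite <- (RInt_Chasles g 0 x y) by (apply ex_RInt_cont; exact hc).
  assert (0 <= RInt g x y); [|unfold plus; simpl; lra].
  apply RInt_ge_0; [lra | apply ex_RInt_cont, hc | intros; apply hg; lra]. }
destruct (completeness (fun y => exists x, 0 <= x /\ y = RInt g 0 x)) as [L [h1 h2]].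
- exists (exp 2); intros y [x [hx ->]].
  apply Rle_trans with (RInt (fun u => exp (2 - u)) 0 x).
  + apply RInt_le_cont; auto; [|intros; apply hg; lra].
    intros u; apply (ex_derive_continuous (fun u => exp (2 - u))); auto_derive; trivial.
  + rewrite (is_RInt_unique _ _ _ (minus (- exp (2 - x)) (- exp (2 - 0)))).
    * unfold minus, plus, opp; simpl; rewrite Rminus_0_r; pose proof (exp_pos (2 - x)); lra.
    * apply (is_RInt_derive (V := R_CompleteNormedModule) (fun u => - exp (2 - u)) (fun u => exp (2 - u))).
      -- intros u _; auto_derive; [trivial | unfold Rminus; ring].
      -- intros u _; apply (ex_derive_continuous (fun u => exp (2 - u))); auto_derive; trivial.
- exists (RInt g 0 0), 0; split; [lra | reflexivity].
- exists L; split; [intros x hx; apply h1; exists x; auto|].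
  intros eps he; destruct (classic (exists x, 0 <= x /\ L - eps < RInt g 0 x)) as [[x [hx hlt]]|no].
  + exists (x + 1); split; [lra|]; intros y hy; eapply Rlt_le_trans; [exact hlt | apply mono; lra].
  + exfalso; assert (L <= L - eps); [|lra]; apply h2; intros y [x [hx ->]].
    apply Rnot_lt_le; intros hlt; apply no; exists x; auto.
Qed.

Lemma is_derive_RInt_unit (f df : R -> R -> R) x :
  (forall y t, is_derive (fun z => f z t) y (df y t)) ->
  (forall y t, continuity_2d_pt df y t) -> (forall y t, continuous (f y) t) ->
  is_derive (fun z => RInt (f z) 0 1) x (RInt (df x) 0 1).
Proof.
intros hd hc hf.
replace (RInt (df x) 0 1) with (RInt (fun t => Derive (fun z => f z t) x) 0 1).
- apply (is_derive_RInt_param f 0 1 x).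
  + apply filter_forall; intros y t _; exists (df y t); apply hd.
  + intros t _; apply continuity_2d_pt_ext with df; [|apply hc].
    intros y s; symmetry; apply is_derive_unique, hd.
  + apply filter_forall; intros y; apply ex_RInt_cont; intros t; apply hf.
- apply RInt_ext; intros t _; apply is_derive_unique, hd.
Qed.

Lemma eq_of_derive (f g df : R -> R) x : 0 < x -> (forall y, is_derive f y (df y)) ->
  (forall y, is_derive g y (df y)) -> f 0 = g 0 -> f x = g x.
Proof.
intros hx hf hg h0.
assert (e : f 0 - g 0 = f x - g x).
{ apply (eq_is_derive (V := R_NormedModule) (fun y => f y - g y)); [|exact hx].
  intros t _; pose proof (is_derive_minus f g t (df t) (df t) (hf t) (hg t)) as q.
  rewrite minus_eq_zero in q; exact q. }
lra.
Qed.

(** Over [0, oo) the integrals of [cube_exp] and [cube_exp1] are [Gamma (1/3) / 3] and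
    [Gamma (2/3) / 3]; [I0] and [I1] are their truncations. *)
Definition cube_exp (u : R) : R := exp (- u ^ 3).
Definition cube_exp1 (u : R) : R := u * exp (- u ^ 3).
Definition I0 (x : R) : R := RInt cube_exp 0 x.
Definition I1 (x : R) : R := RInt cube_exp1 0 x.

Lemma continuous_cube_exp u : continuous cube_exp u.
Proof. apply (ex_derive_continuous cube_exp); unfold cube_exp; auto_derive; trivial. Qed.

Lemma continuous_cube_exp1 u : continuous cube_exp1 u.
Proof. apply (ex_derive_continuous cube_exp1); unfold cube_exp1; auto_derive; trivial. Qed.

Lemma is_derive_I0 x : is_derive I0 x (cube_exp x).
Proof. apply is_derive_primitive, continuous_cube_exp. Qed.

Lemma is_derive_I1 x : is_derive I1 x (cube_exp1 x).
Proof. apply is_derive_primitive, continuous_cube_exp1. Qed.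

Lemma I0_scaled x : I0 x = RInt (fun t => x * cube_exp (x * t)) 0 1.
Proof.
unfold I0; pose proof (RInt_comp_lin (V := R_CompleteNormedModule) cube_exp x 0 0 1) as h.
replace (x * 0 + 0) with 0 in h by ring; replace (x * 1 + 0) with x in h by ring.
rewrite <- h by (apply ex_RInt_cont, continuous_cube_exp).
apply RInt_ext; intros t _; unfold scal; simpl; unfold mult; simpl; rewrite Rplus_0_r; reflexivity.
Qed.

Lemma I1_scaled x : I1 x = RInt (fun t => x * cube_exp1 (x * t)) 0 1.
Proof.
unfold I1; pose proof (RInt_comp_lin (V := R_CompleteNormedModule) cube_exp1 x 0 0 1) as h.
replace (x * 0 + 0) with 0 in h by ring; replace (x * 1 + 0) with x in h by ring.
rewrite <- h by (apply ex_RInt_cont, continuous_cube_exp1).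
apply RInt_ext; intros t _; unfold scal; simpl; unfold mult; simpl; rewrite Rplus_0_r; reflexivity.
Qed.

(* The absolute value only serves to have a positive base for every [t]. *)
Definition cbrt1 (t : R) : R := Rpower (1 + Rabs t ^ 3) (1 / 3).

Lemma cbrt1_base t : 1 <= 1 + Rabs t ^ 3.
Proof. pose proof (pow_le (Rabs t) 3 (Rabs_pos t)); lra. Qed.

Lemma cbrt1_pos t : 0 < cbrt1 t.
Proof. apply exp_pos. Qed.

Lemma cbrt1_ge1 t : 1 <= cbrt1 t.
Proof.
unfold cbrt1; pose proof (cbrt1_base t).
apply Rle_trans with (Rpower (1 + Rabs t ^ 3) 0); [right; symmetry; apply Rpower_O; lra|].
apply Rle_Rpower; lra.
Qed.

Lemma cbrt1_cube t : 0 <= t -> cbrt1 t ^ 3 = 1 + t ^ 3.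
Proof.
intros ht; pose proof (cbrt1_base t); unfold cbrt1; rewrite <- Rpower_pow by apply exp_pos.
rewrite Rpower_mult, Rabs_pos_eq by exact ht; replace (1 / 3 * INR 3) with 1 by (simpl; field).
apply Rpower_1; rewrite Rabs_pos_eq in * by exact ht; lra.
Qed.

Lemma continuous_cbrt1 t : continuous cbrt1 t.
Proof.
unfold cbrt1, Rpower; pose proof (cbrt1_base t).
apply (continuous_comp (fun t => 1 + Rabs t ^ 3) (fun y => exp (1 / 3 * ln y))).
- apply (continuous_comp Rabs (fun y => 1 + y ^ 3)); [apply continuous_Rabs|].
  apply (ex_derive_continuous (fun y => 1 + y ^ 3)); auto_derive; trivial.
- apply (ex_derive_continuous (fun y => exp (1 / 3 * ln y))); auto_derive; lra.
Qed.

Lemma continuous_inv_cbrt1 n t : continuous (fun t => / cbrt1 t ^ n) t.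
Proof.
apply (continuous_comp cbrt1 (fun y => / y ^ n)); [apply continuous_cbrt1|].
apply (ex_derive_continuous (fun y => / y ^ n)); auto_derive.
apply pow_nonzero; pose proof (cbrt1_pos t); lra.
Qed.

Lemma continuity_2d_cube_exp y t : continuity_2d_pt (fun y t => cube_exp (y * cbrt1 t)) y t.
Proof.
apply continuity_1d_2d_pt_comp with (f := cube_exp).
- apply continuity_pt_filterlim, continuous_cube_exp.
- apply continuity_2d_pt_mult; [apply continuity_2d_pt_id1|].
  apply continuity_1d_2d_pt_comp with (f := cbrt1); [apply continuity_pt_filterlim, continuous_cbrt1|].
  apply continuity_2d_pt_id2.
Qed.

(* The square of the integral over [0, x] is twice the integral over a triangle;
   this is its form in the coordinates [(u, u t)]. *)
Lemma I0_square x : 0 < x -> I0 x ^ 2 = 2 * RInt (fun t => I1 (x * cbrt1 t) * / cbrt1 t ^ 2) 0 1.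
Proof.
intros hx.
apply (eq_of_derive (fun x => I0 x ^ 2) (fun x => 2 * RInt (fun t => I1 (x * cbrt1 t) * / cbrt1 t ^ 2) 0 1)
  (fun x => 2 * RInt (fun t => x * cube_exp (x * cbrt1 t)) 0 1) x hx).
- intros y.
  replace (2 * RInt (fun t => y * cube_exp (y * cbrt1 t)) 0 1) with (INR 2 * cube_exp y * I0 y ^ 1).
  + apply (is_derive_pow I0 2), is_derive_I0.
  + rewrite I0_scaled, pow_1; simpl INR; rewrite Rmult_assoc; f_equal.
    rewrite <- (RInt_scal (V := R_CompleteNormedModule)).
    2:{ apply ex_RInt_cont; intros t; apply (ex_derive_continuous (fun t => y * cube_exp (y * t))).
        unfold cube_exp; auto_derive; trivial. }
    apply RInt_ext; intros t; rewrite Rmin_left, Rmax_right by lra; intros ht.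
    unfold scal; simpl; unfold mult; simpl; unfold cube_exp.
    replace ((y * cbrt1 t) ^ 3) with (y ^ 3 + (y * t) ^ 3)
      by (rewrite !Rpow_mult_distr, cbrt1_cube by lra; ring).
    rewrite Ropp_plus_distr, exp_plus; ring.
- intros y; apply (is_derive_scal (fun x => RInt (fun t => I1 (x * cbrt1 t) * / cbrt1 t ^ 2) 0 1)).
  apply (is_derive_RInt_unit (fun x t => I1 (x * cbrt1 t) * / cbrt1 t ^ 2)
    (fun x t => x * cube_exp (x * cbrt1 t))).
  + intros z t; pose proof (cbrt1_pos t).
    replace (z * cube_exp (z * cbrt1 t)) with (/ cbrt1 t ^ 2 * (cbrt1 t * cube_exp1 (z * cbrt1 t)))
      by (unfold cube_exp, cube_exp1; field; lra).
    apply is_derive_ext with (fun z => / cbrt1 t ^ 2 * I1 (z * cbrt1 t)); [intros; apply Rmult_comm|].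
    apply (is_derive_scal (fun z => I1 (z * cbrt1 t))).
    apply (is_derive_comp I1 (fun z => z * cbrt1 t)); [apply is_derive_I1 | auto_derive; [trivial | ring]].
  + intros z t; apply continuity_2d_pt_mult; [apply continuity_2d_pt_id1 | apply continuity_2d_cube_exp].
  + intros z t; apply (continuous_mult (fun t => I1 (z * cbrt1 t)) (fun t => / cbrt1 t ^ 2)).
    * apply (continuous_comp (fun t => z * cbrt1 t) I1).
      -- apply (continuous_scal_r (V := R_NormedModule) z cbrt1), continuous_cbrt1.
      -- apply (ex_derive_continuous I1); eexists; apply is_derive_I1.
    * apply continuous_inv_cbrt1.
- unfold I0 at 1; rewrite RInt_point; unfold zero; simpl.
  rewrite (RInt_ext _ (fun _ => 0)).
  + rewrite RInt_const; unfold scal; simpl; unfold mult; simpl; ring.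
  + intros t _; rewrite Rmult_0_l; unfold I1; rewrite RInt_point; unfold zero; simpl; ring.
Qed.

(** Again both sides have the same derivative in [x], the square being cut along its diagonal. In
    the limit this identity takes the place of the reflection formula for
    [Gamma (1/3) Gamma (2/3)]. *)
Lemma I0_I1 x : 0 < x ->
  I0 x * I1 x = RInt (fun t => (1 + t) * / cbrt1 t ^ 3 / 3 * (1 - cube_exp (x * cbrt1 t))) 0 1.
Proof.
intros hx.
apply (eq_of_derive (fun x => I0 x * I1 x)
  (fun x => RInt (fun t => (1 + t) * / cbrt1 t ^ 3 / 3 * (1 - cube_exp (x * cbrt1 t))) 0 1)
  (fun x => RInt (fun t => (1 + t) * (x ^ 2 * cube_exp (x * cbrt1 t))) 0 1) x hx).
- intros y.
  replace (RInt (fun t => (1 + t) * (y ^ 2 * cube_exp (y * cbrt1 t))) 0 1) with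
    (plus (mult (cube_exp y) (I1 y)) (mult (I0 y) (cube_exp1 y))).
  + apply (is_derive_mult I0 I1); [apply is_derive_I0 | apply is_derive_I1 | intros; apply Rmult_comm].
  + rewrite I0_scaled, I1_scaled; unfold plus, mult; simpl.
    rewrite (Rmult_comm _ (cube_exp1 y)).
    rewrite <- !(RInt_scal (V := R_CompleteNormedModule)) by
     (apply ex_RInt_cont; intros t; [apply (ex_derive_continuous (fun t => y * cube_exp1 (y * t))) ||
        apply (ex_derive_continuous (fun t => y * cube_exp (y * t)))];
      unfold cube_exp, cube_exp1; auto_derive; trivial).
    rewrite <- (RInt_plus (V := R_CompleteNormedModule)).
    2,3: apply (ex_RInt_scal (V := R_NormedModule)), ex_RInt_cont; intros t;
      [apply (ex_derive_continuous (fun t => y * cube_exp1 (y * t))) ||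
        apply (ex_derive_continuous (fun t => y * cube_exp (y * t)))];
      unfold cube_exp, cube_exp1; auto_derive; trivial.
    apply RInt_ext; intros t; rewrite Rmin_left, Rmax_right by lra; intros ht.
    unfold scal, plus; simpl; unfold mult; simpl; unfold cube_exp, cube_exp1.
    replace ((y * cbrt1 t) ^ 3) with (y ^ 3 + (y * t) ^ 3)
      by (rewrite !Rpow_mult_distr, cbrt1_cube by lra; ring).
    rewrite Ropp_plus_distr, exp_plus; ring.
- intros y.
  apply (is_derive_RInt_unit (fun x t => (1 + t) * / cbrt1 t ^ 3 / 3 * (1 - cube_exp (x * cbrt1 t)))
     (fun x t => (1 + t) * (x ^ 2 * cube_exp (x * cbrt1 t)))).
  + intros z t; pose proof (cbrt1_pos t); unfold cube_exp; auto_derive; [trivial|].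
    change ((z * cbrt1 t) ^ 3) with (z * cbrt1 t * (z * cbrt1 t * (z * cbrt1 t * 1))).
    set (e := exp _); field; lra.
  + intros z t; apply continuity_2d_pt_mult.
    * apply continuity_1d_2d_pt_comp with (f := fun t => 1 + t); [|apply continuity_2d_pt_id2].
      apply continuity_pt_filterlim, (ex_derive_continuous (fun t => 1 + t)); auto_derive; trivial.
    * apply continuity_2d_pt_mult; [|apply continuity_2d_cube_exp].
      apply continuity_1d_2d_pt_comp with (f := fun t => t ^ 2); [|apply continuity_2d_pt_id1].
      apply continuity_pt_filterlim, (ex_derive_continuous (fun t => t ^ 2)); auto_derive; trivial.
  + intros z t; apply (continuous_mult (fun t => (1 + t) * / cbrt1 t ^ 3 / 3) (fun t => 1 - cube_exp (z * cbrt1 t))).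
    * apply (continuous_mult (fun t => (1 + t) * / cbrt1 t ^ 3) (fun _ => / 3)); [|apply continuous_const].
      apply (continuous_mult (fun t => 1 + t) (fun t => / cbrt1 t ^ 3)); [|apply continuous_inv_cbrt1].
      apply (ex_derive_continuous (fun t => 1 + t)); auto_derive; trivial.
    * apply (continuous_comp (fun t => z * cbrt1 t) (fun y => 1 - cube_exp y)).
      -- apply (continuous_scal_r (V := R_NormedModule) z cbrt1), continuous_cbrt1.
      -- apply (ex_derive_continuous (fun y => 1 - cube_exp y)); unfold cube_exp; auto_derive; trivial.
- unfold I0 at 1; rewrite RInt_point; unfold zero; simpl; rewrite Rmult_0_l.
  rewrite (RInt_ext _ (fun _ => 0)).
  + rewrite RInt_const; unfold scal; simpl; unfold mult; simpl; ring.
  + intros t _; rewrite Rmult_0_l; unfold cube_exp; replace (- 0 ^ 3) with 0 by ring; rewrite exp_0.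
    match goal with |- @eq _ ?a ?b => change (@eq R a b) end; ring.
Qed.

Definition beta0 : R := RInt (fun t => / cbrt1 t ^ 2) 0 1.

Lemma abs_le_eps x y : (forall e, 0 < e -> Rabs (x - y) <= e) -> x = y.
Proof.
intros h; apply NNPP; intros ne; assert (p : 0 < Rabs (x - y)) by (apply Rabs_pos_lt; lra).
specialize (h (Rabs (x - y) / 2) ltac:(lra)); lra.
Qed.

(** [(1 + t) / (1 + t ^ 3) = 1 / (1 - t + t ^ 2)], whose primitive is an arctangent; the endpoints
    give the angles [PI / 6] and [- PI / 6]. *)
Lemma RInt_third : RInt (fun t => (1 + t) * / cbrt1 t ^ 3 / 3) 0 1 = 2 * PI / (9 * sqrt 3).
Proof.
assert (s3 : sqrt 3 * sqrt 3 = 3) by (apply sqrt_sqrt; lra).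
assert (p3 : 0 < sqrt 3) by (apply sqrt_lt_R0; lra).
rewrite (RInt_ext _ (fun t => / 3 * / (1 - t + t ^ 2))).
2:{ intros t; rewrite Rmin_left, Rmax_right by lra; intros ht; rewrite cbrt1_cube by lra.
    match goal with |- @eq _ ?a ?b => change (@eq R a b) end.
    field; split; [nra | nra]. }
rewrite (is_RInt_unique _ _ _ (minus (2 / (3 * sqrt 3) * atan ((2 * 1 - 1) / sqrt 3)) (2 / (3 * sqrt 3) * atan ((2 * 0 - 1) / sqrt 3)))).
- replace ((2 * 1 - 1) / sqrt 3) with (tan (PI / 6)) by (rewrite tan_PI6; field; lra).
  replace ((2 * 0 - 1) / sqrt 3) with (- tan (PI / 6)) by (rewrite tan_PI6; field; lra).
  pose proof PI_RGT_0.
  rewrite atan_opp, atan_tan by lra.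
  unfold minus, plus, opp; simpl; field; lra.
- apply (is_RInt_derive (V := R_CompleteNormedModule) (fun t => 2 / (3 * sqrt 3) * atan ((2 * t - 1) / sqrt 3))).
  + intros t _; auto_derive; [trivial|].
    rewrite !Rmult_1_r.
    replace (1 + (2 * t + - (1)) * / sqrt 3 * ((2 * t + - (1)) * / sqrt 3)) with
      (1 + (2 * t - 1) * (2 * t - 1) * (/ (sqrt 3 * sqrt 3))) by (field; lra).
    rewrite s3.
    assert (1 - t + t ^ 2 <> 0) by nra.
    replace (1 + (2 * t - 1) * (2 * t - 1) * / 3) with (4 / 3 * (1 - t + t ^ 2)) by field.
    replace (2 / (3 * sqrt 3) * (2 * / sqrt 3 * / (4 / 3 * (1 - t + t ^ 2)))) with
      (4 / (3 * (sqrt 3 * sqrt 3)) * / (4 / 3 * (1 - t + t ^ 2))) by (field; repeat split; lra || assumption).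
    rewrite s3; field; assumption.
  + intros t _; apply (ex_derive_continuous (fun t => / 3 * / (1 - t + t ^ 2))); auto_derive; nra.
Qed.

(** [E] and [E1] are the integrals over [0, oo). Since [1 <= cbrt1 t], the arguments [x * cbrt1 t]
    are large with [x], uniformly in [t], and the identities for finite [x] pass to the limit. *)
Lemma exists_limits : exists E E1, 0 < E /\ E ^ 2 = 2 * E1 * beta0 /\ E * E1 = 2 * PI / (9 * sqrt 3) /\
  (forall x, 0 <= x -> I0 x <= E) /\ forall eps, 0 < eps -> exists X, 0 < X /\ forall x, X <= x -> E - eps < I0 x.
Proof.
destruct (improper_limit cube_exp) as [E [hE1 hE2]].
{ apply continuous_cube_exp. }
{ intros u hu; unfold cube_exp; split; [left; apply exp_pos|].
  assert (0 <= (u - 1) ^ 2 * (u + 2)) by (apply Rmult_le_pos; [apply pow2_ge_0 | lra]).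
  destruct (Rle_lt_or_eq_dec (- u ^ 3) (2 - u)) as [h|h]; [nra | left; apply exp_increasing, h | rewrite h; lra]. }
destruct (improper_limit cube_exp1) as [E1 [hF1 hF2]].
{ apply continuous_cube_exp1. }
{ intros u hu; unfold cube_exp1; split; [apply Rmult_le_pos; [exact hu | left; apply exp_pos]|].
  apply Rle_trans with (exp u * exp (- u ^ 3)).
  - apply Rmult_le_compat_r; [left; apply exp_pos|]; pose proof (exp_ineq1_le u); lra.
  - rewrite <- exp_plus.
    destruct (Rle_lt_or_eq_dec (u + - u ^ 3) (2 - u)) as [h|h]; [| left; apply exp_increasing, h | rewrite h; lra].
    assert (0 <= (u - 1) ^ 2 * (u + 2)) by (apply Rmult_le_pos; [apply pow2_ge_0 | lra]); nra. }
change (forall x, 0 <= x -> I0 x <= E) in hE1.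
change (forall eps, 0 < eps -> exists X, 0 < X /\ forall x, X <= x -> E - eps < I0 x) in hE2.
change (forall x, 0 <= x -> I1 x <= E1) in hF1.
change (forall eps, 0 < eps -> exists X, 0 < X /\ forall x, X <= x -> E1 - eps < I1 x) in hF2.
assert (I0pos : forall x, 0 <= x -> 0 <= I0 x).
{ intros x hx; unfold I0; apply RInt_ge_0; [exact hx | apply ex_RInt_cont, continuous_cube_exp |].
  intros; left; apply exp_pos. }
assert (I1pos : forall x, 0 <= x -> 0 <= I1 x).
{ intros x hx; unfold I1; apply RInt_ge_0; [exact hx | apply ex_RInt_cont, continuous_cube_exp1 |].
  intros; apply Rmult_le_pos; [lra | left; apply exp_pos]. }
assert (E0 : 0 < E).
{ eapply Rlt_le_trans; [|apply (hE1 1); lra].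
  unfold I0; apply RInt_gt_0; [lra | intros; apply exp_pos | intros; apply continuous_cube_exp]. }
assert (E10 : 0 <= E1) by (eapply Rle_trans; [apply (I1pos 0); lra | apply hF1; lra]).
exists E, E1; split; [exact E0|]; split; [|split; [|split; assumption]].
- apply abs_le_eps; intros e he.
  set (e' := e / (2 * E + 4)); assert (he' : 0 < e') by (apply Rdiv_lt_0_compat; lra).
  destruct (hE2 e' he') as [X [hX hx]]; destruct (hF2 e' he') as [Y [hY hy]].
  set (x := Rmax X Y); assert (xX : X <= x) by apply Rmax_l; assert (xY : Y <= x) by apply Rmax_r.
  specialize (hx x xX); pose proof (hE1 x ltac:(lra)) as hx'; pose proof (I0pos x ltac:(lra)) as hx0.
  pose proof (I0_square x ltac:(lra)) as sq.
  set (J := RInt (fun t => I1 (x * cbrt1 t) * / cbrt1 t ^ 2) 0 1) in *.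
  assert (cJ : forall t, continuous (fun t => I1 (x * cbrt1 t) * / cbrt1 t ^ 2) t).
  { intros t; apply (continuous_mult (fun t => I1 (x * cbrt1 t)) (fun t => / cbrt1 t ^ 2)).
    - apply (continuous_comp (fun t => x * cbrt1 t) I1).
      + apply (continuous_scal_r (V := R_NormedModule) x cbrt1), continuous_cbrt1.
      + apply (ex_derive_continuous I1); eexists; apply is_derive_I1.
    - apply continuous_inv_cbrt1. }
  assert (inv1 : forall t, 0 < / cbrt1 t ^ 2 <= 1).
  { intros t; pose proof (cbrt1_ge1 t); split; [apply Rinv_0_lt_compat; nra|].
    rewrite <- Rinv_1; apply Rinv_le_contravar; nra. }
  assert (cI : forall c, forall t, continuous (fun t => c * / cbrt1 t ^ 2) t).
  { intros c t; apply (continuous_scal_r (V := R_NormedModule) c (fun t => / cbrt1 t ^ 2)), continuous_inv_cbrt1. }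
  assert (scalI : forall c, RInt (fun t => c * / cbrt1 t ^ 2) 0 1 = c * beta0).
  { intros c; unfold beta0; apply (RInt_scal (V := R_CompleteNormedModule)), ex_RInt_cont.
    intros t; apply continuous_inv_cbrt1. }
  assert (up : J <= E1 * beta0).
  { rewrite <- scalI; apply RInt_le_cont; auto; [lra|]; intros t _.
    apply Rmult_le_compat_r; [apply Rlt_le, inv1|]; apply hF1; pose proof (cbrt1_pos t); nra. }
  assert (low : (E1 - e') * beta0 <= J).
  { rewrite <- scalI; apply RInt_le_cont; auto; [lra|]; intros t _.
    apply Rmult_le_compat_r; [apply Rlt_le, inv1|]; left; apply hy; pose proof (cbrt1_ge1 t); nra. }
  assert (b1 : 0 <= beta0 <= 1).
  { split.
    - apply RInt_ge_0; [lra | apply ex_RInt_cont; intros; apply continuous_inv_cbrt1 | intros; apply Rlt_le, inv1].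
    - replace 1 with (RInt (fun _ => 1) 0 1) by (rewrite RInt_const; unfold scal; simpl; unfold mult; simpl; ring).
      apply RInt_le_cont; [lra | intros; apply continuous_inv_cbrt1 | intros; apply continuous_const | intros; apply inv1]. }
  assert (ee : e' * (2 * E + 4) = e) by (unfold e'; field; lra).
  apply Rabs_le; split; nra.
- apply abs_le_eps; intros e he.
  rewrite <- RInt_third.
  set (Q := RInt (fun t => (1 + t) * / cbrt1 t ^ 3 / 3) 0 1).
  set (e' := e / (E + E1 + 3)); assert (he' : 0 < e') by (apply Rdiv_lt_0_compat; lra).
  destruct (hE2 e' he') as [X [hX hx]]; destruct (hF2 e' he') as [Y [hY hy]].
  (* The bound [1 + / e'] makes [exp (- y) <= 1 / (1 + y) <= e'] for all [y] beyond [x]. *)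
  set (x := Rmax (Rmax X Y) (1 + / e')).
  assert (xX : X <= x) by (eapply Rle_trans; [apply (Rmax_l X Y) | apply Rmax_l]).
  assert (xY : Y <= x) by (eapply Rle_trans; [apply (Rmax_r X Y) | apply Rmax_l]).
  assert (xe : 1 + / e' <= x) by apply Rmax_r.
  specialize (hx x xX); specialize (hy x xY).
  pose proof (hE1 x ltac:(lra)) as hx'; pose proof (I0pos x ltac:(lra)) as hx0.
  pose proof (hF1 x ltac:(lra)) as hy'; pose proof (I1pos x ltac:(lra)) as hy0.
  pose proof (I0_I1 x ltac:(lra)) as pr.
  set (J := RInt (fun t => (1 + t) * / cbrt1 t ^ 3 / 3 * (1 - cube_exp (x * cbrt1 t))) 0 1) in *.
  assert (cw : forall t, continuous (fun t => (1 + t) * / cbrt1 t ^ 3 / 3) t).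
  { intros t; apply (continuous_mult (fun t => (1 + t) * / cbrt1 t ^ 3) (fun _ => / 3)); [|apply continuous_const].
    apply (continuous_mult (fun t => 1 + t) (fun t => / cbrt1 t ^ 3)); [|apply continuous_inv_cbrt1].
    apply (ex_derive_continuous (fun t => 1 + t)); auto_derive; trivial. }
  assert (cJ : forall t, continuous (fun t => (1 + t) * / cbrt1 t ^ 3 / 3 * (1 - cube_exp (x * cbrt1 t))) t).
  { intros t; apply (continuous_mult (fun t => (1 + t) * / cbrt1 t ^ 3 / 3) (fun t => 1 - cube_exp (x * cbrt1 t))).
    - apply cw.
    - apply (continuous_comp (fun t => x * cbrt1 t) (fun y => 1 - cube_exp y)).
      + apply (continuous_scal_r (V := R_NormedModule) x cbrt1), continuous_cbrt1.
      + apply (ex_derive_continuous (fun y => 1 - cube_exp y)); unfold cube_exp; auto_derive; trivial. }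
  assert (small : forall t, 0 <= cube_exp (x * cbrt1 t) <= e').
  { intros t; unfold cube_exp; split; [left; apply exp_pos|].
    rewrite exp_Ropp; pose proof (cbrt1_ge1 t); pose proof (Rinv_0_lt_compat e' he').
    assert (x1 : x <= (x * cbrt1 t) ^ 3).
    { assert (x <= x * cbrt1 t) by nra.
      apply Rle_trans with (x * cbrt1 t * 1 * 1); [lra|].
      replace ((x * cbrt1 t) ^ 3) with (x * cbrt1 t * (x * cbrt1 t) * (x * cbrt1 t)) by ring.
      apply Rmult_le_compat; nra. }
    pose proof (exp_ineq1_le ((x * cbrt1 t) ^ 3)) as h1.
    rewrite <- (Rinv_inv e'); apply Rinv_le_contravar; lra. }
  assert (w0 : forall t, 0 < t < 1 -> 0 <= (1 + t) * / cbrt1 t ^ 3 / 3 <= 1).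
  { intros t ht; rewrite cbrt1_cube by lra.
    assert (0 < t ^ 3) by (apply pow_lt; lra).
    assert (0 < / (1 + t ^ 3) <= 1).
    { split; [apply Rinv_0_lt_compat; lra|]; rewrite <- Rinv_1; apply Rinv_le_contravar; lra. }
    unfold Rdiv; split; nra. }
  assert (up : J <= Q).
  { apply RInt_le_cont; auto; [lra|]; intros t ht; specialize (w0 t ht); specialize (small t); nra. }
  assert (low : Q - e' <= J).
  { replace (Q - e') with (RInt (fun t => (1 + t) * / cbrt1 t ^ 3 / 3 - e') 0 1).
    - apply RInt_le_cont; auto; [lra | |].
      + intros t; apply (continuous_minus (fun t => (1 + t) * / cbrt1 t ^ 3 / 3) (fun _ => e')); [apply cw | apply continuous_const].
      + intros t ht; specialize (w0 t ht); specialize (small t); nra.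
    - rewrite (RInt_minus (V := R_CompleteNormedModule) (fun t => (1 + t) * / cbrt1 t ^ 3 / 3) (fun _ => e')).
      + rewrite RInt_const; change (Q - (1 - 0) * e' = Q - e'); ring.
      + apply ex_RInt_cont, cw.
      + apply ex_RInt_const. }
  assert (ee : e' * (E + E1 + 3) = e) by (unfold e'; field; lra).
  apply Rabs_le; split; nra.
Qed.

Lemma is_derive_Rpower_pos a t : 0 < t -> is_derive (fun t => Rpower t a) t (a * Rpower t (a - 1)).
Proof.
intros ht; unfold Rpower; auto_derive; [exact ht|].
replace ((a - 1) * ln t) with (a * ln t + - ln t) by ring; rewrite exp_plus, exp_Ropp, exp_ln by exact ht.
field; lra.
Qed.

(** The substitution [t = u ^ 3], carried out on the primitive [3 I0 (t ^ (1/3))] of Euler's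
    integrand. *)
Lemma Gamma_third_limit E : (forall x, 0 <= x -> I0 x <= E) ->
  (forall eps, 0 < eps -> exists X, 0 < X /\ forall x, X <= x -> E - eps < I0 x) -> Gamma (1 / 3) = 3 * E.
Proof.
intros h1 h2; unfold Gamma.
set (f := fun t => 3 * I0 (Rpower t (1 / 3))).
assert (df : forall t, 0 < t -> is_derive f t (Rpower t (1 / 3 - 1) * exp (- t))).
{ intros t ht; unfold f.
  replace (Rpower t (1 / 3 - 1) * exp (- t)) with
    (3 * ((1 / 3 * Rpower t (1 / 3 - 1)) * cube_exp (Rpower t (1 / 3)))).
  - apply (is_derive_scal (fun t => I0 (Rpower t (1 / 3)))).
    apply (is_derive_comp I0 (fun t => Rpower t (1 / 3))); [apply is_derive_I0 | apply is_derive_Rpower_pos, ht].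
  - unfold cube_exp; rewrite <- Rpower_pow by apply exp_pos; rewrite Rpower_mult.
    replace (1 / 3 * INR 3) with 1 by (simpl; field); rewrite Rpower_1 by exact ht; field. }
apply is_RInt_gen_unique.
replace (3 * E) with (3 * E - 0) by ring.
assert (pos : filter_prod (at_right 0) (Rbar_locally p_infty) (fun ab : R * R => 0 < fst ab /\ 0 < snd ab)).
{ exists (fun x => 0 < x) (fun x => 0 < x); [exists (mkposreal 1 Rlt_0_1); intros; assumption | exists 0; auto | auto]. }
apply is_RInt_gen_ext with (Derive f).
{ revert pos; apply filter_imp; intros [a b] [ha hb] x hx; simpl in *.
  apply is_derive_unique, df; pose proof (Rmin_glb_lt a b 0 ha hb); lra. }
apply is_RInt_gen_Derive.
- revert pos; apply filter_imp; intros [a b] [ha hb] x hx; simpl in *.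
  eexists; apply df; pose proof (Rmin_glb_lt a b 0 ha hb); lra.
- revert pos; apply filter_imp; intros [a b] [ha hb] x hx; simpl in *.
  assert (x0 : 0 < x) by (pose proof (Rmin_glb_lt a b 0 ha hb); lra).
  apply continuous_ext_loc with (fun t => Rpower t (1 / 3 - 1) * exp (- t)).
  + exists (mkposreal x x0); intros y hy; symmetry; apply is_derive_unique, df.
    unfold ball in hy; simpl in hy; unfold AbsRing_ball, abs, minus, plus, opp in hy; simpl in hy.
    apply Rabs_lt_between in hy; lra.
  + apply (ex_derive_continuous (fun t => Rpower t (1 / 3 - 1) * exp (- t))); unfold Rpower; auto_derive; lra.
- intros P [eps hP]; destruct eps as [e he].
  assert (r0 : 0 < Rpower (e / 3) 3) by apply exp_pos.
  exists (mkposreal _ r0); intros y hy y0.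
  unfold ball in hy; simpl in hy; unfold AbsRing_ball, abs, minus, plus, opp in hy; simpl in hy.
  apply hP; unfold ball; simpl; unfold AbsRing_ball, abs, minus, plus, opp; simpl.
  rewrite Ropp_0, Rplus_0_r in *; rewrite Rabs_pos_eq in hy by lra.
  set (z := Rpower y (1 / 3)); assert (z0 : 0 < z) by apply exp_pos.
  assert (zl : z < e / 3).
  { unfold z; replace (e / 3) with (Rpower (Rpower (e / 3) 3) (1 / 3)).
    - apply Rlt_Rpower_l; lra.
    - rewrite Rpower_mult; replace (3 * (1 / 3)) with 1 by field; apply Rpower_1; lra. }
  assert (b : 0 <= I0 z <= z).
  { unfold I0; split.
    - apply RInt_ge_0; [lra | apply ex_RInt_cont, continuous_cube_exp | intros; left; apply exp_pos].
    - replace z with (RInt (fun _ => 1) 0 z) at 2 by (rewrite RInt_const; unfold scal; simpl; unfold mult; simpl; ring).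
      apply RInt_le_cont; [lra | apply continuous_cube_exp | intros; apply continuous_const |].
      intros u hu; unfold cube_exp; rewrite <- exp_0.
      left; apply exp_increasing; assert (0 < u ^ 3) by (apply pow_lt; lra); lra. }
  unfold f; fold z; rewrite Rabs_pos_eq; lra.
- intros P [eps hP]; destruct eps as [e he]; destruct (h2 (e / 3) ltac:(lra)) as [X [X0 hX]].
  exists (Rpower X 3); intros y hy; apply hP.
  assert (p3 : 0 < Rpower X 3) by apply exp_pos.
  set (z := Rpower y (1 / 3)).
  assert (zX : X <= z).
  { unfold z; replace X with (Rpower (Rpower X 3) (1 / 3)).
    - apply Rle_Rpower_l; lra.
    - rewrite Rpower_mult; replace (3 * (1 / 3)) with 1 by field; apply Rpower_1; lra. }
  specialize (hX z zX); pose proof (h1 z ltac:(lra)).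
  unfold ball; simpl; unfold AbsRing_ball, abs, minus, plus, opp; simpl; unfold f; fold z.
  rewrite Rabs_left1; lra.
Qed.

(** Eliminate [E1] from the two relations: [E ^ 3 = 2 (E E1) beta0], where [E E1] is known and
    [E = Gamma (1/3) / 3]. *)
Theorem gamma_third : 0 < Gamma (1 / 3) /\ 3 * beta0 = Gamma (1 / 3) ^ 3 * sqrt 3 / (4 * PI).
Proof.
destruct exists_limits as [E [E1 [E0 [e1 [e2 [h1 h2]]]]]].
rewrite (Gamma_third_limit E h1 h2); split; [lra|].
assert (p3 : 0 < sqrt 3) by (apply sqrt_lt_R0; lra); pose proof PI_RGT_0.
assert (E1 <> 0).
{ intros z; rewrite z in e1; assert (0 < E ^ 2) by (apply pow_lt; lra); lra. }
apply Rmult_eq_reg_l with (2 * (E * E1)); [|apply Rmult_integral_contrapositive; split; [lra|];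
  apply Rmult_integral_contrapositive; split; [lra | assumption]].
transitivity (3 * E * E ^ 2); [rewrite e1; ring|]; rewrite e2; field; lra.
Qed.

(* Substitution [t = u ^ (- 3)]. *)
Lemma kernel_integral b : 1 <= b ->
  RInt (fun t => Rpower (t * (t + 1)) (- (2 / 3))) 1 b =
  3 * (beta0 - RInt (fun u => / cbrt1 u ^ 2) 0 (Rpower b (- (1 / 3)))).
Proof.
intros hb.
set (B := fun y => RInt (fun u => / cbrt1 u ^ 2) 0 y).
assert (dB : forall y, is_derive B y (/ cbrt1 y ^ 2)) by (intros y; apply (is_derive_primitive (fun u => / cbrt1 u ^ 2)); intros; apply continuous_inv_cbrt1).
rewrite (is_RInt_unique _ _ _ (minus (-3 * B (Rpower b (- (1 / 3)))) (-3 * B (Rpower 1 (- (1 / 3)))))).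
- replace (Rpower 1 (- (1 / 3))) with 1 by (unfold Rpower; rewrite ln_1, Rmult_0_r, exp_0; reflexivity).
  unfold minus, plus, opp; simpl; unfold B, beta0; ring.
- apply (is_RInt_derive (V := R_CompleteNormedModule) (fun t => -3 * B (Rpower t (- (1 / 3))))).
  + intros t; rewrite Rmin_left, Rmax_right by lra; intros ht.
    assert (e : Rpower (t * (t + 1)) (- (2 / 3)) =
      -3 * ((- (1 / 3) * Rpower t (- (1 / 3) - 1)) * / cbrt1 (Rpower t (- (1 / 3))) ^ 2)).
    { assert (c3 : cbrt1 (Rpower t (- (1 / 3))) = Rpower ((t + 1) * / t) (1 / 3)).
      { unfold cbrt1; f_equal; rewrite Rabs_pos_eq by (left; apply exp_pos).
        rewrite <- Rpower_pow by apply exp_pos; rewrite Rpower_mult.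
        replace (- (1 / 3) * INR 3) with (- (1)) by (simpl; field).
        rewrite Rpower_Ropp, Rpower_1 by lra; field; lra. }
      rewrite c3, <- Rpower_pow by apply exp_pos; rewrite Rpower_mult, <- Rpower_Ropp.
      rewrite <- !Rpower_mult_distr by (try apply Rinv_0_lt_compat; lra).
      replace (/ t) with (Rpower t (- (1))) by (rewrite Rpower_Ropp, Rpower_1; lra).
      rewrite Rpower_mult.
      replace (- (1 / 3 * INR 2)) with (- (2 / 3)) by (simpl; field).
      replace (Rpower t (- (2 / 3))) with (Rpower t (- (1 / 3) - 1) * Rpower t (- (1) * - (2 / 3)))
        by (rewrite <- Rpower_plus; f_equal; field).
      field. }
    rewrite e; apply (is_derive_scal (fun t => B (Rpower t (- (1 / 3))))).
    apply (is_derive_comp B (fun t => Rpower t (- (1 / 3)))); [apply dB | apply is_derive_Rpower_pos; lra].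
  + intros t; rewrite Rmin_left, Rmax_right by lra; intros ht.
    apply (ex_derive_continuous (fun t => Rpower (t * (t + 1)) (- (2 / 3)))); unfold Rpower; auto_derive; nra.
Qed.

Lemma kernel_integral_limit eps : 0 < eps -> exists X, 1 <= X /\ forall b, X <= b ->
  Rabs (RInt (fun t => Rpower (t * (t + 1)) (- (2 / 3))) 1 b - 3 * beta0) < eps.
Proof.
intros he; exists (Rmax 1 (Rpower (eps / 4) (-3))); split; [apply Rmax_l|]; intros b hb.
assert (b1 : 1 <= b) by (eapply Rle_trans; [apply Rmax_l | exact hb]).
assert (b2 : Rpower (eps / 4) (-3) <= b) by (eapply Rle_trans; [apply Rmax_r | exact hb]).
rewrite kernel_integral by exact b1.
set (y := Rpower b (- (1 / 3))); assert (y0 : 0 < y) by apply exp_pos.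
assert (ye : y <= eps / 4).
{ unfold y; replace (eps / 4) with (Rpower (Rpower (eps / 4) (-3)) (- (1 / 3))).
  - rewrite !(Rpower_Ropp _ (1 / 3)); apply Rinv_le_contravar; [apply exp_pos|].
    apply Rle_Rpower_l; [lra | split; [apply exp_pos | exact b2]].
  - rewrite Rpower_mult; replace (-3 * - (1 / 3)) with 1 by field; apply Rpower_1; lra. }
assert (q : 0 <= RInt (fun u => / cbrt1 u ^ 2) 0 y <= y).
{ assert (inv1 : forall t, 0 < / cbrt1 t ^ 2 <= 1).
  { intros t; pose proof (cbrt1_ge1 t); split; [apply Rinv_0_lt_compat; nra|].
    rewrite <- Rinv_1; apply Rinv_le_contravar; nra. }
  split.
  - apply RInt_ge_0; [lra | apply ex_RInt_cont; intros; apply continuous_inv_cbrt1 | intros; apply Rlt_le, inv1].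
  - replace y with (RInt (fun _ => 1) 0 y) at 2 by (rewrite RInt_const; unfold scal; simpl; unfold mult; simpl; ring).
    apply RInt_le_cont; [lra | intros; apply continuous_inv_cbrt1 | intros; apply continuous_const | intros; apply inv1]. }
apply Rabs_def1; lra.
Qed.

(** * The zeta function *)

Lemma Rpower_step a m : 0 < a -> 1 <= m ->
  a * Rpower (m + 1) (- 1 - a) <= Rpower m (- a) - Rpower (m + 1) (- a).
Proof.
intros ha hm.
destruct (MVT_gen (fun t => Rpower t (- a)) m (m + 1) (fun t => - a * Rpower t (- a - 1))) as [c [hc h]].
- rewrite Rmin_left, Rmax_right by lra; intros t ht; apply is_derive_Rpower_pos; lra.
- rewrite Rmin_left, Rmax_right by lra; intros t ht.
  apply derivable_continuous_pt; exists (- a * Rpower t (- a - 1)).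
  apply is_derive_Reals, is_derive_Rpower_pos; lra.
- rewrite Rmin_left, Rmax_right in hc by lra.
  assert (Rpower (m + 1) (- 1 - a) <= Rpower c (- a - 1)).
  { unfold Rpower; apply exp_incr.
    assert (ln c <= ln (m + 1)) by (apply ln_le; lra); nra. }
  nra.
Qed.

(** The comparison of a sum with an integral, in telescoping form through [Rpower_step]. *)
Lemma rbound_Rpower a n0 : 0 < a -> (1 <= n0)%nat ->
  rbound (fun n => (n0 <= n)%nat) (fun n => Rpower (INR n) (- 1 - a))
    (Rpower (INR n0) (- 1 - a) + Rpower (INR n0) (- a) / a).
Proof.
intros ha hn0 L nd hL.
assert (H : forall N, rsum (fun n => Rpower (INR n) (- 1 - a)) (seq n0 (S N)) <=
  Rpower (INR n0) (- 1 - a) + (Rpower (INR n0) (- a) - Rpower (INR (n0 + N)) (- a)) / a).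
{ induction N as [|N IH].
  - rewrite Nat.add_0_r; unfold rsum; simpl seq; simpl map; cbn [fold_right].
    right; unfold Rdiv; ring.
  - rewrite seq_S, rsum_app; unfold rsum at 2; cbn [map fold_right].
    assert (i1 : 1 <= INR (n0 + N)) by (apply (le_INR 1); lia).
    pose proof (Rpower_step a (INR (n0 + N)) ha i1) as st.
    replace (n0 + S N)%nat with (S (n0 + N)) by lia; rewrite S_INR.
    assert (Rpower (INR (n0 + N) + 1) (- 1 - a) <= (Rpower (INR (n0 + N)) (- a) - Rpower (INR (n0 + N) + 1) (- a)) / a).
    { apply Rmult_le_reg_r with a; [lra|]; unfold Rdiv; rewrite (Rmult_assoc _ (/ a) a), Rinv_l by lra; lra. }
    unfold Rdiv in *; lra. }
eapply Rle_trans with (rsum (fun n => Rpower (INR n) (- 1 - a)) (seq n0 (S (list_max L)))).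
- apply rsum_incl_le; auto using seq_NoDup.
  + intros; left; apply exp_pos.
  + intros n hn; rewrite List.Forall_forall in hL; specialize (hL n hn); apply in_seq.
    pose proof (proj1 (list_max_le L (list_max L)) (le_n _)) as hm; rewrite List.Forall_forall in hm.
    specialize (hm n hn); lia.
- eapply Rle_trans; [apply H|].
  assert (0 < Rpower (INR (n0 + list_max L)) (- a)) by apply exp_pos.
  apply Rplus_le_compat_l; apply Rmult_le_compat_r; [left; apply Rinv_0_lt_compat; lra | lra].
Qed.

Lemma Re_mult_real z x : Re (z * RtoC x) = Re z * x.
Proof. destruct z; unfold RtoC, Cmult, Re; simpl; ring. Qed.

Lemma Im_mult_real z x : Im (z * RtoC x) = Im z * x.
Proof. destruct z; unfold RtoC, Cmult, Im; simpl; ring. Qed.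

(** The half plane [Re <= M] is convex, so the derivative is bounded by [exp M] on the whole
    segment. *)
Lemma cexp_lipschitz M z w : Re z <= M -> Re w <= M -> Cmod (cexp z - cexp w) <= exp M * Cmod (z - w).
Proof.
intros hz hw.
destruct (entire_cexp 1%C (Cmod z + Cmod w + 1)) as [K [hK hC]].
pose proof (Cmod_ge_0 z); pose proof (Cmod_ge_0 w).
pose proof (C11_mean_value 0%C _ K _ _ w z 0%C (exp M) hK hC) as h.
replace (w - 0)%C with w in h by ring; replace (z - 0)%C with z in h by ring.
specialize (h ltac:(lra) ltac:(lra)).
rewrite !Cmult_1_r in h.
replace (cexp z - cexp w - 0 * (z - w))%C with (cexp z - cexp w)%C in h by ring.
apply h; intros l hl.
rewrite Cmult_1_r, Cmult_1_l.
replace (cexp (segment w z l) - 0)%C with (cexp (segment w z l)) by ring.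
rewrite Cmod_cexp; apply exp_incr.
replace (Re (segment w z l)) with (Re w + l * (Re z - Re w)); [nra|].
unfold segment; destruct w, z; unfold RtoC, Cmult, Cplus, Cminus, Copp, Re; simpl; ring.
Qed.

(** [n ^ (- v)], the term of a Dirichlet series; at [n = 0] its value is immaterial. *)
Definition npow (n : nat) (v : C) : C := cexp (v * RtoC (- ln (INR n))).

Lemma Cmod_npow n v : Cmod (npow n v) = Rpower (INR n) (- Re v).
Proof. unfold npow; rewrite Cmod_cexp, Re_mult_real; unfold Rpower; f_equal; ring. Qed.

Lemma npow_mult m n v : (1 <= m)%nat -> (1 <= n)%nat -> npow (m * n) v = (npow m v * npow n v)%C.
Proof.
intros hm hn; unfold npow; rewrite <- cexp_plus, mult_INR, ln_mult by (apply lt_0_INR; lia).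
f_equal; rewrite <- Cmult_plus_distr_l, <- RtoC_plus; do 2 f_equal; ring.
Qed.

Lemma npow_shift n v : (1 <= n)%nat -> npow n (v - 1) = (RtoC (INR n) * npow n v)%C.
Proof.
intros hn; assert (0 < INR n) by (apply lt_0_INR; lia).
unfold npow; rewrite <- (exp_ln (INR n)) at 2 by auto; rewrite <- cexp_RtoC, <- cexp_plus; f_equal.
rewrite RtoC_opp; ring.
Qed.

Lemma npow_1 v : npow 1 v = 1%C.
Proof. unfold npow; simpl INR; rewrite ln_1, Ropp_0, Cmult_0_r; apply cexp_0. Qed.

Lemma rbound_npow v n0 : (1 <= n0)%nat -> 1 < v ->
  rbound (fun n => (n0 <= n)%nat) (fun n => Rpower (INR n) (- v))
    (Rpower (INR n0) (- v) + Rpower (INR n0) (1 - v) / (v - 1)).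
Proof.
intros hn hv; pose proof (rbound_Rpower (v - 1) n0 ltac:(lra) hn) as h.
replace (- 1 - (v - 1)) with (- v) in h by ring; replace (- (v - 1)) with (1 - v) in h by ring; exact h.
Qed.

Definition log_shift (n : nat) (x : R) : R := ln (INR n + clamp x).

Lemma continuous_log_shift n x : (1 <= n)%nat -> continuous (log_shift n) x.
Proof.
intros hn; unfold log_shift.
apply continuous_comp with (f := fun x => INR n + clamp x) (g := ln).
- apply (continuous_plus (fun _ => INR n) clamp); [apply continuous_const | apply continuous_clamp].
- apply continuity_pt_filterlim; apply derivable_continuous_pt.
  pose proof (clamp_in x); assert (1 <= INR n) by (apply (le_INR 1); lia).
  exists (/ (INR n + clamp x)); apply derivable_pt_lim_ln; lra.
Qed.

Lemma log_shift_bounds n x : (1 <= n)%nat ->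
  ln (INR n) <= log_shift n x <= ln (INR n) + / INR n.
Proof.
intros hn; assert (1 <= INR n) by (apply (le_INR 1); lia); pose proof (clamp_in x).
unfold log_shift; split; [apply ln_le; lra|].
replace (INR n + clamp x) with (INR n * (1 + clamp x / INR n)) by (field; lra).
assert (0 <= clamp x / INR n) by (apply Rdiv_le_0_compat; lra).
rewrite ln_mult by lra; apply Rplus_le_compat_l.
assert (clamp x / INR n <= / INR n).
{ unfold Rdiv; rewrite <- (Rmult_1_l (/ INR n)) at 2; apply Rmult_le_compat_r; [left; apply Rinv_0_lt_compat; lra | lra]. }
pose proof (exp_ineq1_le (clamp x / INR n)).
apply Rle_trans with (clamp x / INR n); auto.
rewrite <- (ln_exp (clamp x / INR n)) at 2; apply ln_le; lra.
Qed.

Lemma Ccontinuous_RtoC (g : R -> R) : (forall x, continuous g x) -> Ccontinuous (fun x => RtoC (g x)).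
Proof.
intros h x eps he; destruct (proj1 (filterlim_locally _ _) (h x) (mkposreal eps he)) as [del hd].
exists del; split; [apply cond_pos|]; intros y hy.
rewrite <- RtoC_minus, Cmod_R; exact (hd y hy).
Qed.

(* [int_n^(n+1) t ^ (- v) dt] *)
Definition power_integral (n : nat) (v : C) : C := Cint (fun x => cexp (v * RtoC (- log_shift n x))).

Lemma Ccontinuous_neg_log_shift n : (1 <= n)%nat -> Ccontinuous (fun x => RtoC (- log_shift n x)).
Proof.
intros hn; apply Ccontinuous_RtoC; intros x.
apply (continuous_opp (log_shift n)), continuous_log_shift, hn.
Qed.

Lemma power_integral_eq n v : (1 <= n)%nat ->
  ((1 - v) * power_integral n v)%C = (npow (S n) (v - 1) - npow n (v - 1))%C.
Proof.
intros hn; assert (n1 : 1 <= INR n) by (apply (le_INR 1); lia).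
unfold power_integral; rewrite <- Cint_scal by (apply Ccontinuous_cexp, Ccontinuous_neg_log_shift, hn).
set (p := 1 - Re v); set (q := - Im v).
set (Fr := fun x => exp (p * ln (INR n + x)) * cos (q * ln (INR n + x))).
set (Fi := fun x => exp (p * ln (INR n + x)) * sin (q * ln (INR n + x))).
assert (cl : forall x, 0 <= x <= 1 -> log_shift n x = ln (INR n + x)).
{ intros x hx; unfold log_shift; rewrite clamp_id by auto; reflexivity. }
assert (e1 : forall x, 0 <= x <= 1 -> exp (Re v * - ln (INR n + x)) = exp (p * ln (INR n + x)) / (INR n + x)).
{ intros x hx; rewrite <- (exp_ln (INR n + x)) at 3 by lra; unfold Rdiv; rewrite <- exp_Ropp, <- exp_plus; f_equal; unfold p; ring. }
assert (hr : is_RInt (fun x => Re ((1 - v) * cexp (v * RtoC (- log_shift n x)))) 0 1 (minus (Fr 1) (Fr 0))).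
{ apply (is_RInt_derive (V := R_CompleteNormedModule) Fr (fun x => Re ((1 - v) * cexp (v * RtoC (- log_shift n x))))).
  - rewrite Rmin_left, Rmax_right by lra; intros x hx.
    replace (Re ((1 - v) * cexp (v * RtoC (- log_shift n x)))) with
      ((p * exp (p * ln (INR n + x)) * cos (q * ln (INR n + x)) - q * exp (p * ln (INR n + x)) * sin (q * ln (INR n + x))) / (INR n + x)).
    + unfold Fr; auto_derive; [lra | field; lra].
    + rewrite cl by auto; unfold cexp; rewrite Re_mult_real, Im_mult_real, e1 by auto.
      replace (Im v * - ln (INR n + x)) with (q * ln (INR n + x)) by (unfold q; ring).
      unfold p, q; destruct v as [a b]; unfold RtoC, Cmult, Cminus, Cplus, Copp, Re, Im; simpl; field; lra.
  - rewrite Rmin_left, Rmax_right by lra; intros x hx.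
    apply Ccontinuous_Re, Ccontinuous_mult; [apply Ccontinuous_const | apply Ccontinuous_cexp, Ccontinuous_neg_log_shift, hn]. }
assert (hi : is_RInt (fun x => Im ((1 - v) * cexp (v * RtoC (- log_shift n x)))) 0 1 (minus (Fi 1) (Fi 0))).
{ apply (is_RInt_derive (V := R_CompleteNormedModule) Fi (fun x => Im ((1 - v) * cexp (v * RtoC (- log_shift n x))))).
  - rewrite Rmin_left, Rmax_right by lra; intros x hx.
    replace (Im ((1 - v) * cexp (v * RtoC (- log_shift n x)))) with
      ((p * exp (p * ln (INR n + x)) * sin (q * ln (INR n + x)) + q * exp (p * ln (INR n + x)) * cos (q * ln (INR n + x))) / (INR n + x)).
    + unfold Fi; auto_derive; [lra | field; lra].
    + rewrite cl by auto; unfold cexp; rewrite Re_mult_real, Im_mult_real, e1 by auto.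
      replace (Im v * - ln (INR n + x)) with (q * ln (INR n + x)) by (unfold q; ring).
      unfold p, q; destruct v as [a b]; unfold RtoC, Cmult, Cminus, Cplus, Copp, Re, Im; simpl; field; lra.
  - rewrite Rmin_left, Rmax_right by lra; intros x hx.
    apply Ccontinuous_Im, Ccontinuous_mult; [apply Ccontinuous_const | apply Ccontinuous_cexp, Ccontinuous_neg_log_shift, hn]. }
assert (np : forall y m, INR m = INR n + y -> npow m (v - 1) = (Fr y, Fi y)).
{ intros y m e; unfold npow, cexp; rewrite Re_mult_real, Im_mult_real, e; unfold Fr, Fi.
  assert (Re (v - 1) * - ln (INR n + y) = p * ln (INR n + y)) as -> by (unfold p; destruct v; unfold Cminus, Cplus, Copp, RtoC, Re; simpl; ring).
  assert (Im (v - 1) * - ln (INR n + y) = q * ln (INR n + y)) as -> by (unfold q; destruct v; unfold Cminus, Cplus, Copp, RtoC, Im; simpl; ring).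
  reflexivity. }
rewrite (np 1 (S n)), (np 0 n) by (rewrite ?S_INR; ring).
unfold Cint; rewrite (is_RInt_unique _ _ _ _ hr), (is_RInt_unique _ _ _ _ hi); reflexivity.
Qed.

(** The difference between a term and the integral over the next unit interval is
    [O(|v| n ^ (- 1 - Re v))], hence summable for [Re v > 0]. *)
Definition zeta_term (n : nat) (v : C) : C := (npow n v - power_integral n v)%C.

Lemma zeta_term_bound n v : (1 <= n)%nat -> 0 <= Re v ->
  Cmod (zeta_term n v) <= 2 * Cmod v * Rpower (INR n) (- 1 - Re v).
Proof.
intros hn hv; assert (n1 : 1 <= INR n) by (apply (le_INR 1); lia).
unfold zeta_term, power_integral; rewrite <- (Cint_const (npow n v)).
pose proof (Ccontinuous_neg_log_shift n hn) as cc.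
replace (Cint (fun _ : R => npow n v) - Cint (fun x => cexp (v * RtoC (- log_shift n x))))%C with
  (Cint (fun x => npow n v + (- (1)) * cexp (v * RtoC (- log_shift n x)))%C).
2:{ rewrite (Cint_plus (fun _ => npow n v)), Cint_scal; auto using Ccontinuous_cexp; [ring | apply Ccontinuous_const |].
    apply Ccontinuous_mult; [apply Ccontinuous_const | auto using Ccontinuous_cexp]. }
rewrite Rmult_assoc; apply Cint_bound.
{ apply Ccontinuous_plus; [apply Ccontinuous_const|].
  apply Ccontinuous_mult; [apply Ccontinuous_const | auto using Ccontinuous_cexp]. }
intros x hx; pose proof (log_shift_bounds n x hn) as [b1 b2].
replace (npow n v + - (1) * cexp (v * RtoC (- log_shift n x)))%C with
  (npow n v - cexp (v * RtoC (- log_shift n x)))%C by ring.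
unfold npow; eapply Rle_trans.
{ apply (cexp_lipschitz (Re v * - ln (INR n))); rewrite Re_mult_real; [lra | nra]. }
replace (v * RtoC (- ln (INR n)) - v * RtoC (- log_shift n x))%C with (v * RtoC (log_shift n x - ln (INR n)))%C
  by (rewrite RtoC_minus, !RtoC_opp; ring).
rewrite Cmod_mult, Cmod_R, Rabs_pos_eq by lra.
replace (Rpower (INR n) (- 1 - Re v)) with (exp (Re v * - ln (INR n)) * / INR n).
2:{ rewrite <- (exp_ln (INR n)) at 2 by lra; rewrite <- exp_Ropp, <- exp_plus; unfold Rpower; f_equal; ring. }
pose proof (exp_pos (Re v * - ln (INR n))); pose proof (Cmod_ge_0 v).
replace (exp (Re v * - ln (INR n)) * (Cmod v * (log_shift n x - ln (INR n)))) with
  (Cmod v * (exp (Re v * - ln (INR n)) * (log_shift n x - ln (INR n)))) by ring.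
apply Rmult_le_compat_l; auto; apply Rmult_le_compat_l; lra.
Qed.

Lemma has_sum_zeta_term v : 0 < Re v -> exists l, has_sum (fun n => (1 <= n)%nat) (fun n => zeta_term n v) l.
Proof.
intros hv; eapply has_sum_exists.
- intros n hn; apply zeta_term_bound; [exact hn | lra].
- apply rbound_scal; [pose proof (Cmod_ge_0 v); lra | apply rbound_Rpower; [exact hv | lia]].
Qed.

Definition zeta_regular (v : C) : C :=
  epsilon (inhabits (RtoC 0)) (fun l => has_sum (fun n => (1 <= n)%nat) (fun n => zeta_term n v) l).

(** The integrals removed in [zeta_term] add up to [1 / (v - 1)] for [Re v > 1]; adding it back
    continues the zeta function to [Re v > 0] with its pole made explicit. *)
Definition zeta (v : C) : C := (/ (v - 1) + zeta_regular v)%C.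

Lemma zeta_regular_spec v : 0 < Re v ->
  has_sum (fun n => (1 <= n)%nat) (fun n => zeta_term n v) (zeta_regular v).
Proof. intros hv; unfold zeta_regular; apply epsilon_spec, has_sum_zeta_term, hv. Qed.

Lemma Re_close v v0 : Re v0 - Cmod (v - v0) <= Re v.
Proof.
pose proof (re_le_Cmod (v - v0)) as h; unfold Rabs in h.
replace (Re (v - v0)) with (Re v - Re v0) in h by (destruct v, v0; reflexivity).
destruct (Rcase_abs _); lra.
Qed.

Lemma entire_ext u u' v : (forall s, u s = u' s) -> entire u v -> entire u' v.
Proof.
intros e h R; destruct (h R) as [K [hK hC]]; exists K; split; [exact hK|].
intros s t hs ht; rewrite <- !e; auto.
Qed.

Lemma entire_zeta_term n : (1 <= n)%nat -> exists w, entire (zeta_term n) w.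
Proof.
intros hn; assert (n1 : 1 <= INR n) by (apply (le_INR 1); lia); pose proof (Ccontinuous_neg_log_shift n hn) as cc.
assert (hb : forall x, Cmod (RtoC (- log_shift n x)) <= ln (INR n) + / INR n).
{ intros x; rewrite Cmod_R, Rabs_Ropp; pose proof (log_shift_bounds n x hn).
  assert (0 <= ln (INR n)) by (rewrite <- ln_1; apply ln_le; lra); rewrite Rabs_pos_eq; lra. }
eexists; eapply entire_ext; [|exact (entire_plus _ _ _ _ (entire_cexp (RtoC (- ln (INR n))))
  (entire_mult _ _ _ _ (entire_const (- (1))%C) (entire_Cint_cexp _ _ cc hb)))].
intros s; cbn beta; unfold zeta_term, npow, power_integral; ring.
Qed.

Lemma holC_zeta_regular v0 : 0 < Re v0 -> holC zeta_regular v0.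
Proof.
intros hv; set (a := Re v0 / 2).
assert (ha : 0 < a) by (unfold a; lra).
assert (re : forall s, Cmod (s - v0) < a -> a <= Re s) by (intros s hs; pose proof (Re_close s v0); unfold a in *; lra).
assert (en : exists w : nat -> C -> C, forall n, (1 <= n)%nat -> entire (zeta_term n) (w n)).
{ exists (fun n => epsilon (inhabits (fun _ => RtoC 0)) (fun w => entire (zeta_term n) w)).
  intros n hn; apply epsilon_spec, entire_zeta_term, hn. }
destruct en as [w hw].
apply (weierstrass (fun n => (1 <= n)%nat) zeta_term w
  (fun n => 2 * (Cmod v0 + a) * Rpower (INR n) (- 1 - a))
  (2 * (Cmod v0 + a) * (Rpower (INR 1) (- 1 - a) + Rpower (INR 1) (- a) / a)) zeta_regular v0 a ha); cycle 2.
- apply rbound_scal; [pose proof (Cmod_ge_0 v0); lra | apply rbound_Rpower; [exact ha | apply le_n]].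
- intros s hs; apply zeta_regular_spec; specialize (re s hs); lra.
- intros n hn; apply entire_C11, hw, hn.
- intros n hn s hs; specialize (re s hs); eapply Rle_trans; [apply zeta_term_bound; [exact hn | lra]|].
  assert (Cmod s <= Cmod v0 + a).
  { pose proof (Cmod_triangle (s - v0) v0) as h; replace (s - v0 + v0)%C with s in h by ring; lra. }
  apply Rmult_le_compat; [pose proof (Cmod_ge_0 s); lra | left; apply exp_pos | lra |].
  apply Rle_Rpower; [apply (le_INR 1), hn | lra].
Qed.

Lemma holC_zeta v : 0 < Re v -> v <> 1%C -> holC zeta v.
Proof.
intros hv h1; apply (holC_plus (fun v => / (v - 1))%C zeta_regular); [|apply holC_zeta_regular, hv].
apply (holC_inv (fun v => v - 1)%C).
- apply (holC_minus (fun v => v) (fun _ => 1%C)); [apply holC_id | apply holC_const].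
- intros e; apply h1; replace v with (v - 1 + 1)%C by ring; rewrite e; ring.
Qed.

Lemma has_sum_npow v : 1 < Re v -> exists l, has_sum (fun n => (1 <= n)%nat) (fun n => npow n v) l.
Proof.
intros hv; eapply has_sum_exists; [intros n _; right; apply Cmod_npow | apply rbound_npow; [apply le_n | exact hv]].
Qed.

Lemma power_integral_telescope (v : C) N : v <> 1%C ->
  csum (fun n => power_integral n v) (seq 1 N) = ((1 - npow (S N) (v - 1)) / (v - 1))%C.
Proof.
intros h1; assert (h2 : (v - 1)%C <> 0%C).
{ intros e; apply h1; replace v with (v - 1 + 1)%C by ring; rewrite e; ring. }
induction N as [|N IH].
- rewrite npow_1; unfold csum; cbn [seq map fold_right]; field; exact h2.
- rewrite seq_S, csum_app, IH; rewrite csum_cons; unfold csum at 1; cbn [map fold_right].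
  pose proof (power_integral_eq (1 + N) v ltac:(lia)) as e.
  replace (power_integral (1 + N) v) with (- ((1 - v) * power_integral (1 + N) v) / (v - 1))%C by (field; auto).
  rewrite e; simpl Nat.add; field; auto.
Qed.

Lemma Rpower_small a eps : 0 < a -> 0 < eps -> exists X, 1 <= X /\ forall x, X <= x -> Rpower x (- a) < eps.
Proof.
intros ha he; exists (Rmax 1 (Rpower (eps / 2) (- / a))); split; [apply Rmax_l|]; intros x hx.
pose proof (Rmax_l 1 (Rpower (eps / 2) (- / a))); pose proof (Rmax_r 1 (Rpower (eps / 2) (- / a))).
apply Rle_lt_trans with (eps / 2); [|lra].
replace (eps / 2) with (Rpower (Rpower (eps / 2) (- / a)) (- a)).
- unfold Rpower at 1 2; apply exp_incr.
  assert (ln (Rpower (eps / 2) (- / a)) <= ln x) by (apply ln_le; [apply exp_pos | lra]); nra.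
- rewrite Rpower_mult; replace (- / a * - a) with 1 by (field; lra); apply Rpower_1; lra.
Qed.

Theorem has_sum_zeta v : 1 < Re v -> has_sum (fun n => (1 <= n)%nat) (fun n => npow n v) (zeta v).
Proof.
intros hv; destruct (has_sum_npow v hv) as [l hl]; replace (zeta v) with l; [exact hl|].
assert (h1 : v <> 1%C) by (intros ->; simpl in hv; lra).
assert (h2 : (v - 1)%C <> 0%C).
{ intros e; apply h1; replace v with (v - 1 + 1)%C by ring; rewrite e; ring. }
set (c := Cmod (v - 1)); assert (hc : 0 < c) by (apply Cmod_gt_0, h2).
assert (z : Cmod (l - zeta v) <= 0).
{ apply Rnot_lt_le; intros hlt; set (e := Cmod (l - zeta v)) in *.
  destruct (has_sum_seq 1 _ l hl (e / 3) ltac:(lra)) as [N0 H0].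
  destruct (has_sum_seq 1 _ _ (zeta_regular_spec v ltac:(lra)) (e / 3) ltac:(lra)) as [N1 H1].
  destruct (Rpower_small (Re v - 1) (e / 3 * c) ltac:(lra)) as [X [_ HX]]; [apply Rmult_lt_0_compat; lra|].
  destruct (nfloor_ex (Rmax 0 X)) as [N2 [_ hN2]]; [apply Rmax_l|].
  set (N := (N0 + N1 + N2)%nat).
  specialize (H0 N ltac:(unfold N; lia)); specialize (H1 N ltac:(unfold N; lia)).
  assert (H2 : Rpower (INR (S N)) (- (Re v - 1)) < e / 3 * c).
  { apply HX; pose proof (Rmax_r 0 X); rewrite S_INR; unfold N; rewrite !plus_INR.
    pose proof (pos_INR N0); pose proof (pos_INR N1); lra. }
  assert (E : csum (fun n => npow n v) (seq 1 N) =
    (csum (fun n => zeta_term n v) (seq 1 N) + csum (fun n => power_integral n v) (seq 1 N))%C).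
  { rewrite <- csum_plus; apply csum_ext; intros; unfold zeta_term; ring. }
  rewrite power_integral_telescope in E by auto.
  set (Sn := csum (fun n => npow n v) (seq 1 N)) in *; set (Sk := csum (fun n => zeta_term n v) (seq 1 N)) in *.
  assert (T : Cmod (npow (S N) (v - 1) / (v - 1)) < e / 3).
  { rewrite Cmod_div by auto; rewrite Cmod_npow; fold c.
    replace (Re (v - 1)) with (Re v - 1) by (destruct v; reflexivity).
    apply Rmult_lt_reg_r with c; auto; unfold Rdiv at 1; rewrite Rmult_assoc, Rinv_l by lra; lra. }
  assert (e < e); [|lra]; unfold e at 1; unfold zeta.
  replace (l - (/ (v - 1) + zeta_regular v))%C with
    (- (Sn - l) + ((Sk - zeta_regular v) - npow (S N) (v - 1) / (v - 1)))%C by (rewrite E; field; auto).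
  eapply Rle_lt_trans; [apply Cmod_triangle|]; rewrite Cmod_opp.
  pose proof (Cmod_triangle (Sk - zeta_regular v) (- (npow (S N) (v - 1) / (v - 1)))) as t; rewrite Cmod_opp in t.
  unfold Cminus at 2; lra. }
replace l with ((l - zeta v) + zeta v)%C by ring.
rewrite (Cmod_eq_0 (l - zeta v)) by (pose proof (Cmod_ge_0 (l - zeta v)); lra); ring.
Qed.

(* [2 ^ (13/7) > 10/3] makes the tail of the series smaller than its first term. *)
Lemma zeta_neq_0 v : 13 / 7 <= Re v -> zeta v <> 0%C.
Proof.
intros hv e.
(* The value [13/7] is [3 * 13/21], and [B = (10/3) 2 ^ (- 13/7)] bounds all terms with [n >= 2]. *)
set (B := Rpower 2 (- (13 / 7)) + Rpower 2 (1 - 13 / 7) / (13 / 7 - 1)).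
assert (hB : B < 1).
{ unfold B; replace (1 - 13 / 7) with (- (13 / 7) + 1) by lra; rewrite Rpower_plus, Rpower_1, Rpower_Ropp by lra.
  assert (10 / 3 < Rpower 2 (13 / 7)).
  { apply Rnot_le_lt; intros h; assert (p : 0 < Rpower 2 (13 / 7)) by apply exp_pos.
    assert (q : Rpower 2 (13 / 7) ^ 7 = 2 ^ 13).
    { rewrite <- (Rpower_pow 7) by auto; rewrite Rpower_mult, <- (Rpower_pow 13) by lra; f_equal; simpl; lra. }
    assert (Rpower 2 (13 / 7) ^ 7 <= (10 / 3) ^ 7) by (apply pow_incr; lra); lra. }
  assert (/ Rpower 2 (13 / 7) < / (10 / 3)) by (apply Rinv_lt_contravar; [apply Rmult_lt_0_compat|]; lra).
  lra. }
destruct (has_sum_seq 1 _ _ (has_sum_zeta v ltac:(lra)) (1 - B) ltac:(lra)) as [N0 H].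
specialize (H (S N0) ltac:(lia)); cbn [seq] in H; rewrite csum_cons, npow_1, e in H.
assert (hb : Cmod (csum (fun n => npow n v) (seq 2 N0)) <= B).
{ eapply Rle_trans; [apply Cmod_csum_le|].
  eapply Rle_trans; [|apply (rbound_npow (13 / 7) 2 ltac:(lia) ltac:(lra) (seq 2 N0)); [apply seq_NoDup|]].
  - apply rsum_le; intros n hn; apply in_seq in hn; rewrite Cmod_npow; apply Rle_Rpower; [apply (le_INR 1); lia | lra].
  - rewrite List.Forall_forall; intros n hn; apply in_seq in hn; lia. }
set (c := csum _ _) in *.
pose proof (Cmod_triangle (1 + c - 0) (- c)) as t; rewrite Cmod_opp in t.
replace (1 + c - 0 + - c)%C with (RtoC 1) in t by ring; rewrite Cmod_1 in t; lra.
Qed.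

Lemma csum_real_scal {T} (f : T -> R) (c : C) l : csum (fun x => RtoC (f x) * c)%C l = (RtoC (rsum f l) * c)%C.
Proof.
rewrite <- csum_RtoC, Cmult_comm, <- (csum_scal (fun x => RtoC (f x)) c); apply csum_ext; intros; apply Cmult_comm.
Qed.

Lemma units_length_le d : INR (length (units d)) <= INR d.
Proof.
apply le_INR; replace d with (length (seq 0 d)) at 2 by apply length_seq.
apply NoDup_incl_length; [apply nodup_units|]; intros r hr; apply in_units in hr; apply in_seq; lia.
Qed.

Lemma totient_term_bound d w : (1 <= d)%nat ->
  Cmod (RtoC (INR (length (units d))) * npow d w) <= Rpower (INR d) (- (Re w - 1)).
Proof.
intros hd; assert (0 < INR d) by (apply lt_0_INR; lia).
rewrite Cmod_mult, Cmod_R, Rabs_pos_eq, Cmod_npow by apply pos_INR.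
replace (- (Re w - 1)) with (1 + - Re w) by ring; rewrite Rpower_plus, Rpower_1 by auto.
apply Rmult_le_compat_r; [left; apply exp_pos | apply units_length_le].
Qed.

(** Multiply by [zeta w] and group the pairs [(d, k)] by the product [n = d k]: the totients of the
    divisors of [n] add up to [n], which leaves the series of [zeta (w - 1)]. *)
Theorem totient_series w : 2 < Re w ->
  has_sum (fun d => (1 <= d)%nat) (fun d => RtoC (INR (length (units d))) * npow d w)%C (zeta (w - 1) / zeta w)%C.
Proof.
intros hw; assert (hz : zeta w <> 0%C) by (apply zeta_neq_0; lra).
destruct (has_sum_exists (fun d => (1 <= d)%nat) (fun d => RtoC (INR (length (units d))) * npow d w)%C
  (fun d => Rpower (INR d) (- (Re w - 1))) _ (fun d hd => totient_term_bound d w hd)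
  (rbound_npow (Re w - 1) 1 (le_n _) ltac:(lra))) as [l hl].
replace (zeta (w - 1) / zeta w)%C with l; [exact hl|].
pose proof (has_sum_prod _ _ _ _ _ _ hl (has_sum_zeta w ltac:(lra))) as hp.
assert (fibs : forall n, (1 <= n)%nat -> NoDup (map (fun k => (k, n / k)%nat) (divisor_list n)) /\
  forall t, In t (map (fun k => (k, n / k)%nat) (divisor_list n)) <->
    both (fun d => (1 <= d)%nat) (fun d => (1 <= d)%nat) t /\ (fst t * snd t)%nat = n).
{ intros n hn; split.
  - apply FinFun.Injective_map_NoDup; [intros x y e; injection e; auto | apply nodup_divisor_list].
  - intros [d k]; rewrite in_map_iff; unfold both; cbn [fst snd]; split.
    + intros [x [ex hx]]; injection ex as <- <-; apply in_divisor_list in hx; [|lia].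
      destruct hx as [q ->]; assert (x <> 0)%nat by nia; rewrite Nat.div_mul by auto; nia.
    + intros [[h1 h2] <-]; exists d; rewrite (Nat.mul_comm d k), Nat.div_mul by lia; split; auto.
      apply in_divisor_list; [nia|]; exists k; reflexivity. }
assert (pr : forall t, both (fun d => (1 <= d)%nat) (fun d => (1 <= d)%nat) t -> (1 <= fst t * snd t)%nat).
{ intros [d k] [h1 h2]; simpl in *; nia. }
pose proof (has_sum_fiber _ _ _ _ _ _ pr fibs hp) as hf.
assert (E : has_sum (fun n => (1 <= n)%nat) (fun n => npow n (w - 1)) (l * zeta w)%C).
{ revert hf; apply has_sum_ext; intros n hn; rewrite csum_map.
  rewrite npow_shift, <- sum_totient_divisor_list by auto.
  rewrite <- csum_real_scal; apply csum_ext; intros k hk; cbn [fst snd].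
  apply in_divisor_list in hk; [|lia]; destruct hk as [q ->]; assert (k <> 0)%nat by nia.
  rewrite Nat.div_mul, npow_mult by nia; ring. }
rewrite (has_sum_unique _ _ _ _ (has_sum_zeta (w - 1) ltac:(destruct w; simpl in *; lra)) E); field; exact hz.
Qed.

(** * Farey intervals *)

Lemma D_in_error g g' x : unit_interval x -> D_in g g' unit_interval x ->
  forall eps, 0 < eps -> exists del, 0 < del /\ forall y, unit_interval y -> Rabs (y - x) < del ->
    Rabs (g y - g x - g' x * (y - x)) <= eps * Rabs (y - x).
Proof.
intros hx h eps he; destruct (h eps he) as [del [hd h']]; exists del; split; [exact hd|]; intros y hy hyx.
destruct (Req_dec x y) as [<-|ne].
{ replace (g x - g x - g' x * (x - x)) with 0 by ring; rewrite Rabs_R0; apply Rmult_le_pos; [lra | apply Rabs_pos]. }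
specialize (h' y (conj (conj hy ne) hyx)); simpl in h'; unfold R_dist in h'.
replace (g y - g x - g' x * (y - x)) with (((g y - g x) / (y - x) - g' x) * (y - x)) by (field; lra).
rewrite Rabs_mult; apply Rmult_le_compat_r; [apply Rabs_pos | left; exact h'].
Qed.

Lemma D_in_is_derive g g' x : 0 < x < 1 -> D_in g g' unit_interval x -> is_derive g x (g' x).
Proof.
intros hx h; apply is_derive_Reals; intros eps he.
destruct (D_in_error g g' x ltac:(split; lra) h (eps / 2) ltac:(lra)) as [del [hd h']].
assert (hm : 0 < Rmin del (Rmin x (1 - x))) by (repeat apply Rmin_glb_lt; lra).
exists (mkposreal _ hm); intros k hk hlt; simpl in hlt.
pose proof (Rmin_l del (Rmin x (1 - x))); pose proof (Rmin_r del (Rmin x (1 - x))).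
pose proof (Rmin_l x (1 - x)); pose proof (Rmin_r x (1 - x)).
assert (b : - Rmin x (1 - x) < k < Rmin x (1 - x)) by (apply Rabs_def2 in hlt; lra).
specialize (h' (x + k) ltac:(split; lra)); replace (x + k - x) with k in h' by ring.
specialize (h' ltac:(lra)).
replace ((g (x + k) - g x) / k - g' x) with ((g (x + k) - g x - g' x * k) / k) by (field; auto).
assert (0 < Rabs k) by (apply Rabs_pos_lt; auto).
unfold Rdiv; rewrite Rabs_mult, Rabs_inv.
apply Rmult_lt_reg_r with (Rabs k); auto; rewrite Rmult_assoc, Rinv_l by lra; nra.
Qed.

Lemma clamped_continuous g :
  (forall x, unit_interval x -> forall eps, 0 < eps -> exists del, 0 < del /\
     forall y, unit_interval y -> Rabs (y - x) < del -> Rabs (g y - g x) < eps) ->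
  forall x, continuous (fun t => g (clamp t)) x.
Proof.
intros h x; apply filterlim_locally; intros eps.
destruct (h (clamp x) (clamp_in x) eps (cond_pos eps)) as [del [hd h']].
exists (mkposreal del hd); intros y hy; apply h'; [apply clamp_in|].
eapply Rle_lt_trans; [apply clamp_dist | exact hy].
Qed.

Lemma D_in_clamped_continuous g g' : (forall x, unit_interval x -> D_in g g' unit_interval x) ->
  forall x, continuous (fun t => g (clamp t)) x.
Proof.
intros h; apply clamped_continuous; intros x hx eps he.
destruct (D_in_error g g' x hx (h x hx) 1 ltac:(lra)) as [del [hd h']].
pose proof (Rabs_pos (g' x)).
assert (0 < eps / (2 + Rabs (g' x))) by (apply Rdiv_lt_0_compat; lra).
exists (Rmin del (eps / (2 + Rabs (g' x)))); split; [apply Rmin_glb_lt; auto|]; intros y hy hlt.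
pose proof (Rmin_l del (eps / (2 + Rabs (g' x)))); pose proof (Rmin_r del (eps / (2 + Rabs (g' x)))).
specialize (h' y hy ltac:(lra)).
replace (g y - g x) with ((g y - g x - g' x * (y - x)) + g' x * (y - x)) by ring.
eapply Rle_lt_trans; [apply Rabs_triang|]; rewrite Rabs_mult.
assert (Rabs (y - x) * (2 + Rabs (g' x)) < eps).
{ apply Rmult_lt_reg_r with (/ (2 + Rabs (g' x))); [apply Rinv_0_lt_compat; lra|].
  rewrite Rmult_assoc, Rinv_r by lra; unfold Rdiv in *; lra. }
pose proof (Rabs_pos (y - x)); nra.
Qed.

Lemma continue_in_clamped g : (forall x, unit_interval x -> continue_in g unit_interval x) ->
  forall x, continuous (fun t => g (clamp t)) x.
Proof.
intros h; apply clamped_continuous; intros x hx eps he; destruct (h x hx eps he) as [del [hd h']].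
exists del; split; [exact hd|]; intros y hy hlt; destruct (Req_dec x y) as [<-|ne].
- unfold Rminus; rewrite Rplus_opp_r, Rabs_R0; exact he.
- exact (h' y (conj (conj hy ne) hlt)).
Qed.

Lemma is_derive_clamped (g : R -> R) x l : 0 < x < 1 -> is_derive g x l -> is_derive (fun t => g (clamp t)) x l.
Proof.
intros hx; apply is_derive_ext_loc.
assert (hm : 0 < Rmin x (1 - x)) by (apply Rmin_glb_lt; lra).
exists (mkposreal _ hm); intros y hy; rewrite clamp_id; [reflexivity|].
pose proof (Rmin_l x (1 - x)); pose proof (Rmin_r x (1 - x)).
change (Rabs (y - x) < Rmin x (1 - x)) in hy; apply Rabs_def2 in hy; lra.
Qed.

(** Only continuity is asked at the ends of the interval, because at 0 and 1 the function [f] has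
    one-sided derivatives only. *)
Lemma Rolle_continuous (F F' : R -> R) x y : x < y -> (forall z, x <= z <= y -> continuous F z) ->
  (forall z, x < z < y -> is_derive F z (F' z)) -> F x = F y -> exists z, x < z < y /\ F' z = 0.
Proof.
intros hxy hc hd e.
assert (pr : forall z, x < z < y -> derivable_pt F z).
{ intros z hz; exists (F' z); apply is_derive_Reals, hd, hz. }
destruct (Rolle F x y pr) as [z [hz e']]; auto.
- intros z hz; apply continuity_pt_filterlim, hc, hz.
- exists z; split; [exact hz|]; rewrite <- e'; symmetry; apply derive_pt_eq; apply is_derive_Reals, hd, hz.
Qed.

Lemma D_in_mean_value g g' x y : (forall x, unit_interval x -> D_in g g' unit_interval x) ->
  0 <= x -> x < y -> y <= 1 -> exists z, x < z < y /\ g y - g x = g' z * (y - x).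
Proof.
intros h hx hxy hy.
set (k := (g y - g x) / (y - x)).
destruct (Rolle_continuous (fun t => g (clamp t) - k * t) (fun t => g' t - k) x y) as [z [hz e]]; auto.
- intros z _; apply (continuous_minus (fun t => g (clamp t)) (fun t => k * t)).
  + apply D_in_clamped_continuous with g', h.
  + apply (ex_derive_continuous (fun t => k * t)); auto_derive; trivial.
- intros z hz; apply (is_derive_minus (fun t => g (clamp t)) (fun t => k * t) z (g' z) k).
  + apply is_derive_clamped; [lra|]; apply D_in_is_derive; [lra|]; apply h; split; lra.
  + auto_derive; [trivial | ring].
- rewrite !clamp_id by lra; unfold k; field; lra.
- exists z; split; [exact hz|]; replace (g' z) with k by lra; unfold k; field; lra.
Qed.

Section Interpolation.

Variables (f f1 f2 : R -> R).
Hypotheses (h0 : forall x, unit_interval x -> D_in f f1 unit_interval x)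
  (h1 : forall x, unit_interval x -> D_in f1 f2 unit_interval x).

(** Subtract from [f] the polynomial of degree 2 that agrees with it at [x0], [y] and [x1]. Rolle's
    theorem, twice for the difference [Phi] and once for its derivative, gives a point where [f2]
    equals [2 k]. *)
Lemma interpolation_error x0 y x1 : 0 <= x0 -> x0 < y -> y < x1 -> x1 <= 1 ->
  exists z, x0 < z < x1 /\
    (x1 - x0) * f y - (y - x0) * f x1 - (x1 - y) * f x0 = - (f2 z / 2) * ((y - x0) * (x1 - y) * (x1 - x0)).
Proof.
intros b0 b1 b2 b3.
set (sl := (f x1 - f x0) / (x1 - x0)).
set (k := (f y - f x0 - sl * (y - x0)) / ((y - x0) * (y - x1))).
set (Phi := fun t => f (clamp t) - f x0 - sl * (t - x0) - k * ((t - x0) * (t - x1))).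
set (Phi1 := fun t => f1 t - sl - k * ((t - x0) + (t - x1))).
assert (cPhi : forall z, continuous Phi z).
{ intros z; unfold Phi; apply (continuous_minus (fun t => f (clamp t) - f x0 - sl * (t - x0)) (fun t => k * ((t - x0) * (t - x1)))).
  2:{ apply (ex_derive_continuous (fun t => k * ((t - x0) * (t - x1)))); auto_derive; trivial. }
  apply (continuous_minus (fun t => f (clamp t) - f x0) (fun t => sl * (t - x0))).
  2:{ apply (ex_derive_continuous (fun t => sl * (t - x0))); auto_derive; trivial. }
  apply (continuous_minus (fun t => f (clamp t)) (fun t => f x0)); [|apply continuous_const].
  apply D_in_clamped_continuous with f1, h0. }
assert (dPhi : forall z, 0 < z < 1 -> is_derive Phi z (Phi1 z)).
{ intros z hz; unfold Phi, Phi1.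
  replace (f1 z - sl - k * (z - x0 + (z - x1))) with (minus (f1 z) (sl + k * (z - x0 + (z - x1)))) by (unfold minus, plus, opp; simpl; ring).
  apply is_derive_ext with (fun t => minus (f (clamp t)) (f x0 + sl * (t - x0) + k * ((t - x0) * (t - x1)))).
  { intros t; unfold minus, plus, opp; simpl; ring. }
  apply (is_derive_minus (fun t => f (clamp t))).
  - apply is_derive_clamped; [exact hz|]; apply D_in_is_derive; [exact hz|]; apply h0; split; lra.
  - auto_derive; [trivial | ring]. }
assert (z0 : Phi x0 = 0) by (unfold Phi; rewrite clamp_id by lra; ring).
assert (z1 : Phi y = 0) by (unfold Phi, k; rewrite clamp_id by lra; field; lra).
assert (z2 : Phi x1 = 0) by (unfold Phi, sl; rewrite clamp_id by lra; field; lra).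
destruct (Rolle_continuous Phi Phi1 x0 y) as [u [hu eu]]; auto; [intros; apply dPhi; lra | lra |].
destruct (Rolle_continuous Phi Phi1 y x1) as [v [hv ev]]; auto; [intros; apply dPhi; lra | lra |].
assert (dPhi1 : forall z, 0 < z < 1 -> is_derive Phi1 z (f2 z - 2 * k)).
{ intros z hz; unfold Phi1; apply is_derive_ext with (fun t => minus (f1 t) (sl + k * (t - x0 + (t - x1)))).
  { intros t; unfold minus, plus, opp; simpl; ring. }
  apply (is_derive_minus f1); [apply D_in_is_derive; [exact hz|]; apply h1; split; lra | auto_derive; [trivial | ring]]. }
destruct (Rolle_continuous Phi1 (fun z => f2 z - 2 * k) u v) as [z [hz ez]]; [lra | | intros; apply dPhi1; lra | lra |].
{ intros z hz; apply (ex_derive_continuous Phi1); eexists; apply dPhi1; lra. }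
exists z; split; [lra|]; replace (f2 z / 2) with k by lra.
unfold k, sl; field; lra.
Qed.

End Interpolation.

Section LogSecond.

Variables (f2 f3 : R -> R) (m : R).
Hypotheses (hm : 0 < m) (h2 : forall x, unit_interval x -> D_in f2 f3 unit_interval x)
  (h3 : forall x, unit_interval x -> continue_in f3 unit_interval x)
  (hf2 : forall x, 0 <= x <= 1 -> m <= Rabs (f2 x)).

Lemma log_lipschitz a b : m <= a -> m <= b -> Rabs (ln a - ln b) <= Rabs (a - b) / m.
Proof.
assert (W : forall a b, m <= b -> b <= a -> Rabs (ln a - ln b) <= Rabs (a - b) / m).
{ intros u v hv hu; assert (ln v <= ln u) by (apply ln_le; lra).
  rewrite !Rabs_pos_eq by lra.
  replace u with (v * (1 + (u - v) / v)) at 1 by (field; lra).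
  assert (0 <= (u - v) / v) by (apply Rdiv_le_0_compat; lra).
  rewrite ln_mult by lra.
  pose proof (exp_ineq1_le ((u - v) / v)) as e.
  assert (ln (1 + (u - v) / v) <= (u - v) / v) by (rewrite <- (ln_exp ((u - v) / v)) at 2; apply ln_le; lra).
  assert ((u - v) / v <= (u - v) / m) by (apply Rmult_le_compat_l; [lra | apply Rinv_le_contravar; lra]).
  lra. }
intros ha hb; destruct (Rle_dec b a) as [h|h]; [apply W; auto|].
rewrite (Rabs_minus_sym a), (Rabs_minus_sym (ln a)); apply W; lra.
Qed.

(** [f2] is Lipschitz because [f3] is continuous on a compact interval, and the logarithm is
    Lipschitz on [[m, oo)]. This is where the third derivative and the lower bound on [|f2|]
    enter. *)
Lemma bounded_lipschitz_log : exists A, bounded_lipschitz (fun x => ln (Rabs (f2 x) / 2)) A.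
Proof.
destruct (continuity_ab_maj (fun t => Rabs (f3 (clamp t))) 0 1 ltac:(lra)) as [xm [hmax _]].
{ intros c _; apply continuity_pt_filterlim; apply (continuous_comp (fun t => f3 (clamp t)) Rabs).
  - apply continue_in_clamped, h3.
  - apply continuous_Rabs. }
set (K := Rabs (f3 (clamp xm))) in *; assert (K0 : 0 <= K) by apply Rabs_pos.
assert (lip : forall x y, 0 <= x -> x < y -> y <= 1 -> Rabs (f2 x - f2 y) <= K * Rabs (x - y)).
{ intros x y hx hxy hy; destruct (D_in_mean_value f2 f3 x y h2 hx hxy hy) as [z [hz e]].
  rewrite Rabs_minus_sym, e, Rabs_mult, (Rabs_minus_sym x y); apply Rmult_le_compat_r; [apply Rabs_pos|].
  specialize (hmax z ltac:(lra)); rewrite (clamp_id z) in hmax by lra; exact hmax. }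
assert (lip' : forall x y, 0 <= x <= 1 -> 0 <= y <= 1 -> Rabs (f2 x - f2 y) <= K * Rabs (x - y)).
{ intros x y hx hy; destruct (Rtotal_order x y) as [h | [<- | h]].
  - apply lip; lra.
  - unfold Rminus; rewrite !Rplus_opp_r, Rabs_R0; lra.
  - rewrite Rabs_minus_sym, (Rabs_minus_sym x y); apply lip; lra. }
assert (L : forall x y, 0 <= x <= 1 -> 0 <= y <= 1 ->
  Rabs (ln (Rabs (f2 x) / 2) - ln (Rabs (f2 y) / 2)) <= K / m * Rabs (x - y)).
{ intros x y hx hy; pose proof (hf2 x hx); pose proof (hf2 y hy).
  rewrite !ln_div by lra.
  replace (ln (Rabs (f2 x)) - ln 2 - (ln (Rabs (f2 y)) - ln 2)) with (ln (Rabs (f2 x)) - ln (Rabs (f2 y))) by ring.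
  eapply Rle_trans; [apply log_lipschitz; auto|].
  replace (K / m * Rabs (x - y)) with (K * Rabs (x - y) / m) by (field; lra).
  apply Rmult_le_compat_r; [left; apply Rinv_0_lt_compat, hm|].
  eapply Rle_trans; [apply Rabs_triang_inv2 | apply lip'; auto]. }
assert (K / m >= 0) by (apply Rle_ge, Rdiv_le_0_compat; auto).
exists (Rabs (ln (Rabs (f2 0) / 2)) + K / m); split.
- intros x hx; specialize (L x 0 hx ltac:(lra)).
  rewrite Rminus_0_r, (Rabs_pos_eq x) in L by lra.
  pose proof (Rabs_triang_inv (ln (Rabs (f2 x) / 2)) (ln (Rabs (f2 0) / 2))).
  assert (K / m * x <= K / m) by nra; lra.
- intros x y hx hy; eapply Rle_trans; [apply L; auto|]; apply Rmult_le_compat_r; [apply Rabs_pos|].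
  pose proof (Rabs_pos (ln (Rabs (f2 0) / 2))); lra.
Qed.

End LogSecond.

(* [- 1 / r] modulo [d] *)
Definition neg_inverse (d r : nat) : nat :=
  epsilon (inhabits 0%nat) (fun c => (c < d)%nat /\ Nat.divide d (r * c + 1)).

Lemma neg_inverse_spec d r : (1 <= d)%nat -> Nat.gcd r d = 1%nat ->
  (neg_inverse d r < d)%nat /\ Nat.divide d (r * neg_inverse d r + 1).
Proof.
intros hd hg; unfold neg_inverse; apply epsilon_spec.
(* The relation reads [u d = 1 + v r], so [v] is [- 1 / r] modulo [d], and it only has to be
   reduced. *)
destruct (Nat.gcd_bezout_pos d r ltac:(lia)) as [u [v e]].
rewrite Nat.gcd_comm, hg in e.
exists (v mod d)%nat; split; [apply Nat.mod_upper_bound; lia|].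
exists (u - r * (v / d))%nat.
pose proof (Nat.div_mod_eq v d).
assert (r * (v / d) <= u)%nat by (apply (Nat.mul_le_mono_pos_r _ _ d); nia).
rewrite Nat.mul_sub_distr_r; nia.
Qed.

Lemma neg_inverse_unique d r c : (1 <= d)%nat -> Nat.gcd r d = 1%nat -> (c < d)%nat ->
  Nat.divide d (r * c + 1) -> c = neg_inverse d r.
Proof.
intros hd hg hc hdiv; destruct (neg_inverse_spec d r hd hg) as [h1 h2]; set (e := neg_inverse d r) in *.
assert (W : forall x y, (x < d)%nat -> (x <= y)%nat -> (y < d)%nat -> Nat.divide d (r * x + 1) -> Nat.divide d (r * y + 1) -> x = y).
{ intros x y hx hxy hy [u hu] [v hv].
  assert (D : Nat.divide d (r * (y - x))) by (exists (v - u)%nat; rewrite Nat.mul_sub_distr_r; nia).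
  apply Nat.gauss in D; [|rewrite Nat.gcd_comm; exact hg].
  destruct D as [w hw]; destruct w; nia. }
destruct (Nat.le_ge_cases c e); [apply W; auto | symmetry; apply W; auto].
Qed.

(** With [b = k d + r] the condition [a d - b c = 1] says that [r c = - 1] modulo [d], and then
    [a = (b c + 1) / d] exactly. The bound [k >= 1] amounts to [d <= b]. *)
Definition quad_of (d k r : nat) : quad :=
  let b := (k * d + r)%nat in let c := neg_inverse d r in
  Quad (Z.of_nat ((b * c + 1) / d)) (Z.of_nat b) (Z.of_nat c) (Z.of_nat d).

(** The mirror image under [x -> 1 - x], which exchanges the two denominators. *)
Definition reflect (I : quad) : quad := let (a, b, c, d) := I in Quad (d - c) d (b - a) b.

Lemma farey_intro (a b c d : Z) : (1 <= b -> 1 <= d -> 0 <= c <= d -> 0 <= a <= b -> a * d - b * c = 1 ->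
  farey (Quad a b c d))%Z.
Proof.
intros hb hd hc ha e; repeat split; try lia.
- apply Z.bezout_1_gcd; exists d, (- c)%Z; lia.
- apply Z.bezout_1_gcd; exists (- b)%Z, a; lia.
Qed.

Lemma reflect_farey I : farey I -> farey (reflect I).
Proof. destruct I as [a b c d]; intros (h1 & h2 & h3 & h4 & _ & _ & e); apply farey_intro; nia. Qed.

Lemma reflect_involutive I : reflect (reflect I) = I.
Proof. destruct I as [a b c d]; unfold reflect; f_equal; lia. Qed.

Definition parameter (p : nat * nat * nat) : Prop :=
  (1 <= fst (fst p))%nat /\ (1 <= snd (fst p))%nat /\ In (snd p) (units (fst (fst p))).

Definition quad_of_parameter (p : nat * nat * nat) : quad := quad_of (fst (fst p)) (snd (fst p)) (snd p).

Definition parameter_of_quad (I : quad) : nat * nat * nat :=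
  let d := Z.to_nat (qd I) in let b := Z.to_nat (qb I) in (d, (b / d)%nat, (b mod d)%nat).

Lemma quad_of_farey d k r : (1 <= d)%nat -> (1 <= k)%nat -> In r (units d) ->
  farey (quad_of d k r) /\ (qd (quad_of d k r) <= qb (quad_of d k r))%Z.
Proof.
intros hd hk hr; apply in_units in hr; destruct hr as [hr hg].
destruct (neg_inverse_spec d r hd hg) as [h1 [q hq]].
unfold quad_of; set (c := neg_inverse d r) in *; set (b := (k * d + r)%nat).
assert (e : ((b * c + 1) = (k * c + q) * d)%nat) by (unfold b; nia).
rewrite e, Nat.div_mul by lia; cbn [qb qd]; split; [|unfold b; nia].
assert (hb : (d <= b)%nat) by (unfold b; nia).
assert (k * c + q <= b)%nat by nia.
apply farey_intro; try lia; nia.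
Qed.

Lemma parameter_of_quad_of p : parameter p -> parameter_of_quad (quad_of_parameter p) = p.
Proof.
destruct p as [[d k] r]; intros (hd & hk & hr); cbn [fst snd] in *; apply in_units in hr; destruct hr as [hr hg].
unfold quad_of_parameter, parameter_of_quad, quad_of; cbn [fst snd qb qd]; rewrite !Nat2Z.id.
rewrite Nat.add_comm, Nat.div_add, Nat.Div0.mod_add, Nat.div_small, Nat.mod_small by lia; reflexivity.
Qed.

Lemma parameter_of_quad_spec I : farey I -> (qd I <= qb I)%Z ->
  parameter (parameter_of_quad I) /\ quad_of_parameter (parameter_of_quad I) = I.
Proof.
destruct I as [a b c d]; intros (h1 & h2 & h3 & h4 & _ & _ & e) hle; cbn [qb qd] in hle.
destruct (Z_of_nat_complete a ltac:(lia)) as [a' ->]; destruct (Z_of_nat_complete b ltac:(lia)) as [b' ->].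
destruct (Z_of_nat_complete c ltac:(lia)) as [c' ->]; destruct (Z_of_nat_complete d ltac:(lia)) as [d' ->].
assert (E : (a' * d' = b' * c' + 1)%nat) by nia.
assert (hd : (1 <= d')%nat) by lia; assert (hle' : (d' <= b')%nat) by lia.
unfold quad_of_parameter, parameter_of_quad; cbn [qb qd fst snd]; rewrite !Nat2Z.id.
set (k := (b' / d')%nat); set (r := (b' mod d')%nat).
pose proof (Nat.div_mod_eq b' d') as eb; fold k r in eb.
assert (hr : (r < d')%nat) by (apply Nat.mod_upper_bound; lia).
assert (hk : (1 <= k)%nat) by (destruct k; nia).
(* If [c = d], then [d (a - b) = 1], which contradicts [a <= b]. *)
assert (hc : (c' < d')%nat).
{ apply Nat.nle_gt; intros hc; assert (c' = d') as -> by lia; assert (d' * (a' - b') = 1)%nat by nia.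
  assert (d' = 1)%nat by nia; subst d'; nia. }
assert (hdiv : Nat.divide d' (r * c' + 1)).
{ exists (a' - k * c')%nat; rewrite Nat.mul_sub_distr_r; nia. }
assert (hg : Nat.gcd r d' = 1%nat).
{ pose proof (Nat.gcd_divide_l r d') as [u hu]; pose proof (Nat.gcd_divide_r r d') as [v hv].
  destruct hdiv as [w hw]; set (g := Nat.gcd r d') in *.
  assert (Nat.divide g 1); [|apply Nat.divide_1_r; auto].
  exists (w * v - u * c')%nat; rewrite Nat.mul_sub_distr_r; nia. }
assert (hu : In r (units d')) by (apply in_units; auto).
split; [unfold parameter; cbn [fst snd]; auto|].
unfold quad_of; rewrite <- (neg_inverse_unique d' r c' hd hg hc hdiv).
replace (k * d' + r)%nat with b' by lia; rewrite <- E, Nat.div_mul by lia; reflexivity.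
Qed.

(** For a Farey interval and its mediant the three gaps are [1 / (b d)], [1 / (d (b + d))] and
    [1 / (b (b + d))], all by [a d - b c = 1]. *)
Lemma farey_T_value f f1 f2 f3 I : C3_unit_interval f f1 f2 f3 -> farey I ->
  exists z, IZR (qc I) / IZR (qd I) < z < IZR (qa I) / IZR (qb I) /\
    farey_T f I = - (f2 z / 2) / (IZR (qb I) * IZR (qd I) * IZR (qb I + qd I)).
Proof.
destruct I as [a b c d]; intros hf (h1 & h2 & h3 & h4 & _ & _ & e); cbn [qa qb qc qd].
assert (B : 1 <= IZR b) by (apply IZR_le; lia); assert (D : 1 <= IZR d) by (apply IZR_le; lia).
assert (E : IZR a * IZR d - IZR b * IZR c = 1) by (rewrite <- !mult_IZR, <- minus_IZR, e; reflexivity).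
assert (C0 : 0 <= IZR c) by (apply IZR_le; lia); assert (AB : IZR a <= IZR b) by (apply IZR_le; lia).
destruct (interpolation_error f f1 f2) with (x0 := IZR c / IZR d) (y := IZR (a + c) / IZR (b + d)) (x1 := IZR a / IZR b)
  as [z [hz ez]].
- intros x hx; apply hf, hx.
- intros x hx; apply hf, hx.
- apply Rdiv_le_0_compat; lra.
- rewrite !plus_IZR; apply Rminus_gt_0_lt.
  replace ((IZR a + IZR c) / (IZR b + IZR d) - IZR c / IZR d) with ((IZR a * IZR d - IZR b * IZR c) / (IZR d * (IZR b + IZR d))) by (field; lra).
  rewrite E; apply Rdiv_lt_0_compat; nra.
- rewrite !plus_IZR; apply Rminus_gt_0_lt.
  replace (IZR a / IZR b - (IZR a + IZR c) / (IZR b + IZR d)) with ((IZR a * IZR d - IZR b * IZR c) / (IZR b * (IZR b + IZR d))) by (field; lra).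
  rewrite E; apply Rdiv_lt_0_compat; nra.
- apply Rmult_le_reg_r with (IZR b); [lra|]; unfold Rdiv; rewrite Rmult_assoc, Rinv_l; lra.
- exists z; split; [exact hz|]; unfold farey_T, farey_c; cbn [qb qd].
  set (P := f (IZR (a + c) / IZR (b + d))) in *; set (Q := f (IZR a / IZR b)) in *; set (W := f (IZR c / IZR d)) in *.
  rewrite !plus_IZR in *.
  assert (e1 : IZR a / IZR b - IZR c / IZR d = / (IZR b * IZR d)).
  { replace (IZR a / IZR b - IZR c / IZR d) with ((IZR a * IZR d - IZR b * IZR c) / (IZR b * IZR d)) by (field; lra).
    rewrite E; unfold Rdiv; ring. }
  assert (e2 : (IZR a + IZR c) / (IZR b + IZR d) - IZR c / IZR d = / (IZR d * (IZR b + IZR d))).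
  { replace ((IZR a + IZR c) / (IZR b + IZR d) - IZR c / IZR d) with ((IZR a * IZR d - IZR b * IZR c) / (IZR d * (IZR b + IZR d))) by (field; lra).
    rewrite E; unfold Rdiv; ring. }
  assert (e3 : IZR a / IZR b - (IZR a + IZR c) / (IZR b + IZR d) = / (IZR b * (IZR b + IZR d))).
  { replace (IZR a / IZR b - (IZR a + IZR c) / (IZR b + IZR d)) with ((IZR a * IZR d - IZR b * IZR c) / (IZR b * (IZR b + IZR d))) by (field; lra).
    rewrite E; unfold Rdiv; ring. }
  rewrite e1, e2, e3 in ez.
  apply Rmult_eq_reg_l with (/ (IZR b * IZR d) * / (IZR b + IZR d)).
  2:{ apply Rmult_integral_contrapositive; split; apply Rinv_neq_0_compat; nra. }
  transitivity (/ (IZR b * IZR d) * P - / (IZR d * (IZR b + IZR d)) * Q - / (IZR b * (IZR b + IZR d)) * W).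
  + field; lra.
  + rewrite ez; field; lra.
Qed.

Section LogSize.

Variables (f f1 f2 f3 : R -> R) (m : R).
Hypotheses (hf : C3_unit_interval f f1 f2 f3) (hm : 0 < m)
  (hf2 : forall x : R, 0 <= x <= 1 -> m <= Rabs (f2 x)).

Definition log_half_second (x : R) : R := ln (Rabs (f2 x) / 2).

Lemma farey_endpoints I : farey I -> 0 <= IZR (qc I) / IZR (qd I) /\ IZR (qa I) / IZR (qb I) <= 1 /\
  IZR (qa I) / IZR (qb I) = IZR (qc I) / IZR (qd I) + / (IZR (qb I) * IZR (qd I)) /\ 1 <= IZR (qb I) /\ 1 <= IZR (qd I).
Proof.
destruct I as [a b c d]; intros (h1 & h2 & h3 & h4 & _ & _ & e); cbn [qa qb qc qd].
assert (B : 1 <= IZR b) by (apply IZR_le; lia); assert (D : 1 <= IZR d) by (apply IZR_le; lia).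
assert (E : IZR a * IZR d - IZR b * IZR c = 1) by (rewrite <- !mult_IZR, <- minus_IZR, e; reflexivity).
assert (C0 : 0 <= IZR c) by (apply IZR_le; lia); assert (AB : IZR a <= IZR b) by (apply IZR_le; lia).
repeat split; auto.
- apply Rdiv_le_0_compat; lra.
- apply Rmult_le_reg_r with (IZR b); [lra|]; unfold Rdiv; rewrite Rmult_assoc, Rinv_l; lra.
- replace (IZR a / IZR b) with ((IZR b * IZR c + 1) / (IZR b * IZR d)); [field; lra|].
  replace (IZR b * IZR c + 1) with (IZR a * IZR d) by lra; field; lra.
Qed.

Lemma ln_farey_T I : farey I -> exists z, IZR (qc I) / IZR (qd I) < z < IZR (qa I) / IZR (qb I) /\
  0 < Rabs (farey_T f I) /\
  ln (Rabs (farey_T f I)) = log_half_second z - ln (IZR (qb I)) - ln (IZR (qd I)) - ln (IZR (qb I + qd I)).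
Proof.
intros hI; destruct (farey_T_value f f1 f2 f3 I hf hI) as [z [hz e]].
destruct (farey_endpoints I hI) as (e1 & e2 & _ & hb & hd).
exists z; split; [exact hz|].
pose proof (hf2 z ltac:(lra)) as hz2; rewrite e, plus_IZR in *.
assert (p : 0 < IZR (qb I) * IZR (qd I) * (IZR (qb I) + IZR (qd I))) by (repeat apply Rmult_lt_0_compat; lra).
assert (E : Rabs (- (f2 z / 2) / (IZR (qb I) * IZR (qd I) * (IZR (qb I) + IZR (qd I)))) =
  Rabs (f2 z) / 2 / (IZR (qb I) * IZR (qd I) * (IZR (qb I) + IZR (qd I)))).
{ unfold Rdiv; rewrite !Rabs_mult, Rabs_Ropp, Rabs_mult, (Rabs_pos_eq (/ 2)), (Rabs_inv _), (Rabs_pos_eq (IZR (qb I) * _ * _)) by lra; reflexivity. }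
rewrite E; split; [apply Rdiv_lt_0_compat; lra|].
rewrite ln_div, (ln_mult (_ * _)), (ln_mult (IZR (qb I))) by (solve [lra | repeat apply Rmult_lt_0_compat; lra]); unfold log_half_second; lra.
Qed.

(* [ln ((k + x) (k + 1 + x))], where [k + x = b / d] *)
Definition log_kernel (k : nat) (x : R) : R := ln (INR k + x) + ln (INR k + x + 1).

Variable A : R.
Hypothesis hA : bounded_lipschitz log_half_second A.

(** With [x = r / d] one has [b d (b + d) = d ^ 3 (k + x) (k + x + 1)]. Thus [t] is compared with a
    function of [c / d] alone plus a function of [r / d] alone, as equidistribution requires. *)
Definition approximates (t : nat -> nat -> nat -> R) (L : R -> R) : Prop :=
  forall d k r, (1 <= d)%nat -> (1 <= k)%nat -> In r (units d) ->
    Rabs (t d k r - (L (INR (neg_inverse d r) / INR d) - 3 * ln (INR d) - log_kernel k (INR r / INR d))) <= A / INR d.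

Lemma sizes d k r : (1 <= d)%nat -> (1 <= k)%nat -> In r (units d) ->
  let I := quad_of d k r in
  IZR (qd I) = INR d /\ IZR (qb I) = INR d * (INR k + INR r / INR d) /\
  IZR (qb I + qd I) = INR d * (INR k + INR r / INR d + 1) /\ 0 <= INR r / INR d /\
  IZR (qc I) / IZR (qd I) = INR (neg_inverse d r) / INR d /\ 1 <= INR d /\ 1 <= INR k.
Proof.
intros hd hk hr; assert (1 <= INR d) by (apply (le_INR 1), hd); assert (1 <= INR k) by (apply (le_INR 1), hk).
pose proof (pos_INR r); unfold quad_of; cbv zeta; cbn [qa qb qc qd]; rewrite plus_IZR, <- !INR_IZR_INZ.
rewrite plus_INR, mult_INR; repeat split; try (field; lra); auto; apply Rdiv_le_0_compat; lra.
Qed.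

Lemma log_sum d x k : 1 <= d -> 1 <= k -> 0 <= x ->
  ln (d * (k + x)) + ln d + ln (d * (k + x + 1)) = 3 * ln d + (ln (k + x) + ln (k + x + 1)).
Proof. intros; rewrite !ln_mult by lra; ring. Qed.

(** The point [z] and the endpoint [c / d] lie in an interval of length [1 / (b d) <= 1 / d], and
    [log_half_second] is Lipschitz. *)
Lemma approximates_left : approximates (fun d k r => ln (Rabs (farey_T f (quad_of d k r)))) log_half_second.
Proof.
intros d k r hd hk hr; destruct (quad_of_farey d k r hd hk hr) as [hI _].
destruct (ln_farey_T _ hI) as [z [hz [_ e]]]; destruct (farey_endpoints _ hI) as (e1 & e2 & e3 & hb' & _).
destruct (sizes d k r hd hk hr) as (s1 & s2 & s3 & s4 & s5 & s6 & s7); rewrite e.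
rewrite s5 in *; rewrite s1, s2, s3 in *; set (x := INR r / INR d) in *; set (y := INR (neg_inverse d r) / INR d) in *.
pose proof (log_sum (INR d) x (INR k) s6 s7 s4); unfold log_kernel.
match goal with |- Rabs ?u <= _ => replace u with (log_half_second z - log_half_second y) by lra end.
eapply Rle_trans; [apply hA; lra|].
unfold Rdiv; apply Rmult_le_compat_l; [apply (bounded_lipschitz_pos _ _ hA)|].
rewrite Rabs_pos_eq by lra.
assert (/ (INR d * (INR k + x) * INR d) <= / INR d); [apply Rinv_le_contravar; nra | lra].
Qed.

Lemma approximates_right : approximates (fun d k r => ln (Rabs (farey_T f (reflect (quad_of d k r)))))
  (fun x => log_half_second (1 - x)).
Proof.
intros d k r hd hk hr; destruct (quad_of_farey d k r hd hk hr) as [hI _].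
pose proof (reflect_farey _ hI) as hJ.
destruct (ln_farey_T _ hJ) as [z [hz [_ e]]]; destruct (farey_endpoints _ hI) as (e1 & e2 & e3 & hb' & hd').
destruct (farey_endpoints _ hJ) as (j1 & j2 & j3 & _ & _).
destruct (sizes d k r hd hk hr) as (s1 & s2 & s3 & s4 & s5 & s6 & s7); rewrite e.
set (I := quad_of d k r) in *; clearbody I; destruct I as [a b c d']; unfold reflect in *; cbn [qa qb qc qd] in *.
rewrite (Z.add_comm d' b) in *.
assert (r1 : IZR (d' - c) / IZR d' = 1 - IZR c / IZR d') by (rewrite minus_IZR; field; lra).
rewrite r1, s5 in *; rewrite s1, s2, s3 in *; set (x := INR r / INR d) in *; set (y := INR (neg_inverse d r) / INR d) in *.
pose proof (log_sum (INR d) x (INR k) s6 s7 s4); unfold log_kernel.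
match goal with |- Rabs ?u <= _ => replace u with (log_half_second z - log_half_second (1 - y)) by lra end.
assert (/ (INR d * (INR d * (INR k + x))) <= / INR d) by (apply Rinv_le_contravar; nra).
assert (0 <= y) by lra; assert (y <= 1) by lra.
eapply Rle_trans; [apply hA; lra|].
unfold Rdiv; apply Rmult_le_compat_l; [apply (bounded_lipschitz_pos _ _ hA)|].
rewrite Rabs_left by lra; lra.
Qed.

End LogSize.

(** * Decomposition into blocks *)

Definition Cbounded_lipschitz (F : R -> C) (A : R) : Prop :=
  (forall x, 0 <= x <= 1 -> Cmod (F x) <= A) /\
  (forall x y, 0 <= x <= 1 -> 0 <= y <= 1 -> Cmod (F x - F y) <= A * Rabs (x - y)).

Lemma bounded_lipschitz_Re F A : Cbounded_lipschitz F A -> bounded_lipschitz (fun x => Re (F x)) A.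
Proof.
intros [h1 h2]; split.
- intros x hx; eapply Rle_trans; [apply re_le_Cmod | apply h1, hx].
- intros x y hx hy; eapply Rle_trans; [|apply h2; auto].
  replace (Re (F x) - Re (F y)) with (Re (F x - F y)) by reflexivity; apply re_le_Cmod.
Qed.

Lemma bounded_lipschitz_Im F A : Cbounded_lipschitz F A -> bounded_lipschitz (fun x => Im (F x)) A.
Proof.
intros [h1 h2]; split.
- intros x hx; eapply Rle_trans; [apply im_le_Cmod | apply h1, hx].
- intros x y hx hy; eapply Rle_trans; [|apply h2; auto].
  replace (Im (F x) - Im (F y)) with (Im (F x - F y)) by reflexivity; apply im_le_Cmod.
Qed.

Lemma Cmod_le_four a b c d e : Rabs a <= e -> Rabs b <= e -> Rabs c <= e -> Rabs d <= e ->
  Cmod (a - b, c + d) <= 4 * e.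
Proof.
intros; eapply Rle_trans; [apply Cmod_le_abs|]; simpl.
pose proof (Rabs_triang a (- b)) as h; rewrite Rabs_Ropp in h; pose proof (Rabs_triang c d); unfold Rminus; lra.
Qed.

(** Real and imaginary parts of [F] and [G] give four real sums, each with the error of
    [kloosterman_equidistribution]. *)
Lemma complex_equidistribution : exists c, 0 < c /\
  forall d F G A B, (1 <= d)%nat -> Cbounded_lipschitz F A -> Cbounded_lipschitz G B ->
  Cmod (csum (fun r => F (INR r / INR d)%R * G (INR (neg_inverse d r) / INR d)%R)%C (units d)
        - RtoC (INR (length (units d))) * (Cint F * Cint G)) <= c * A * B * Rpower (INR d) (6 / 7).
Proof.
destruct kloosterman_equidistribution as [c [hc H]]; exists (4 * c); split; [lra|].
intros d F G A B hd hF hG.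
pose proof (fun F' G' => H d (neg_inverse d) F' G' A B hd (fun r _ hg => neg_inverse_spec d r hd hg)) as K.
pose proof (bounded_lipschitz_Re _ _ hF) as f1; pose proof (bounded_lipschitz_Im _ _ hF) as f2.
pose proof (bounded_lipschitz_Re _ _ hG) as g1; pose proof (bounded_lipschitz_Im _ _ hG) as g2.
pose proof (Cmod_le_four _ _ _ _ _ (K _ _ f1 g1) (K _ _ f2 g2) (K _ _ f1 g2) (K _ _ f2 g1)) as h.
eapply Rle_trans; [|eapply Rle_trans; [exact h | right; ring]].
right; f_equal; rewrite csum_pair; unfold Cint, RtoC, Cminus, Cplus, Copp, Cmult; simpl.
f_equal.
- rewrite (rsum_ext _ (fun x => Re (F (INR x / INR d)) * Re (G (INR (neg_inverse d x) / INR d)) +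
    (- 1) * (Im (F (INR x / INR d)) * Im (G (INR (neg_inverse d x) / INR d))))) by (intros; unfold Re, Im; ring).
  rewrite rsum_plus, rsum_scal; ring.
- rewrite (rsum_ext _ (fun x => Re (F (INR x / INR d)) * Im (G (INR (neg_inverse d x) / INR d)) +
    Im (F (INR x / INR d)) * Re (G (INR (neg_inverse d x) / INR d)))) by (intros; unfold Re, Im; ring).
  rewrite rsum_plus; ring.
Qed.

Definition kernel (k : nat) (s : C) (x : R) : C := cexp (s * RtoC (- log_kernel k (clamp x))).

Lemma log_kernel_ge k x : (1 <= k)%nat -> 0 <= x -> 0 <= ln (INR k) /\ 2 * ln (INR k) <= log_kernel k x.
Proof.
intros hk hx; assert (1 <= INR k) by (apply (le_INR 1), hk); unfold log_kernel.
assert (0 <= ln (INR k)) by (rewrite <- ln_1; apply ln_le; lra).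
assert (ln (INR k) <= ln (INR k + x)) by (apply ln_le; lra).
assert (ln (INR k) <= ln (INR k + x + 1)) by (apply ln_le; lra); lra.
Qed.

Lemma log_kernel_lipschitz k x y : (1 <= k)%nat -> 0 <= x -> 0 <= y ->
  Rabs (log_kernel k x - log_kernel k y) <= 2 * Rabs (x - y).
Proof.
intros hk hx hy; assert (1 <= INR k) by (apply (le_INR 1), hk); unfold log_kernel.
pose proof (log_lipschitz 1 Rlt_0_1 (INR k + x) (INR k + y) ltac:(lra) ltac:(lra)) as h1.
pose proof (log_lipschitz 1 Rlt_0_1 (INR k + x + 1) (INR k + y + 1) ltac:(lra) ltac:(lra)) as h2.
replace (INR k + x - (INR k + y)) with (x - y) in h1 by ring.
replace (INR k + x + 1 - (INR k + y + 1)) with (x - y) in h2 by ring.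
unfold Rdiv in *; rewrite Rinv_1, Rmult_1_r in *.
match goal with |- Rabs ?u <= _ => replace u with ((ln (INR k + x) - ln (INR k + y)) + (ln (INR k + x + 1) - ln (INR k + y + 1))) by ring end.
eapply Rle_trans; [apply Rabs_triang|]; lra.
Qed.

Lemma Cmod_minus_RtoC_mult s x y : Cmod (s * RtoC x - s * RtoC y) = Cmod s * Rabs (x - y).
Proof. rewrite <- Cmod_R, <- Cmod_mult, RtoC_minus; f_equal; ring. Qed.

Lemma kernel_lipschitz k s sg S : (1 <= k)%nat -> 0 <= sg -> sg <= Re s -> Cmod s <= S ->
  Cbounded_lipschitz (kernel k s) ((1 + 2 * S) * Rpower (INR k) (- (2 * sg))).
Proof.
intros hk hs hr hS; pose proof (Cmod_ge_0 s).
assert (M : forall x, Re (s * RtoC (- log_kernel k (clamp x))) <= - (2 * sg) * ln (INR k)).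
{ intros x; rewrite Re_mult_real; pose proof (clamp_in x) as hx.
  destruct (log_kernel_ge k (clamp x) hk ltac:(lra)); nra. }
assert (p : 0 < Rpower (INR k) (- (2 * sg))) by apply exp_pos.
split.
- intros x _; unfold kernel; rewrite Cmod_cexp.
  assert (exp (Re (s * RtoC (- log_kernel k (clamp x)))) <= Rpower (INR k) (- (2 * sg))) by (apply exp_incr, M).
  nra.
- intros x y hx hy; unfold kernel; eapply Rle_trans; [apply (cexp_lipschitz _ _ _ (M x) (M y))|].
  fold (Rpower (INR k) (- (2 * sg))); rewrite Cmod_minus_RtoC_mult, !clamp_id by auto.
  pose proof (log_kernel_lipschitz k x y hk ltac:(lra) ltac:(lra)) as h.
  replace (- log_kernel k x - - log_kernel k y) with (- (log_kernel k x - log_kernel k y)) by ring; rewrite Rabs_Ropp.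
  pose proof (Rabs_pos (x - y)).
  assert (Cmod s * Rabs (log_kernel k x - log_kernel k y) <= S * (2 * Rabs (x - y))).
  { apply Rmult_le_compat; auto; apply Rabs_pos. }
  assert (Cmod s * Rabs (log_kernel k x - log_kernel k y) <= (1 + 2 * S) * Rabs (x - y)) by nra.
  rewrite (Rmult_comm (1 + 2 * S)), Rmult_assoc; apply Rmult_le_compat_l; lra.
Qed.

Lemma continuous_log_kernel k x : (1 <= k)%nat -> continuous (fun x => - log_kernel k (clamp x)) x.
Proof.
intros hk; apply (lipschitz_continuous _ 2); [lra|]; intros u v.
pose proof (clamp_in u); pose proof (clamp_in v); pose proof (clamp_dist u v).
replace (- log_kernel k (clamp u) - - log_kernel k (clamp v)) with (- (log_kernel k (clamp u) - log_kernel k (clamp v))) by ring.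
rewrite Rabs_Ropp; pose proof (log_kernel_lipschitz k (clamp u) (clamp v) hk ltac:(lra) ltac:(lra)); lra.
Qed.

Definition kernel_mean (k : nat) (s : C) : C := Cint (kernel k s).

Lemma entire_kernel_mean k : (1 <= k)%nat -> exists v, entire (kernel_mean k) v.
Proof.
intros hk; eexists; apply (entire_Cint_cexp (fun x => RtoC (- log_kernel k (clamp x))) (log_kernel k 0 + 2)).
- apply Ccontinuous_RtoC; intros x; apply continuous_log_kernel, hk.
- intros x; rewrite Cmod_R, Rabs_Ropp; pose proof (clamp_in x).
  destruct (log_kernel_ge k (clamp x) hk ltac:(lra)); rewrite Rabs_pos_eq by lra.
  pose proof (log_kernel_lipschitz k (clamp x) 0 hk ltac:(lra) ltac:(lra)) as h.
  rewrite Rminus_0_r, (Rabs_pos_eq (clamp x)) in h by lra.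
  pose proof (Rle_abs (log_kernel k (clamp x) - log_kernel k 0)); lra.
Qed.

Lemma kernel_mean_bound k s sg : (1 <= k)%nat -> 0 <= sg -> sg <= Re s ->
  Cmod (kernel_mean k s) <= 2 * Rpower (INR k) (- (2 * sg)).
Proof.
intros hk hs hr; apply Cint_bound.
- apply Ccontinuous_cexp, Ccontinuous_RtoC; intros x; apply continuous_log_kernel, hk.
- intros x hx; unfold kernel; rewrite Cmod_cexp, Re_mult_real; apply exp_incr.
  pose proof (clamp_in x); destruct (log_kernel_ge k (clamp x) hk ltac:(lra)); nra.
Qed.

Lemma has_sum_kernel_mean s : 1 / 2 < Re s -> exists l, has_sum (fun k => (1 <= k)%nat) (fun k => kernel_mean k s) l.
Proof.
intros hs; eapply has_sum_exists.
- intros k hk; apply (kernel_mean_bound k s (Re s)); [exact hk | lra | lra].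
- apply rbound_scal; [lra | apply rbound_npow; [apply le_n | lra]].
Qed.

(** For [Re s > 1/2] this is the integral of [(t (t + 1)) ^ (- s)] over [1, oo); [kernel_mean k] is
    the part from [k] to [k + 1]. *)
Definition kernel_sum (s : C) : C :=
  epsilon (inhabits (RtoC 0)) (fun l => has_sum (fun k => (1 <= k)%nat) (fun k => kernel_mean k s) l).

Lemma kernel_sum_spec s : 1 / 2 < Re s ->
  has_sum (fun k => (1 <= k)%nat) (fun k => kernel_mean k s) (kernel_sum s).
Proof. intros hs; unfold kernel_sum; apply epsilon_spec, has_sum_kernel_mean, hs. Qed.

Lemma entire_choice {T} (A : T -> Prop) (u : T -> C -> C) : (forall i, A i -> exists v, entire (u i) v) ->
  exists v : T -> C -> C, forall i, A i -> entire (u i) (v i).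
Proof.
intros h; exists (fun i => epsilon (inhabits (fun _ => RtoC 0)) (fun v => entire (u i) v)).
intros i hi; apply epsilon_spec, h, hi.
Qed.

Lemma holC_kernel_sum s0 : 1 / 2 < Re s0 -> holC kernel_sum s0.
Proof.
intros hs; set (a := (Re s0 - 1 / 2) / 2); assert (ha : 0 < a) by (unfold a; lra).
assert (re : forall s, Cmod (s - s0) < a -> 1 / 2 + a <= Re s).
{ intros s h; pose proof (Re_close s s0); unfold a in *; lra. }
destruct (entire_choice _ kernel_mean entire_kernel_mean) as [v hv].
apply (weierstrass (fun k => (1 <= k)%nat) kernel_mean v
  (fun k => 2 * Rpower (INR k) (- (2 * (1 / 2 + a))))
  (2 * (Rpower (INR 1) (- (2 * (1 / 2 + a))) + Rpower (INR 1) (1 - 2 * (1 / 2 + a)) / (2 * (1 / 2 + a) - 1)))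
  kernel_sum s0 a ha).
- intros k hk; apply entire_C11, hv, hk.
- intros k hk s h; apply kernel_mean_bound; auto; lra.
- apply rbound_scal; [lra | apply rbound_npow; [apply le_n | lra]].
- intros s h; apply kernel_sum_spec; specialize (re s h); lra.
Qed.

(* The means over [0,1] glue to the integral of [(t (t + 1)) ^ (- 2/3)] over [1, oo). *)
Lemma kernel_sum_two_thirds : kernel_sum (RtoC (2 / 3)) = RtoC (3 * beta0).
Proof.
set (g := fun t => Rpower (t * (t + 1)) (- (2 / 3))).
assert (km : forall k, (1 <= k)%nat -> kernel_mean k (RtoC (2 / 3)) = RtoC (RInt g (INR k) (INR k + 1))).
{ intros k hk; assert (1 <= INR k) by (apply (le_INR 1), hk).
  assert (e : forall x, kernel k (RtoC (2 / 3)) x = RtoC (g (clamp x + INR k))).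
  { intros x; pose proof (clamp_in x); unfold kernel; rewrite <- RtoC_mult, cexp_RtoC; f_equal.
    unfold g, Rpower; f_equal; unfold log_kernel; rewrite ln_mult by lra.
    rewrite (Rplus_comm (clamp x)); ring. }
  unfold kernel_mean, Cint, RtoC; f_equal.
  - pose proof (RInt_comp_lin (V := R_CompleteNormedModule) g 1 (INR k) 0 1) as c.
    replace (1 * 0 + INR k) with (INR k) in c by ring; replace (1 * 1 + INR k) with (INR k + 1) in c by ring.
    rewrite <- c.
    + apply RInt_ext; rewrite Rmin_left, Rmax_right by lra; intros x hx.
      match goal with |- @eq _ ?a ?b => change (@eq R a b) end.
      rewrite e, clamp_id by lra; unfold RtoC, scal; simpl; unfold mult; simpl; rewrite !Rmult_1_l; reflexivity.
    + apply (ex_RInt_continuous (V := R_CompleteNormedModule)); rewrite Rmin_left, Rmax_right by lra; intros z hz.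
      apply (ex_derive_continuous g); unfold g, Rpower; auto_derive; nra.
  - rewrite (RInt_ext _ (fun _ => 0)); [rewrite RInt_const; unfold scal; simpl; unfold mult; simpl; ring|].
    intros x _; rewrite e; reflexivity. }
assert (ps : forall N, csum (fun k => kernel_mean k (RtoC (2 / 3))) (seq 1 N) = RtoC (RInt g 1 (INR (S N)))).
{ assert (ex : forall a b, 1 <= a -> a <= b -> ex_RInt g a b).
  { intros a b h1 h2; apply (ex_RInt_continuous (V := R_CompleteNormedModule)); rewrite Rmin_left, Rmax_right by lra; intros z hz.
    apply (ex_derive_continuous g); unfold g, Rpower; auto_derive; nra. }
  induction N as [|N IH].
  - simpl INR; rewrite RInt_point; reflexivity.
  - rewrite seq_S, csum_app, IH, csum_cons, km by lia; unfold csum; cbn [map fold_right].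
    assert (1 <= INR (S N)) by (apply (le_INR 1); lia).
    replace (INR (1 + N)) with (INR (S N)) by reflexivity; rewrite (S_INR (S N)), Cplus_0_r, <- RtoC_plus; f_equal.
    apply (RInt_Chasles (V := R_CompleteNormedModule) g); apply ex; lra. }
pose proof (kernel_sum_spec (RtoC (2 / 3)) ltac:(simpl; lra)) as h; set (P := kernel_sum _) in *.
assert (z : Cmod (P - RtoC (3 * beta0)) <= 0).
{ apply Rnot_lt_le; intros hlt; set (e := Cmod (P - RtoC (3 * beta0))) in *.
  destruct (has_sum_seq 1 _ _ h (e / 2) ltac:(lra)) as [N0 H0].
  destruct (kernel_integral_limit (e / 2) ltac:(lra)) as [X [_ HX]].
  destruct (nfloor_ex (Rmax 0 X)) as [N1 [_ hN1]]; [apply Rmax_l|].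
  specialize (H0 (N0 + N1)%nat ltac:(lia)); rewrite ps in H0.
  assert (H1 : Rabs (RInt g 1 (INR (S (N0 + N1))) - 3 * beta0) < e / 2).
  { apply HX; pose proof (Rmax_r 0 X); rewrite S_INR, plus_INR; pose proof (pos_INR N0); lra. }
  rewrite <- Cmod_R, RtoC_minus in H1.
  assert (e < e); [|lra]; unfold e at 1; set (Q := RtoC (RInt _ _ _)) in *.
  replace (P - RtoC (3 * beta0))%C with (- (Q - P) + (Q - RtoC (3 * beta0)))%C by ring.
  eapply Rle_lt_trans; [apply Cmod_triangle|]; rewrite Cmod_opp; lra. }
replace P with ((P - RtoC (3 * beta0)) + RtoC (3 * beta0))%C by ring.
rewrite (Cmod_eq_0 (P - RtoC (3 * beta0))) by (pose proof (Cmod_ge_0 (P - RtoC (3 * beta0))); lra); ring.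
Qed.

(** Any finite set of terms lies in finitely many full fibers, and enlarging it only increases a sum
    of nonnegative terms. *)
Lemma rbound_fiber {I T} (A : T -> Prop) (A' : I -> Prop) (pr : T -> I) (fib : I -> list T) (a : T -> R) b B :
  (forall t, A t -> 0 <= a t) -> (forall t, A t -> A' (pr t)) ->
  (forall i, A' i -> NoDup (fib i) /\ forall t, In t (fib i) <-> A t /\ pr t = i) ->
  (forall i, A' i -> rsum a (fib i) <= b i) -> rbound A' b B -> rbound A a B.
Proof.
intros ha hpr hfib hb hB L nd hL; rewrite List.Forall_forall in hL.
destruct (dedup (map pr L)) as [l [ndl hl]].
assert (hl' : forall i, In i l -> A' i).
{ intros i hi; apply hl, in_map_iff in hi; destruct hi as [t [<- ht]]; apply hpr, hL, ht. }
assert (e : forall l, rsum a (flat_map fib l) = rsum (fun i => rsum a (fib i)) l).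
{ induction l0 as [|i l0 IH]; [reflexivity|]; simpl flat_map; rewrite rsum_app, IH; reflexivity. }
eapply Rle_trans; [apply (rsum_incl_le a L (flat_map fib l))|].
- intros t ht; apply in_flat_map in ht; destruct ht as [i [hi ht]].
  apply ha; apply (proj2 (hfib i (hl' i hi))), ht.
- exact nd.
- apply (NoDup_flat_map fib pr l ndl); intros i hi; destruct (hfib i (hl' i hi)) as [h1 h2]; split; [exact h1|].
  intros t ht; apply h2, ht.
- intros t ht; apply in_flat_map; exists (pr t); split.
  + apply hl, in_map, ht.
  + apply (hfib (pr t) (hpr t (hL t ht))); split; [apply hL, ht | reflexivity].
- rewrite e; eapply Rle_trans; [apply rsum_le; intros i hi; apply hb, hl', hi | apply hB; auto].
  rewrite List.Forall_forall; exact hl'.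
Qed.

Definition is_positive (n : nat) : Prop := (1 <= n)%nat.

(** The section is applied twice, to the intervals with [d <= b] and to their mirror images; [L] is
    the logarithm of [|f''| / 2], read from the left or from the right. *)
Section HalfSeries.

Variables (L : R -> R) (A : R) (t : nat -> nat -> nat -> R).
Hypotheses (hL : bounded_lipschitz L A) (ht : approximates A t L).

Definition profile (s : C) (x : R) : C := cexp (s * RtoC (L (clamp x))).
Definition profile_mean (s : C) : C := Cint (profile s).

Lemma profile_lipschitz s S : Cmod s <= S -> Cbounded_lipschitz (profile s) (exp (S * A) * (1 + S * A)).
Proof using hL.
intros hS; pose proof (Cmod_ge_0 s); pose proof (bounded_lipschitz_pos _ _ hL) as A0.
assert (S0 : 0 <= S * A) by (apply Rmult_le_pos; lra).
assert (M : forall x, Re (s * RtoC (L (clamp x))) <= S * A).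
{ intros x; eapply Rle_trans; [apply Rle_abs|]; eapply Rle_trans; [apply re_le_Cmod|].
  rewrite Cmod_mult, Cmod_R; apply Rmult_le_compat; auto; [apply Rabs_pos | apply hL, clamp_in]. }
pose proof (exp_pos (S * A)); split.
- intros x _; unfold profile; rewrite Cmod_cexp; pose proof (exp_incr _ _ (M x)); nra.
- intros x y hx hy; unfold profile; eapply Rle_trans; [apply (cexp_lipschitz _ _ _ (M x) (M y))|].
  rewrite Cmod_minus_RtoC_mult, !clamp_id by auto; rewrite Rmult_assoc; apply Rmult_le_compat_l; [lra|].
  pose proof (Rabs_pos (x - y)).
  assert (Cmod s * Rabs (L x - L y) <= S * (A * Rabs (x - y))).
  { apply Rmult_le_compat; auto; [apply Rabs_pos | apply hL; auto]. }
  lra.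
Qed.

Lemma entire_profile_mean : exists v, entire profile_mean v.
Proof using hL.
eexists; apply (entire_Cint_cexp (fun x => RtoC (L (clamp x))) A).
- apply Ccontinuous_RtoC; intros x; apply (continuous_clamped _ _ _ hL).
- intros x; rewrite Cmod_R; apply hL, clamp_in.
Qed.

(** A common bound for the exponent and its approximation, as [cexp_lipschitz] needs. One [S * A]
    comes from the values of [L], the other from the error [A / d <= A]. *)
Lemma block_term_bound d k r s sg S : (1 <= d)%nat -> (1 <= k)%nat -> In r (units d) ->
  0 <= sg -> sg <= Re s -> Cmod s <= S ->
  Re (s * RtoC (t d k r)) <= 2 * (S * A) - 3 * sg * ln (INR d) - 2 * sg * ln (INR k) /\
  Re (s * RtoC (L (INR (neg_inverse d r) / INR d) - 3 * ln (INR d) - log_kernel k (INR r / INR d))) <=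
    2 * (S * A) - 3 * sg * ln (INR d) - 2 * sg * ln (INR k).
Proof.
intros hd hk hr h0 h1 h2; assert (d1 : 1 <= INR d) by (apply (le_INR 1), hd).
pose proof (ht d k r hd hk hr) as e; apply in_units in hr; destruct hr as [hr hg].
destruct (neg_inverse_spec d r hd hg) as [hc _].
assert (x01 : 0 <= INR r / INR d <= 1).
{ split; [apply Rdiv_le_0_compat; [apply pos_INR | lra]|].
  apply Rmult_le_reg_r with (INR d); [lra|]; unfold Rdiv; rewrite Rmult_assoc, Rinv_l, Rmult_1_r, Rmult_1_l by lra; apply le_INR; lia. }
assert (y01 : 0 <= INR (neg_inverse d r) / INR d <= 1).
{ split; [apply Rdiv_le_0_compat; [apply pos_INR | lra]|].
  apply Rmult_le_reg_r with (INR d); [lra|]; unfold Rdiv; rewrite Rmult_assoc, Rinv_l, Rmult_1_r, Rmult_1_l by lra; apply le_INR; lia. }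
pose proof (bounded_lipschitz_pos _ _ hL) as A0.
pose proof (proj1 hL _ y01) as by0; pose proof (Rle_abs (L (INR (neg_inverse d r) / INR d))).
destruct (log_kernel_ge k (INR r / INR d) hk ltac:(lra)) as [k0 k1].
assert (d0 : 0 <= ln (INR d)) by (rewrite <- ln_1; apply ln_le; lra).
assert (A / INR d <= A).
{ apply Rmult_le_reg_r with (INR d); [lra|]; unfold Rdiv; rewrite Rmult_assoc, Rinv_l by lra; nra. }
pose proof (Rle_abs (t d k r - (L (INR (neg_inverse d r) / INR d) - 3 * ln (INR d) - log_kernel k (INR r / INR d)))).
assert (rs : Re s <= S) by (eapply Rle_trans; [apply Rle_abs | eapply Rle_trans; [apply re_le_Cmod | exact h2]]).
assert (W : forall v, v <= 2 * A - 3 * ln (INR d) - 2 * ln (INR k) ->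
  Re s * v <= 2 * (S * A) - 3 * sg * ln (INR d) - 2 * sg * ln (INR k)).
{ intros v hv; assert (Re s * v <= Re s * (2 * A - 3 * ln (INR d) - 2 * ln (INR k))) by (apply Rmult_le_compat_l; lra).
  assert (Re s * A <= S * A) by (apply Rmult_le_compat_r; lra).
  assert (sg * ln (INR d) <= Re s * ln (INR d)) by (apply Rmult_le_compat_r; lra).
  assert (sg * ln (INR k) <= Re s * ln (INR k)) by (apply Rmult_le_compat_r; lra).
  lra. }
rewrite !Re_mult_real; split; apply W; lra.
Qed.

Definition block (p : nat * nat) (s : C) : C := csum (fun r => cexp (s * RtoC (t (fst p) (snd p) r))) (units (fst p)).

(** What the block would be if [r / d] and [c / d] were independent and uniform: the number of units
    times the two mean values. *)
Definition block_mean (p : nat * nat) (s : C) : C :=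
  (RtoC (INR (length (units (fst p)))) * npow (fst p) (3 * s) * (kernel_mean (snd p) s * profile_mean s))%C.

Lemma npow_triple d s : npow d (3 * s) = cexp (s * RtoC (- 3 * ln (INR d))).
Proof. unfold npow; f_equal; rewrite !RtoC_mult, !RtoC_opp; ring. Qed.

Lemma Cmod_csum_const {T} (u : T -> C) c l : (forall x, In x l -> Cmod (u x) <= c) ->
  Cmod (csum u l) <= INR (length l) * c.
Proof. intros h; eapply Rle_trans; [apply Cmod_csum_le|]; rewrite <- rsum_const; apply rsum_le, h. Qed.

(** [K] does not depend on [s] in the region considered, which makes the bound a majorant for
    [weierstrass]. *)
Lemma block_approximation S sg : 0 <= sg -> 0 <= S -> exists K, 0 <= K /\
  forall s p, both is_positive is_positive p -> sg <= Re s -> Cmod s <= S ->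
    Cmod (block p s - block_mean p s) <=
    K * (Rpower (INR (fst p)) (- (3 * sg - 6 / 7)) * Rpower (INR (snd p)) (- (2 * sg))).
Proof.
intros h0 hS; destruct complex_equidistribution as [c [hc E]].
pose proof (bounded_lipschitz_pos _ _ hL) as A0.
assert (SA : 0 <= S * A) by (apply Rmult_le_pos; auto).
set (K1 := exp (2 * (S * A)) * (S * A)); set (K2 := c * (1 + 2 * S) * (exp (S * A) * (1 + S * A))).
assert (0 <= K1) by (apply Rmult_le_pos; [left; apply exp_pos | auto]).
assert (0 <= K2) by (pose proof (exp_pos (S * A)); repeat apply Rmult_le_pos; lra).
exists (K1 + K2); split; [lra|].
intros s [d k] [hd hk] h1 h2; unfold is_positive in hd, hk; cbn [fst snd] in *.
assert (d1 : 1 <= INR d) by (apply (le_INR 1), hd); assert (k1 : 1 <= INR k) by (apply (le_INR 1), hk).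
set (t' := fun r => L (INR (neg_inverse d r) / INR d) - 3 * ln (INR d) - log_kernel k (INR r / INR d)).
set (D := Rpower (INR d)); set (Kp := Rpower (INR k) (- (2 * sg))); assert (Kp0 : 0 < Kp) by apply exp_pos.
(* Replacing [t] by its approximation costs a factor [A / d] for each of at most [d] units, so
   nothing worse than [d ^ (- 3 sg)]. *)
assert (b1 : Cmod (block (d, k) s - csum (fun r => cexp (s * RtoC (t' r))) (units d)) <= K1 * (D (- (3 * sg - 6 / 7)) * Kp)).
{ unfold block; cbn [fst snd].
  replace (csum (fun r => cexp (s * RtoC (t d k r))) (units d) - csum (fun r => cexp (s * RtoC (t' r))) (units d))%C
    with (csum (fun r => cexp (s * RtoC (t d k r)) + RtoC (- (1)) * cexp (s * RtoC (t' r)))%C (units d)).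
  2:{ rewrite csum_plus, csum_scal, RtoC_opp; ring. }
  eapply Rle_trans; [apply (Cmod_csum_const _ (K1 * (D (- (3 * sg)) * Kp) / INR d))|].
  - intros r hr; destruct (block_term_bound d k r s sg S hd hk hr h0 h1 h2) as [m1 m2].
    replace (cexp (s * RtoC (t d k r)) + RtoC (- (1)) * cexp (s * RtoC (t' r)))%C with
      (cexp (s * RtoC (t d k r)) - cexp (s * RtoC (t' r)))%C by (rewrite RtoC_opp; ring).
    eapply Rle_trans; [apply (cexp_lipschitz _ _ _ m1 m2)|]; rewrite Cmod_minus_RtoC_mult.
    pose proof (ht d k r hd hk hr) as e; fold (t' r) in e.
    replace (K1 * (D (- (3 * sg)) * Kp) / INR d) with
      (exp (2 * (S * A) - 3 * sg * ln (INR d) - 2 * sg * ln (INR k)) * (S * (A / INR d))).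
    + apply Rmult_le_compat_l; [left; apply exp_pos|]; apply Rmult_le_compat; auto; [apply Cmod_ge_0 | apply Rabs_pos].
    + replace (2 * (S * A) - 3 * sg * ln (INR d) - 2 * sg * ln (INR k)) with
        (2 * (S * A) + (- (3 * sg) * ln (INR d) + - (2 * sg) * ln (INR k))) by ring.
      rewrite !exp_plus; unfold K1, D, Kp, Rpower; field; lra.
  - assert (D (- (3 * sg)) <= D (- (3 * sg - 6 / 7))) by (apply Rle_Rpower; lra).
    assert (0 < D (- (3 * sg))) by apply exp_pos.
    assert (INR (length (units d)) * (K1 * (D (- (3 * sg)) * Kp) / INR d) <= K1 * (D (- (3 * sg)) * Kp)).
    { pose proof (units_length_le d).
      assert (0 <= K1 * (D (- (3 * sg)) * Kp) / INR d).
      { apply Rdiv_le_0_compat; [|lra]; apply Rmult_le_pos; [lra|]; apply Rmult_le_pos; lra. }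
      apply Rle_trans with (INR d * (K1 * (D (- (3 * sg)) * Kp) / INR d)); [apply Rmult_le_compat_r; auto | right; field; lra]. }
    assert (K1 * (D (- (3 * sg)) * Kp) <= K1 * (D (- (3 * sg - 6 / 7)) * Kp)); [|lra].
    apply Rmult_le_compat_l; [lra|]; apply Rmult_le_compat_r; lra. }
(* After [npow d (3 * s)] is taken out, the block is a sum of products to which equidistribution
   applies; the error is [d ^ (6/7 - 3 sg)]. *)
assert (b2 : Cmod (csum (fun r => cexp (s * RtoC (t' r))) (units d) - block_mean (d, k) s) <= K2 * (D (- (3 * sg - 6 / 7)) * Kp)).
{ pose proof (E d (kernel k s) (profile s) _ _ hd (kernel_lipschitz k s sg S hk h0 h1 h2) (profile_lipschitz s S h2)) as e.
  replace (csum (fun r => cexp (s * RtoC (t' r))) (units d)) with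
    (npow d (3 * s) * csum (fun r => kernel k s (INR r / INR d)%R * profile s (INR (neg_inverse d r) / INR d)%R) (units d))%C.
  - unfold block_mean; cbn [fst snd]; unfold kernel_mean, profile_mean.
    match goal with |- Cmod (?n * ?x - ?f * ?n * ?y) <= _ => replace (n * x - f * n * y)%C with (n * (x - f * y))%C by ring end.
    rewrite Cmod_mult, Cmod_npow; eapply Rle_trans; [apply Rmult_le_compat_l; [left; apply exp_pos | exact e]|].
    fold Kp; fold D.
    replace (Re (3 * s)) with (3 * Re s) by (destruct s; unfold RtoC, Cmult, Re; simpl; ring).
    assert (D (- (3 * Re s)) <= D (- (3 * sg))) by (apply Rle_Rpower; lra).
    replace (- (3 * sg - 6 / 7)) with (- (3 * sg) + 6 / 7) by ring; unfold D at 3; rewrite Rpower_plus; fold D.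
    assert (0 < D (6 / 7)) by apply exp_pos.
    replace (K2 * (D (- (3 * sg)) * D (6 / 7) * Kp)) with (D (- (3 * sg)) * (K2 * (D (6 / 7) * Kp))) by ring.
    replace (c * ((1 + 2 * S) * Kp) * (exp (S * A) * (1 + S * A)) * D (6 / 7)) with (K2 * (D (6 / 7) * Kp)) by (unfold K2; ring).
    apply Rmult_le_compat_r; auto; apply Rmult_le_pos; auto; apply Rmult_le_pos; lra.
  - rewrite <- csum_scal; apply csum_ext; intros r hr.
    apply in_units in hr; destruct hr as [hr hg]; destruct (neg_inverse_spec d r hd hg) as [hc' _].
    assert (fr : forall n, (n < d)%nat -> 0 <= INR n / INR d <= 1).
    { intros n hn; split; [apply Rdiv_le_0_compat; [apply pos_INR | lra]|].
      apply Rmult_le_reg_r with (INR d); [lra|]; unfold Rdiv; rewrite Rmult_assoc, Rinv_l, Rmult_1_r, Rmult_1_l by lra; apply le_INR; lia. }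
    unfold kernel, profile; rewrite !clamp_id by auto; rewrite npow_triple, <- !cexp_plus; f_equal; unfold t'.
    rewrite !RtoC_minus, !RtoC_mult, !RtoC_opp; ring. }
pose proof (Cmod_sub_triangle (block (d, k) s) (csum (fun r => cexp (s * RtoC (t' r))) (units d)) (block_mean (d, k) s)); lra.
Qed.

(** The sum of all equidistribution errors; its value matters for [Re s > 13/21] only, where the
    series converges. *)
Definition remainder (s : C) : C :=
  epsilon (inhabits (RtoC 0)) (fun l => has_sum (both is_positive is_positive) (fun p => block p s - block_mean p s)%C l).

(* [13/21] is where [3 s - 6/7 = 1]. *)
Lemma rbound_pairs sg : 13 / 21 < sg -> exists B, rbound (both is_positive is_positive)
  (fun p => Rpower (INR (fst p)) (- (3 * sg - 6 / 7)) * Rpower (INR (snd p)) (- (2 * sg))) B.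
Proof.
intros h; eexists.
apply (rbound_prod is_positive is_positive (fun n => Rpower (INR n) (- (3 * sg - 6 / 7))) (fun n => Rpower (INR n) (- (2 * sg)))).
- intros; left; apply exp_pos.
- intros; left; apply exp_pos.
- apply rbound_npow; [apply le_n | lra].
- apply rbound_npow; [apply le_n | lra].
Qed.

Lemma remainder_spec s : 13 / 21 < Re s ->
  has_sum (both is_positive is_positive) (fun p => block p s - block_mean p s)%C (remainder s).
Proof.
intros h; unfold remainder; apply epsilon_spec.
destruct (block_approximation (Cmod s) (Re s) ltac:(lra) (Cmod_ge_0 s)) as [K [hK H]].
destruct (rbound_pairs (Re s) h) as [B hB].
eapply has_sum_exists; [intros p hp; apply H; [exact hp | lra | lra] | apply rbound_scal; [exact hK | exact hB]].
Qed.

Lemma entire_difference p : both is_positive is_positive p -> exists v, entire (fun s => block p s - block_mean p s)%C v.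
Proof using hL.
intros [_ hk]; destruct (entire_kernel_mean (snd p) hk) as [v1 e1]; destruct entire_profile_mean as [v2 e2].
pose proof (entire_csum (units (fst p)) _ _ (fun r _ => entire_cexp (RtoC (t (fst p) (snd p) r)))) as eb.
eexists; eapply entire_ext; [|exact (entire_plus _ _ _ _ eb
  (entire_mult _ _ _ _ (entire_const (- RtoC (INR (length (units (fst p)))))%C)
    (entire_mult _ _ _ _ (entire_cexp (RtoC (- 3 * ln (INR (fst p))))) (entire_mult _ _ _ _ e1 e2))))].
intros s; cbn beta; unfold block_mean; rewrite npow_triple; unfold block; ring.
Qed.

Lemma holC_remainder s0 : 13 / 21 < Re s0 -> holC remainder s0.
Proof.
intros hs; set (a := (Re s0 - 13 / 21) / 2); assert (ha : 0 < a) by (unfold a; lra).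
assert (re : forall s, Cmod (s - s0) < a -> 13 / 21 + a <= Re s).
{ intros s h; pose proof (Re_close s s0); unfold a in *; lra. }
destruct (entire_choice _ _ entire_difference) as [v hv].
pose proof (Cmod_ge_0 s0).
destruct (block_approximation (Cmod s0 + a) (13 / 21 + a) ltac:(lra) ltac:(lra)) as [K [hK H']].
destruct (rbound_pairs (13 / 21 + a) ltac:(lra)) as [B hB].
apply (weierstrass (both is_positive is_positive) (fun p s => block p s - block_mean p s)%C v
  (fun p => K * (Rpower (INR (fst p)) (- (3 * (13 / 21 + a) - 6 / 7)) * Rpower (INR (snd p)) (- (2 * (13 / 21 + a))))) (K * B)
  remainder s0 a ha).
- intros p hp; apply entire_C11, hv, hp.
- intros p hp s h; apply H'; [exact hp | apply re, h|].
  pose proof (Cmod_triangle (s - s0) s0) as q; replace (s - s0 + s0)%C with s in q by ring; lra.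
- apply rbound_scal; auto.
- intros s h; apply remainder_spec; specialize (re s h); lra.
Qed.

Lemma Re_triple s : Re (3 * s) = 3 * Re s.
Proof. destruct s; unfold RtoC, Cmult, Re; simpl; ring. Qed.

Definition block_term (p : nat * nat * nat) (s : C) : C := cexp (s * RtoC (t (fst (fst p)) (snd (fst p)) (snd p))).

Theorem half_series s : 2 / 3 < Re s -> has_sum parameter (fun p => block_term p s)
  (remainder s + zeta (3 * s - 1) / zeta (3 * s) * (kernel_sum s * profile_mean s)).
Proof.
intros hs.
assert (mean : has_sum (both is_positive is_positive) (fun p => block_mean p s)
  (zeta (3 * s - 1) / zeta (3 * s) * (kernel_sum s * profile_mean s))%C).
{ pose proof (has_sum_prod _ _ _ _ _ _ (totient_series (3 * s) ltac:(rewrite Re_triple; lra)) (kernel_sum_spec s ltac:(lra))) as h.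
  apply (has_sum_scal _ _ _ (profile_mean s)) in h.
  replace (zeta (3 * s - 1) / zeta (3 * s) * (kernel_sum s * profile_mean s))%C with
    (profile_mean s * (zeta (3 * s - 1) / zeta (3 * s) * kernel_sum s))%C by ring.
  revert h; apply has_sum_ext; intros p _; unfold block_mean; ring. }
pose proof (has_sum_plus _ _ _ _ _ (remainder_spec s ltac:(lra)) mean) as sum.
set (l := (remainder s + _)%C) in *.
assert (sum' : has_sum (both is_positive is_positive) (fun p => block p s) l).
{ revert sum; apply has_sum_ext; intros; ring. }
set (fib := fun p : nat * nat => map (fun r => (p, r)) (units (fst p))).
assert (pr : forall p, parameter p -> both is_positive is_positive (fst p)) by (intros p (h1 & h2 & _); split; auto).
assert (hfib : forall p, both is_positive is_positive p -> NoDup (fib p) /\ forall q, In q (fib p) <-> parameter q /\ fst q = p).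
{ intros p [h1 h2]; split.
  - apply FinFun.Injective_map_NoDup; [intros x y e; injection e; auto | apply nodup_units].
  - intros [p' r]; unfold fib; rewrite in_map_iff; unfold parameter; cbn [fst snd]; split.
    + intros [x [e hx]]; injection e as <- <-; auto.
    + intros [(_ & _ & h) ->]; exists r; auto. }
(* Convergence of the series of blocks does not imply that of the series of single terms, because
   blocks may hide cancellation. The latter is shown first, by an absolute bound; grouping then
   identifies its sum. *)
assert (ex : exists l', has_sum parameter (fun p => block_term p s) l').
{ set (K := exp (2 * (Cmod s * A))).
  assert (K0 : 0 < K) by apply exp_pos.
  apply has_sum_exists with (a := fun p => Cmod (block_term p s))
    (B := K * ((Rpower (INR 1) (- (3 * Re s - 1)) + Rpower (INR 1) (1 - (3 * Re s - 1)) / (3 * Re s - 1 - 1)) *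
      (Rpower (INR 1) (- (2 * Re s)) + Rpower (INR 1) (1 - 2 * Re s) / (2 * Re s - 1)))); [intros; lra|].
  apply (rbound_fiber parameter (both is_positive is_positive) fst fib _
    (fun p => K * (Rpower (INR (fst p)) (- (3 * Re s - 1)) * Rpower (INR (snd p)) (- (2 * Re s))))); auto.
  - intros; apply Cmod_ge_0.
  - intros [d k] [hd hk]; unfold is_positive in *; cbn [fst snd] in *; unfold fib; cbn [fst]; rewrite rsum_map.
    assert (d1 : 1 <= INR d) by (apply (le_INR 1), hd).
    eapply Rle_trans; [apply (rsum_le _ (fun _ => K * (Rpower (INR d) (- (3 * Re s)) * Rpower (INR k) (- (2 * Re s)))))|].
    + intros r hr; unfold block_term; cbn [fst snd]; rewrite Cmod_cexp.
      destruct (block_term_bound d k r s (Re s) (Cmod s) hd hk hr ltac:(lra) ltac:(lra) ltac:(lra)) as [m1 _].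
      unfold K, Rpower; rewrite <- !exp_plus; apply exp_incr; lra.
    + rewrite rsum_const; pose proof (units_length_le d).
      replace (- (3 * Re s - 1)) with (1 + - (3 * Re s)) by ring; rewrite Rpower_plus, Rpower_1 by lra.
      replace (K * (INR d * Rpower (INR d) (- (3 * Re s)) * Rpower (INR k) (- (2 * Re s)))) with
        (INR d * (K * (Rpower (INR d) (- (3 * Re s)) * Rpower (INR k) (- (2 * Re s))))) by ring.
      apply Rmult_le_compat_r; auto; repeat apply Rmult_le_pos; left; auto; apply exp_pos.
  - apply rbound_scal; [lra|]; apply (rbound_prod is_positive is_positive (fun n => Rpower (INR n) (- (3 * Re s - 1))) (fun n => Rpower (INR n) (- (2 * Re s)))).
    + intros; left; apply exp_pos.
    + intros; left; apply exp_pos.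
    + apply rbound_npow; [apply le_n | lra].
    + apply rbound_npow; [apply le_n | lra]. }
destruct ex as [l' hl']; replace l with l'; [exact hl'|].
pose proof (has_sum_fiber _ _ _ _ _ _ pr hfib hl') as h.
refine (has_sum_unique _ _ _ _ _ sum'); revert h; apply has_sum_ext; intros p _.
unfold fib, block; rewrite csum_map; reflexivity.
Qed.

End HalfSeries.

(** * Continuation and residue *)

Section SimplePole.

Variables (H N : C -> C) (z0 : C).
Hypotheses (hH : holC H z0) (hN : holC N z0) (N0 : N z0 <> 0%C).

Definition with_pole (s : C) : C := (H s + N s / (s - z0))%C.

Lemma sub_neq_0 (s w : C) : s <> w -> (s - w)%C <> 0%C.
Proof. intros h e; apply h; replace s with (s - w + w)%C by ring; rewrite e; ring. Qed.

Lemma holC_numerator : holC (fun s => H s * (s - z0) + N s)%C z0.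
Proof.
apply (holC_plus (fun s => H s * (s - z0))%C N); [|exact hN].
apply (holC_mult H (fun s => s - z0)%C); [exact hH|].
apply (holC_minus (fun s => s) (fun _ => z0)); [apply holC_id | apply holC_const].
Qed.

Lemma has_pole_with_pole : has_pole with_pole z0 1.
Proof.
split; [lia|]; exists (fun s => H s * (s - z0) + N s)%C; split; [apply holC_holomorphic, holC_numerator|]; split.
- replace (H z0 * (z0 - z0) + N z0)%C with (N z0) by ring; exact N0.
- apply locally_Cmod; exists 1; split; [lra|]; intros y _ hy.
  unfold with_pole; simpl Cpow; field; apply sub_neq_0, hy.
Qed.

(** [N s / (s - z0)] is [N z0 / (s - z0)] plus the quotient of [holC_quotient], which is
    holomorphic. *)
Lemma has_residue_with_pole : has_residue with_pole z0 (N z0).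
Proof.
destruct (holC_quotient N z0 hN) as [q [hq eq]].
exists 0%nat, (fun _ => N z0), (fun s => H s + q s)%C; split; [|split; [reflexivity|]].
- destruct (proj2 (locally_Cmod z0 _) hq) as [e1 [p1 h1]].
  destruct (proj2 (locally_Cmod z0 _) (holC_holomorphic H z0 hH)) as [e2 [p2 h2]].
  apply locally_Cmod; exists (Rmin e1 e2); split; [apply Rmin_glb_lt; auto|]; intros y hy.
  pose proof (Rmin_l e1 e2); pose proof (Rmin_r e1 e2).
  apply (@ex_derive_plus C_AbsRing C_NormedModule); [apply h2 | apply h1]; lra.
- apply locally_Cmod; exists 1; split; [lra|]; intros y _ hy.
  rewrite sum_O; simpl Cpow; unfold with_pole; rewrite eq by exact hy; field; apply sub_neq_0, hy.
Qed.

Lemma holomorphic_with_pole s : s <> z0 -> holC H s -> holC N s -> holomorphic_at with_pole s.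
Proof.
intros ne h1 h2; apply holC_holomorphic; unfold with_pole.
apply (holC_plus H (fun s => N s / (s - z0))%C); [exact h1|].
apply (holC_mult N (fun s => / (s - z0))%C); [exact h2|].
apply (holC_inv (fun s => s - z0)%C); [|apply sub_neq_0, ne].
apply (holC_minus (fun s => s) (fun _ => z0)); [apply holC_id | apply holC_const].
Qed.

(** The product [x * with_pole (z0 + x)] tends to [N z0], which is not 0, at a Lipschitz rate.
    Points on the right of [z0] are wanted because there the series converges. *)
Lemma with_pole_unbounded B e : 0 < e -> exists x, 0 < x < e /\ B < Cmod (with_pole (z0 + RtoC x)).
Proof.
intros he; destruct holC_numerator as [R [K [v [hR [hK hC]]]]].
destruct (C11_lipschitz _ _ _ _ _ hK hR hC) as [Lc [hL [lip _]]].
assert (n0 : 0 < Cmod (N z0)) by (apply Cmod_gt_0, N0).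
set (M := Rabs B + Lc + 1); assert (M0 : 0 < M) by (unfold M; pose proof (Rabs_pos B); lra).
set (x := Rmin (e / 2) (Rmin (R / 2) (Cmod (N z0) / (2 * M)))).
assert (hx : 0 < x) by (repeat apply Rmin_glb_lt; try lra; apply Rdiv_lt_0_compat; lra).
assert (x1 : x <= e / 2) by apply Rmin_l.
assert (x2 : x <= R / 2) by (eapply Rle_trans; [apply Rmin_r | apply Rmin_l]).
assert (x3 : x <= Cmod (N z0) / (2 * M)) by (eapply Rle_trans; [apply Rmin_r | apply Rmin_r]).
exists x; split; [lra|]; apply Rnot_le_lt; intros hB.
assert (dx : Cmod (z0 + RtoC x - z0) = x).
{ replace (z0 + RtoC x - z0)%C with (RtoC x) by ring; rewrite Cmod_R; apply Rabs_pos_eq; lra. }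
specialize (lip z0 (z0 + RtoC x)%C); rewrite Cmod_self, dx in lip; specialize (lip hR ltac:(lra)); cbn beta in lip.
assert (x0 : RtoC x <> 0%C) by (intros e0; apply RtoC_inj in e0; lra).
replace (H (z0 + RtoC x) * (z0 + RtoC x - z0) + N (z0 + RtoC x))%C with (RtoC x * with_pole (z0 + RtoC x))%C in lip.
2:{ unfold with_pole; replace (z0 + RtoC x - z0)%C with (RtoC x) by ring; field; exact x0. }
replace (H z0 * (z0 - z0) + N z0)%C with (N z0) in lip by ring.
pose proof (Cmod_triangle (RtoC x * with_pole (z0 + RtoC x)) (- (RtoC x * with_pole (z0 + RtoC x) - N z0))) as tr.
replace (RtoC x * with_pole (z0 + RtoC x) + - (RtoC x * with_pole (z0 + RtoC x) - N z0))%C with (N z0) in tr by ring.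
rewrite Cmod_opp, Cmod_mult, Cmod_R, (Rabs_pos_eq x) in tr by lra.
assert (x * Cmod (with_pole (z0 + RtoC x)) <= x * Rabs B).
{ apply Rmult_le_compat_l; [lra|]; pose proof (Rle_abs B); lra. }
assert (x * M <= Cmod (N z0) / 2).
{ apply Rle_trans with (Cmod (N z0) / (2 * M) * M); [apply Rmult_le_compat_r; lra | right; field; lra]. }
unfold M in *; nra.
Qed.

End SimplePole.

Lemma half_plane_open a : open (fun s : C => a < Re s).
Proof.
intros s hs; apply locally_Cmod; exists (Re s - a); split; [lra|]; intros y hy.
pose proof (Re_close y s); lra.
Qed.

(** A separation would give, along the segment joining points of its two parts, a continuous
    function that takes only the values -1 and 1 and both of them. *)
Lemma half_plane_connected a : connected_set (fun s => a < Re s).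
Proof.
intros (A & B & oA & oB & cov & [x [ux ax]] & [y [uy by_]] & dis).
set (g := fun l => segment x y (clamp l)).
assert (gu : forall l, a < Re (g l)).
{ intros l; pose proof (clamp_in l); unfold g, segment.
  replace (Re (x + RtoC (clamp l) * (y - x))) with (Re x + clamp l * (Re y - Re x))
    by (destruct x, y; unfold RtoC, Cmult, Cplus, Cminus, Copp, Re; simpl; ring).
  set (l' := clamp l) in *; clearbody l'.
  assert (0 <= l' * (Re y - a)) by (apply Rmult_le_pos; lra).
  assert (0 <= (1 - l') * (Re x - a)) by (apply Rmult_le_pos; lra).
  destruct (Req_dec l' 1) as [-> | ne]; [lra|].
  assert (0 < (1 - l') * (Re x - a)) by (apply Rmult_lt_0_compat; lra); lra. }
assert (gc : forall l e, 0 < e -> exists d, 0 < d /\ forall l', Rabs (l' - l) < d -> Cmod (g l' - g l) < e).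
{ intros l e he; pose proof (Cmod_ge_0 (y - x)).
  exists (e / (1 + Cmod (y - x))); split; [apply Rdiv_lt_0_compat; lra|]; intros l' hl.
  replace (g l' - g l)%C with (RtoC (clamp l' - clamp l) * (y - x))%C by (unfold g, segment; rewrite RtoC_minus; ring).
  rewrite Cmod_mult, Cmod_R; pose proof (clamp_dist l' l); pose proof (Rabs_pos (clamp l' - clamp l)).
  assert (Rabs (l' - l) * (1 + Cmod (y - x)) < e); [|nra].
  apply Rmult_lt_reg_r with (/ (1 + Cmod (y - x))); [apply Rinv_0_lt_compat; lra|].
  rewrite Rmult_assoc, Rinv_r by lra; unfold Rdiv in *; lra. }
set (h := fun l => if excluded_middle_informative (A (g l)) then - 1 else 1).
assert (hc : continuity h).
{ intros l; apply continuity_pt_filterlim, filterlim_locally; intros eps.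
  destruct (cov (g l) (gu l)) as [hA | hB].
  - destruct (proj2 (locally_Cmod _ _) (oA _ hA)) as [e [he h']]; destruct (gc l e he) as [d [hd hd']].
    exists (mkposreal d hd); intros l' hl; specialize (h' _ (hd' l' hl)); unfold h.
    destruct (excluded_middle_informative (A (g l'))); [|contradiction].
    destruct (excluded_middle_informative (A (g l))); [apply ball_center | contradiction].
  - destruct (proj2 (locally_Cmod _ _) (oB _ hB)) as [e [he h']]; destruct (gc l e he) as [d [hd hd']].
    exists (mkposreal d hd); intros l' hl; specialize (h' _ (hd' l' hl)); unfold h.
    destruct (excluded_middle_informative (A (g l'))) as [h1|]; [exfalso; apply (dis _ (gu l')); auto|].
    destruct (excluded_middle_informative (A (g l))) as [h1|]; [exfalso; apply (dis _ (gu l)); auto | apply ball_center]. }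
assert (g0 : g 0 = x) by (unfold g; rewrite clamp_id by lra; unfold segment; ring).
assert (g1 : g 1 = y) by (unfold g; rewrite clamp_id by lra; unfold segment; ring).
destruct (IVT h 0 1 hc Rlt_0_1) as [z [_ hz]].
- unfold h; destruct (excluded_middle_informative (A (g 0))) as [|n]; [lra | rewrite g0 in n; contradiction].
- unfold h; destruct (excluded_middle_informative (A (g 1))) as [n|]; [rewrite g1 in n; exfalso; apply (dis y uy); auto | lra].
- unfold h in hz; destruct (excluded_middle_informative (A (g z))); lra.
Qed.

Lemma cpow_pos t s : 0 < t -> cpow t s = cexp (s * RtoC (ln t)).
Proof.
intros h; unfold cpow; destruct (Req_EM_T t 0); [lra|].
unfold cexp; rewrite Re_mult_real, Im_mult_real; reflexivity.
Qed.

Lemma has_sum_singleton {T} (x0 : T) (u : T -> C) : has_sum (fun x => x = x0) u (u x0).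
Proof.
intros eps he; exists (x0 :: nil); split; [repeat constructor|].
intros L nd hL hi; assert (In x0 L) by (apply hi; left; reflexivity).
rewrite List.Forall_forall in hL; destruct L as [|x L]; [contradiction|].
assert (x = x0) as -> by (apply hL; left; reflexivity).
destruct L as [|x L].
- simpl; replace (u x0 + 0 - u x0)%C with (RtoC 0) by ring; rewrite Cmod_0; exact he.
- exfalso; inversion nd as [|? ? hx _]; apply hx; left; apply hL; right; left; reflexivity.
Qed.

(** The remaining terms are summable because unordered convergence is absolute. *)
Lemma has_sum_remove {T} (A : T -> Prop) (x0 : T) (u : T -> C) l : A x0 -> has_sum A u l ->
  has_sum (fun x => A x /\ x <> x0) u (l - u x0)%C.
Proof.
intros h0 h; destruct (has_sum_rbound A u l h) as [B hB].
destruct (has_sum_exists (fun x => A x /\ x <> x0) u (fun x => Cmod (u x)) B) as [l' hl'].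
- intros; apply Rle_refl.
- intros L nd hL; apply hB; [exact nd|]; revert hL; apply Forall_impl; tauto.
- replace (l - u x0)%C with l'; [exact hl'|].
  assert (e : l = (l' + u x0)%C); [|rewrite e; ring].
  apply (has_sum_unique A u); [exact h|].
  eapply has_sum_pred_ext; [|apply has_sum_union; [|exact hl' | apply has_sum_singleton]].
  + intros x; split; [intros [[hx _] | ->]; auto|]; intros hx; destruct (classic (x = x0)); tauto.
  + intros x [_ n] e; contradiction.
Qed.

Lemma zeta_two : zeta (RtoC 2) = RtoC (PI ^ 2 / 6).
Proof.
apply (has_sum_unique _ _ _ _ (has_sum_zeta (RtoC 2) ltac:(simpl; lra))).
apply has_sum_ext with (2 := basel); intros n hn; assert (0 < INR n) by (apply lt_0_INR; lia).
unfold npow; rewrite <- RtoC_mult, cexp_RtoC; f_equal.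
replace (2 * - ln (INR n)) with (- (2 * ln (INR n))) by ring; rewrite exp_Ropp; f_equal.
change (exp (2 * ln (INR n))) with (Rpower (INR n) (INR 2)); symmetry; apply Rpower_pow; auto.
Qed.

(** * The Farey zeta function from its two halves *)

Section Assembly.

Variables (f f1 f2 f3 : R -> R) (m : R).
Hypotheses (hf : C3_unit_interval f f1 f2 f3) (hm : 0 < m)
  (hf2 : forall x : R, 0 <= x <= 1 -> m <= Rabs (f2 x)).
Variable A : R.
Hypothesis hA : bounded_lipschitz (log_half_second f2) A.

Definition t_left (d k r : nat) : R := ln (Rabs (farey_T f (quad_of d k r))).
Definition t_right (d k r : nat) : R := ln (Rabs (farey_T f (reflect (quad_of d k r)))).
Definition profile_left : R -> R := log_half_second f2.
Definition profile_right (x : R) : R := log_half_second f2 (1 - x).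
Definition unit_quad : quad := Quad 1 1 0 1.

Lemma bounded_lipschitz_right : bounded_lipschitz profile_right A.
Proof.
destruct hA as [h1 h2]; split.
- intros x hx; apply h1; lra.
- intros x y hx hy; unfold profile_right; eapply Rle_trans; [apply h2; lra|].
  replace (1 - x - (1 - y)) with (- (x - y)) by ring; rewrite Rabs_Ropp; lra.
Qed.

Lemma approx_left : approximates A t_left profile_left.
Proof. exact (approximates_left f f1 f2 f3 m hf hm hf2 A hA). Qed.

Lemma approx_right : approximates A t_right profile_right.
Proof. exact (approximates_right f f1 f2 f3 m hf hm hf2 A hA). Qed.

(** The two main terms together are [zeta (3 s - 1)] times this factor. Splitting [zeta (3 s - 1)]
    into [1 / (3 s - 2)] and [zeta_regular] yields [polar_part], with [1/3] from
    [3 s - 2 = 3 (s - 2/3)], and the last term of [regular_part]. *)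
Definition residue_factor (s : C) : C :=
  (kernel_sum s * (profile_mean profile_left s + profile_mean profile_right s) / zeta (3 * s))%C.

(** The subtracted exponential is the term of [0,1], which is its own mirror image and is counted in
    both halves. *)
Definition regular_part (s : C) : C :=
  (remainder profile_left t_left s + remainder profile_right t_right s
   - cexp (s * RtoC (ln (Rabs (farey_T f unit_quad)))) + residue_factor s * zeta_regular (3 * s - 1))%C.

Definition polar_part (s : C) : C := (RtoC (/ 3) * residue_factor s)%C.

Definition continuation : C -> C := with_pole regular_part polar_part (RtoC (2 / 3)).

Lemma unit_quad_farey : farey unit_quad.
Proof. apply farey_intro; lia. Qed.

Lemma equal_denominators I : farey I -> (qd I <= qb I)%Z -> (qb I <= qd I)%Z -> I = unit_quad.
Proof.
destruct I as [a b c d]; intros (h1 & h2 & h3 & h4 & _ & _ & e) hl hr; cbn [qb qd] in *.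
assert (b = d) as -> by lia; assert (d * (a - c) = 1)%Z by nia.
assert (1 <= a - c)%Z by nia; assert (d = 1)%Z by nia; subst d; unfold unit_quad; f_equal; nia.
Qed.

Lemma farey_T_pos I : farey I -> 0 < Rabs (farey_T f I).
Proof using hf hf2 hm. intros h; destruct (ln_farey_T f f1 f2 f3 m hf hm hf2 I h) as [z [_ [h' _]]]; exact h'. Qed.

Theorem farey_zeta_continuation s : 2 / 3 < Re s -> farey_zeta f s (continuation s).
Proof using A f1 f3 hA hf hf2 hm m.
intros hs; set (u := fun I => cpow (Rabs (farey_T f I)) s).
set (D := (zeta (3 * s - 1) / zeta (3 * s))%C).
assert (left : has_sum (fun I => farey I /\ (qd I <= qb I)%Z) u
  (remainder profile_left t_left s + D * (kernel_sum s * profile_mean profile_left s))).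
{ apply (has_sum_bij parameter _ quad_of_parameter parameter_of_quad).
  - intros p hp; split; [|apply parameter_of_quad_of, hp]; destruct p as [[d k] r]; destruct hp as (h1 & h2 & h3); apply quad_of_farey; auto.
  - intros I [h1 h2]; apply parameter_of_quad_spec; auto.
  - generalize (half_series profile_left A t_left hA approx_left s hs); apply has_sum_ext; intros p hp; destruct p as [[d k] r]; destruct hp as (h1 & h2 & h3); cbn [fst snd] in *.
    unfold u; rewrite cpow_pos; [reflexivity|]; apply farey_T_pos, quad_of_farey; auto. }
assert (right : has_sum (fun I => farey I /\ (qb I <= qd I)%Z) u
  (remainder profile_right t_right s + D * (kernel_sum s * profile_mean profile_right s))).
{ apply (has_sum_bij parameter _ (fun p => reflect (quad_of_parameter p)) (fun I => parameter_of_quad (reflect I))).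
  - intros p hp; rewrite reflect_involutive; split; [|apply parameter_of_quad_of, hp].
    destruct p as [[d k] r]; destruct hp as (h1 & h2 & h3); destruct (quad_of_farey d k r h1 h2 h3) as [q1 q2].
    split; [apply reflect_farey, q1|]; unfold quad_of_parameter; cbn [fst snd] in *; destruct (quad_of d k r); exact q2.
  - intros I [h1 h2]; destruct (parameter_of_quad_spec (reflect I)) as [p1 p2].
    + apply reflect_farey, h1.
    + destruct I; exact h2.
    + split; [exact p1|]; rewrite p2; apply reflect_involutive.
  - generalize (half_series profile_right A t_right bounded_lipschitz_right approx_right s hs); apply has_sum_ext; intros p hp; destruct p as [[d k] r]; destruct hp as (h1 & h2 & h3); cbn [fst snd] in *.
    unfold u; rewrite cpow_pos; [reflexivity|]; apply farey_T_pos, reflect_farey, quad_of_farey; auto. }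
(* By [equal_denominators] the interval [0,1] is the only one common to both halves; it is kept in
   the left one. *)
apply (has_sum_remove _ unit_quad) in right; [|split; [apply unit_quad_farey | unfold unit_quad; cbn; lia]].
assert (disj : forall I, farey I /\ (qd I <= qb I)%Z -> (farey I /\ (qb I <= qd I)%Z) /\ I <> unit_quad -> False).
{ intros I [i1 i2] [[_ i3] i4]; exact (i4 (equal_denominators I i1 i2 i3)). }
pose proof (has_sum_union _ _ _ _ _ disj left right) as all.
unfold farey_zeta; fold u.
match type of all with has_sum _ _ ?v => replace (continuation s) with v end.
- revert all; apply has_sum_pred_ext; intros I; split; [tauto|]; intros hI.
  destruct (classic (I = unit_quad)) as [-> | ne].
  + left; split; [exact hI | unfold unit_quad; cbn; lia].
  + destruct (Z.le_ge_cases (qd I) (qb I)); [left | right]; auto.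
- unfold u; rewrite cpow_pos by apply farey_T_pos, unit_quad_farey.
  assert (s3 : (s - RtoC (2 / 3))%C <> 0%C).
  { apply sub_neq_0; intros e; rewrite e in hs; simpl in hs; lra. }
  assert (z0 : zeta (3 * s) <> 0%C) by (apply zeta_neq_0; rewrite Re_triple; lra).
  assert (e3 : (3 * s - 1 - 1)%C = (3 * (s - RtoC (2 / 3)))%C).
  { unfold Rdiv; rewrite RtoC_mult, RtoC_inv by lra; field; intros e; apply RtoC_inj in e; lra. }
  unfold continuation, with_pole, regular_part, polar_part, residue_factor, D, zeta at 1 3; fold (zeta (3 * s)).
  rewrite e3, RtoC_inv by lra; field; repeat split; auto; intros e; apply RtoC_inj in e; lra.
Qed.

Lemma holC_profile_mean L s0 : bounded_lipschitz L A -> holC (profile_mean L) s0.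
Proof. intros h; destruct (entire_profile_mean L A h) as [v hv]; exact (entire_holC _ _ _ hv). Qed.

Lemma holC_residue_factor s0 : 13 / 21 < Re s0 -> holC residue_factor s0.
Proof using A hA.
intros hs; unfold residue_factor.
apply (holC_mult (fun s => kernel_sum s * (profile_mean profile_left s + profile_mean profile_right s))%C (fun s => / zeta (3 * s))%C).
- apply (holC_mult kernel_sum); [apply holC_kernel_sum; lra|].
  apply (holC_plus (profile_mean profile_left)); apply holC_profile_mean; [exact hA | exact bounded_lipschitz_right].
- apply (holC_inv (fun s => zeta (3 * s))); [|apply zeta_neq_0; rewrite Re_triple; lra].
  apply (holC_ext (fun s => zeta (3 * s + 0))) with 1; [lra | intros; f_equal; ring|].
  apply holC_affine; replace (3 * s0 + 0)%C with (3 * s0)%C by ring; apply holC_zeta; [rewrite Re_triple; lra|].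
  intros e; apply (f_equal Re) in e; rewrite Re_triple in e; simpl in e; lra.
Qed.

Lemma holC_regular_part s0 : 13 / 21 < Re s0 -> holC regular_part s0.
Proof using A f1 f3 hA hf hf2 hm m.
intros hs; unfold regular_part.
apply (holC_plus (fun s => remainder profile_left t_left s + remainder profile_right t_right s
   - cexp (s * RtoC (ln (Rabs (farey_T f unit_quad)))))%C (fun s => residue_factor s * zeta_regular (3 * s - 1))%C).
- apply (holC_minus (fun s => remainder profile_left t_left s + remainder profile_right t_right s)%C (fun s => cexp (s * RtoC (ln (Rabs (farey_T f unit_quad)))))).
  + apply holC_plus; [apply (holC_remainder _ A _ hA approx_left) | apply (holC_remainder _ A _ bounded_lipschitz_right approx_right)]; exact hs.
  + exact (entire_holC _ _ _ (entire_cexp _)).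
- apply (holC_mult residue_factor); [apply holC_residue_factor, hs|].
  apply (holC_ext (fun s => zeta_regular (3 * s + - (1)))) with 1; [lra | intros; f_equal; ring|].
  apply holC_affine, holC_zeta_regular.
  replace (Re (3 * s0 + - (1))) with (3 * Re s0 - 1) by (destruct s0; unfold RtoC, Cmult, Cplus, Copp, Re; simpl; ring); lra.
Qed.

Lemma holC_polar_part s0 : 13 / 21 < Re s0 -> holC polar_part s0.
Proof using A hA. intros hs; apply (holC_mult (fun _ => RtoC (/ 3)) residue_factor); [apply holC_const | apply holC_residue_factor, hs]. Qed.

(** The integral of [(|f''| / 2) ^ (2/3)], written with an exponential and [clamp] to have an
    integrand continuous everywhere. *)
Definition second_derivative_integral : R := RInt (fun x => exp (2 / 3 * log_half_second f2 (clamp x))) 0 1.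

Lemma continuous_exp_profile x : continuous (fun x => exp (2 / 3 * log_half_second f2 (clamp x))) x.
Proof using A hA.
apply (continuous_comp (fun x => 2 / 3 * log_half_second f2 (clamp x)) exp).
- apply (continuous_scal_r (2 / 3) (fun x => log_half_second f2 (clamp x))), (continuous_clamped _ _ _ hA).
- apply (ex_derive_continuous exp); eexists; apply is_derive_Reals, derivable_pt_lim_exp.
Qed.

Lemma profile_mean_two_thirds (L : R -> R) :
  profile_mean L (RtoC (2 / 3)) = RtoC (RInt (fun x => exp (2 / 3 * L (clamp x))) 0 1).
Proof.
unfold profile_mean, profile, Cint, RtoC; f_equal.
- apply RInt_ext; intros x _; match goal with |- @eq _ ?a ?b => change (@eq R a b) end.
  change ((2 / 3, 0)%R : C) with (RtoC (2 / 3)); change ((L (clamp x), 0)%R : C) with (RtoC (L (clamp x))).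
  rewrite <- RtoC_mult, cexp_RtoC; reflexivity.
- rewrite (RInt_ext _ (fun _ => 0)); [rewrite RInt_const; unfold scal; simpl; unfold mult; simpl; ring|].
  intros x _; change ((2 / 3, 0)%R : C) with (RtoC (2 / 3)); change ((L (clamp x), 0)%R : C) with (RtoC (L (clamp x))).
  rewrite <- RtoC_mult, cexp_RtoC; reflexivity.
Qed.

Lemma profile_mean_left : profile_mean profile_left (RtoC (2 / 3)) = RtoC second_derivative_integral.
Proof. apply profile_mean_two_thirds. Qed.

Lemma profile_mean_right : profile_mean profile_right (RtoC (2 / 3)) = RtoC second_derivative_integral.
Proof using A hA.
rewrite profile_mean_two_thirds; f_equal; unfold second_derivative_integral.
set (g := fun x => exp (2 / 3 * log_half_second f2 (clamp x))).
assert (cg : forall x, continuous g x) by apply continuous_exp_profile.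
pose proof (RInt_comp_lin (V := R_CompleteNormedModule) g (- 1) 1 0 1 (ex_RInt_cont g _ _ cg)) as c.
replace (- 1 * 0 + 1) with 1 in c by ring; replace (- 1 * 1 + 1) with 0 in c by ring.
rewrite <- (opp_RInt_swap (V := R_CompleteNormedModule) g 0 1) in c by (apply ex_RInt_cont, cg).
rewrite (RInt_scal (V := R_CompleteNormedModule)) in c.
- transitivity (RInt (fun y => g (- 1 * y + 1)) 0 1).
  + apply RInt_ext; rewrite Rmin_left, Rmax_right by lra; intros x hx.
    match goal with |- @eq _ ?a ?b => change (@eq R a b) end.
    unfold g, profile_right; rewrite !clamp_id by lra; do 3 f_equal; ring.
  + unfold scal, opp in c; simpl in c; unfold mult in c; simpl in c; lra.
- apply ex_RInt_cont; intros x; apply (continuous_comp (fun y => - 1 * y + 1) g); [|apply cg].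
  apply (ex_derive_continuous (fun y => - 1 * y + 1)); auto_derive; trivial.
Qed.

Lemma second_derivative_integral_pos : 0 < second_derivative_integral.
Proof using A hA.
apply Rlt_le_trans with (RInt (fun _ => exp (2 / 3 * - A)) 0 1).
- rewrite RInt_const; unfold scal; simpl; unfold mult; simpl; pose proof (exp_pos (2 / 3 * - A)); lra.
- apply RInt_le_cont; [lra | intros; apply continuous_const | apply continuous_exp_profile |].
  intros x _; apply exp_incr; pose proof (proj1 hA (clamp x) (clamp_in x)) as h.
  pose proof (Rle_abs (- log_half_second f2 (clamp x))) as h'; rewrite Rabs_Ropp in h'; lra.
Qed.

Lemma second_derivative_integral_eq :
  second_derivative_integral = / Rpower 2 (2 / 3) * RInt (fun v => Rpower (Rabs (f2 v)) (2 / 3)) 0 1.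
Proof using A hA hf2 hm m.
assert (e : forall x, 0 <= x <= 1 -> Rpower (Rabs (f2 x)) (2 / 3) = Rpower 2 (2 / 3) * exp (2 / 3 * log_half_second f2 (clamp x))).
{ intros x hx; rewrite clamp_id by auto; unfold Rpower, log_half_second; rewrite <- exp_plus; f_equal.
  pose proof (hf2 x hx); rewrite ln_div by lra; ring. }
assert (p : 0 < Rpower 2 (2 / 3)) by apply exp_pos.
rewrite (RInt_ext _ (fun x => scal (Rpower 2 (2 / 3)) (exp (2 / 3 * log_half_second f2 (clamp x))))).
- rewrite (RInt_scal (V := R_CompleteNormedModule)) by (apply ex_RInt_cont, continuous_exp_profile).
  fold second_derivative_integral; unfold scal; simpl; unfold mult; simpl; field; lra.
- rewrite Rmin_left, Rmax_right by lra; intros x hx; apply e; lra.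
Qed.

(** The factors are [1/3] from the pole, [3 * beta0] from [kernel_sum], a factor 2 for the two
    halves, [2 ^ (- 2/3)] from [|f''| / 2], and [6 / PI ^ 2] from [1 / zeta 2]. *)
Lemma polar_part_value : polar_part (RtoC (2 / 3)) =
  RtoC (sqrt 3 * Gamma (1 / 3) ^ 3 / (Rpower 2 (2 / 3) * PI ^ 3) * RInt (fun v => Rpower (Rabs (f2 v)) (2 / 3)) 0 1).
Proof using A hA hf2 hm m.
unfold polar_part, residue_factor; rewrite kernel_sum_two_thirds, profile_mean_left, profile_mean_right.
replace (3 * RtoC (2 / 3))%C with (RtoC 2) by (rewrite <- RtoC_mult; f_equal; field).
pose proof PI_RGT_0; pose proof (exp_pos (2 / 3 * ln 2)) as p; change (0 < Rpower 2 (2 / 3)) in p.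
assert (PI ^ 2 / 6 <> 0) by (apply Rgt_not_eq, Rdiv_lt_0_compat; [apply pow_lt|]; lra).
rewrite zeta_two, <- RtoC_plus, <- RtoC_mult, <- RtoC_div, <- RtoC_mult by auto; f_equal.
destruct gamma_third as [_ g]; rewrite g, second_derivative_integral_eq; field; lra.
Qed.

Lemma polar_part_neq_0 : polar_part (RtoC (2 / 3)) <> 0%C.
Proof using A hA hf2 hm m.
rewrite polar_part_value; pose proof second_derivative_integral_pos as h; rewrite second_derivative_integral_eq in h.
intros e; apply RtoC_inj in e; destruct gamma_third as [g _]; pose proof PI_RGT_0.
pose proof (sqrt_lt_R0 3 ltac:(lra)); pose proof (exp_pos (2 / 3 * ln 2)) as p; change (0 < Rpower 2 (2 / 3)) in p.
set (J := RInt _ 0 1) in *.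
assert (0 < sqrt 3 * Gamma (1 / 3) ^ 3 / (Rpower 2 (2 / 3) * PI ^ 3) * J); [|lra].
apply Rmult_lt_0_compat.
- apply Rdiv_lt_0_compat; apply Rmult_lt_0_compat; auto using pow_lt.
- apply Rmult_lt_reg_l with (/ Rpower 2 (2 / 3)); [apply Rinv_0_lt_compat, p | lra].
Qed.

(* Convergence on the line [Re s <= 2/3] would bound the sums at the points slightly to the right of [2/3]. *)
Theorem farey_zeta_abscissa s z : farey_zeta f s z -> 2 / 3 < Re s.
Proof using A f1 f2 f3 hA hf hf2 hm m.
intros h; apply Rnot_le_lt; intros hs.
destruct (has_sum_rbound _ _ _ h) as [B hB].
(* Since [ln |T_I| <= A], the power of exponent [sg] is at most [E] times that of exponent [Re s]
   for [Re s <= sg <= 1]; the distance [1/3] below keeps [sg] under 1. *)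
set (E := exp ((1 - Re s) * A)).
destruct (with_pole_unbounded regular_part polar_part (RtoC (2 / 3)) (holC_regular_part (RtoC (2 / 3)) ltac:(simpl; lra))
  (holC_polar_part (RtoC (2 / 3)) ltac:(simpl; lra)) polar_part_neq_0 (E * B) (1 / 3) ltac:(lra)) as [x [hx hlt]].
fold continuation in hlt; rewrite <- RtoC_plus in hlt; set (sg := 2 / 3 + x) in *.
apply (Rlt_not_le _ _ hlt).
apply (has_sum_bound farey (fun I => cpow (Rabs (farey_T f I)) (RtoC sg)) (fun I => E * Cmod (cpow (Rabs (farey_T f I)) s))).
- intros I hI; destruct (ln_farey_T f f1 f2 f3 m hf hm hf2 I hI) as [y [hy [hp e]]].
  destruct (farey_endpoints I hI) as (e1 & e2 & _ & hb & hd).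
  rewrite !cpow_pos, !Cmod_cexp, !Re_mult_real by auto.
  replace (Re (RtoC sg)) with sg by reflexivity; unfold E; rewrite <- exp_plus; apply exp_incr.
  assert (ln (Rabs (farey_T f I)) <= A).
  { pose proof (proj1 hA y ltac:(lra)) as ha; pose proof (Rle_abs (log_half_second f2 y)).
    assert (w : forall v, 1 <= v -> 0 <= ln v) by (intros v hv; rewrite <- ln_1; apply ln_le; lra).
    rewrite plus_IZR in e; pose proof (w _ hb); pose proof (w _ hd); pose proof (w (IZR (qb I) + IZR (qd I)) ltac:(lra)); lra. }
  pose proof (bounded_lipschitz_pos _ _ hA).
  replace (sg * ln (Rabs (farey_T f I))) with ((sg - Re s) * ln (Rabs (farey_T f I)) + Re s * ln (Rabs (farey_T f I))) by ring.
  apply Rplus_le_compat_r; apply Rle_trans with ((sg - Re s) * A); [apply Rmult_le_compat_l; unfold sg in *; lra|].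
  apply Rmult_le_compat_r; unfold sg in *; lra.
- apply rbound_scal; [left; apply exp_pos | exact hB].
- apply farey_zeta_continuation; simpl; unfold sg; lra.
Qed.

End Assembly.

Theorem theorem3 (f f1 f2 f3 : R -> R) (m : R)
  (hf : C3_unit_interval f f1 f2 f3)
  (hm : 0 < m)
  (hf2 : forall x : R, 0 <= x <= 1 -> m <= Rabs (f2 x)) :
  (exists sigma0 : R, forall s : C, sigma0 < Re s -> exists z : C, farey_zeta f s z) /\
  (forall eta : R, 0 < eta -> eta < 1 / 21 ->
    exists F : C -> C,
      meromorphic_continuation (farey_zeta f) (disk (RtoC (2 / 3)) eta) F /\
      has_pole F (RtoC (2 / 3)) 1 /\
      has_residue F (RtoC (2 / 3))
        (RtoC (sqrt 3 * Gamma (1 / 3) ^ 3 / (Rpower 2 (2 / 3) * PI ^ 3)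
               * RInt (fun v => Rpower (Rabs (f2 v)) (2 / 3)) 0 1))).
Proof.
destruct (bounded_lipschitz_log f2 f3 m hm (fun x hx => proj1 (proj2 (proj2 (hf x hx))))
  (fun x hx => proj2 (proj2 (proj2 (hf x hx)))) hf2) as [A hA].
pose proof (farey_zeta_continuation f f1 f2 f3 m hf hm hf2 A hA) as cont.
pose proof (fun s => holC_regular_part f f1 f2 f3 m hf hm hf2 A hA s) as hH.
pose proof (fun s => holC_polar_part f2 A hA s) as hN.
pose proof (polar_part_neq_0 f2 m hm hf2 A hA) as N0.
assert (pole : has_pole (continuation f f2) (RtoC (2 / 3)) 1).
{ apply has_pole_with_pole; [apply hH; simpl; lra | apply hN; simpl; lra | exact N0]. }
split; [exists (2 / 3); intros s hs; eexists; apply cont, hs|].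
intros eta _ he; exists (continuation f f2); split; [|split; [exact pole|]].
(* One connected open set for every [eta]: the half plane contains the disk, because
   [2/3 - 1/21 = 13/21], and by [farey_zeta_abscissa] it contains all points where the series
   converges. *)
- exists (fun s => 13 / 21 < Re s); repeat split.
  + apply half_plane_open.
  + apply half_plane_connected.
  + intros s hs; unfold disk in hs; pose proof (Re_close s (RtoC (2 / 3))) as h; simpl Re in h at 1; lra.
  + pose proof (farey_zeta_abscissa f f1 f2 f3 m hf hm hf2 A hA s z H); lra.
  + pose proof (farey_zeta_abscissa f f1 f2 f3 m hf hm hf2 A hA s z H) as h.
    exact (has_sum_unique _ _ _ _ (cont s h) H).
  + intros s hs; destruct (classic (s = RtoC (2 / 3))) as [-> | ne]; [right; exists 1%nat; exact pole|].
    left; apply holomorphic_with_pole; auto.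
- rewrite <- (polar_part_value f2 m hm hf2 A hA).
  apply has_residue_with_pole; [apply hH; simpl; lra | apply hN; simpl; lra].
Qed.
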